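(* Let $(\mathbf V_h,Q_h)$ be a stable pair of discrete spaces on $\Gamma_h$ (with $h\le h_0$ small enough) and let $\omega_h\in\Omega_h$ be a parametric macroelement with associated flat macroelement $\bar\omega$ and parametrization $F_h:\bar\omega\to\omega_h$. Denote by $\mathbf V_h(\omega_h)=\mathbf V_h|_{\omega_h}$, $Q_h(\omega_h)=Q_h|_{\omega_h}$ the restricted spaces and $\mathbf V_{0,h}(\omega_h)=\{\mathbf v\in\mathbf V_h(\omega_h):\mathbf v|_{\partial\omega_h}=\mathbf 0\}$. Then there is $\beta'>0$, depending on the stability constant $\bar\beta'$ and on $\max_{\bar T\in\mathcal T(\bar\omega)}\|F_h\|_{C^\infty(\bar T)}$, such that for all $0\neq q_h\in Q_h(\omega_h)\cap L^2_0(\omega_h)$ there exists $0\ne\mathbf v_h\in\mathbf V_{0,h}(\omega_h)$ with $$(\operatorname{div}_{\Gamma_h}\mathbf P_h\mathbf v_h,\,q_h)_{\omega_h}\ \ge\ \beta'\,\|\mathbf v_h\|_{1,h,\omega_h}\,\|q_h\|_{\omega_h}.$$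
   Context: **Geometry.** $\Gamma\subset\mathbb R^3$ is a closed (compact, boundaryless) smooth two-dimensional hypersurface; $\pi:U_\delta(\Gamma)\to\Gamma$ is the closest-point projection on a $\delta$-neighbourhood where it is well defined. $\{\hat\Gamma_h\}_{h>0}$ is a shape-regular, quasi-uniform sequence of conforming piecewise flat triangulated surfaces in $U_\delta(\Gamma)$ with vertices on $\Gamma$; $h$ is the uniform bound on the element size; each element $\hat T\in\mathcal T(\hat\Gamma_h)$ is $F_{\hat T}(T^{\mathrm{ref}})$ with $F_{\hat T}$ affine. For $k_g\ge1$, $\pi_h$ is the elementwise Lagrange interpolant of order $k_g$ of $\pi$ on $\hat\Gamma_h$, $\Gamma_h=\bigcup_{\hat T}\pi_h(\hat T)$, $\mathcal T(\Gamma_h)=\{\pi_h(\hat T)\}$. $\mathbf n_h$ is the elementwise unit normal of $\Gamma_h$, $\mathbf P_h=\mathbf I-\mathbf n_h\otimes\mathbf n_h$, $\mathbf Q_h=\mathbf I-\mathbf P_h$. **Derivatives, norms.** $\mathcal D_{\Gamma_h}$ is the elementwise componentwise surface derivative; for vector fields $\nabla_{\Gamma_h}\mathbf u=\mathbf P_h(\mathcal D_{\Gamma_h}\mathbf u)$, $\operatorname{div}_{\Gamma_h}\mathbf u=\operatorname{tr}\nabla_{\Gamma_h}\mathbf u$. $(\cdot,\cdot)_\omega$, $\|\cdot\|_\omega$: $L^2(\omega)$ inner product and norm. $L^2_0(\omega)$: zero-mean $L^2$ functions. $\|\mathbf u\|_{1,h,\omega_h}=\|\mathbf P_h\mathbf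 u\|_{\mathbf H^1_{\mathrm{tan}}(\omega_h)}+h^{-1}\|\mathbf Q_h\mathbf u\|_{\omega_h}$ with $\|\mathbf P_h\mathbf u\|^2_{\mathbf H^1_{\mathrm{tan}}(\omega_h)}=\|\nabla_{\Gamma_h}\mathbf P_h\mathbf u\|^2_{\omega_h}+\|\mathbf P_h\mathbf u\|^2_{\omega_h}$. $A\lesssim B$ means $A\le CB$ with $C$ independent of $h$. **Pair of discrete spaces.** For a finite-dimensional space $\mathbb F$ on $T^{\mathrm{ref}}$ with $\mathbb P_r\subseteq\mathbb F\subset W^{r+1,\infty}(T^{\mathrm{ref}})$, $r\ge1$ (the largest such $r$ is the order), let $\hat S^b(\mathbb F)=\{v\in L^\infty(\hat\Gamma_h):v|_{\hat T}\circ F_{\hat T}\in\mathbb F\ \forall\hat T\}$, $S_h^b(\mathbb F)=\{v:v\circ\pi_h\in\hat S^b(\mathbb F)\}$, and $S_h(\mathbb F)\subset S_h^b(\mathbb F)$ the functions without jumps across interior edges. A pair of discrete spaces consists of $\mathbf V_h=[V_h]^3$ with $V_h=S_h(\mathbb F_V)$ and $Q_h=S_h^b(\mathbb F_Q)$ or its continuous version $S_h(\mathbb F_Q)$; its order is $k_u=\min\{r_v,r_q+1\}\ge1$ with $r_v,r_q$ the orders of $\mathbb F_V,\mathbb F_Q$. Both local spaces are required to satisfy: (Interpolation) there is $\hat{\mathcal I}_{h,\mathbb F}:L^1(\hat\Gamma_h)\to\hat S^b(\mathbb F)$ with $|v-\hat{\mathcal I}_{h,\mathbb F}v|_{W^{m,s}(\hat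 T)}\lesssim h_{\hat T}^{l-m}|v|_{W^{l,s}(\hat T)}$ for $s\in[1,\infty]$, $0\le m\le l\le r+1$, all $\hat T$; (Inverse estimates) if $\mathbb F\subset W^{l,\infty}(T^{\mathrm{ref}})$, $0\le m\le l$, $1\le s,t\le\infty$ and $h$ is small, then $\|v_h\|_{W^{l,s}(\hat T)}\lesssim h_{\hat T}^{m-l+2/s-2/t}\|v_h\|_{W^{m,t}(\hat T)}$ for $v_h\in\hat S^b(\mathbb F)$. **Macroelements.** A piecewise flat macroelement is a union $\hat\omega=\bigcup_{k=1}^m\hat T_k$ of elements of $\mathcal T(\hat\Gamma_h)$ connected via edges. Fix one element $\hat T$ of it with orthonormal tangent basis $\hat{\mathbf t}^1,\hat{\mathbf t}^2$; with $\hat{\mathbf P}_k$ the tangential projection onto $\hat T_k$, use local coordinates on $\hat T_k$ with respect to $\hat{\mathbf P}_k\hat{\mathbf t}^1,\hat{\mathbf P}_k\hat{\mathbf t}^2$. The flattening map $\bar\pi:\hat\omega\to\mathbb R^2$ is the continuous elementwise affine map whose matrix on $\hat T_k$ is $(\langle\hat{\mathbf t}^\alpha,\hat{\mathbf P}_k\hat{\mathbf t}^\beta\rangle)_{\alpha\beta}$. $\bar\omega=\bar\pi(\hat\omega)$ is the flat macroelement (triangulated by the $\bar\pi(\hat T_k)$), $\omega_h=\pi_h(\hat\omega)\subset\Gamma_h$ the parametric macroelement, $F_h=\pi_h\circ\bar\pi^{-1}:\bar\omega\to\omega_h$. A macroelement partitioning $\Omega_h$ of $\Gamma_h$ is a collection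 of parametric macroelements such that every element of $\Gamma_h$ lies in at least one and at most $L$ of them. Two macroelements are equivalent if there is a continuous piecewise affine bijection between the (piecewise) flat ones preserving the triangulation; the total number of equivalence classes over all $h$ is assumed finite. **Stable pair.** A pair of discrete spaces is stable if: (Local super-approximation) for a flat domain $\bar\omega\subset\mathbb R^2$ with triangulation $\bar{\mathcal T}_h$, with $\bar S(\bar\omega;\mathbb F_V)$, $\bar S^b$ the corresponding continuous/broken spaces on $\bar\omega$ (lifted by $\bar\pi$), for each $\bar v\in\bar S(\bar\omega;\mathbb F_V)$ and each elementwise $C^\infty$ function $\phi$ there is $\bar w\in\bar S^b(\bar{\mathcal T}_h;\mathbb F_V)$ with $\|\phi\bar v-\bar w\|_{H^m(\bar T)}\le Ch\|\bar v\|_{H^m(\bar T)}$ for all $\bar T\in\bar{\mathcal T}_h$, $m=0,1$, $C=C(\|\phi\|_{C^\infty(\bar T)})$, and $\bar w$ vanishes on the outer faces of $\bar\omega$ if $\bar v$ does; (Stability) there are macroelement partitionings $\{\Omega_h\}_{h\le h_0}$ of $\{\Gamma_h\}_{h\le h_0}$ such that every $\omega_h\in\Omega_h$ has an associated flat macroelement $\bar\omega$ with $\operatorname{diam}(\bar\omega)\lesssim h$, and with $\bar V(\bar\omega)=\{\bar v\in H^1(\bar\omega):\bar v\circ F_h^{-1}\in V_h|_{\omega_h}\}$, $\bar Q(\bar\omega)=\{\bar q\in L^2(\bar\omega):\bar q\circ F_h^{-1}\in Q_h|_{\omega_h}\}$: for every $0\ne\bar q\in\bar Q(\bar\omega)\cap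 L^2_0(\bar\omega)$ there is $0\ne\bar{\mathbf v}\in[\bar V(\bar\omega)]^2$ with $\bar{\mathbf v}|_{\partial\bar\omega}=\mathbf 0$ and $(\nabla\cdot\bar{\mathbf v},\bar q)_{\bar\omega}\ge\bar\beta'\|\nabla\bar{\mathbf v}\|_{\bar\omega}\|\bar q\|_{\bar\omega}$, with $\bar\beta'>0$ independent of $\bar\omega$ and $h$. *)

(* Defs.v *)
From HB Require Import structures.
From mathcomp Require Import all_boot all_order all_algebra.
From mathcomp Require Import all_classical all_reals all_analysis.

Set Implicit Arguments.
Unset Strict Implicit.
Unset Printing Implicit Defensive.

Import Order.TTheory GRing.Theory Num.Theory.
Import numFieldNormedType.Exports.

Local Open Scope classical_set_scope.
Local Open Scope ring_scope.

(* Points of R^d are row vectors.  The library norm on row vectors is the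
   sup norm (same topology), hence the separate Euclidean norm [enorm]. *)
Definition dot (R : realType) (d : nat) (u v : 'rV[R]_d) : R :=
  \sum_(i < d) u 0 i * v 0 i.

Definition enorm (R : realType) (d : nat) (u : 'rV[R]_d) : R :=
  Num.sqrt (dot u u).

Definition diam (R : realType) (d : nat) (A : set 'rV[R]_d) : R :=
  sup [set r | exists x y, [/\ A x, A y & r = enorm (x - y)]].

(* Indices in 'I_3 are added modulo 3. *)
Definition cross (R : realType) (u v : 'rV[R]_3) : 'rV[R]_3 :=
  \row_(i < 3) (u 0 (i + 1) * v 0 (i + 2) - u 0 (i + 2) * v 0 (i + 1)).

(* Unit normal of the plane spanned by the two rows of J. *)
Definition unormal (R : realType) (J : 'M[R]_(2, 3)) : 'rV[R]_3 :=
  let c := cross (row 0 J) (row 1 J) in (enorm c)^-1 *: c.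

Definition tanproj (R : realType) (J : 'M[R]_(2, 3)) : 'M[R]_3 :=
  1%:M - (unormal J)^T *m unormal J.

Definition pd (R : realType) (d : nat) (V : normedModType R) (i : 'I_d)
    (f : 'rV[R]_d -> V) : 'rV[R]_d -> V :=
  fun x => 'D_(delta_mx 0 i) f x.

(* Higher partial derivatives are indexed by words of coordinate indices. *)
Definition pder (R : realType) (d : nat) (V : normedModType R)
    (a : seq 'I_d) (f : 'rV[R]_d -> V) : 'rV[R]_d -> V :=
  foldr (fun i g => pd i g) f a.

Definition smooth_on (R : realType) (d : nat) (V : normedModType R)
    (U : set 'rV[R]_d) (f : 'rV[R]_d -> V) : Prop :=
  forall (a : seq 'I_d) (x : 'rV[R]_d), U x ->
    {for x, continuous (pder a f)} /\
    forall i : 'I_d, derivable (pder a f) x (delta_mx 0 i).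

(* The size of a function in C^oo(closure U), U convex and bounded, is measured
   by the whole family of sup norms of its derivatives: [B j] bounds those of
   order j. *)
Definition Cinf_bounded (R : realType) (d : nat) (V : normedModType R)
    (U : set 'rV[R]_d) (B : nat -> R) (f : 'rV[R]_d -> V) : Prop :=
  smooth_on U f /\
  forall (a : seq 'I_d) (x : 'rV[R]_d), U x -> `|pder a f x| <= B (size a).

(* Lebesgue measure of R^2 is the product measure on R * R, transported to row
   vectors by [vec2]. *)
Definition leb2 (R : realType) :
    {measure set (measurableTypeR R * measurableTypeR R) -> \bar R} :=
  (@lebesgue_measure R \x @lebesgue_measure R)%E.
Arguments leb2 R : clear implicits.

Definition vec2 (R : realType) (p : R * R) : 'rV[R]_2 :=
  \row_(i < 2) (if i == 0 then p.1 else p.2).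

Definition int2 (R : realType) (U : set 'rV[R]_2) (f : 'rV[R]_2 -> R) : R :=
  \int[leb2 R]_(p in @vec2 R @^-1` U) f (vec2 p).

Definition l2norm (R : realType) (U : set 'rV[R]_2) (f : 'rV[R]_2 -> R) : R :=
  Num.sqrt (int2 U (fun x => f x ^+ 2)).

Definition measurable2 (R : realType) (U : set 'rV[R]_2)
    (f : 'rV[R]_2 -> R) : Prop :=
  measurable_fun (@vec2 R @^-1` U) (f \o @vec2 R).

Definition integrable2 (R : realType) (U : set 'rV[R]_2)
    (f : 'rV[R]_2 -> R) : Prop :=
  (leb2 R).-integrable (@vec2 R @^-1` U) (fun p => (f (vec2 p))%:E).

Definition Lpnorm (R : realType) (U : set 'rV[R]_2) (p : \bar R)
    (f : 'rV[R]_2 -> R) : \bar R :=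
  Lnorm (leb2 R) p (fun z => ((f \_ U) (vec2 z))%:E).

Definition in_Lp (R : realType) (U : set 'rV[R]_2) (p : \bar R)
    (f : 'rV[R]_2 -> R) : Prop :=
  measurable2 U f /\ (Lpnorm U p f < +oo)%E.

Definition loc_integrable (R : realType) (U : set 'rV[R]_2)
    (f : 'rV[R]_2 -> R) : Prop :=
  measurable2 U f /\
  forall K : set 'rV[R]_2, compact K -> K `<=` U -> integrable2 K f.

Definition test_function (R : realType) (U : set 'rV[R]_2)
    (phi : 'rV[R]_2 -> R) : Prop :=
  smooth_on setT phi /\
  exists K : set 'rV[R]_2,
    [/\ compact K, K `<=` U & forall x, ~ K x -> phi x = 0].

Definition is_wder (R : realType) (U : set 'rV[R]_2) (a : seq 'I_2)
    (f g : 'rV[R]_2 -> R) : Prop :=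
  [/\ loc_integrable U f, loc_integrable U g &
    forall phi, test_function U phi ->
      int2 U (fun x => f x * pder a phi x) =
      (-1) ^+ size a * int2 U (fun x => g x * phi x)].

(* A choice of the weak derivative (unique up to null sets when it exists). *)
Definition wD (R : realType) (U : set 'rV[R]_2) (a : seq 'I_2)
    (f : 'rV[R]_2 -> R) : 'rV[R]_2 -> R :=
  get [set g | is_wder U a f g].

Definition in_sobolev (R : realType) (U : set 'rV[R]_2) (m : nat) (p : \bar R)
    (f : 'rV[R]_2 -> R) : Prop :=
  forall a : seq 'I_2, (size a <= m)%N ->
    exists g, is_wder U a f g /\ in_Lp U p g.

Definition wsemi (R : realType) (U : set 'rV[R]_2) (m : nat) (p : \bar R)
    (f : 'rV[R]_2 -> R) : R :=
  match p with
  | (r%:E)%E =>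
      (\sum_(a : m.-tuple 'I_2) fine (Lpnorm U p (wD U a f)) `^ r) `^ r^-1
  | _ => \big[Num.max/0]_(a : m.-tuple 'I_2) fine (Lpnorm U p (wD U a f))
  end.

Definition wnorm (R : realType) (U : set 'rV[R]_2) (m : nat) (p : \bar R)
    (f : 'rV[R]_2 -> R) : R :=
  match p with
  | (r%:E)%E => (\sum_(j < m.+1) wsemi U j p f `^ r) `^ r^-1
  | _ => \big[Num.max/0]_(j < m.+1) wsemi U j p f
  end.

(* 1/p, with 1/oo = 0. *)
Definition einv (R : realType) (p : \bar R) : R :=
  match p with (r%:E)%E => r^-1 | _ => 0 end.

Definition bary (R : realType) (xi : 'rV[R]_2) (k : 'I_3) : R :=
  if unlift ord0 k is Some a then xi 0 a else 1 - \sum_(a < 2) xi 0 a.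

Definition Tref (R : realType) : set 'rV[R]_2 :=
  [set xi | forall k : 'I_3, 0 <= bary xi k].

(* The face of the reference triangle spanned by the vertices in A. *)
Definition ref_face (R : realType) (A : {set 'I_3}) : set 'rV[R]_2 :=
  [set xi | Tref xi /\ forall k, k \notin A -> bary xi k = 0].

Definition edgemx (R : realType) (d : nat) (P : 'I_3 -> 'rV[R]_d) :
    'M[R]_(2, d) :=
  \matrix_(a < 2) (P (lift ord0 a) - P ord0).

(* The affine map from the reference triangle onto the triangle with vertices
   P, extended to the whole plane. *)
Definition aff (R : realType) (d : nat) (P : 'I_3 -> 'rV[R]_d)
    (xi : 'rV[R]_2) : 'rV[R]_d :=
  P ord0 + xi *m edgemx P.

Definition affinv (R : realType) (P : 'I_3 -> 'rV[R]_2) (y : 'rV[R]_2) :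
    'rV[R]_2 :=
  (y - P ord0) *m invmx (edgemx P).

Definition face (R : realType) (d : nat) (P : 'I_3 -> 'rV[R]_d)
    (A : {set 'I_3}) : set 'rV[R]_d :=
  aff P @` @ref_face R A.

Definition tri (R : realType) (d : nat) (P : 'I_3 -> 'rV[R]_d) :
    set 'rV[R]_d :=
  aff P @` @Tref R.

(* P is a nondegenerate triangle containing a disc of its own plane of radius
   diam / sigma. *)
Definition shape_regular (R : realType) (d : nat) (sigma : R)
    (P : 'I_3 -> 'rV[R]_d) : Prop :=
  row_free (edgemx P) /\
  exists2 c, tri P c &
    forall xi, enorm (aff P xi - c) <= diam (tri P) / sigma ->
      tri P (aff P xi).

(* An element T in R^3 is identified with a triangle of R^2 by orthonormal
   coordinates of its plane: [isovert P] are its vertices in them. *)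
Definition orthobasis (R : realType) (P : 'I_3 -> 'rV[R]_3) : 'M[R]_(2, 3) :=
  let e := row 0 (edgemx P) in
  let t := (enorm e)^-1 *: e in
  \matrix_(a < 2) (if a == 0 then t else cross (unormal (edgemx P)) t).

Definition isovert (R : realType) (P : 'I_3 -> 'rV[R]_3) (k : 'I_3) :
    'rV[R]_2 :=
  (P k - P ord0) *m (orthobasis P)^T.

(* Sobolev spaces and norms on the triangle with vertices P in R^2 of the
   function whose pull-back to the reference triangle is v. *)
Definition in_sobolevT (R : realType) (P : 'I_3 -> 'rV[R]_2) (m : nat)
    (p : \bar R) (v : 'rV[R]_2 -> R) : Prop :=
  in_sobolev (interior (tri P)) m p (v \o affinv P).

Definition wsemiT (R : realType) (P : 'I_3 -> 'rV[R]_2) (m : nat)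
    (p : \bar R) (v : 'rV[R]_2 -> R) : R :=
  wsemi (interior (tri P)) m p (v \o affinv P).

Definition wnormT (R : realType) (P : 'I_3 -> 'rV[R]_2) (m : nat)
    (p : \bar R) (v : 'rV[R]_2 -> R) : R :=
  wnorm (interior (tri P)) m p (v \o affinv P).

(* Compact embedded surface without boundary: locally a regular level set. *)
Definition closed_hypersurface (R : realType) (Gamma : set 'rV[R]_3) : Prop :=
  compact Gamma /\
  forall x, Gamma x ->
    exists (U : set 'rV[R]_3) (phi : 'rV[R]_3 -> R),
      [/\ open U, U x, smooth_on U phi,
          Gamma `&` U = [set y | U y /\ phi y = 0] &
          forall y, U y -> phi y = 0 -> exists i : 'I_3, pd i phi y != 0].

Definition nbhd_delta (R : realType) (Gamma : set 'rV[R]_3) (delta : R) :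
    set 'rV[R]_3 :=
  [set x | exists2 y, Gamma y & enorm (x - y) < delta].

Definition closest_point_projection (R : realType) (Gamma : set 'rV[R]_3)
    (delta : R) (proj : 'rV[R]_3 -> 'rV[R]_3) : Prop :=
  forall x, nbhd_delta Gamma delta x ->
    Gamma (proj x) /\
    forall y, Gamma y -> y <> proj x -> enorm (x - proj x) < enorm (x - y).

(* A triangulation in R^3: [aff (vert M i)] is the affine parametrization
   F_T of the i-th element T. *)
Record mesh (R : realType) := Mesh {
  nel : nat;
  vert : 'I_nel -> 'I_3 -> 'rV[R]_3 }.

(* The vertices of element i (as local indices) shared with element j. *)
Definition common (R : realType) (M : mesh R) (i j : 'I_(nel M)) :
    {set 'I_3} :=
  [set k | [exists l, vert i k == vert j l]].

Definition edge_adjacent (R : realType) (M : mesh R) : rel 'I_(nel M) :=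
  fun i j => #|common i j| == 2%N.

(* A conforming triangulated surface: any two elements meet exactly in a common
   proper face, every edge belongs to exactly two elements, and the elements
   around a vertex are connected through edges. *)
Definition triangulated_surface (R : realType) (M : mesh R) : Prop :=
  [/\ forall i, row_free (edgemx (@vert R M i)),
      forall i j, i != j ->
        (#|@common R M i j| < 3)%N /\
        tri (vert i) `&` tri (vert j) = face (vert i) (common i j),
      forall i (A : {set 'I_3}), #|A| = 2%N ->
        exists! j, @common R M i j = A &
      forall i j k l, @vert R M i k = vert j l ->
        let around a := [exists m, vert a m == @vert R M i k] in
        connect (fun a b => [&& around a, around b & @edge_adjacent R M a b]) i j].

(* Shape-regular, quasi-uniform family, indexed by the set H of mesh sizes;
   h bounds the element diameters of [msh h]. *)
Definition surface_family (R : realType) (Gamma : set 'rV[R]_3) (delta : R)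
    (H : set R) (msh : R -> mesh R) : Prop :=
  (forall h, H h -> 0 < h) /\
  exists2 sigma : R, 0 < sigma &
    forall h, H h ->
      triangulated_surface (msh h) /\
      forall i : 'I_(nel (msh h)),
        [/\ shape_regular sigma (vert i),
            h / sigma <= diam (tri (vert i)) <= h,
            tri (vert i) `<=` nbhd_delta Gamma delta &
            forall k, Gamma (vert i k)].

Definition lagrange1 (R : realType) (k m : nat) (t : R) : R :=
  \prod_(a < m) ((k%:R * t - a%:R) / (m - a)%:R).

Definition lagrange_node (R : realType) (k i j : nat) : 'rV[R]_2 :=
  \row_(a < 2) (if a == 0 then i%:R / k%:R else j%:R / k%:R).

(* Lagrange interpolation of order k on the reference triangle at the nodes
   (i/k, j/k), i + j <= k, with the nodal basis written in barycentric
   coordinates. *)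
Definition lagrange_interp (R : realType) (k : nat)
    (f : 'rV[R]_2 -> 'rV[R]_3) (xi : 'rV[R]_2) : 'rV[R]_3 :=
  \sum_(i < k.+1) \sum_(j < k.+1 | (i + j <= k)%N)
    (lagrange1 k i (xi 0 0) * lagrange1 k j (xi 0 1) *
     lagrange1 k (k - (i + j)) (bary xi ord0))
      *: f (lagrange_node R k i j).

(* pi_h o F_T on the reference triangle; its image is an element of Gamma_h.
   It is a polynomial map, defined on the whole plane. *)
Definition param (R : realType) (proj : 'rV[R]_3 -> 'rV[R]_3) (kg : nat)
    (M : mesh R) (i : 'I_(nel M)) : 'rV[R]_2 -> 'rV[R]_3 :=
  lagrange_interp kg (proj \o aff (vert i)).

(* Elementwise functions v on the flat surface or on Gamma_h are given by
   their pull-backs [v i] to the reference triangle, i.e. v o F_T and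
   v o pi_h o F_T respectively; values off the reference triangle are
   irrelevant.  Composition with pi_h does not change this representation. *)
Definition bfun (R : realType) (M : mesh R) (V : Type) : Type :=
  'I_(nel M) -> 'rV[R]_2 -> V.

(* A finite-dimensional space of functions on the reference triangle, given by
   a spanning family. *)
Record fspace (R : realType) := FSpace {
  fdim : nat;
  fgen : 'I_fdim -> 'rV[R]_2 -> R }.

Definition inF (R : realType) (F : fspace R) (f : 'rV[R]_2 -> R) : Prop :=
  exists c : 'I_(fdim F) -> R,
    forall xi, Tref xi -> f xi = \sum_(i < fdim F) c i * fgen i xi.

Definition is_poly2 (R : realType) (r : nat) (f : 'rV[R]_2 -> R) : Prop :=
  exists c : nat -> nat -> R, forall xi,
    f xi = \sum_(i < r.+1) \sum_(j < r.+1 | (i + j <= r)%N)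
             c i j * xi 0 0 ^+ i * xi 0 1 ^+ j.

Definition F_in_Winf (R : realType) (F : fspace R) (l : nat) : Prop :=
  forall f, inF F f -> in_sobolev (interior (@Tref R)) l +oo%E f.

Definition P_to_W (R : realType) (F : fspace R) (r : nat) : Prop :=
  (forall f, is_poly2 r f -> inF F f) /\ F_in_Winf F r.+1.

(* Elements of W^{r+1,oo} with r >= 1 are represented by their continuous
   representatives. *)
Definition fspace_order (R : realType) (F : fspace R) (r : nat) : Prop :=
  [/\ (1 <= r)%N,
      forall f, inF F f -> {within @Tref R, continuous f},
      P_to_W F r &
      forall r', P_to_W F r' -> (r' <= r)%N].

Definition in_Sb (R : realType) (F : fspace R) (M : mesh R)
    (v : bfun M R) : Prop :=
  forall i, inF F (v i).

Definition in_S (R : realType) (F : fspace R) (M : mesh R)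
    (v : bfun M R) : Prop :=
  in_Sb F v /\
  forall i j, edge_adjacent i j -> forall xi eta, Tref xi -> Tref eta ->
    aff (vert i) xi = aff (vert j) eta -> v i xi = v j eta.

Definition in_L1 (R : realType) (M : mesh R) (v : bfun M R) : Prop :=
  forall i, integrable2 (@Tref R) (v i).

Definition ae_equal (R : realType) (M : mesh R) (v w : bfun M R) : Prop :=
  forall i, {ae leb2 R, forall p,
    Tref (vec2 p) -> v i (vec2 p) = w i (vec2 p)}.

Definition interpolation (R : realType) (H : set R) (msh : R -> mesh R)
    (F : fspace R) (r : nat) : Prop :=
  exists I : forall h : R, bfun (msh h) R -> bfun (msh h) R,
    [/\ forall h, H h -> forall v, in_L1 v -> in_Sb F (I h v),
        forall h, H h -> forall v w, in_L1 v -> in_L1 w -> ae_equal v w ->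
          forall i xi, Tref xi -> I h v i xi = I h w i xi &
        forall (s : \bar R) (m l : nat),
          (1%:E <= s)%E -> (m <= l)%N -> (l <= r.+1)%N ->
          exists C : R, forall h, H h -> forall v, in_L1 v ->
            forall i : 'I_(nel (msh h)), in_sobolevT (isovert (vert i)) l s (v i) ->
            wsemiT (isovert (vert i)) m s (v i \- I h v i) <=
            C * diam (tri (vert i)) ^+ (l - m) *
              wsemiT (isovert (vert i)) l s (v i)].

Definition inverse_estimates (R : realType) (H : set R) (msh : R -> mesh R)
    (F : fspace R) : Prop :=
  forall (l m : nat) (s t : \bar R),
    F_in_Winf F l -> (m <= l)%N -> (1%:E <= s)%E -> (1%:E <= t)%E ->
    exists C h1 : R, 0 < h1 /\
      forall h, H h -> h <= h1 -> forall v, in_Sb F v ->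
      forall i : 'I_(nel (msh h)),
        wnormT (isovert (vert i)) l s (v i) <=
        C * diam (tri (vert i))
              `^ (m%:R - l%:R + 2 * einv s - 2 * einv t) *
          wnormT (isovert (vert i)) m t (v i).

Definition discrete_space (R : realType) (H : set R) (msh : R -> mesh R)
    (F : fspace R) : Prop :=
  exists r, [/\ fspace_order F r, interpolation H msh F r &
                inverse_estimates H msh F].

(* The pressure space is the broken or the continuous one. *)
Definition in_Q (R : realType) (cont : bool) (F : fspace R) (M : mesh R)
    (q : bfun M R) : Prop :=
  if cont then in_S F q else in_Sb F q.

(* A macroelement of M: its elements, the fixed element, the rows t^1, t^2 of
   the tangent basis of that element, and the flattening map. *)
Record macro (R : realType) (M : mesh R) := Macro {
  mel : {set 'I_(nel M)};
  mbase : 'I_(nel M);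
  mtan : 'M[R]_(2, 3);
  mflat : 'rV[R]_3 -> 'rV[R]_2 }.

Definition macro_hat (R : realType) (M : mesh R) (w : macro M) :
    set 'rV[R]_3 :=
  [set x | exists2 k, k \in mel w & tri (vert k) x].

(* Local coordinates c of a tangent vector of element k are taken with respect
   to the rows of [mtan w *m tanproj _], the projected tangent basis. *)
Definition is_macro (R : realType) (M : mesh R) (w : macro M) : Prop :=
  [/\ mbase w \in mel w,
      forall i j, i \in mel w -> j \in mel w ->
        connect (fun a b => [&& a \in mel w, b \in mel w & edge_adjacent a b]) i j,
      mtan w *m (mtan w)^T = 1%:M /\
        unormal (edgemx (vert (mbase w))) *m (mtan w)^T = 0,
      forall k, k \in mel w ->
        let tk := mtan w *m tanproj (edgemx (vert k)) in
        row_free tk /\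
        forall x y (c : 'rV[R]_2), tri (vert k) x -> tri (vert k) y ->
          y - x = c *m tk ->
          mflat w y - mflat w x = c *m (mtan w *m tk^T)^T &
      {within macro_hat w, continuous (mflat w)} /\
        {in macro_hat w &, injective (mflat w)}].

Definition fvert (R : realType) (M : mesh R) (w : macro M) (k : 'I_(nel M))
    (a : 'I_3) : 'rV[R]_2 :=
  mflat w (vert k a).

Definition macro_bar (R : realType) (M : mesh R) (w : macro M) :
    set 'rV[R]_2 :=
  mflat w @` macro_hat w.

Definition outer_edge (R : realType) (M : mesh R) (w : macro M)
    (k : 'I_(nel M)) (A : {set 'I_3}) : Prop :=
  [/\ k \in mel w, #|A| = 2%N & forall j, j \in mel w -> common k j <> A].

Definition vanishes_on_boundary (R : realType) (V : nmodType) (M : mesh R)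
    (w : macro M) (v : bfun M V) : Prop :=
  forall k A, outer_edge w k A -> forall xi, ref_face A xi -> v k xi = 0.

(* F_h = pi_h o flat^-1 on the flat element k (a polynomial map there). *)
Definition Fh (R : realType) (proj : 'rV[R]_3 -> 'rV[R]_3) (kg : nat)
    (M : mesh R) (w : macro M) (k : 'I_(nel M)) : 'rV[R]_2 -> 'rV[R]_3 :=
  param proj kg k \o affinv (fvert w k).

Definition Fh_bounded (R : realType) (proj : 'rV[R]_3 -> 'rV[R]_3) (kg : nat)
    (M : mesh R) (w : macro M) (B : nat -> R) : Prop :=
  forall k, k \in mel w ->
    Cinf_bounded (interior (tri (fvert w k))) B (Fh proj kg w k).

Record mpart (R : realType) (M : mesh R) := MPart {
  npart : nat;
  pmac : 'I_npart -> macro M }.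

Definition is_partitioning (R : realType) (M : mesh R) (L : nat)
    (Om : mpart M) : Prop :=
  (forall p : 'I_(npart Om), is_macro (pmac p)) /\
  forall i : 'I_(nel M),
    (1 <= #|[set p : 'I_(npart Om) | i \in mel (pmac p)]| <= L)%N.

Definition macro_equiv (R : realType) (M M' : mesh R) (w : macro M)
    (w' : macro M') : Prop :=
  exists psi : 'rV[R]_2 -> 'rV[R]_2,
    [/\ set_bij (macro_bar w) (macro_bar w') psi,
        {within macro_bar w, continuous psi} &
        forall k, k \in mel w ->
          (exists2 k', k' \in mel w' &
             psi @` tri (fvert w k) = tri (fvert w' k')) /\
          exists (A : 'M[R]_2) (b : 'rV[R]_2),
            forall x, tri (fvert w k) x -> psi x = x *m A + b].

(* The continuous/broken functions on the flat macroelement are the families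
   (v k), k in [mel w], of pull-backs to the reference triangle; phi k is a
   function of the flat coordinates.  The constant depends on the derivative
   bounds B of phi and on the shape regularity rho of the flat triangulation. *)
Definition super_approximation (R : realType) (H : set R) (msh : R -> mesh R)
    (FV : fspace R) (h0 : R) : Prop :=
  forall (rho : R) (B : nat -> R), 0 < rho -> exists C : R,
    forall h, H h -> h <= h0 -> forall w : macro (msh h), is_macro w ->
    (forall k, k \in mel w -> shape_regular rho (fvert w k)) ->
    forall v : bfun (msh h) R,
    (forall k, k \in mel w -> inF FV (v k)) ->
    (forall k l xi eta, k \in mel w -> l \in mel w -> Tref xi -> Tref eta ->
       aff (fvert w k) xi = aff (fvert w l) eta -> v k xi = v l eta) ->
    forall phi : 'I_(nel (msh h)) -> 'rV[R]_2 -> R,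
    (forall k, k \in mel w ->
       Cinf_bounded (interior (tri (fvert w k))) B (phi k)) ->
    exists z : bfun (msh h) R,
      [/\ forall k, k \in mel w -> inF FV (z k),
          forall k m, k \in mel w -> (m <= 1)%N ->
            wnormT (fvert w k) m 2%:E
              (fun xi => phi k (aff (fvert w k) xi) * v k xi - z k xi) <=
            C * h * wnormT (fvert w k) m 2%:E (v k) &
          vanishes_on_boundary w v -> vanishes_on_boundary w z].

Definition in_Vbar (R : realType) (FV : fspace R) (M : mesh R) (w : macro M)
    (f : 'rV[R]_2 -> R) : Prop :=
  in_sobolev (interior (macro_bar w)) 1 2%:E f /\
  exists2 v : bfun M R, in_S FV v &
    forall k xi, k \in mel w -> Tref xi -> f (mflat w (aff (vert k) xi)) = v k xi.

(* Pressures may jump across edges: they are compared inside elements. *)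
Definition in_Qbar (R : realType) (cont : bool) (FQ : fspace R) (M : mesh R)
    (w : macro M) (f : 'rV[R]_2 -> R) : Prop :=
  in_Lp (interior (macro_bar w)) 2%:E f /\
  exists2 q : bfun M R, in_Q cont FQ q &
    forall k xi, k \in mel w -> interior (@Tref R) xi ->
      f (mflat w (aff (vert k) xi)) = q k xi.

Definition flat_stability (R : realType) (cont : bool) (FV FQ : fspace R)
    (M : mesh R) (w : macro M) (beta : R) : Prop :=
  let U := interior (macro_bar w) in
  forall q, in_Qbar cont FQ w q -> int2 U q = 0 -> l2norm U q != 0 ->
  exists v : 'I_2 -> 'rV[R]_2 -> R,
    [/\ forall a, in_Vbar FV w (v a),
        exists a x, macro_bar w x /\ v a x != 0,
        forall a, vanishes_on_boundary w
                    (fun k xi => v a (mflat w (aff (vert k) xi))) &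
        beta *
          Num.sqrt (\sum_(a < 2) \sum_(b < 2) l2norm U (wD U [:: b] (v a)) ^+ 2)
          * l2norm U q <=
        int2 U (fun x => (\sum_(a < 2) wD U [:: a] (v a) x) * q x)].

(* Omega is the family of macroelement partitionings and beta the stability
   constant of the flat macroelements. *)
Definition stable_pair (R : realType) (H : set R) (msh : R -> mesh R)
    (cont : bool) (FV FQ : fspace R) (Omega : forall h : R, mpart (msh h))
    (h0 beta : R) : Prop :=
  [/\ super_approximation H msh FV h0,
      exists L : nat, forall h, H h -> h <= h0 ->
        is_partitioning L (Omega h),
      exists (N : nat) (rep : 'I_N -> {h : R & macro (msh h)}),
        (forall n, H (projT1 (rep n)) /\ is_macro (projT2 (rep n))) /\
        forall h, H h -> h <= h0 -> forall p : 'I_(npart (Omega h)),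
          exists n, macro_equiv (projT2 (rep n)) (pmac p),
      exists C : R, forall h, H h -> h <= h0 ->
        forall p : 'I_(npart (Omega h)), diam (macro_bar (pmac p)) <= C * h &
      forall h, H h -> h <= h0 -> forall p : 'I_(npart (Omega h)),
        flat_stability cont FV FQ (pmac p) beta].

(* Surface calculus on the element parametrized by X over the reference
   triangle; functions and fields are given by their pull-backs.  Row a of
   [jacobian X xi] is the a-th partial derivative of X at xi.  Classical
   derivatives suffice, in the open triangle: X is polynomial and the local
   spaces lie in W^{2,oo}, hence in C^1. *)
Definition gram (R : realType) (X : 'rV[R]_2 -> 'rV[R]_3) (xi : 'rV[R]_2) :
    'M[R]_2 :=
  jacobian X xi *m (jacobian X xi)^T.

Definition area (R : realType) (X : 'rV[R]_2 -> 'rV[R]_3) (xi : 'rV[R]_2) : R :=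
  Num.sqrt (\det (gram X xi)).

Definition Ph (R : realType) (X : 'rV[R]_2 -> 'rV[R]_3) (xi : 'rV[R]_2) :
    'M[R]_3 :=
  tanproj (jacobian X xi).

Definition surface_grad (R : realType) (X : 'rV[R]_2 -> 'rV[R]_3)
    (f : 'rV[R]_2 -> R) (xi : 'rV[R]_2) : 'rV[R]_3 :=
  (\row_(a < 2) pd a f xi) *m invmx (gram X xi) *m jacobian X xi.

Definition surface_D (R : realType) (X : 'rV[R]_2 -> 'rV[R]_3)
    (u : 'rV[R]_2 -> 'rV[R]_3) (xi : 'rV[R]_2) : 'M[R]_3 :=
  \matrix_(i < 3) surface_grad X (fun eta => u eta 0 i) xi.

Definition surface_nabla (R : realType) (X : 'rV[R]_2 -> 'rV[R]_3)
    (u : 'rV[R]_2 -> 'rV[R]_3) (xi : 'rV[R]_2) : 'M[R]_3 :=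
  Ph X xi *m surface_D X u xi.

Definition surface_div (R : realType) (X : 'rV[R]_2 -> 'rV[R]_3)
    (u : 'rV[R]_2 -> 'rV[R]_3) (xi : 'rV[R]_2) : R :=
  \tr (surface_nabla X u xi).

Definition Pfield (R : realType) (X : 'rV[R]_2 -> 'rV[R]_3)
    (u : 'rV[R]_2 -> 'rV[R]_3) (xi : 'rV[R]_2) : 'rV[R]_3 :=
  u xi *m Ph X xi.

Definition Qfield (R : realType) (X : 'rV[R]_2 -> 'rV[R]_3)
    (u : 'rV[R]_2 -> 'rV[R]_3) (xi : 'rV[R]_2) : 'rV[R]_3 :=
  u xi *m (1%:M - Ph X xi).

Definition surface_int (R : realType) (M : mesh R) (X : bfun M 'rV[R]_3)
    (w : macro M) (f : bfun M R) : R :=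
  \sum_(k in mel w)
    int2 (interior (@Tref R)) (fun xi => f k xi * area (X k) xi).

Definition surface_l2 (R : realType) (M : mesh R) (X : bfun M 'rV[R]_3)
    (w : macro M) (q : bfun M R) : R :=
  Num.sqrt (surface_int X w (fun k xi => q k xi ^+ 2)).

Definition norm_H1tan (R : realType) (M : mesh R) (X : bfun M 'rV[R]_3)
    (w : macro M) (u : bfun M 'rV[R]_3) : R :=
  Num.sqrt (
    surface_int X w (fun k xi =>
      let G := surface_nabla (X k) (u k) xi in \tr (G *m G^T)) +
    surface_int X w (fun k xi => enorm (u k xi) ^+ 2)).

Definition norm_1h (R : realType) (M : mesh R) (X : bfun M 'rV[R]_3) (h : R)
    (w : macro M) (u : bfun M 'rV[R]_3) : R :=
  norm_H1tan X w (fun k => Pfield (X k) (u k)) +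
  h^-1 * surface_l2 X w (fun k xi => enorm (Qfield (X k) (u k) xi)).

Definition in_V3 (R : realType) (FV : fspace R) (M : mesh R)
    (u : bfun M 'rV[R]_3) : Prop :=
  forall c : 'I_3, in_S FV (fun k xi => u k xi 0 c).

Definition nonzero_on (R : realType) (V : nmodType) (M : mesh R) (w : macro M)
    (v : bfun M V) : Prop :=
  exists k xi, [/\ k \in mel w, Tref xi & v k xi <> 0].

(* Main.v *)
Require Import Defs.
From HB Require Import structures.
From mathcomp Require Import all_boot all_order all_algebra.
From mathcomp Require Import all_classical all_reals all_analysis.
From mathcomp Require Import measurable_realfun ess_sup_inf.
From mathcomp Require Import ring lra.

(** Flattening an element is the orthogonal projection onto the tangent plane
    of the fixed element of its macroelement.  Since Gamma is C^1 and compact and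
    a macroelement consists of boundedly many elements of size h, the jacobian of
    the parametrization of an element of Gamma_h is, up to a relative error e(h)
    tending to 0, that of the flat element followed by the inclusion of the
    fixed plane.  Given a pressure q, subtract its flat mean c, which is O(e)
    because the surface mean of q is 0, and let v be the velocity that flat
    stability provides for q - c.  Its components in the fixed tangent basis
    define a field on Gamma_h whose surface divergence differs from the flat
    divergence of v by O(e) |grad v| + O(e / h) |v|.  The last term is harmless
    by a discrete Poincare inequality |v| <= C h |grad v|: v vanishes on an outer
    edge, and its oscillation over one element is controlled by its gradient
    because the local space is finite dimensional.  The same bounds control the
    norm of the field.  So the flat inequality survives for small h.

    The flat inequality involves weak derivatives while the surface calculus is
    pointwise: functions of W^{2,oo} are shown to be of class C^1 by testing their
    difference quotients, and the weak derivatives on the flat macroelement are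
    identified with the classical ones element by element. *)

Set Implicit Arguments.
Unset Strict Implicit.
Unset Printing Implicit Defensive.

Import Order.TTheory GRing.Theory Num.Theory.
Import numFieldNormedType.Exports.

Local Open Scope classical_set_scope.
Local Open Scope ring_scope.

(** * Integration over planar sets *)

Section Plane.
Context {R : realType}.
Local Notation L1 := (@lebesgue_measure R).
Local Notation RR := (measurableTypeR R * measurableTypeR R)%type.

(** The obstacle is the factor 1/h. Differentiating the slowly turning tangent frame costs [S / h]
    times a small number, so the terms containing v itself must gain a factor h from the Poincare
    inequality; the same gain pays for the normal part, which [norm_1h] weights by 1/h. This gain
    must be uniform. The number of elements of a macroelement is bounded through the finitely many
    equivalence classes, an equivalence never increasing that number. The local constant lives on
    the reference triangle, and the powers of h cancel because the Dirichlet energy is scale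
    invariant in dimension two. The order of quantifiers in [macro_near_frame] is essential: the
    bound S on the inverse edge matrices is fixed before the tolerance e, so e may be chosen small
    in terms of S, of the Poincare constant and of [betabar]. The final constant is
    [betabar / (4 * C5 * K)]: K compares the first-order size of the field (gradient and v/h
    together) with the flat gradient, and C5 compares the norm of the field with that size. *)

Lemma lebesgue_affine_pos (c t : R) (A : set R) : 0 < c -> measurable A ->
  L1 A = (c%:E * L1 ((fun x : R => c * x + t)%R @^-1` A))%E.
Proof.
move=> c0 mA.
have mf : measurable_fun setT (fun x : measurableTypeR R => c * x + t : measurableTypeR R).
  by apply: measurable_funD => //; apply: measurable_funM.
have := @lebesgue_measure_unique R (mscale (NngNum (ltW c0)) (pushforward L1 (fun x : measurableTypeR R => c * x + t : measurableTypeR R))) _ A mA; apply => X [[a b] _ <-] /=.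
rewrite /mscale /= /pushforward.
have -> : (fun x : R => c * x + t) @^-1` `]a, b]%classic = `](a - t) / c, (b - t) / c]%classic.
  apply/seteqP; split => x /=; rewrite !in_itv /= ltr_pdivrMr// ler_pdivlMr// ltrBlDr lerBrDr mulrC //.
rewrite !lebesgue_measure_itv /= !lte_fin ltr_pM2r ?invr_gt0// ltrD2r.
case: ifP => // ab; last by rewrite mule0.
by rewrite -!EFinB -EFinM; congr (_%:E); field; rewrite gt_eqF.
Qed.

Lemma lebesgue_affine (c t : R) (A : set R) : c != 0 -> measurable A ->
  L1 A = (`|c|%:E * L1 ((fun x : R => c * x + t)%R @^-1` A))%E.
Proof.
move=> c0 mA; have [c1|c1|c1] := ltgtP 0 c.
- by rewrite gtr0_norm//; exact: lebesgue_affine_pos.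
- rewrite ltr0_norm// -lebesgue_measureN// /pushforward.
  have mA' : measurable ((-%R : R -> measurableTypeR R) @^-1` A).
    by rewrite -[X in measurable X]setTI; exact: oppr_measurable.
  rewrite (@lebesgue_affine_pos (- c) (- t) _ _ mA') ?oppr_gt0//.
  congr (_ * L1 _)%E; apply/seteqP; split => x /=; rewrite mulNr -opprD opprK//.
- by rewrite -c1 eqxx in c0.
Qed.

(** Change of variables by a map with constant Jacobian d, stated for measures only. In this form it
    composes, so linear maps can be treated factor by factor. *)
Definition cov (L : RR -> RR) (d : R) : Prop :=
  [/\ measurable_fun setT L, 0 < d &
      forall S, measurable S -> leb2 R S = (d%:E * leb2 R (L @^-1` S))%E].

Lemma cov_comp L L' d d' : cov L d -> cov L' d' -> cov (L \o L') (d * d').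
Proof.
move=> [mL d0 H] [mL' d0' H']; split; [exact: measurableT_comp|exact: mulr_gt0|].
move=> S mS; rewrite H// H'; first by rewrite muleA -EFinM.
by rewrite -[X in measurable X]setTI; exact: mL.
Qed.

Lemma cov_diag (a b s t : R) : a != 0 -> b != 0 ->
  cov (fun p : RR => (a * p.1 + s, b * p.2 + t)) (`|a| * `|b|).
Proof.
move=> a0 b0.
have m1 (c u : R) : measurable_fun setT (fun x : measurableTypeR R => c * x + u : measurableTypeR R).
  by apply: measurable_funD => //; apply: measurable_funM.
have mL : measurable_fun setT (fun p : RR => (a * p.1 + s, b * p.2 + t) : RR).
  apply/measurable_fun_pairP; split => /=.
    exact: (measurableT_comp (m1 a s) measurable_fst).
  exact: (measurableT_comp (m1 b t) measurable_snd).
have ab0 : 0 < `|a| * `|b| by rewrite mulr_gt0// normr_gt0.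
split => // S mS.
have := @product_measure_unique _ _ _ _ R L1 L1 (mscale (NngNum (ltW ab0)) (pushforward (leb2 R) (fun p : RR => (a * p.1 + s, b * p.2 + t) : RR))) _ S mS; apply => A B mA mB.
transitivity ((`|a| * `|b|)%:E * leb2 R (((fun x : R => a * x + s)%R @^-1` A) `*` ((fun x : R => b * x + t)%R @^-1` B)))%E; first by [].
rewrite [X in (_ * X)%E]product_measure1E; first last.
  by rewrite -[X in measurable X]setTI; exact: m1.
  by rewrite -[X in measurable X]setTI; exact: m1.
have eA := lebesgue_affine s a0 mA; have eB := lebesgue_affine t b0 mB.
transitivity ((`|a|%:E * L1 ((fun x : R => a * x + s)%R @^-1` A)) * (`|b|%:E * L1 ((fun x : R => b * x + t)%R @^-1` B)))%E; last by rewrite -eA -eB.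
by rewrite EFinM muleACA.
Qed.

Lemma cov_swap : cov (fun p : RR => (p.2, p.1)) 1.
Proof.
have mL : measurable_fun setT (fun p : RR => (p.2, p.1) : RR).
  by apply/measurable_fun_pairP; split => /=; [exact: measurable_snd|exact: measurable_fst].
split => // S mS.
have := @product_measure_unique _ _ _ _ R L1 L1 (pushforward (leb2 R) (fun p : RR => (p.2, p.1) : RR)) _ S mS; rewrite mul1e; apply => A B mA mB.
rewrite /= /pushforward.
rewrite [X in (leb2 R) X](_ : _ = B `*` A); last by apply/seteqP; split => x /= [].
by rewrite [LHS]product_measure1E// muleC.
Qed.

(** Uniqueness of the product measure reduces the claim to rectangles. The slice of a sheared
    rectangle at height y is a translate of its base, hence has the same length. *)
Lemma cov_shear (c : R) : cov (fun p : RR => (p.1 + c * p.2, p.2)) 1.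
Proof.
have mL : measurable_fun setT (fun p : RR => (p.1 + c * p.2, p.2) : RR).
  apply/measurable_fun_pairP; split => /=; last exact: measurable_snd.
  apply: measurable_funD; first exact: measurable_fst.
  by apply: measurable_funM => //; exact: measurable_snd.
split => // S mS.
have := @product_measure_unique _ _ _ _ R L1 L1 (pushforward (leb2 R) (fun p : RR => (p.1 + c * p.2, p.2) : RR)) _ S mS; rewrite mul1e; apply => A B mA mB.
have mX : measurable ((fun p : RR => (p.1 + c * p.2, p.2) : RR) @^-1` (A `*` B)).
  by rewrite -[X in measurable X]setTI; apply: mL => //; exact: measurableX.
rewrite /= /pushforward.
transitivity ((L1 \x^ L1)%E ((fun p : RR => (p.1 + c * p.2, p.2) : RR) @^-1` (A `*` B))).
  by apply: product_measure_unique => // A' B' mA' mB'; exact: product_measure2E.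
rewrite /= /product_measure2.
rewrite (eq_integral (fun y => L1 A * (\1_B y)%:E)%E); last first.
  move=> y _ /=; rewrite indicE; case: (boolP (y \in B)) => [|/negP] yB /=.
    rewrite mule1 (lebesgue_affine_pos (c * y) ltr01 mA) mul1e; congr (L1 _).
    apply/seteqP; split => x /=; rewrite /ysection /= ?inE /= mul1r; first by case.
    by move=> ?; split => //; exact: set_mem.
  rewrite mule0 [X in L1 X](_ : _ = set0) ?measure0//.
  by apply/seteqP; split => x //=; rewrite /ysection /= ?inE /= => -[_] /mem_set.
by rewrite ge0_integralZl ?integral_indic ?setIT//; exact: measurableT_comp.
Qed.

Lemma cov_shear' (c : R) : cov (fun p : RR => (p.1, p.2 + c * p.1)) 1.
Proof.
have := cov_comp cov_swap (cov_comp (cov_shear c) cov_swap).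
by rewrite !mulr1; apply.
Qed.

Lemma cov_linear (a b c d s t : R) : a * d - b * c != 0 ->
  cov (fun p : RR => (a * p.1 + c * p.2 + s, b * p.1 + d * p.2 + t)) `|a * d - b * c|.
Proof.
have main (a' b' c' d' : R) : a' != 0 -> a' * d' - b' * c' != 0 ->
  cov (fun p : RR => (a' * p.1 + c' * p.2 + s, b' * p.1 + d' * p.2 + t)) `|a' * d' - b' * c'|.
  move=> a0 D0.
  (* Gaussian elimination: when a' is nonzero the matrix is shear, diagonal, shear, and this is the
     second pivot. *)
  have e0 : d' - b' * c' / a' != 0.
    by apply: contra_neq D0 => /(congr1 (fun z => a' * z)); rewrite mulr0 => <-; field.
  have H := cov_comp (cov_shear' (b' / a')) (cov_comp (cov_diag s (t - b' / a' * s) a0 e0) (cov_shear (c' / a'))).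
  rewrite mulr1 mul1r -normrM in H.
  rewrite (_ : a' * d' - b' * c' = a' * (d' - b' * c' / a')); last by field.
  rewrite (_ : (fun p => _) = ((fun p : RR => (p.1, p.2 + b' / a' * p.1)) \o
     ((fun p : RR => (a' * p.1 + s, (d' - b' * c' / a') * p.2 + (t - b' / a' * s))) \o (fun p : RR => (p.1 + c' / a' * p.2, p.2)))))//.
  by apply/funext => -[x y] /=; congr (_, _); field.
(* If a = 0 then c is nonzero, and swapping the two variables brings c to the pivot position. *)
move=> D0; case: (eqVneq a 0) => [a0|a0]; last exact: main.
have c0 : c != 0 by apply: contra_neq D0 => ->; rewrite a0; ring.
have D1 : c * b - d * a != 0 by apply: contra_neq D0 => H; rewrite -[LHS]opprK -[RHS]oppr0; congr (- _); rewrite -H; ring.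
have := cov_comp (main c d a b c0 D1) cov_swap.
rewrite mulr1 -normrN (_ : - (c * b - d * a) = a * d - b * c); last by ring.
rewrite (_ : (fun p => (_, _)) \o _ = (fun p : RR => (a * p.1 + c * p.2 + s, b * p.1 + d * p.2 + t)))//.
by apply/funext => -[x y] /=; congr (_, _); ring.
Qed.

(** By definition of [cov], d times the pushforward of Lebesgue measure under L is Lebesgue measure
    itself. *)
Lemma cov_ge0_integral L d (D : set RR) (f : RR -> \bar R) :
  cov L d -> measurable D -> measurable_fun D f -> {in D, forall y, (0 <= f y)%E} ->
  (\int[leb2 R]_(x in D) f x = d%:E * \int[leb2 R]_(x in L @^-1` D) (f \o L) x)%E.
Proof.
move=> [mL d0 H] mD mf f0.
have := ge0_integral_pushforward mL (leb2 R) mD mf f0.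
move=> <-.
rewrite -[d in RHS]/((NngNum (ltW d0))%:num) -ge0_integral_mscale//; last by move=> x /mem_set; exact: f0.
apply: eq_measure_integral => A mA _.
exact: (H A mA).
Qed.

Lemma cov_integrable L d (D : set RR) (f : RR -> \bar R) :
  cov L d -> measurable D -> (leb2 R).-integrable D f ->
  (leb2 R).-integrable (L @^-1` D) (f \o L).
Proof.
move=> cL mD /integrableP [mf fi]; have [mL d0 _] := cL.
have mLD : measurable (L @^-1` D) by rewrite -[X in measurable X]setTI; exact: mL.
apply/integrableP; split.
  apply: (measurable_comp mD) => //; first by move=> _ [x Lx <-].
  exact: measurable_funTS.
move: fi; rewrite (cov_ge0_integral cL)//; last exact: measurableT_comp.
move=> fi; have [//|] := boolP (\int[leb2 R]_(x in L @^-1` D) `|(f \o L) x| < +oo)%E.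
rewrite -leNgt leye_eq => /eqP E.
by rewrite E /= mulry gtr0_sg// mul1e ltxx in fi.
Qed.

Lemma cov_integral L d (D : set RR) (f : RR -> \bar R) :
  cov L d -> measurable D -> (leb2 R).-integrable D f ->
  (\int[leb2 R]_(x in D) f x = d%:E * \int[leb2 R]_(x in L @^-1` D) (f \o L) x)%E.
Proof.
move=> cL mD fi; have [mL d0 _] := cL; have /integrableP[mf _] := fi.
have e1 : ((f \o L)^\+ = f^\+ \o L)%E by apply/funext => x; rewrite /= !funeposE.
have e2 : ((f \o L)^\- = f^\- \o L)%E by apply/funext => x; rewrite /= !funenegE.
rewrite [LHS]integralE [in RHS]integralE.
rewrite (cov_ge0_integral cL)//; last exact/measurable_funepos.
rewrite [X in (_ - X)%E](cov_ge0_integral cL)//; last exact/measurable_funeneg.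
rewrite -muleBr//.
  by rewrite e1 e2.
apply: fin_num_adde_defl; rewrite fin_numN.
have mLD : measurable (L @^-1` D) by rewrite -[X in measurable X]setTI; exact: mL.
rewrite -e2; apply: integrable_fin_num => //; apply: integrable_funeneg => //; exact: cov_integrable cL mD fi.
Qed.
End Plane.

(** * Measurability and the integral [int2] in row-vector coordinates *)

Section Int2.
Context {R : realType}.
Local Notation RR := (measurableTypeR R * measurableTypeR R)%type.
Implicit Types (U : set 'rV[R]_2) (f g : 'rV[R]_2 -> R).

Lemma ord2P (i : 'I_2) : i = 0 \/ i = 1.
Proof. by case: i => [[|[|//]] ?]; [left|right]; exact/val_inj. Qed.

Definition msb U := measurable (@vec2 R @^-1` U : set RR).

Lemma msb_ball (x : 'rV[R]_2) e : 0 < e -> msb (ball x e).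
Proof.
move=> e0.
rewrite /msb (_ : _ @^-1` _ = ball (x 0 0 : R) e `*` ball (x 0 1 : R) e).
  by apply: measurableX; exact: measurable_ball.
apply/seteqP; split => [[a b] /= H|[a b] /= [Ha Hb]].
  by case: H => _ H; split; [have := H 0 0|have := H 0 1]; rewrite mxE.
split=> // i j; rewrite ord1 mxE /=; by case: (ord2P j) => ->.
Qed.

Lemma msbD U V : msb U -> msb V -> msb (U `\` V).
Proof. by move=> *; exact: measurableD. Qed.
Lemma msbT : msb setT.
Proof. by rewrite /msb preimage_setT. Qed.

(** The topology lives on row vectors and the sigma-algebra on pairs. An open set is a countable
    union of sup-norm balls with rational centres and radii 1/(n+1), whose preimages are products of
    intervals. *)
Lemma msb_open U : open U -> msb U.
Proof.
move=> oU.
pose c (i : rat * rat * nat) : 'rV[R]_2 := vec2 (ratr i.1.1, ratr i.1.2).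
pose r (i : rat * rat * nat) : R := i.2.+1%:R^-1.
have -> : U = \bigcup_(i in [set i | ball (c i) (r i) `<=` U]) ball (c i) (r i).
  apply/seteqP; split => [x Ux|x [i /= + bx]]; last exact.
  have /nbhs_ballP [e /= e0 eU] : nbhs x U by exact: open_nbhs_nbhs.
  have [n ne] : exists n : nat, n.+1%:R^-1 < e / 2 :> R.
    have [n _ H] := near_infty_natSinv_lt (PosNum (divr_gt0 e0 (ltr0n R 2))).
    by exists n; apply: (H n) => /=.
  have n0 : 0 < n.+1%:R^-1 :> R by rewrite invr_gt0.
  have q (d y : R) : 0 < d -> exists q : rat, ball (ratr q : R) d y.
    move=> d0; have /rat_in_itvoo [q] : y - d < y + d by lra.
    rewrite in_itv /= => /andP[q1 q2]; exists q; rewrite /ball /= ltr_norml; lra.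
  have [q0 h0] := q _ (x 0 0) n0; have [q1 h1] := q _ (x 0 1) n0.
  have bx : ball (c (q0, q1, n)) (r (q0, q1, n)) x.
    by split=> // i j; rewrite ord1 mxE /=; case: (ord2P j) => ->.
  exists (q0, q1, n) => //= y hy; apply: eU.
  apply: (@ball_splitr _ _ (c (q0, q1, n))); [exact: le_ball (ltW ne) _ bx|exact: le_ball (ltW ne) _ hy].
rewrite /msb preimage_bigcup bigcup_mkcond; apply: countable_bigcupT_measurable.
  exact: countableP.
by move=> i; case: ifP => // _; apply: msb_ball; rewrite invr_gt0.
Qed.

Lemma measurable2_sub U V f : msb V -> U `<=` V -> measurable2 V f -> measurable2 U f.
Proof. by move=> mV UV; apply: measurable_funS => //; exact: preimage_subset. Qed.

Lemma measurable2_continuous U f :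
  open U -> (forall x, U x -> {for x, continuous f}) -> measurable2 U f.
Proof.
move=> oU cf; rewrite /measurable2 => mU.
apply: (measurability _ (RGenOInfty.measurableE R)) => // _ [_ [a ->] <-].
rewrite (_ : _ `&` _ = @vec2 R @^-1` (U `&` f @^-1` `]a, +oo[)); last by apply/seteqP; split.
apply: msb_open; rewrite openE => x [Ux] /=; rewrite in_itv /= andbT => afx.
rewrite /interior; near=> y; split; first by near: y; exact: open_nbhs_nbhs.
rewrite /= in_itv /= andbT; near: y.
by have /cvgr_gt := cf x Ux; exact.
Unshelve. all: by end_near.
Qed.

Lemma eq_int2 U f g : (forall x, U x -> f x = g x) -> int2 U f = int2 U g.
Proof. by move=> fg; apply: eq_Rintegral => p; rewrite inE => /= Up; exact: fg. Qed.

Lemma eq_integrable2 U f g : (forall x, U x -> f x = g x) ->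
  msb U -> integrable2 U f -> integrable2 U g.
Proof. by move=> fg mU; apply: eq_integrable => // p; rewrite inE => /= Up; rewrite fg. Qed.

Lemma int2D U f g : msb U -> integrable2 U f -> integrable2 U g ->
  int2 U (fun x => f x + g x) = int2 U f + int2 U g.
Proof. by move=> mU fi gi; exact: RintegralD. Qed.

Lemma int2B U f g : msb U -> integrable2 U f -> integrable2 U g ->
  int2 U (fun x => f x - g x) = int2 U f - int2 U g.
Proof. by move=> mU fi gi; exact: RintegralB. Qed.

Lemma int2Z U c f : msb U -> integrable2 U f ->
  int2 U (fun x => c * f x) = c * int2 U f.
Proof. by move=> mU fi; exact: RintegralZl. Qed.

Lemma integrable2D U f g : msb U -> integrable2 U f -> integrable2 U g ->
  integrable2 U (fun x => f x + g x).
Proof. by move=> mU fi gi; exact: (integrableD mU fi gi). Qed.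

Lemma integrable2B U f g : msb U -> integrable2 U f -> integrable2 U g ->
  integrable2 U (fun x => f x - g x).
Proof. by move=> mU fi gi; exact: (integrableB mU fi gi). Qed.

Lemma integrable2Z U c f : msb U -> integrable2 U f ->
  integrable2 U (fun x => c * f x).
Proof. by move=> mU fi; exact: (integrableZl mU _ fi). Qed.

Lemma le_int2 U f g : msb U -> integrable2 U f -> integrable2 U g ->
  (forall x, U x -> f x <= g x) -> int2 U f <= int2 U g.
Proof. by move=> mU fi gi fg; apply: le_Rintegral => // p Up; exact: fg. Qed.

Lemma int2_ge0 U f : (forall x, U x -> 0 <= f x) -> 0 <= int2 U f.
Proof. by move=> f0; apply: Rintegral_ge0 => p Up; exact: f0. Qed.

Lemma ler_norm_int2 U f : msb U -> integrable2 U f ->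
  `|int2 U f| <= int2 U (fun x => `|f x|).
Proof. by move=> mU fi; exact: le_normr_Rintegral. Qed.

Lemma integrable2_norm U f : integrable2 U f -> integrable2 U (fun x => `|f x|).
Proof. by move=> fi; exact: integrable_norm. Qed.

Lemma integrable2_measurable U f : integrable2 U f -> measurable2 U f.
Proof. by move=> /integrableP[mf _]; exact/measurable_EFinP. Qed.

Lemma le_integrable2 U f g : msb U -> measurable2 U f ->
  (forall x, U x -> `|f x| <= g x) -> integrable2 U g -> integrable2 U f.
Proof.
move=> mU mf fg; apply: le_integrable => //; first exact/measurable_EFinP.
by move=> p Up /=; rewrite lee_fin (le_trans (fg _ Up))// ler_norm.
Qed.

Lemma integrable2S U V f : msb U -> msb V -> U `<=` V -> integrable2 V f -> integrable2 U f.
Proof. by move=> mU mV UV; apply: integrableS => //; exact: preimage_subset. Qed.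

Lemma int2_0 U : int2 U (fun=> 0) = 0.
Proof. by rewrite /int2 /Rintegral integral0. Qed.

Lemma integrable2_0 U : integrable2 U (fun=> 0).
Proof. exact: integrable0. Qed.

Lemma int2_sum U (I : Type) (r : seq I) (P : pred I) (F : I -> 'rV[R]_2 -> R) : msb U ->
  (forall i, P i -> integrable2 U (F i)) ->
  integrable2 U (fun x => \sum_(i <- r | P i) F i x) /\
  int2 U (fun x => \sum_(i <- r | P i) F i x) = \sum_(i <- r | P i) int2 U (F i).
Proof.
move=> mU Fi; elim: r => [|i r [IH1 IH2]].
  rewrite big_nil (_ : (fun x => _) = fun=> 0); last by apply/funext => p; rewrite big_nil.
  by split; [exact: integrable2_0|exact: int2_0].
rewrite big_cons (_ : (fun x => _) = (fun x => if P i then F i x + \sum_(j <- r | P j) F j x else \sum_(j <- r | P j) F j x)); last first.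
  by apply/funext => x; rewrite big_cons.
case: ifP => Pi //; split; first exact/integrable2D/IH1/Fi.
by rewrite int2D ?IH2//; exact: Fi.
Qed.

End Int2.

(** * Affine change of variables *)

Section Affine2.
Context {R : realType}.
Local Notation RR := (measurableTypeR R * measurableTypeR R)%type.
Implicit Types (P : 'I_3 -> 'rV[R]_2) (U : set 'rV[R]_2) (f : 'rV[R]_2 -> R).

(** [aff P] in the coordinates of pairs, where the measure lives. *)
Definition aff_plane P (p : RR) : RR :=
  let E := edgemx P in
  (E 0 0 * p.1 + E 1 0 * p.2 + P ord0 0 0, E 0 1 * p.1 + E 1 1 * p.2 + P ord0 0 1).

Lemma vec2_aff P p : vec2 (aff_plane P p) = aff P (vec2 p).
Proof.
apply/rowP => i; rewrite /aff [RHS]mxE [X in _ = _ + X]mxE big_ord_recl big_ord1.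
rewrite /vec2 [LHS]mxE [X in X * _ + _]mxE [X in _ + (_ + X * _)]mxE /= (_ : lift ord0 ord0 = 1 :> 'I_2); last exact/val_inj.
by case: (ord2P i) => -> /=; rewrite addrC; congr (_ + (_ + _)); rewrite mulrC.
Qed.

Lemma det2E (A : 'M[R]_2) : \det A = A 0 0 * A 1 1 - A 0 1 * A 1 0.
Proof.
have l0 : lift ord0 ord0 = 1 :> 'I_2 by exact/val_inj.
have l1 : lift 1 0 = 0 :> 'I_2 by exact/val_inj.
rewrite (expand_det_row _ 0) big_ord_recl big_ord1 /cofactor !det_mx11 /= !mxE /=.
by rewrite !l0 l1 expr0 expr1; ring.
Qed.

Lemma cov_aff P : \det (edgemx P) != 0 -> cov (aff_plane P) `|\det (edgemx P)|.
Proof. by rewrite det2E; exact: cov_linear. Qed.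

Lemma affK P : \det (edgemx P) != 0 -> cancel (aff P) (affinv P).
Proof.
move=> D0 x; rewrite /affinv /aff addrAC subrr add0r mulmxK//.
by rewrite unitmxE unitfE.
Qed.

Lemma affinvK P : \det (edgemx P) != 0 -> cancel (affinv P) (aff P).
Proof.
move=> D0 x; rewrite /affinv /aff mulmxKV ?unitmxE ?unitfE//.
by rewrite addrC subrK.
Qed.

Lemma int2_aff P U f : \det (edgemx P) != 0 -> msb U -> integrable2 U f ->
  [/\ msb (aff P @^-1` U), integrable2 (aff P @^-1` U) (f \o aff P) &
  int2 U f = `|\det (edgemx P)| * int2 (aff P @^-1` U) (f \o aff P)].
Proof.
move=> D0 mU fi; have cL := cov_aff D0; have [mL _ _] := cL.
have e1 : @vec2 R @^-1` (aff P @^-1` U) = aff_plane P @^-1` (@vec2 R @^-1` U).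
  by apply/seteqP; split => p; rewrite /= vec2_aff.
have mL' : measurable (aff_plane P @^-1` (@vec2 R @^-1` U)).
  by rewrite -[X in measurable X]setTI; exact: mL.
have e2 : (fun p => ((f \o aff P) (vec2 p))%:E) = (fun p => (f (vec2 p))%:E) \o aff_plane P.
  by apply/funext => p; rewrite /= vec2_aff.
have ci := cov_integrable cL mU fi.
split; [by rewrite /msb e1|by rewrite /integrable2 e1 e2|].
rewrite /int2 /Rintegral (cov_integral cL mU fi) e1 -[X in integral _ _ X]e2 fineM//.
by rewrite e2; exact: integrable_fin_num.
Qed.
End Affine2.

(** * Test functions *)

Section Smooth1.
Context {R : realType}.
Implicit Types (a b f g : R -> R).

(** Smoothness is encoded coinductively: a function is smooth if it belongs to some class stable
    under derivation. Exhibiting such a class replaces inductions on the order of the derivative. *)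
Definition dclosed (K : (R -> R) -> Prop) : Prop :=
  forall f, K f -> exists2 g, K g & forall x : R, is_derive x 1 f (g x).

Definition smooth1 a : Prop := exists2 K, dclosed K & K a.

Lemma smooth1_derive a : smooth1 a ->
  exists2 b, smooth1 b & forall x : R, is_derive x 1 a (b x).
Proof. by move=> [K dK Ka]; have [b Kb ab] := dK _ Ka; exists b => //; exists K. Qed.

Lemma smooth1_intro a b : smooth1 b -> (forall x : R, is_derive x 1 a (b x)) -> smooth1 a.
Proof.
move=> [K dK Kb] ab; exists (fun f => K f \/ f = a); last by right.
move=> f [Kf|->]; last by exists b => //; left.
by have [g Kg fg] := dK _ Kf; exists g => //; left.
Qed.

Lemma is_derive_continuous f (x l : R) : is_derive x 1 f l -> {for x, continuous f}.
Proof. by move=> [H _]; apply: differentiable_continuous; exact/derivable1_diffP. Qed.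

Lemma smooth1_continuous a : smooth1 a -> continuous a.
Proof.
by move=> /smooth1_derive[b _ ab] x; exact: (is_derive_continuous (ab x)).
Qed.

(** By the Leibniz rule the algebra generated by a class stable under derivation is stable too; this
    gives products and sums of smooth functions. *)
Inductive alg (K : (R -> R) -> Prop) : (R -> R) -> Prop :=
| alg_base f : K f -> alg K f
| alg_mul f g : alg K f -> alg K g -> alg K (fun x => f x * g x)
| alg_add f g : alg K f -> alg K g -> alg K (fun x => f x + g x).

Lemma alg_dclosed K : (forall f, K f -> exists2 g, alg K g & forall x : R, is_derive x 1 f (g x)) ->
  dclosed (alg K).
Proof.
move=> dK f; elim => {f} [f /dK//|f g Af [f' Af' ff'] Ag [g' Ag' gg']|f g Af [f' Af' ff'] Ag [g' Ag' gg']].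
- exists (fun x => f x * g' x + g x * f' x).
    by apply: alg_add; apply: alg_mul.
  move=> x; have := ff' x; have := gg' x => ? ?; exact: is_derive_eq.
- by exists (fun x => f' x + g' x); [exact: alg_add|move=> x; exact: is_deriveD].
Qed.

Lemma smooth1M a b : smooth1 a -> smooth1 b -> smooth1 (fun x => a x * b x).
Proof.
move=> [K dK Ka] [K' dK' Kb]; exists (alg (fun f => K f \/ K' f)).
  apply: alg_dclosed => f [/dK|/dK'] [g ? ?]; exists g => //; apply: alg_base; by [left|right].
by apply: alg_mul; apply: alg_base; [left|right].
Qed.

Lemma smooth1D a b : smooth1 a -> smooth1 b -> smooth1 (fun x => a x + b x).
Proof.
move=> [K dK Ka] [K' dK' Kb]; exists (alg (fun f => K f \/ K' f)).
  apply: alg_dclosed => f [/dK|/dK'] [g ? ?]; exists g => //; apply: alg_base; by [left|right].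
by apply: alg_add; apply: alg_base; [left|right].
Qed.

Lemma smooth1_cst (c : R) : smooth1 (fun=> c).
Proof.
exists (fun f => exists d, f = fun=> d); last by exists c.
by move=> f [d ->]; exists (fun=> 0); [exists 0|move=> x; exact: is_derive_cst].
Qed.

Lemma smooth1Z (c : R) a : smooth1 a -> smooth1 (fun x => c * a x).
Proof. by move=> sa; apply: smooth1M => //; exact: smooth1_cst. Qed.

Lemma is_derive_line f (c d x l : R) : is_derive (c * x + d) 1 f l ->
  is_derive x 1 (fun y => f (c * y + d)) (c * l).
Proof.
move=> fl; have H : is_derive x 1 (fun y : R => c * y + d) c.
  by apply: is_derive_eq; rewrite addr0 !scaler1 // -[RHS]mulr1.
have := @is_derive1_comp R f (fun y : R => c * y + d) x _ _ fl H; by rewrite mulrC.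
Qed.

Lemma smooth1_line a (c d : R) : smooth1 a -> smooth1 (fun x => a (c * x + d)).
Proof.
move=> [K dK Ka].
exists (fun f => exists g k, K g /\ f = fun x => k * g (c * x + d)); last first.
  by exists a, 1; split => //; apply/funext => x; rewrite mul1r.
move=> _ [g [k [Kg ->]]]; have [g' Kg' gg'] := dK _ Kg.
exists (fun x => (k * c) * g' (c * x + d)); first by exists g', (k * c).
move=> x; have := is_derive_line (gg' (c * x + d)) => H.
have -> : k * c * g' (c * x + d) = k *: (c * g' (c * x + d)) by rewrite -mulrA.
exact: is_deriveZ.
Qed.

(** The functions p(1/x) exp(-1/x), extended by 0, form a class stable under derivation:
    differentiating replaces p by X^2 (p - p'). The case p = 1 is the usual flat function. *)
Definition flat_exp (p : {poly R}) (x : R) : R :=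
  if 0 < x then p.[x^-1] * expR (- x^-1) else 0.

Lemma pow_le_expR n (t : R) : 0 <= t -> t ^+ n <= n%:R ^+ n * expR t.
Proof.
move=> t0; case: n => [|n]; first by rewrite !expr0 mul1r -expR0 ler_expR.
have n0 : 0 < n.+1%:R :> R by rewrite ltr0n.
have H : t / n.+1%:R <= expR (t / n.+1%:R).
  by apply: le_trans (expR_ge1Dx _); rewrite lerDr ler01.
have := lerXn2r n.+1 (divr_ge0 t0 (ltW n0)) (expR_ge0 _) H.
rewrite -expRM_natl [_ * (_ / _)]mulrC divfK ?gt_eqF// expr_div_n ler_pdivrMr ?exprn_gt0//.
by rewrite mulrC.
Qed.

Lemma poly_le_expR (p : {poly R}) : exists2 C, 0 <= C &
  forall t, 0 <= t -> `|p.[t]| <= C * expR t.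
Proof.
elim/poly_ind : p => [|p c [C C0 H]].
  by exists 0 => // t _; rewrite horner0 normr0 mul0r.
have [C1 C10 H1] : exists2 C1, 0 <= C1 & forall t, 0 <= t -> `|p.[t] * t| <= C1 * expR t.
  clear C C0 H c.
  suff main n (q : {poly R}) : (size q <= n)%N -> exists2 C, 0 <= C &
      forall t, 0 <= t -> `|q.[t]| <= C * expR t.
    by have [C C0 HC] := main _ (p * 'X) (leqnn _); exists C => // t /HC; rewrite hornerMX.
  move=> _; exists (\sum_(i < size q) `|q`_i| * i%:R ^+ i).
    by apply: sumr_ge0 => i _; rewrite mulr_ge0 ?exprn_ge0.
  move=> t t0; rewrite horner_coef (le_trans (ler_norm_sum _ _ _))// mulr_suml.
  apply: ler_sum => i _; rewrite normrM -mulrA ler_wpM2l// ger0_norm ?exprn_ge0//.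
  exact: pow_le_expR.
exists (C1 + `|c|) => [|t t0]; first exact: addr_ge0.
rewrite hornerMXaddC (le_trans (ler_normD _ _))// mulrDl lerD ?H1// ler_peMr//.
by rewrite -expR0 ler_expR.
Qed.

(** Quadratic smallness makes the difference quotient at the gluing point 0 tend to 0. It follows
    from the exponential bound on the polynomial X^2 p at 1/x. *)
Lemma flat_exp_small p : exists2 C, 0 <= C & forall x, `|flat_exp p x| <= C * x ^+ 2.
Proof.
have [C C0 HC] := poly_le_expR ('X^2 * p); exists C => // x; rewrite /flat_exp.
case: ifPn => x0; last by rewrite normr0 mulr_ge0 ?sqr_ge0.
have /HC : 0 <= x^-1 by rewrite invr_ge0 ltW.
rewrite hornerM hornerXn normrM ger0_norm ?sqr_ge0// normrM (ger0_norm (expR_ge0 _)) expRN.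
rewrite exprVn ler_pdivrMl ?exprn_gt0// ler_pdivrMr ?expR_gt0// => /le_trans; apply.
by rewrite mulrA [_ * C]mulrC.
Qed.

Lemma is_derive_cvg (V W : normedModType R) (f : V -> W) x v l :
  h^-1 *: (f (h *: v + x) - f x) @[h --> 0^'] --> l -> is_derive x v f l.
Proof.
move=> H; have dH : derivable f x v by apply/cvg_ex; exists l.
by split => //; exact: cvg_lim.
Qed.

Lemma is_derive_flat_exp p (x : R) :
  is_derive x 1 (flat_exp p) (flat_exp ('X^2 * (p - p^`())) x).
Proof.
have [x0|x0|->] := ltgtP x 0.
- have -> : flat_exp ('X^2 * (p - p^`())) x = 0 by rewrite /flat_exp ltNge ltW.
  apply: (near_eq_is_derive (f := cst 0)) => //.
  by near=> y; rewrite /flat_exp ltNge ltW//; near: y; exact: lt_nbhsl.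
- have -> : flat_exp ('X^2 * (p - p^`())) x = (- x^-2 * p^`().[x^-1]) * expR (- x^-1) + p.[x^-1] * (x^-2 * expR (- x^-1)).
    by rewrite /flat_exp x0 hornerM hornerXn hornerD hornerN -exprVn; ring.
  apply: (@near_eq_is_derive R R R (fun y : R => p.[y^-1] * expR (- y^-1)) (flat_exp p) x 1).
    by near=> y; rewrite /flat_exp ifT//; near: y; exact: lt_nbhsr.
  have dV : is_derive x 1 (fun y : R => y^-1) (- x^-2).
    have := @is_deriveV R id x 1 1; rewrite gt_eqF// => /(_ isT (is_derive_id _ _)) H.
    by apply: is_derive_eq; rewrite /GRing.scale /= mulr1.
  have d1 := @is_derive1_comp R (fun y => p.[y]) (fun y : R => y^-1) x _ _ (is_derive_poly p _) dV.
  have d2 := @is_derive1_comp R expR (fun y : R => - y^-1) x _ _ (is_derive_expR _) (is_deriveN dV).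
  apply: (is_derive_eq (is_deriveM d1 d2)).
  by rewrite opprK /GRing.scale /=; ring.
- rewrite [X in is_derive _ _ _ X](_ : _ = 0); last by rewrite /flat_exp ltxx.
  apply: is_derive_cvg; have [C C0 HC] := flat_exp_small p.
  have C1 : 0 < C + 1 by rewrite ltr_wpDl.
  apply/cvgr0Pnorm_lt => e e0; near=> h.
  have h0 : h != 0 by near: h; exact: nbhs_dnbhs_neq.
  have hh : 0 < `|h| by rewrite normr_gt0.
  have he : `|h| < e / (C + 1) by near: h; apply: dnbhs0_lt; exact: divr_gt0.
  rewrite scaler1 addr0 [X in _ - X]/flat_exp ltxx subr0 normrZ normfV.
  rewrite mulrC ltr_pdivrMr//; apply: (le_lt_trans (HC h)).
  rewrite -normr_id -real_normK ?num_real// expr2 normr_id mulrA ltr_pM2r//.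
  move: he; rewrite ltr_pdivlMr//; nra.
Unshelve. all: by end_near.
Qed.

Lemma smooth1_flat_exp : smooth1 (flat_exp 1).
Proof.
exists (fun f => exists p, f = flat_exp p); last by exists 1.
move=> _ [p ->]; exists (flat_exp ('X^2 * (p - p^`()))); first by eexists.
by move=> x; exact: is_derive_flat_exp.
Qed.

(** For 0 < c it is positive exactly on ]l, r[. A large c steepens it towards the indicator, so one
    family serves both as mollifiers and as approximations of boxes. *)
Definition bump (c l r x : R) : R :=
  flat_exp 1 (c * (x - l)) * flat_exp 1 (c * (r - x)).

Lemma smooth1_bump c l r : smooth1 (bump c l r).
Proof.
rewrite /bump; apply: smooth1M.
  rewrite (_ : (fun x => _) = (fun x => flat_exp 1 (c * x + (- c * l)))); last by apply/funext => x; congr flat_exp; ring.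
  exact/smooth1_line/smooth1_flat_exp.
rewrite (_ : (fun x => _) = (fun x => flat_exp 1 (- c * x + c * r))); last by apply/funext => x; congr flat_exp; ring.
exact/smooth1_line/smooth1_flat_exp.
Qed.

Lemma flat_exp1_ge0 x : 0 <= flat_exp 1 x.
Proof. by rewrite /flat_exp hornerC mul1r; case: ifP => // _; exact: expR_ge0. Qed.

Lemma flat_exp1_le1 x : flat_exp 1 x <= 1.
Proof.
rewrite /flat_exp hornerC mul1r; case: ifP => // x0.
by rewrite -expR0 ler_expR oppr_le0 invr_ge0 ltW.
Qed.

Lemma bump_ge0 c l r x : 0 <= bump c l r x.
Proof. by rewrite mulr_ge0// flat_exp1_ge0. Qed.

Lemma bump_le1 c l r x : bump c l r x <= 1.
Proof. by rewrite mulr_ile1 ?flat_exp1_ge0 ?flat_exp1_le1. Qed.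

Lemma bump_eq0 c l r x : 0 < c -> ~~ (l < x < r) -> bump c l r x = 0.
Proof.
move=> c0; rewrite negb_and => /orP[] H; rewrite /bump /flat_exp.
  by rewrite pmulr_rgt0// subr_gt0 (negbTE H) mul0r.
by rewrite [in X in _ * X]pmulr_rgt0// subr_gt0 (negbTE H) mulr0.
Qed.

Lemma bump_gt0 c l r x : 0 < c -> l < x < r -> 0 < bump c l r x.
Proof.
move=> c0 /andP[lx xr].
have H y : 0 < y -> 0 < flat_exp 1 y.
  by move=> y0; rewrite /flat_exp y0 hornerC mul1r expR_gt0.
by rewrite /bump mulr_gt0// H// mulr_gt0// subr_gt0.
Qed.

(** The integral starts at -oo, so the primitive inherits the vanishing on the left half-line and
    the construction can be iterated. *)
Lemma smooth1_antiderivative a l : smooth1 a -> (forall x, x <= l -> a x = 0) ->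
  exists A, [/\ smooth1 A, forall x : R, is_derive x 1 A (a x) & forall x, x <= l -> A x = 0].
Proof.
move=> sa a0; have ca := smooth1_continuous sa.
have ia u : (@lebesgue_measure R).-integrable `]-oo, u] (EFin \o a).
  have ia' : (@lebesgue_measure R).-integrable `[l, u] (EFin \o a).
    apply: continuous_compact_integrable; first exact: segment_compact.
    exact: continuous_subspaceT.
  have mI i : measurable ([set` i] : set (measurableTypeR R)) := measurable_itv i.
  apply/(integrable_mkcond _ (mI _)); move: ((integrable_mkcond _ (mI _)).1 ia').
  rewrite (_ : _ \_ `[l, u] = (EFin \o a) \_ `]-oo, u])//; apply/funext => x.
  rewrite !patchE /= !mem_setE /= !in_itv /=.
  by case: (leP l x) => //= xl; rewrite a0 ?if_same// ltW.
pose A x := (\int[lebesgue_measure]_(t in [set` `]-oo, x]]) a t)%R.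
have dA (x : R) : is_derive x 1 A (a x).
  have [] := @continuous_FTC1 R a -oo%O x (x + 1) _ (ia _) _ (ca x).
  - by rewrite ltrDl.
  - by rewrite ltNyr.
  - by rewrite derive1E => d1 d2; split.
exists A; split => //; first exact: smooth1_intro sa dA.
move=> x xl; rewrite /A /Rintegral integral0_eq// => t.
by rewrite /= in_itv /= => tx; rewrite a0// (le_trans tx).
Qed.

Lemma Rintegral_derivative a A l r : l < r -> smooth1 a ->
  (forall x : R, is_derive x 1 A (a x)) ->
  (forall x, ~~ (l < x < r) -> a x = 0) ->
  (\int[lebesgue_measure]_x (a x)%:E = (A r - A l)%:E)%E.
Proof.
move=> lr sa dA a0; have ca := smooth1_continuous sa.
have cA : continuous A by move=> x; exact: is_derive_continuous (dA x).
transitivity (\int[lebesgue_measure]_(x in `[l, r]) (a x)%:E)%E.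
  rewrite [RHS]integral_mkcond; apply: eq_integral => x _ /=.
  rewrite patchE; case: ifPn => // /negP xn; rewrite a0//; apply/negP => /andP[x1 x2].
  by apply: xn; rewrite inE /= in_itv /= !ltW.
rewrite (@continuous_FTC2 _ a A)//; first exact: continuous_subspaceT.
  split; [by move=> x _; have [] := dA x|apply: cvg_at_right_filter; exact: cA|apply: cvg_at_left_filter; exact: cA].
by move=> x _; rewrite derive1E; have [_ ->] := dA x.
Qed.
End Smooth1.

(** * Product test functions of two variables *)

Section Smooth2.
Context {R : realType}.
Implicit Types (f g phi : 'rV[R]_2 -> R) (a b : R -> R) (P : 'I_3 -> 'rV[R]_2).
Local Notation e_ i := (delta_mx 0 i : 'rV[R]_2).

(** The same coinductive device in two variables. Continuity is required of every member because
    partial derivatives alone do not give it. *)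
Definition dclosed2 (K : ('rV[R]_2 -> R) -> Prop) : Prop :=
  forall f, K f -> continuous f /\
    forall i, exists2 g, K g & forall x, is_derive x (e_ i) f (g x).

Lemma pdE i f g : (forall x, is_derive x (e_ i) f (g x)) -> pd i f = g.
Proof. by move=> H; apply/funext => x; rewrite /pd; have [_ ->] := H x. Qed.

Lemma smooth_on_dclosed2 K f : dclosed2 K -> K f -> smooth_on setT f.
Proof.
move=> dK Kf.
have main (w : seq 'I_2) : exists2 g, K g & pder w f = g.
  elim: w => [|i w [g Kg gE]]; first by exists f.
  have [_ /(_ i) [g' Kg' gg']] := dK _ Kg; exists g' => //=.
  by rewrite gE; exact: pdE.
move=> w x _; have [g Kg ->] := main w; have [cg dg] := dK _ Kg.
split; first exact: cg.
by move=> i; have [g' _ H] := dg i; have [] := H x.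
Qed.

Lemma is_derive_along f x (v : 'rV[R]_2) l :
  is_derive (0 : R) 1 (fun h => f (h *: v + x)) l -> is_derive x v f l.
Proof.
move=> [dF lF]; apply: is_derive_cvg; rewrite -lF; apply: cvg_trans dF.
apply: near_eq_cvg; near=> h => /=.
by rewrite /shift /= scaler1 addr0 scale0r add0r.
Unshelve. all: by end_near.
Qed.

Lemma continuous_rV (T : topologicalType) (d : nat) (f : T -> 'rV[R]_d) (x : T) :
  (forall j, {for x, continuous (fun y => f y 0 j)}) -> {for x, continuous f}.
Proof.
move=> cf; apply/cvg_ballP => e e0; near=> y.
split=> // i j; rewrite ord1; move: j; near: y; apply: filter_forall => j.
by have /cvg_ballP := cf j; exact.
Unshelve. all: by end_near.
Qed.

Lemma continuous_mulmxr2 (d : nat) (M : 'M[R]_(2, d)) : continuous (fun x : 'rV[R]_2 => x *m M).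
Proof.
move=> x; apply: continuous_rV => j.
rewrite (_ : (fun y => _) = (fun y : 'rV[R]_2 => y 0 0 * M 0 j + y 0 1 * M 1 j)); last first.
  by apply/funext => y; rewrite mxE big_ord_recl big_ord1 (_ : lift ord0 ord0 = 1)//; exact/val_inj.
apply: (@continuousD R R _ (fun y : 'rV[R]_2 => y 0 0 * M 0 j) (fun y : 'rV[R]_2 => y 0 1 * M 1 j));
  apply: (@continuousM R _ (fun y : 'rV[R]_2 => y 0 _) (fun=> M _ j));
  by [exact: coord_continuous|exact: cst_continuous].
Qed.

Lemma continuous_aff (d : nat) (Q : 'I_3 -> 'rV[R]_d) : continuous (aff Q).
Proof.
move=> x; apply: (@continuousD R _ _ (fun=> Q ord0) (fun y : 'rV[R]_2 => y *m edgemx Q)).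
  exact: cst_continuous.
exact: continuous_mulmxr2.
Qed.

Lemma continuous_affinv P : continuous (affinv P).
Proof.
move=> x; apply: (@continuous_comp _ _ _ (fun y : 'rV[R]_2 => y - P ord0) (fun z => z *m invmx (edgemx P))).
  by apply: (@continuousB R _ _ (fun y : 'rV[R]_2 => y) (fun=> P ord0)); [exact: cvg_id|exact: cst_continuous].
exact: continuous_mulmxr2.
Qed.

(** Products in the affine coordinates attached to P. Composed with [aff P] they become ordinary
    products, so one test function can be read both on an element and on the reference triangle. *)
Definition tensor P a b (y : 'rV[R]_2) : R := a (affinv P y 0 0) * b (affinv P y 0 1).

Lemma affinv_line P (h : R) (i j : 'I_2) y :
  affinv P (h *: e_ i + y) 0 j = invmx (edgemx P) i j * h + affinv P y 0 j.
Proof.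
rewrite /affinv -addrA mulmxDl -scalemxAl mxE; congr (_ + _).
by rewrite mxE -rowE mxE mulrC.
Qed.

Lemma is_derive_tensor P a b a' b' i y :
  (forall x : R, is_derive x 1 a (a' x)) -> (forall x : R, is_derive x 1 b (b' x)) ->
  is_derive y (e_ i) (tensor P a b)
    (invmx (edgemx P) i 0 * tensor P a' b y + invmx (edgemx P) i 1 * tensor P a b' y).
Proof.
move=> da db; apply: is_derive_along; rewrite /tensor.
set M := invmx _; set x := affinv P y.
rewrite (_ : (fun h => _) = (fun h : R => a (M i 0 * h + x 0 0)) * (fun h : R => b (M i 1 * h + x 0 1))); last first.
  by apply/funext => h; rewrite !affinv_line.
have Ha := is_derive_line (da (M i 0 * 0 + x 0 0)).
have Hb := is_derive_line (db (M i 1 * 0 + x 0 1)).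
apply: (is_derive_eq (is_deriveM Ha Hb)).
by rewrite /GRing.scale /= !mulr0 !add0r; ring.
Qed.

(** A Cartesian derivative of a tensor mixes the two affine coordinates, so the class stable under
    derivation has to contain sums. *)
Inductive tens P : ('rV[R]_2 -> R) -> Prop :=
| tens_base c a b : smooth1 a -> smooth1 b -> tens P (fun y => c * tensor P a b y)
| tens_add f g : tens P f -> tens P g -> tens P (fun y => f y + g y).

Lemma continuous_tensor P a b : continuous a -> continuous b -> continuous (tensor P a b).
Proof.
move=> ca cb x; apply: (@continuousM R _ (fun y => a (affinv P y 0 0)) (fun y => b (affinv P y 0 1))).
  apply: (@continuous_comp _ _ _ (fun y => affinv P y 0 0) a); last exact: ca.
  apply: (@continuous_comp _ _ _ (affinv P) (fun z : 'rV[R]_2 => z 0 0)); last exact: coord_continuous.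
  exact: continuous_affinv.
apply: (@continuous_comp _ _ _ (fun y => affinv P y 0 1) b); last exact: cb.
apply: (@continuous_comp _ _ _ (affinv P) (fun z : 'rV[R]_2 => z 0 1)); last exact: coord_continuous.
exact: continuous_affinv.
Qed.

Lemma tens_dclosed2 P : dclosed2 (tens P).
Proof.
move=> f; elim => {f} [c a b sa sb|f g Tf [cf df] Tg [cg dg]].
  split.
    move=> x; apply: (@continuousM R _ (fun=> c) (tensor P a b)); first exact: cst_continuous.
    by apply: continuous_tensor; exact: smooth1_continuous.
  move=> i; have [a' sa' da] := smooth1_derive sa; have [b' sb' db] := smooth1_derive sb.
  exists (fun y => (c * invmx (edgemx P) i 0) * tensor P a' b y + (c * invmx (edgemx P) i 1) * tensor P a b' y).
    by apply: tens_add; exact: tens_base.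
  move=> x; apply: (is_derive_eq (is_deriveZ c (is_derive_tensor P i x da db))).
  by rewrite /GRing.scale /=; ring.
split; first by move=> x; apply: (@continuousD R R _ f g); [exact: cf|exact: cg].
move=> i; have [f' Tf' ff'] := df i; have [g' Tg' gg'] := dg i.
by exists (fun y => f' y + g' y); [exact: tens_add|move=> x; exact: is_deriveD].
Qed.

Lemma smooth_on_tensor P a b : smooth1 a -> smooth1 b -> smooth_on setT (tensor P a b).
Proof.
move=> sa sb; apply: (smooth_on_dclosed2 (@tens_dclosed2 P)).
by have := tens_base P 1 sa sb; under [X in tens _ X]eq_fun do rewrite mul1r.
Qed.

Definition box (l0 r0 l1 r1 : R) : set 'rV[R]_2 :=
  [set x | l0 <= x 0 0 <= r0 /\ l1 <= x 0 1 <= r1].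

Lemma compact_box l0 r0 l1 r1 : compact (box l0 r0 l1 r1).
Proof.
have := @rV_compact R 2 (fun i => if i == 0 then `[l0, r0]%classic else `[l1, r1]%classic).
rewrite (_ : [set v : 'rV_2 | _] = box l0 r0 l1 r1).
  by apply => i; case: ifP => _; exact: segment_compact.
apply/seteqP; split => x /= H.
  by split; [have := H 0|have := H 1]; rewrite /= in_itv.
move=> i; case: H => H0 H1.
by case: (ord2P i) => ->; rewrite /= in_itv.
Qed.

Lemma test_tensor P a b l0 r0 l1 r1 (U : set 'rV[R]_2) : \det (edgemx P) != 0 ->
  smooth1 a -> smooth1 b ->
  (forall x, ~~ (l0 < x < r0) -> a x = 0) -> (forall x, ~~ (l1 < x < r1) -> b x = 0) ->
  (forall x, box l0 r0 l1 r1 x -> U (aff P x)) ->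
  test_function U (tensor P a b).
Proof.
move=> D0 sa sb a0 b0 HU; split; first exact: smooth_on_tensor.
exists (aff P @` box l0 r0 l1 r1); split.
- apply: continuous_compact; last exact: compact_box.
  by apply: continuous_subspaceT; exact: continuous_aff.
- by move=> _ [x bx <-]; exact: HU.
- move=> y ny; rewrite /tensor.
  case: (boolP (l0 < affinv P y 0 0 < r0)) => [/andP[h1 h2]|/a0 ->]; last by rewrite mul0r.
  case: (boolP (l1 < affinv P y 0 1 < r1)) => [/andP[h3 h4]|/b0 ->]; last by rewrite mulr0.
  exfalso; apply: ny; exists (affinv P y); last by rewrite affinvK.
  by split; rewrite !ltW.
Qed.

(** Vertices of the reference triangle, for which [aff] is the identity: ordinary products are
    special tensors. *)
Definition refP (k : 'I_3) : 'rV[R]_2 := if unlift ord0 k is Some i then e_ i else 0.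

Lemma edgemx_ref : edgemx refP = 1%:M.
Proof.
by apply/row_matrixP => i; rewrite rowK rowE mulmx1 /refP liftK unlift_none subr0.
Qed.

Lemma affinv_ref y : affinv refP y = y.
Proof. by rewrite /affinv edgemx_ref invmx1 mulmx1 /refP unlift_none subr0. Qed.

Lemma aff_ref y : aff refP y = y.
Proof. by rewrite /aff edgemx_ref mulmx1 /refP unlift_none add0r. Qed.

Lemma det_ref : \det (edgemx refP) != 0.
Proof. by rewrite edgemx_ref det1 oner_neq0. Qed.

Definition other (i : 'I_2) : 'I_2 := if i == 0 then 1 else 0.

(** The factor a acts in direction i and b in the other one, so that both directions are covered by
    a single statement. *)
Definition tens2 (i : 'I_2) a b (x : 'rV[R]_2) : R := a (x 0 i) * b (x 0 (other i)).

Lemma tens2E i a b : tens2 i a b = if i == 0 then tensor refP a b else tensor refP b a.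
Proof.
apply/funext => x; rewrite /tens2 /tensor /other.
by case: (ord2P i) => -> /=; rewrite affinv_ref // mulrC.
Qed.

Lemma is_derive_tens2 i a a' b x : smooth1 b ->
  (forall x : R, is_derive x 1 a (a' x)) ->
  is_derive x (e_ i) (tens2 i a b) (tens2 i a' b x).
Proof.
move=> sb da; have [b' sb' db] := smooth1_derive sb; rewrite !tens2E.
by case: (ord2P i) => -> /=; [have := is_derive_tensor refP 0 x da db|have := is_derive_tensor refP 1 x db da];
  rewrite edgemx_ref invmx1 !mxE /= ?mul1r ?mul0r ?addr0 ?add0r.
Qed.

Definition box2 (i : 'I_2) (l r l' r' : R) : set 'rV[R]_2 :=
  [set x | l <= x 0 i <= r /\ l' <= x 0 (other i) <= r'].

Lemma test_tens2 i a b l r l' r' (U : set 'rV[R]_2) :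
  smooth1 a -> smooth1 b ->
  (forall x, ~~ (l < x < r) -> a x = 0) -> (forall x, ~~ (l' < x < r') -> b x = 0) ->
  box2 i l r l' r' `<=` U ->
  test_function U (tens2 i a b).
Proof.
move=> sa sb a0 b0 HU; rewrite tens2E; case: (ord2P i) HU => -> /= HU.
  by apply: (@test_tensor refP a b l r l' r') => //; [exact: det_ref|move=> x; rewrite aff_ref; exact: HU].
apply: (@test_tensor refP b a l' r' l r) => //; first exact: det_ref.
by move=> x [? ?]; rewrite aff_ref; apply: HU.
Qed.
End Smooth2.

(** * Dominated convergence, translations, and vanishing integrals over boxes *)

Section Int2More.
Context {R : realType}.
Local Notation RR := (measurableTypeR R * measurableTypeR R)%type.
Local Notation L1 := (@lebesgue_measure R).
Implicit Types (U V : set 'rV[R]_2) (f g w : 'rV[R]_2 -> R).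

Lemma int2_dct U (F : nat -> 'rV[R]_2 -> R) f g : msb U ->
  (forall n, measurable2 U (F n)) ->
  (forall x, U x -> F n x @[n --> \oo] --> f x) -> integrable2 U g ->
  (forall n x, U x -> `|F n x| <= g x) ->
  integrable2 U f /\ int2 U (F n) @[n --> \oo] --> int2 U f.
Proof.
move=> mU mF Ff gi Fg.
have mf : measurable2 U f by apply: measurable_fun_cvg mF _ => p Up; exact: Ff.
have [] := @dominated_convergence _ _ R (leb2 R) _ mU
  (fun n p => (F n (vec2 p))%:E) (fun p => (f (vec2 p))%:E) (fun p => (g (vec2 p))%:E).
- by move=> n; apply/measurable_EFinP; exact: mF.
- exact/measurable_EFinP.
- by apply: aeW => p Up; apply: cvg_EFin; [exact: nearW|exact: Ff].
- exact: gi.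
- by apply: aeW => p n Up; rewrite /= lee_fin Fg.
move=> fi _ H; split => //.
by rewrite /int2 /Rintegral; apply: fine_cvg; rewrite fineK ?integrable_fin_num.
Qed.

Lemma int2_mkcond U f : int2 U f = int2 setT (f \_ U).
Proof.
rewrite /int2 preimage_setT Rintegral_mkcond; apply: eq_Rintegral => p _.
by rewrite !patchE.
Qed.

Lemma integrable2_mkcond U f : msb U -> integrable2 U f <-> integrable2 setT (f \_ U).
Proof.
move=> mU; rewrite /integrable2 preimage_setT.
have := @integrable_mkcond _ _ R (leb2 R) _ (fun p => (f (vec2 p))%:E) mU.
rewrite (_ : (_ \_ _) = (fun p => ((f \_ U) (vec2 p))%:E))//.
apply/funext => p; rewrite !patchE /=.
by rewrite (_ : (p \in @vec2 R @^-1` U) = (vec2 p \in U)); [case: ifP|apply/idP/idP => /set_mem ?; apply/mem_set].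
Qed.

Lemma int2_supp U V f : msb U -> msb V -> U `<=` V ->
  (forall x, V x -> ~ U x -> f x = 0) ->
  (integrable2 U f <-> integrable2 V f) /\ int2 U f = int2 V f.
Proof.
move=> mU mV UV f0.
have e : f \_ U = f \_ V.
  apply/funext => x; rewrite !patchE.
  case: (boolP (x \in U)) => [|/negP] xU; first by rewrite mem_set//; apply: UV; exact: set_mem.
  case: ifP => // /set_mem xV; rewrite f0// => /mem_set; exact: xU.
split; last by rewrite (int2_mkcond U) (int2_mkcond V) e.
apply: (iff_trans (integrable2_mkcond f mU)); rewrite e; apply: iff_sym.
exact: integrable2_mkcond.
Qed.

Lemma msb_box (l r l' r' : R) : msb (box l r l' r').
Proof.
rewrite /msb (_ : _ @^-1` _ = `[l, r]%classic `*` `[l', r']%classic).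
  by apply: measurableX; exact: measurable_itv.
by apply/seteqP; split => -[a b]; rewrite /= /box /= !mxE /= !in_itv.
Qed.

Lemma leb2_box (l r l' r' : R) : (leb2 R (@vec2 R @^-1` (box l r l' r')) < +oo)%E.
Proof.
rewrite (_ : _ @^-1` _ = `[l, r]%classic `*` `[l', r']%classic); last first.
  by apply/seteqP; split => -[a b]; rewrite /= /box /= !mxE /= !in_itv.
rewrite [X in (X < _)%E]product_measure1E//; do ?exact: measurable_itv.
change (L1 `[l, r]%classic * L1 `[l', r']%classic < +oo)%E.
rewrite !lebesgue_measure_itv /=.
by case: ifP; case: ifP => *; rewrite ?mule0 ?mul0e ?ltry// -!EFinD -EFinM ltry.
Qed.

Lemma integrable2_bounded U f (C l r l' r' : R) : msb U -> U `<=` box l r l' r' ->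
  measurable2 U f -> (forall x, U x -> `|f x| <= C) -> integrable2 U f.
Proof.
move=> mU UB mf fC; apply: measurable_bounded_integrable => //.
  apply: le_lt_trans (leb2_box l r l' r'); apply: le_measure; rewrite ?inE//.
  - exact: msb_box.
  - exact: preimage_subset.
exists C; split; first exact: num_real.
by move=> M CM p Up /=; rewrite (le_trans (fC _ Up))// ltW.
Qed.

(** A translation is the affine map of a translated reference triangle, so invariance of the
    integral is a case of [int2_aff]. *)
Definition translate (v : 'rV[R]_2) (k : 'I_3) : 'rV[R]_2 := v + refP k.

Lemma edgemx_translate v : edgemx (translate v) = 1%:M.
Proof.
rewrite -edgemx_ref; apply/row_matrixP => i; rewrite !rowK /translate.
by rewrite opprD addrACA subrr add0r.
Qed.

Lemma aff_translate v x : aff (translate v) x = v + x.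
Proof. by rewrite /aff edgemx_translate mulmx1 /translate /refP unlift_none addr0. Qed.

Lemma int2_translate v f : integrable2 setT f ->
  integrable2 setT (fun x => f (v + x)) /\ int2 setT (fun x => f (v + x)) = int2 setT f.
Proof.
move=> fi; have D : \det (edgemx (translate v)) != 0 by rewrite edgemx_translate det1 oner_neq0.
have [_ i2 e2] := int2_aff D (@msbT R) fi.
have e : f \o aff (translate v) = fun x => f (v + x).
  by apply/funext => x; rewrite /= aff_translate.
rewrite e preimage_setT in i2 e2; split => //.
by rewrite e2 edgemx_translate det1 normr1 mul1r.
Qed.

Lemma int2_tens2 i (a b : R -> R) (A B : R) :
  measurable_fun setT a -> measurable_fun setT b -> (forall x, 0 <= a x) -> (forall x, 0 <= b x) ->
  (\int[L1]_x (a x)%:E = A%:E)%E -> (\int[L1]_x (b x)%:E = B%:E)%E ->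
  integrable2 setT (tens2 i a b) /\ int2 setT (tens2 i a b) = A * B.
Proof.
move=> ma mb a0 b0 iA iB.
wlog : i a b A B ma mb a0 b0 iA iB / i = 0.
  move=> H; case: (ord2P i) => [->|->]; first exact: (H 0).
  have := H 0 b a B A mb ma b0 a0 iB iA erefl.
  by rewrite (_ : tens2 0 b a = tens2 1 a b) 1?mulrC//; apply/funext => x; rewrite /tens2 /other /= mulrC.
move=> ->.
have e : (\int[leb2 R]_p (tens2 0 a b (vec2 p))%:E = (A * B)%:E)%E.
  under eq_integral do rewrite /tens2 /other /vec2 !mxE /=.
  have m2 : measurable_fun setT (fun p : RR => (a p.1 * b p.2)%:E).
    apply/measurable_EFinP; apply: measurable_funM.
      exact: (measurableT_comp ma measurable_fst).
    exact: (measurableT_comp mb measurable_snd).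
  rewrite (fubini_tonelli1 _ m2); last by move=> p /=; rewrite lee_fin mulr_ge0.
  transitivity (\int[L1]_x ((a x)%:E * B%:E))%E; last first.
    rewrite ge0_integralZr ?iA//; [exact/measurable_EFinP|by move=> x _; rewrite lee_fin|].
    by rewrite -iB; apply: integral_ge0 => x _; rewrite lee_fin.
  apply: eq_integral => x _; rewrite /fubini_F -iB -ge0_integralZl//.
    by apply/measurable_EFinP.
  by move=> y _; rewrite lee_fin.
  by rewrite lee_fin.
have mt : measurable_fun setT (fun p : RR => tens2 0 a b (vec2 p)).
  rewrite (_ : (fun p => _) = fun p : RR => a p.1 * b p.2); last by apply/funext => p; rewrite /tens2 /other /vec2 !mxE.
  apply: measurable_funM; [exact: (measurableT_comp ma measurable_fst)|exact: (measurableT_comp mb measurable_snd)].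
split; last by rewrite /int2 preimage_setT /Rintegral e.
rewrite /integrable2 preimage_setT; apply/integrableP; split; first exact/measurable_EFinP.
suff -> : (\int[leb2 R]_x `|(tens2 0 a b (vec2 x))%:E| = (A * B)%:E)%E by rewrite ltry.
by rewrite -e; apply: eq_integral => p _; rewrite /= ger0_norm// /tens2 mulr_ge0.
Qed.

(** Half-open boxes match the generators [ocitv] of the Borel sets and are stable under
    intersection. *)
Definition hbox (l r l' r' : R) : set 'rV[R]_2 :=
  [set x | l < x 0 0 <= r /\ l' < x 0 1 <= r'].

Lemma hboxE l r l' r' : @vec2 R @^-1` hbox l r l' r' = `]l, r]%classic `*` `]l', r']%classic.
Proof. by apply/seteqP; split => -[a b]; rewrite /= /hbox /= !mxE /= !in_itv. Qed.

Lemma msb_hbox l r l' r' : msb (hbox l r l' r').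
Proof. by rewrite /msb hboxE; apply: measurableX; exact: measurable_itv. Qed.

(** Bounded intervals do not include the whole line, so each projection is shown to be measurable by
    exhausting the other coordinate with the intervals ]-n, n]. *)
Lemma measurable_sub_ocitvX : (fun E : set RR => measurable E) `<=`
  <<s [set A `*` B | A in @ocitv R & B in @ocitv R] >>.
Proof.
set G := [set A `*` B | A in @ocitv R & B in @ocitv R].
have cover (f : g_sigma_algebraType G -> measurableTypeR R) (g : R * R -> R) :
    (forall A B, ocitv A -> ocitv B -> G [set p | A (f p) /\ B (g p)]) -> measurable_fun setT f.
  move=> fG; apply: (measurability _ (erefl : measurable = <<s @ocitv R>>)) => _ [A oA <-].
  rewrite setTI (_ : f @^-1` A = \bigcup_n [set p | A (f p) /\ `]- n%:R, n%:R]%classic (g p)]).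
    by apply: bigcupT_measurable => n; apply: sub_sigma_algebra; apply: fG => //; eexists (_, _).
  apply/seteqP; split => [p Ap|p [n _ []//]].
  have [n gn] : exists n : nat, `|g p| < n%:R.
    by exists (Num.truncn `|g p|).+1; exact: truncnS_gt.
  by exists n => //; split => //=; rewrite in_itv /=; move: gn; rewrite ltr_norml => /andP[-> /ltW].
have mf : measurable_fun setT (fst : g_sigma_algebraType G -> measurableTypeR R).
  by apply: (cover _ snd) => A B oA oB; exists A => //; exists B.
have mg : measurable_fun setT (snd : g_sigma_algebraType G -> measurableTypeR R).
  by apply: (cover _ fst) => A B oA oB; exists B => //; exists A => //; apply/seteqP; split => p [].
rewrite measurable_prod_measurableType; apply: smallest_sub; first exact: smallest_sigma_algebra.
move=> _ [A mA [B mB <-]].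
have := measurableI _ _ (mf measurableT A mA) (mg measurableT B mB).
by rewrite !setTI.
Qed.

(** The sets over which h integrates to 0 form a lambda-system, by dominated convergence for
    increasing unions, and it contains a generating pi-system. The total integral is a separate
    hypothesis since the plane is not a box. *)
Lemma ae0_of_hbox (h : 'rV[R]_2 -> R) : integrable2 setT h ->
  (forall l r l' r', int2 (hbox l r l' r') h = 0) -> int2 setT h = 0 ->
  {ae leb2 R, forall p, h (vec2 p) = 0}.
Proof.
rewrite /integrable2 preimage_setT => hi h0 hT.
pose I (E : set RR) := \int[leb2 R]_(p in E) h (vec2 p).
have hiE (E : set RR) : measurable E -> (leb2 R).-integrable E (fun p => (h (vec2 p))%:E).
  by move=> mE; apply: integrableS hi.
pose H := [set E : set RR | measurable E /\ I E = 0].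
have lH : lambda_system setT H.
  split => //.
  - move=> A B BA [mA A0] [mB B0]; split; first exact: measurableD.
    have := @Rintegral_setU _ _ R (leb2 R) B (A `\` B) (h \o @vec2 R) mB (measurableD mA mB).
    rewrite setDUK// -/(I A) -/(I B) A0 B0 add0r => /(_ (hiE _ mA)) ->//.
    by apply/disj_setPS => x [? []].
  - move=> F ndF FH; split; first by apply: bigcupT_measurable => n; have [] := FH n.
    have mF n : measurable (F n) by have [] := FH n.
    have mUF : measurable (\bigcup_n F n) by exact: bigcupT_measurable.
    have := @dominated_convergence _ _ R (leb2 R) setT measurableT
      (fun n p => (h (vec2 p) * \1_(F n) p)%:E) (fun p => (h (vec2 p) * \1_(\bigcup_n F n) p)%:E) (fun p => `|(h (vec2 p))%:E|%E).
    case.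
    + move=> n; apply/measurable_EFinP; apply: measurable_funM.
        by move/integrableP : hi => [/measurable_EFinP].
      exact: measurable_indic.
    + apply/measurable_EFinP; apply: measurable_funM.
        by move/integrableP : hi => [/measurable_EFinP].
      exact: measurable_indic.
    + apply: aeW => p _; apply: cvg_EFin; first exact: nearW.
      apply: cvgMr; have [[n _ Fnp]|nF] := pselect ((\bigcup_n F n) p).
        apply: cvg_near_cst; near=> m; rewrite !indicE !mem_set//; first by exists n.
        have nm : (n <= m)%N by near: m; exact: nbhs_infty_ge.
        by have /subsetPset := ndF _ _ nm; exact.
      apply: cvg_near_cst; near=> m; rewrite !indicE !memNset// => Fm; apply: nF; by exists m.
    + exact: integrable_abse.
    + apply: aeW => p n _; rewrite /= lee_fin normrM indicE.
      by case: (p \in F n); rewrite ?normr1 ?mulr1// normr0 mulr0.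
    move=> _ _.
    have E (A : set RR) : measurable A -> (\int[leb2 R]_p (h (vec2 p) * \1_A p)%:E = (I A)%:E)%E.
      move=> mA; rewrite /I /Rintegral fineK ?integrable_fin_num//; last exact: hiE.
      rewrite [RHS]integral_mkcond; apply: eq_integral => p _; rewrite patchE indicE /=.
      by case: ifP => _; rewrite ?mulr1// mulr0.
    rewrite (E _ mUF) (_ : [sequence _]_n = fun=> 0%E).
      by move=> /cvg_lim => /(_ (@ereal_hausdorff R)); rewrite lim_cst// => -[].
    by apply/funext => n /=; rewrite (E _ (mF n)); have [_ ->] := FH n.
have sub : (fun E => measurable E) `<=` H.
  apply: (subset_trans measurable_sub_ocitvX).
  apply: (@lambda_system_subset _ _ _ setT) => //.
    move=> _ _ [A oA [B oB <-]] [A' oA' [B' oB' <-]]; rewrite -setXI.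
    by exists (A `&` A'); [exact: ocitvI|exists (B `&` B') => //; exact: ocitvI].
  move=> _ [_ [[a b] _ <-] [_ [[c d] _ <-] <-]] /=.
  rewrite -[X in H X]/(`]a, b]%classic `*` `]c, d]%classic) -hboxE; split; first exact: msb_hbox.
  by have := h0 a b c d.
have := @integral_ae_eq _ _ R (leb2 R) setT measurableT (cst 0%E) (fun p => (h (vec2 p))%:E) hi.
case => //.
  move=> E _ mE; rewrite integral0; have [_ IE] := sub _ mE.
  have fE : (\int[leb2 R]_(p in E) (h (vec2 p))%:E)%E \is a fin_num.
    by apply: integrable_fin_num => //; exact: hiE.
  by rewrite -(fineK fE) -[fine _]/(I E) IE.
move=> N [mN N0 sN]; exists N; split => // p /= np; apply: sN => /= H'.
by apply: np; have [] := H' Logic.I.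
Unshelve. all: by end_near.
Qed.
End Int2More.
(** * Regularity of functions of W^{2,oo} *)

Section DuBoisReymond.
Context {R : realType}.
Implicit Types (U O : set 'rV[R]_2) (f g w : 'rV[R]_2 -> R).

Lemma flat_exp1_low (y : R) : 0 < y -> 1 - y^-1 <= flat_exp 1 y.
Proof.
by move=> y0; rewrite /flat_exp y0 hornerC mul1r; exact: expR_ge1Dx.
Qed.

Lemma flat_exp1_cvg (c : R) (y : nat -> R) : 0 < c -> (forall n, c * n.+1%:R <= y n) ->
  flat_exp 1 (y n) @[n --> \oo] --> (1 : R).
Proof.
move=> c0 cy; apply: (@squeeze_cvgr _ _ _ _ (fun n => 1 - c^-1 * n.+1%:R^-1) (cst 1)).
- apply: nearW => n; rewrite flat_exp1_le1 andbT.
  have cn : 0 < c * n.+1%:R by rewrite mulr_gt0.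
  have yn : 0 < y n := lt_le_trans cn (cy n).
  apply: le_trans (flat_exp1_low yn); rewrite lerD2l lerN2 -invfM lef_pV2 ?posrE//.
- rewrite -[X in _ --> X]subr0; apply: cvgB; first exact: cvg_cst.
  by rewrite -(mulr0 c^-1); apply: cvgMr; exact: cvg_harmonic.
- exact: cvg_cst.
Qed.

(** At x = r the second factor has argument (n+1)^2 * e/(n+1) = (n+1) e, which still tends to
    infinity although the interval shrinks to ]l, r]. The limit is thus the indicator of the
    half-open interval, right endpoint included. *)
Definition obump (e l r : R) (n : nat) : R -> R := bump (n.+1%:R ^+ 2) l (r + e / n.+1%:R).

Lemma obump_cvg e l r x : 0 < e -> obump e l r n x @[n --> \oo] --> ((l < x <= r)%R%:R : R).
Proof.
move=> e0; have n0 n : 0 < n.+1%:R ^+ 2 :> R by rewrite exprn_gt0.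
have [xl|lx] := leP x l.
  apply: cvg_near_cst; apply: nearW => n.
  by rewrite /obump bump_eq0// ltNge xl.
have [xr|rx] := leP x r; last first.
  apply: cvg_near_cst; near=> n; rewrite /obump bump_eq0//.
  rewrite lx /= -leNgt -lerBrDl.
  have : n.+1%:R^-1 < (x - r) / e :> R.
    near: n; have xr0 : 0 < (x - r) / e by rewrite divr_gt0// subr_gt0.
    exact: (near_infty_natSinv_lt (PosNum xr0)).
  by rewrite ltr_pdivlMr// mulrC => /ltW.
rewrite /= -[X in _ --> X](mulr1 1); apply: cvgM.
  apply: (@flat_exp1_cvg (x - l)); first by rewrite subr_gt0.
  move=> n; rewrite mulrC ler_wpM2r ?subr_ge0 ?(ltW lx)//.
  by rewrite ler_eXnr// ler1n.
apply: (@flat_exp1_cvg e) => // n.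
rewrite expr2 -mulrA mulrC ler_wpM2l//.
have : n.+1%:R * (r + e / n.+1%:R - x) = n.+1%:R * (r - x) + e.
  by field.
move=> ->; rewrite lerDr mulr_ge0// subr_ge0//.
Unshelve. all: by end_near.
Qed.

Lemma boxS (l r l' r' a b a' b' : R) : a <= l -> r <= b -> a' <= l' -> r' <= b' ->
  box l r l' r' `<=` box a b a' b'.
Proof.
by move=> *; move=> x [/andP[? ?] /andP[? ?]]; split; apply/andP; split; lra.
Qed.

Lemma measurable_tensor (P : 'I_3 -> 'rV[R]_2) (a b : R -> R) U : msb U ->
  continuous a -> continuous b -> measurable2 U (tensor P a b).
Proof.
move=> mU ca cb; apply: (measurable2_sub (@msbT R)) => //.
by apply: measurable2_continuous; [exact: openT|move=> x _; exact: continuous_tensor].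
Qed.

(** Dominated convergence along [obump]; the margin e keeps the supports inside O. *)
Lemma int2_hbox_eq0 O w e l r l' r' : open O -> loc_integrable O w ->
  (forall l r l' r', box l r l' r' `<=` O -> forall c : R, 0 < c ->
    int2 O (fun x => w x * tensor refP (bump c l r) (bump c l' r') x) = 0) ->
  0 < e -> box l (r + e) l' (r' + e) `<=` O ->
  integrable2 (hbox l r l' r') w /\ int2 (hbox l r l' r') w = 0.
Proof.
move=> oO [mw iw] H e0 BO; set B := box l (r + e) l' (r' + e).
have mB : msb B by exact: msb_box.
have iB : integrable2 B w by apply: iw => //; exact: compact_box.
pose t n := tensor refP (obump e l r n) (obump e l' r' n).
pose F n x := w x * t n x.
have n0 n : 0 < n.+1%:R ^+ 2 :> R by rewrite exprn_gt0.
have ne n : e / n.+1%:R <= e by rewrite ler_pdivrMr// ler_peMr ?(ltW e0)// ler1n.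
have F0 n : int2 B (F n) = 0.
  rewrite -(H l (r + e / n.+1%:R) l' (r' + e / n.+1%:R) _ _ (n0 n)).
    apply: (int2_supp mB (msb_open oO) BO _).2 => x Ox nB.
    rewrite /F /t /tensor affinv_ref /obump.
    have [/andP[h1 h2]|/(bump_eq0 (n0 n)) ->] := boolP (l < x 0 0 < r + e / n.+1%:R); last by rewrite mul0r mulr0.
    have [/andP[h3 h4]|/(bump_eq0 (n0 n)) ->] := boolP (l' < x 0 1 < r' + e / n.+1%:R); last by rewrite !mulr0.
    exfalso; apply: nB; move: (e / n.+1%:R) (ne n) h2 h4 => z ? ? ?; split; apply/andP; split; lra.
  by move=> x Bx; apply: BO; apply: (boxS _ _ _ _ Bx) => //; rewrite lerD2l.
have cb n : continuous (obump e l r n) by exact/smooth1_continuous/smooth1_bump.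
have cb' n : continuous (obump e l' r' n) by exact/smooth1_continuous/smooth1_bump.
have t1 n x : 0 <= t n x <= 1.
  rewrite /t /tensor /obump; apply/andP; split; [apply: mulr_ge0; exact: bump_ge0|apply: mulr_ile1; by [exact: bump_ge0|exact: bump_le1]].
have [] := @int2_dct R B F (fun x => w x * ((l < x 0 0 <= r)%R%:R * (l' < x 0 1 <= r')%R%:R)) (fun x => `|w x|) mB.
- move=> n; apply: measurable_funM; first exact: integrable2_measurable.
  exact: measurable_tensor.
- move=> x _; apply: cvgMr; rewrite /t /tensor affinv_ref.
  by apply: cvgM; exact: obump_cvg.
- exact: integrable2_norm.
- move=> n x _; rewrite normrM ler_piMr// ger0_norm; by have /andP[] := t1 n x.
move=> iF; rewrite (_ : (fun n => int2 B (F n)) = cst 0); last by apply/funext.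
move=> /cvg_lim => /(_ (@Rhausdorff R)); rewrite lim_cst// => E.
have hB : hbox l r l' r' `<=` B.
  by move=> x [/andP[? ?] /andP[? ?]]; split; apply/andP; split; lra.
have mh := msb_hbox l r l' r'.
have e1 x : hbox l r l' r' x -> w x * ((l < x 0 0 <= r)%R%:R * (l' < x 0 1 <= r')%R%:R) = w x.
  by move=> [-> ->]; rewrite !mulr1.
split; first exact: integrable2S iB.
rewrite -(eq_int2 e1) (int2_supp mh mB hB _).2 -?E// => x _ nh.
case: (boolP (l < x 0 0 <= r)) => h1; last by rewrite mul0r mulr0.
by case: (boolP (l' < x 0 1 <= r')) => h2; [exfalso; apply: nh|rewrite !mulr0].
Qed.

Lemma hboxI (l r l' r' a b a' b' : R) : hbox l r l' r' `&` hbox a b a' b' =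
  hbox (Num.max l a) (Num.min r b) (Num.max l' a') (Num.min r' b').
Proof.
apply/seteqP; split => x; rewrite /hbox /= !gt_max !le_min.
  by move=> [[/andP[-> ->] /andP[-> ->]] [/andP[-> ->] /andP[-> ->]]].
by move=> [/andP[/andP[-> ->] /andP[-> ->]] /andP[/andP[-> ->] /andP[-> ->]]].
Qed.

Lemma negligible_bigcup_countable (T : countType) (F : T -> set (measurableTypeR R * measurableTypeR R)) :
  (forall i, (leb2 R).-negligible (F i)) -> (leb2 R).-negligible (\bigcup_i F i).
Proof.
move=> nF; pose G n := if unpickle n is Some i then F i else set0.
apply: (@negligibleS _ _ _ _ (\bigcup_n G n)).
  by move=> p [i _ Fp]; exists (pickle i) => //; rewrite /G pickleK.
by apply: negligible_bigcup => n; rewrite /G; case: unpickle => // ; exact: negligible_set0.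
Qed.

(** Fundamental lemma of the calculus of variations, tested with products of bumps only.
    [ae0_of_hbox] applies to w cut off to a half-open box, and O is covered by countably many
    rational boxes whose enlargements lie in O. *)
Lemma ae0_of_bumps O w : open O -> loc_integrable O w ->
  (forall l r l' r', box l r l' r' `<=` O -> forall c : R, 0 < c ->
    int2 O (fun x => w x * tensor refP (bump c l r) (bump c l' r') x) = 0) ->
  {ae leb2 R, forall p, O (vec2 p) -> w (vec2 p) = 0}.
Proof.
move=> oO lw H; have [mw iw] := lw.
have loc l r l' r' e : 0 < e -> box l (r + e) l' (r' + e) `<=` O ->
    {ae leb2 R, forall p, hbox l r l' r' (vec2 p) -> w (vec2 p) = 0}.
  move=> e0 BO; set K := hbox l r l' r'; have mK : msb K by exact: msb_hbox.
  have [iK _] := int2_hbox_eq0 oO lw H e0 BO.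
  have HK a b a' b' : int2 (K `&` hbox a b a' b') w = 0.
    rewrite hboxI; apply: (int2_hbox_eq0 oO lw H e0 _).2.
    apply: subset_trans BO; apply: boxS; rewrite ?le_max ?lexx// lerD2r ge_min lexx//.
  have := @ae0_of_hbox R (w \_ K); case.
  - by apply/(integrable2_mkcond w mK).
  - move=> a b a' b'; rewrite -(HK a b a' b') int2_mkcond [RHS]int2_mkcond; congr int2.
    apply/funext => x; rewrite !patchE.
    rewrite in_setI andbC; by case: (x \in hbox a b a' b') => //=.
  - by rewrite -int2_mkcond -(HK l r l' r') setIid.
  move=> N [mN N0 sN]; exists N; split => // p /= np; apply: sN => /= H'.
  by apply: np => Kp; move: H'; rewrite patchE mem_set.
pose idx := ((rat * rat) * (rat * rat) * nat)%type.
pose q (i : idx) := hbox (ratr i.1.1.1 : R) (ratr i.1.1.2) (ratr i.1.2.1) (ratr i.1.2.2).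
pose e (i : idx) : R := i.2.+1%:R^-1.
pose C (i : idx) := box (ratr i.1.1.1 : R) (ratr i.1.1.2 + e i) (ratr i.1.2.1) (ratr i.1.2.2 + e i) `<=` O.
pose F (i : idx) := [set p : measurableTypeR R * measurableTypeR R | C i /\ ~ (q i (vec2 p) -> w (vec2 p) = 0)].
have : (leb2 R).-negligible (\bigcup_i F i).
  apply: negligible_bigcup_countable => i; rewrite /F.
  have [Ci|nC] := pselect (C i); last first.
    by rewrite (_ : mkset _ = set0); [exact: negligible_set0|apply/seteqP; split => // p []].
  have := @loc _ _ _ _ (e i) _ Ci; rewrite invr_gt0 ltr0n => /(_ isT).
  by apply: negligibleS => p /= [].
apply: negligibleS => p /= /not_implyP [Op wp].
have /nbhs_ballP [d /= d0 dO] : nbhs (vec2 p) O by exact: open_nbhs_nbhs.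
have d4 : 0 < d / 4 by rewrite divr_gt0.
have [n _ /(_ n (leqnn n)) /= ne] := near_infty_natSinv_lt (PosNum d4).
have Q (y : R) : exists a b : rat, y - d / 4 < ratr a < y /\ y < ratr b < y + d / 4.
  have /rat_in_itvoo [a] : y - d / 4 < y by lra.
  have /rat_in_itvoo [b] : y < y + d / 4 by lra.
  by rewrite !in_itv /= => ? ?; exists a, b.
have [a [b [/andP[a1 a2] /andP[b1 b2]]]] := Q (vec2 p 0 0).
have [a' [b' [/andP[a1' a2'] /andP[b1' b2']]]] := Q (vec2 p 0 1).
pose i : idx := ((a, b), (a', b'), n).
exists i => //; split.
  move=> x [/andP[/= x1 x2] /andP[/= x3 x4]]; apply: dO.
  have ne' : e i < d / 4 by exact: ne.
  have e0 : 0 < e i by rewrite invr_gt0.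
  move: (e i) e0 ne' x2 x4 => ee ? ? ? ?.
  split=> // s t; rewrite ord1; case: (ord2P t) => ->; rewrite /ball /= ltr_norml; apply/andP; split; lra.
apply/not_implyP; split => //; split; apply/andP; split; by [|exact: ltW].
Qed.
End DuBoisReymond.

(** * Test fields whose derivatives are finite differences *)

Section WeakDifferences.
Context {R : realType}.
Implicit Types (U O V : set 'rV[R]_2) (f g w : 'rV[R]_2 -> R) (a b B : R -> R).
Local Notation e_ i := (delta_mx 0 i : 'rV[R]_2).
Local Notation L1 := (@lebesgue_measure R).

Lemma int2_ae U f g : msb U -> measurable2 U f -> measurable2 U g ->
  {ae leb2 R, forall p, U (vec2 p) -> f (vec2 p) = g (vec2 p)} -> int2 U f = int2 U g.
Proof.
move=> mU mf mg fg; rewrite /int2 /Rintegral; congr fine.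
apply: ae_eq_integral => //; [exact/measurable_EFinP|exact/measurable_EFinP|].
case: fg => N [mN N0 sN]; exists N; split => // p /= np; apply: sN => /= H.
by apply: np => /H ->.
Qed.

Lemma in_Linf_bound U f : in_Lp U +oo%E f -> exists2 K, 0 <= K &
  {ae leb2 R, forall p, U (vec2 p) -> `|f (vec2 p)| <= K}.
Proof.
(* The second branch is that of a measure of total mass zero, for which every property holds almost
   everywhere. *)
move=> [_]; rewrite /Lpnorm unlock /=; case: ifPn => [_ Hy|mT _]; last first.
  exists 0 => //; exists setT; split => //.
  apply/eqP; rewrite eq_le; apply/andP; split; last exact: measure_ge0.
  by rewrite leNgt.
set E := ess_sup _ _ in Hy *.
have HE := ess_sup_ge (leb2 R) (abse \o (fun z => ((f \_ U) (vec2 z))%:E)).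
exists (Num.max 0 (fine E)); first by rewrite le_max lexx.
move: HE => [N [mN N0 sN]]; exists N; split => // p /= np; apply: sN => /= H.
apply: np => Up; move: H; rewrite patchE mem_set// -/E.
move: Hy; case: E => [r||] //= _.
by rewrite lee_fin => fr; rewrite le_max fr orbT.
Qed.

Lemma measurable2_patch U f : msb U -> measurable2 U f -> measurable2 setT (f \_ U).
Proof.
move=> mU mf; have := (measurable_restrictT (f \o @vec2 R) mU).1 mf.
rewrite /measurable2 preimage_setT; apply: eq_measurable_fun => p _; rewrite /= !patchE.
by rewrite (_ : (p \in @vec2 R @^-1` U) = (vec2 p \in U)) //; apply/idP/idP => /set_mem ?; apply/mem_set.
Qed.

Lemma integrable2_compactly (h : 'rV[R]_2 -> R) (C l r l' r' : R) :
  measurable2 setT h -> (forall x, `|h x| <= C) -> (forall x, ~ box l r l' r' x -> h x = 0) ->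
  integrable2 setT h.
Proof.
move=> mh hC h0; have mB := @msb_box R l r l' r'.
have [[H _] _] := int2_supp (f := h) mB (@msbT R) (@subsetT _ _) (fun x _ => h0 x).
by apply: H; apply: (@integrable2_bounded _ (box l r l' r') h C l r l' r') => //; exact: (measurable2_sub (@msbT R)).
Qed.

Lemma box2_sub_box i (l r l' r' : R) : exists p q p' q', box2 i l r l' r' = box p q p' q'.
Proof.
case: (ord2P i) => ->; first by exists l, r, l', r'.
by exists l', r', l, r; apply/seteqP; split => x [? ?].
Qed.

Lemma compact_box2 i (l r l' r' : R) : compact (box2 i l r l' r').
Proof. by have [p [q [p' [q' ->]]]] := box2_sub_box i l r l' r'; exact: compact_box. Qed.

Lemma msb_box2 i (l r l' r' : R) : msb (box2 i l r l' r').
Proof. by have [p [q [p' [q' ->]]]] := box2_sub_box i l r l' r'; exact: msb_box. Qed.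

Lemma smooth1_bounded a (l r : R) : continuous a -> (forall x, ~~ (l < x < r) -> a x = 0) ->
  exists2 C, 0 <= C & forall x, `|a x| <= C.
Proof.
move=> ca a0.
have /compact_bounded [M [_ HM]] : compact (a @` `[l, r]).
  by apply: continuous_compact; [exact: continuous_subspaceT|exact: segment_compact].
exists (Num.max 0 (M + 1)); first by rewrite le_max lexx.
move=> x; have [/andP[x1 x2]|/a0 ->] := boolP (l < x < r); last by rewrite normr0 le_max lexx.
rewrite le_max (HM (M + 1)) ?ltrDl// ?orbT//.
by exists x => //=; rewrite in_itv /= !ltW.
Qed.

Lemma continuous_tens2 i a b : continuous a -> continuous b -> continuous (tens2 i a b).
Proof. by move=> ca cb; rewrite tens2E; case: ifP => _; exact: continuous_tensor. Qed.

Lemma measurable_tens2 i a b : continuous a -> continuous b -> measurable2 setT (tens2 i a b).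
Proof.
move=> ca cb; apply: measurable2_continuous; first exact: openT.
by move=> x _; exact: continuous_tens2.
Qed.

Lemma le_int2S U V f : msb U -> msb V -> U `<=` V -> integrable2 V f ->
  (forall x, 0 <= f x) -> int2 U f <= int2 V f.
Proof.
move=> mU mV UV fi f0; rewrite (int2_mkcond U) (int2_mkcond V).
apply: le_int2; [exact: msbT| | |].
- by apply/(integrable2_mkcond f mU); exact: integrable2S UV fi.
- exact/(integrable2_mkcond f mV).
- move=> x _; rewrite !patchE; case: ifPn => [/set_mem/UV/mem_set ->//|_].
  by case: ifP.
Qed.

(** Up to sign this is the pairing of the weak derivative g with the test function, at most K times
    the L^1 norm of a product whose first factor is bounded by m on an interval. *)
Lemma weak_pairing_bound O (s : seq 'I_2) f g (K : R) i B b (m l r l' r' J : R) :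
  open O -> is_wder O s f g ->
  {ae leb2 R, forall p, O (vec2 p) -> `|g (vec2 p)| <= K} -> 0 <= K ->
  smooth1 B -> smooth1 b -> (forall y, 0 <= b y) -> l <= r ->
  (forall y, ~~ (l < y < r) -> B y = 0) -> (forall y, ~~ (l' < y < r') -> b y = 0) ->
  (forall y, `|B y| <= m) -> box2 i l r l' r' `<=` O ->
  (\int[L1]_x (b x)%:E = J%:E)%E ->
  `|int2 O (fun x => f x * pder s (tens2 i B b) x)| <= K * (m * (r - l) * J).
Proof.
move=> oO [_ [mg ig] H] gK K0 sB sb b0 lr B0 bz Bm BO bJ.
have m0 : 0 <= m := le_trans (normr_ge0 _) (Bm 0).
have cB := smooth1_continuous sB; have cb := smooth1_continuous sb.
have tf := test_tens2 (i := i) sB sb B0 bz BO.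
rewrite H// normrM normrX normrN1 expr1n mul1r.
set D := box2 i l r l' r' in BO.
have mD : msb D by exact: msb_box2.
have z x : ~ D x -> tens2 i B b x = 0.
  rewrite /D /box2 /tens2 /= => nD.
  have [/andP[h1 h2]|/B0 ->] := boolP (l < x 0 i < r); last by rewrite mul0r.
  have [/andP[h3 h4]|/bz ->] := boolP (l' < x 0 (other i) < r'); last by rewrite mulr0.
  by exfalso; apply: nD; split; rewrite !ltW.
rewrite -(int2_supp (f := fun x => g x * tens2 i B b x) mD (msb_open oO) BO _).2; last first.
  by move=> x _ /z ->; rewrite mulr0.
have mt : measurable2 D (tens2 i B b).
  by apply: measurable2_sub (@msbT R) _ _ => //; exact: measurable_tens2.
have mgD : measurable2 D g by apply: measurable2_sub (msb_open oO) BO mg.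
(* Clamping changes g on a null set only and turns the essential bound into a pointwise one, which
   gives integrability. *)
pose g' x := Num.max (- K) (Num.min (g x) K).
have mg' : measurable2 D g'.
  by apply: measurable_maxr => //; exact: measurable_minr.
have g'K x : `|g' x| <= K.
  by rewrite /g' ler_norml le_max lexx ge_max ge_min lexx orbT andbT; lra.
pose chi y : R := (l <= y <= r)%R%:R.
have [it ct] : integrable2 setT (tens2 i chi b) /\ int2 setT (tens2 i chi b) = (r - l) * J.
  apply: int2_tens2 => //; [|exact: continuous_measurable_fun|].
    rewrite (_ : chi = \1_`[l, r]%classic); first exact: measurable_indic.
    by apply/funext => y; rewrite indicE /chi; congr (nat_of_bool _)%:R; apply/idP/idP; rewrite inE /= in_itv.
  rewrite (_ : (fun x => (chi x)%:E) = (fun x => (\1_`[l, r]%classic x)%:E)).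
    rewrite integral_indic// setIT; have := @lebesgue_measure_itv R `[l, r]; rewrite /= => ->.
    rewrite lte_fin; case: ltP => [_|rl]; first by rewrite -EFinD.
    by congr EFin; apply/eqP; rewrite eq_sym subr_eq0 eq_le lr rl.
  by apply/funext => y; rewrite indicE /chi; congr (nat_of_bool _)%:R%:E; apply/idP/idP; rewrite inE /= in_itv.
have iD := integrable2S mD (@msbT R) (@subsetT _ D) it.
have le x : D x -> `|g' x * tens2 i B b x| <= K * m * tens2 i chi b x.
  move=> [xl _]; rewrite normrM -mulrA ler_pM// /tens2 /chi xl mul1r normrM (ger0_norm (b0 _)).
  by rewrite ler_wpM2r.
have ig' : integrable2 D (fun x => g' x * tens2 i B b x).
  apply: (le_integrable2 mD _ le); first exact: measurable_funM.
  exact: integrable2Z.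
rewrite (@int2_ae D _ (fun x => g' x * tens2 i B b x))//; first last.
- case: gK => N [mN N0 sN]; exists N; split => // p /= np; apply: sN => /= h.
  apply: np => Dp; have /h := BO _ Dp; rewrite ler_norml => /andP[h1 h2].
  by congr (_ * _); rewrite /g' (min_idPl h2) (max_idPr h1).
- exact: measurable_funM.
- exact: measurable_funM.
apply: (le_trans (ler_norm_int2 mD ig')).
apply: (le_trans (le_int2 mD (integrable2_norm ig') (integrable2Z _ mD iD) le)).
rewrite int2Z// -!mulrA ler_wpM2l// ler_wpM2l// -ct.
apply: (le_int2S mD (@msbT R) (@subsetT _ D) it) => x.
by rewrite /tens2 mulr_ge0// ler0n.
Qed.

(* The test fields of difference quotients: [potential w cs sigma] says that the
   combination [sum_k c_k a(. - s_k)] of translates of a bump is the w-th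
   derivative of a function with compact support. *)
Definition potential (w : nat) (cs : seq (R * R)) (sigma : R) : Prop :=
  forall a A AA (l r m : R), smooth1 a -> smooth1 A -> smooth1 AA ->
    (forall y : R, is_derive y 1 A (a y)) -> (forall y : R, is_derive y 1 AA (A y)) ->
    (forall y, y <= l -> a y = 0 /\ A y = 0 /\ AA y = 0) ->
    (forall y, r <= y -> a y = 0 /\ A y = m) -> (forall y, 0 <= A y <= m) -> l < r ->
  exists B, [/\ smooth1 B, forall y, `|B y| <= m,
    forall y, ~~ (l - sigma < y < r + sigma) -> B y = 0 &
    forall i b, smooth1 b -> pder (nseq w i) (tens2 i B b) =
      tens2 i (fun y => \sum_(k <- cs) k.1 * a (y - k.2)) b].

Lemma pd_tens2 i a a' b : smooth1 b -> (forall y : R, is_derive y 1 a (a' y)) ->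
  pd i (tens2 i a b) = tens2 i a' b.
Proof. by move=> sb da; apply: pdE => x; exact: is_derive_tens2. Qed.

Lemma smooth1_shift a (s : R) : smooth1 a -> smooth1 (fun y => a (y - s)).
Proof.
move=> sa; have := smooth1_line 1 (- s) sa.
by rewrite (_ : (fun x => _) = (fun y => a (y - s)))//; apply/funext => x; rewrite mul1r.
Qed.

Lemma is_derive_shift1 a a' (s : R) : (forall y : R, is_derive y 1 a (a' y)) ->
  forall y : R, is_derive y 1 (fun y => a (y - s)) (a' (y - s)).
Proof.
move=> da y; have := is_derive_line (f := a) (c := 1) (d := - s) (x := y) (da _).
by rewrite !mul1r (_ : (fun y0 => _) = (fun y0 => a (y0 - s)))//; apply/funext => x; rewrite mul1r.
Qed.

(** The potential is A(y) - A(y - s). To the right both terms equal m, so the support is compact,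
    and the size is at most the total mass m whatever s is. *)
Lemma potential1 (s : R) : potential 1 [:: (1, 0); (-1, s)] `|s|.
Proof.
move=> a A AA l r m sa sA sAA dA dAA L0 R0 Am lr.
exists (fun y => A y - A (y - s)); split.
- have := smooth1D sA (smooth1Z (-1) (smooth1_shift s sA)).
  by rewrite (_ : (fun x => _) = (fun y => A y - A (y - s)))//; apply/funext => y; rewrite mulN1r.
- move=> y; have /andP[? ?] := Am y; have /andP[? ?] := Am (y - s).
  rewrite ler_norml; apply/andP; split; lra.
- move=> y; rewrite negb_and -!leNgt => /orP[h|h].
    have [_ [-> _]] : a y = 0 /\ A y = 0 /\ AA y = 0 by apply: L0; have := normr_ge0 s; lra.
    have hs := ler_norm (- s); rewrite normrN in hs.
    by have [_ [-> _]] := L0 (y - s) ltac:(lra); rewrite subrr.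
  have [_ ->] : a y = 0 /\ A y = m by apply: R0; have := normr_ge0 s; lra.
  have hs := ler_norm s.
  by have [_ ->] := R0 (y - s) ltac:(lra); rewrite subrr.
- move=> i b sb /=; transitivity (tens2 i (fun y => a y - a (y - s)) b).
    by apply: pd_tens2 => // y; apply: is_deriveB; exact: is_derive_shift1.
  by congr (tens2 i _ b); apply/funext => y; rewrite !big_cons big_nil /= subr0; ring.
Qed.

Lemma quotient_mean (f df : R -> R) (m s y : R) : (forall y : R, is_derive y 1 f (df y)) ->
  (forall y, 0 <= df y <= m) -> s != 0 -> 0 <= s^-1 * (f y - f (y - s)) <= m.
Proof.
move=> dfd Hm s0.
have main (p q : R) : p < q -> 0 <= (q - p)^-1 * (f q - f p) <= m.
  move=> pq; have [c _ ->] := @MVT R f df p q pq (fun x _ => dfd x) (continuous_subspaceT (fun x => is_derive_continuous (dfd x))).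
  by rewrite mulrC mulfK ?subr_eq0 ?gt_eqF.
have [s1|s1|/eqP] := ltgtP s 0; last by rewrite (negbTE s0).
  have := main y (y - s); rewrite ltrDl oppr_gt0 => /(_ s1).
  by rewrite addrAC subrr add0r invrN mulNr -mulrN opprB.
have := main (y - s) y; rewrite ltrBlDr ltrDl => /(_ s1).
by rewrite opprB addrC subrK.
Qed.

(** A difference of two difference quotients is integrated twice. To the right of the support AA is
    affine with slope m, so both quotients equal m and cancel. By the mean value theorem each lies
    between 0 and m, hence their difference is bounded by m. *)
Lemma potential2 (s t sigma : R) : s != 0 -> t != 0 -> `|s| <= sigma -> `|t| <= sigma ->
  potential 2 [:: (s^-1, 0); (- s^-1, s); (- t^-1, 0); (t^-1, t)] sigma.
Proof.
move=> s0 t0 ss ts a A AA l r m sa sA sAA dA dAA L0 R0 Am lr.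
pose q (f : R -> R) (y : R) := s^-1 * (f y - f (y - s)) - t^-1 * (f y - f (y - t)).
have sq (f : R -> R) : smooth1 f -> smooth1 (q f).
  move=> sf.
  have dq u : smooth1 (fun y => u^-1 * (f y - f (y - u))).
    apply: smooth1Z; have := smooth1D sf (smooth1Z (-1) (smooth1_shift u sf)).
    by rewrite (_ : (fun x => _) = (fun y => f y - f (y - u)))//; apply/funext => y; rewrite mulN1r.
  have := smooth1D (dq s) (smooth1Z (-1) (dq t)).
  by rewrite (_ : (fun x => _) = q f)//; apply/funext => y; rewrite mulN1r.
have dq (f f' : R -> R) : (forall y : R, is_derive y 1 f (f' y)) -> forall y : R, is_derive y 1 (q f) (q f' y).
  move=> ff' y; apply: is_deriveB.
    by apply: (@is_deriveZ R _ _ (fun y => f y - f (y - s)) s^-1); apply: is_deriveB; exact: is_derive_shift1.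
  by apply: (@is_deriveZ R _ _ (fun y => f y - f (y - t)) t^-1); apply: is_deriveB; exact: is_derive_shift1.
have AAr y : r <= y -> AA y = AA r + m * (y - r).
  rewrite le_eqVlt => /orP[/eqP <-|ry]; first by rewrite subrr mulr0 addr0.
  have [c] := @MVT R AA A r y ry (fun x _ => dAA x) (continuous_subspaceT (fun x => is_derive_continuous (dAA x))).
  rewrite in_itv /= => /andP[/ltW /R0[_ ->] _] E.
  by rewrite -E addrC subrK.
exists (q AA); split.
- exact: sq.
- move=> y; have /andP[? ?] := quotient_mean y dAA Am s0; have /andP[? ?] := quotient_mean y dAA Am t0.
  rewrite ler_norml /q; apply/andP; split; lra.
- move=> y; have hs := ler_norm s; have hs' := ler_norm (- s).
  have ht := ler_norm t; have ht' := ler_norm (- t); rewrite !normrN in hs' ht'.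
  rewrite negb_and -!leNgt => /orP[h|h]; rewrite /q.
    have [_ [_ ->]] : a y = 0 /\ A y = 0 /\ AA y = 0 by apply: L0; have := normr_ge0 s; lra.
    have [_ [_ ->]] := L0 (y - s) ltac:(lra); have [_ [_ ->]] := L0 (y - t) ltac:(lra).
    by rewrite subrr !mulr0 subrr.
  have e u : u != 0 -> `|u| <= sigma -> u^-1 * (AA y - AA (y - u)) = m.
    move=> u0 us; have := ler_norm u; have := normr_ge0 u => ? ?.
    rewrite (AAr y); last by lra.
    rewrite (AAr (y - u)); last by lra.
    by field.
  by rewrite !e// subrr.
- move=> i b sb /=; transitivity (tens2 i (q a) b).
    have -> : pd i (tens2 i (q AA) b) = tens2 i (q A) b by apply: pd_tens2 => //; exact: dq.
    by apply: pd_tens2 => //; exact: dq.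
  by congr (tens2 i _ b); apply/funext => y; rewrite /q !big_cons big_nil /= subr0; ring.
Qed.
Lemma bump_antiderivative (c rho : R) : 0 < rho ->
  let a := bump 1 (c - rho) (c + rho) in
  exists A AA m, [/\ smooth1 A, smooth1 AA, (forall y : R, is_derive y 1 A (a y)),
    (forall y : R, is_derive y 1 AA (A y)) & [/\ 0 < m,
    (forall y, y <= c - rho -> a y = 0 /\ A y = 0 /\ AA y = 0),
    (forall y, c + rho <= y -> a y = 0 /\ A y = m), (forall y, 0 <= A y <= m) &
    (\int[L1]_y (a y)%:E = m%:E)%E]].
Proof.
move=> r0 a; have sa : smooth1 a by exact: smooth1_bump.
have a0 y : y <= c - rho -> a y = 0 by move=> h; apply: bump_eq0 => //; rewrite negb_and -leNgt h.
have a1 y : c + rho <= y -> a y = 0 by move=> h; apply: bump_eq0 => //; rewrite negb_and -!leNgt h orbT.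
have [A [sA dA A0]] := smooth1_antiderivative sa a0.
have [AA [sAA dAA AA0]] := smooth1_antiderivative sA A0.
have mvt y z : y < z -> exists2 d, y < d < z & A z - A y = a d * (z - y).
  move=> yz; have [d] := @MVT R A a y z yz (fun x _ => dA x) (continuous_subspaceT (fun x => is_derive_continuous (dA x))).
  by rewrite in_itv /= => ? ?; exists d.
have nd y z : y <= z -> A y <= A z.
  rewrite le_eqVlt => /orP[/eqP -> //|yz]; rewrite -subr_ge0; have [d _ ->] := mvt _ _ yz.
  by rewrite mulr_ge0 ?bump_ge0// subr_ge0 ltW.
have Ar y : c + rho <= y -> A y = A (c + rho).
  rewrite le_eqVlt => /orP[/eqP -> //|yz]; apply/eqP; rewrite -subr_eq0.
  by have [d /andP[d1 _] ->] := mvt _ _ yz; rewrite a1 ?mul0r// ltW.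
exists A, AA, (A (c + rho)); split => //; split.
- have h : c < c + rho by rewrite ltrDl.
  have [d /andP[d1 d2] E] := mvt _ _ h.
  have : 0 < A (c + rho) - A c.
    by rewrite E mulr_gt0 ?subr_gt0// bump_gt0// d2 andbT (lt_trans _ d1)// ltrBlDr ltrDl.
  have : 0 <= A c by rewrite -(A0 (c - rho))// nd// lerBlDr lerDl ltW.
  lra.
- by move=> y h; rewrite a0 ?A0 ?AA0.
- by move=> y h; rewrite a1 ?Ar.
- move=> y; apply/andP; split.
    by case: (leP y (c - rho)) => h; [rewrite A0|rewrite -(A0 (c - rho))// nd// ltW].
  by case: (leP (c + rho) y) => h; [rewrite Ar|rewrite nd// ltW].
- rewrite (@Rintegral_derivative R a A (c - rho) (c + rho))//; first by rewrite (A0 (c - rho))// subr0.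
    lra.
  by move=> y; exact: bump_eq0.
Qed.

End WeakDifferences.

(** * Finite differences bounded by weak derivatives *)

Section WeakDifferenceBound.
Context {R : realType}.
Implicit Types (U O V : set 'rV[R]_2) (f g w : 'rV[R]_2 -> R) (a b B : R -> R).
Local Notation e_ i := (delta_mx 0 i : 'rV[R]_2).
Local Notation L1 := (@lebesgue_measure R).

Lemma itv_dist (c y r : R) : c - r < y < c + r -> `|c - y| < r.
Proof. by move=> /andP[? ?]; rewrite ltr_norml; apply/andP; split; lra. Qed.

Lemma itv_widen (c y r s k : R) : c - r < y < c + r -> `|k| <= s ->
  c - r - s <= k + y <= c + r + s.
Proof. by rewrite ler_norml => /andP[? ?] /andP[? ?]; apply/andP; split; lra. Qed.

Lemma itv_narrow (c y r s t : R) : c - r - s <= y <= c + r + s -> s < t -> r <= (t - s) / 2 ->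
  `|c - y| < t.
Proof. by move=> /andP[? ?] ? ?; rewrite ltr_norml; apply/andP; split; lra. Qed.

(** The combination of values of f is averaged against a product of narrow bumps around x.
    Translation invariance moves the shifts onto the test function, [potential] writes the result as
    a derivative, and the bound K on the weak derivative applies. The support has width 2 (rho +
    sigma) in direction i; letting rho tend to 0 leaves 2 K sigma. *)
Lemma weak_diff_bound O f g (K : R) (n : nat) (cs : seq (R * R)) (sigma : R) i (x : 'rV[R]_2) (rho0 : R) : open O ->
  (forall y, O y -> {for y, continuous f}) -> is_wder O (nseq n i) f g ->
  {ae leb2 R, forall p, O (vec2 p) -> `|g (vec2 p)| <= K} -> 0 <= K ->
  potential n cs sigma -> (forall k, k \in cs -> `|k.2| <= sigma) ->
  0 <= sigma -> sigma < rho0 -> ball x rho0 `<=` O ->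
  `|\sum_(k <- cs) k.1 * f (k.2 *: e_ i + x)| <= 2 * K * sigma.
Proof.
move=> oO cf wf gK K0 pot cs_s s0 sr BO.
have r00 : 0 < rho0 := le_lt_trans s0 sr.
pose G (y : 'rV[R]_2) := \sum_(k <- cs) k.1 * f (k.2 *: e_ i + y).
have cin (k : R * R) (y : 'rV[R]_2) : k \in cs -> (forall j, `|x 0 j - y 0 j| < rho0 - sigma) -> ball x rho0 (k.2 *: e_ i + y).
  move=> kc xy; split=> // j1 j; rewrite ord1 /ball /= !mxE eqxx /=.
  have := cs_s _ kc; have := xy j; case: (j == i); rewrite ?mulr1 ?mulr0 ?add0r; rewrite !ltr_norml ?ler_norml.
    by move=> /andP[? ?] /andP[? ?]; apply/andP; split; lra.
  by move=> /andP[? ?] _; apply/andP; split; lra.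
have cG : {for x, continuous G}.
  suff : forall l, {subset l <= cs} ->
    {for x, continuous (fun y : 'rV[R]_2 => \sum_(k <- l) k.1 * f (k.2 *: e_ i + y))} by exact.
  elim => [|k l IH] lc.
    rewrite (_ : (fun y : 'rV[R]_2 => _) = fun=> 0); last by apply/funext => y; rewrite big_nil.
    exact: cst_continuous.
  rewrite (_ : (fun y : 'rV[R]_2 => _) = fun y => k.1 * f (k.2 *: e_ i + y) + \sum_(k <- l) k.1 * f (k.2 *: e_ i + y)); last first.
    by apply/funext => y; rewrite big_cons.
  apply: (@continuousD R R _ (fun y => k.1 * f (k.2 *: e_ i + y))); last first.
    by apply: IH => k' k'l; apply: lc; rewrite inE k'l orbT.
  apply: (@continuousM R _ (fun=> k.1)); first exact: cst_continuous.
  apply: (@continuous_comp _ _ _ (fun y => k.2 *: e_ i + y) f).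
    by apply: (@continuousD R _ _ (fun=> k.2 *: e_ i) id); [exact: cst_continuous|exact: cvg_id].
  apply: cf; apply: BO; apply: cin; first by apply: lc; rewrite inE eqxx.
  by move=> j; rewrite subrr normr0; lra.
rewrite -/(G x); apply/ler_addgt0Pr => ep ep0.
have ep2 : 0 < ep / 2 by lra.
have [r1 /= r10 Hr1] : exists2 r1 : R, 0 < r1 & forall y, ball x r1 y -> `|G x - G y| < ep / 2.
  by move/cvg_ballP : cG => /(_ _ ep2) /nbhs_ballP[r1 ? H]; exists r1.
(* In this order: continuity of G at x, inclusion of the enlarged box in the ball, and smallness of
   the surplus 2 K rho. *)
pose rho := Num.min (r1 / 2) (Num.min ((rho0 - sigma) / 2) (ep / (4 * (K + 1)))).
have rho0' : 0 < rho by rewrite !lt_min !divr_gt0//; lra.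
have h1 : rho <= r1 / 2 by rewrite ge_min lexx.
have h2 : rho <= (rho0 - sigma) / 2 by rewrite !ge_min lexx orbT.
have h3 : 4 * (K + 1) * rho <= ep.
  by rewrite mulrC -ler_pdivlMr; [rewrite !ge_min lexx !orbT|lra].
clearbody rho.
set xi := x 0 i; set xj := x 0 (other i).
have [A [AA [m [sA sAA dA dAA [m0 L0 R0 Am ia]]]]] := bump_antiderivative xi rho0'.
have [Ab [AAb [J [_ _ _ _ [J0 _ _ _ ib]]]]] := bump_antiderivative xj rho0'.
set a := bump 1 (xi - rho) _ in ia dA L0 R0; set b := bump 1 (xj - rho) _ in ib.
have sa : smooth1 a by exact: smooth1_bump.
have sb : smooth1 b by exact: smooth1_bump.
have lr : xi - rho < xi + rho by lra.
have [B [sB Bm Bz BD]] := pot a A AA (xi - rho) (xi + rho) m sa sA sAA dA dAA L0 R0 Am lr.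
set V := box2 i (xi - rho - sigma) (xi + rho + sigma) (xj - rho) (xj + rho).
have VO : V `<=` O.
  move=> y [v1 v3]; apply: BO; split=> // j1 j; rewrite ord1 /ball /=.
  have [->|->] : j = i \/ j = other i.
    by rewrite /other; case: (ord2P i) => ->; case: (ord2P j) => ->; [left|right|right|left].
  - by rewrite -/xi; apply: (itv_narrow v1).
  - rewrite -/xj; apply: (@itv_narrow xj (y 0 (other i)) rho sigma rho0) => //.
    case/andP: v3 => v3 v4; rewrite lerBlDr (le_trans v3) ?lerDl//=.
    by rewrite (le_trans v4)// lerDl.
have bz y : ~~ (xj - rho < y < xj + rho) -> b y = 0 by exact: bump_eq0.
have := weak_pairing_bound oO wf gK K0 sB sb (fun y => bump_ge0 _ _ _ y) _ Bz bz Bm VO ib.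
have -> : xi - rho - sigma <= xi + rho + sigma by lra.
move=> /(_ isT); rewrite BD//.
have mV : msb V by exact: msb_box2.
pose fV := f \_ V.
have mf : measurable2 O f by case: wf => -[].
have mfV : measurable2 setT fV.
  by apply: measurable2_patch => //; exact: measurable2_sub (msb_open oO) VO mf.
have [C C0 fC] : exists2 C, 0 <= C & forall y, `|fV y| <= C.
  have /compact_bounded [M [_ HM]] : compact (f @` V).
    apply: continuous_compact; last exact: compact_box2.
    by apply: continuous_in_subspaceT => y /set_mem /VO; exact: cf.
  exists (Num.max 0 (M + 1)); first by rewrite le_max lexx.
  move=> y; rewrite /fV patchE; case: ifPn => [/set_mem yV|_]; last by rewrite normr0 le_max lexx.
  by rewrite le_max (HM (M + 1)) ?ltrDl// ?orbT//; exists y.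
have b1 c (l r y : R) : `|bump c l r y| <= 1 by rewrite ger0_norm ?bump_ge0 ?bump_le1.
have [p [q [p' [q' VE]]]] := box2_sub_box i (xi - rho - sigma) (xi + rho + sigma) (xj - rho) (xj + rho).
pose F (k : R * R) y := fV y * tens2 i (fun z => a (z - k.2)) b y.
have iF k : integrable2 setT (F k).
  apply: (@integrable2_compactly R (F k) C p q p' q').
  - apply: measurable_funM => //; apply: measurable_tens2; last exact: smooth1_continuous.
    exact/smooth1_continuous/smooth1_shift.
  - move=> y; rewrite /F normrM; apply: (le_trans _ (fC y)).
    by rewrite ler_piMr// /tens2 normrM mulr_ile1//; exact: b1.
  - by move=> y; rewrite -VE => nV; rewrite /F /fV patchE memNset// mul0r.
have -> : int2 O (fun y => f y * tens2 i (fun z => \sum_(k <- cs) k.1 * a (z - k.2)) b y) =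
          \sum_(k <- cs) k.1 * int2 setT (F k).
  transitivity (int2 setT (fun y => \sum_(k <- cs) k.1 * F k y)); last first.
    have [_ ->] := int2_sum cs (@msbT R) (fun k _ => integrable2Z k.1 (@msbT R) (iF k)) (P := predT).
    by apply: eq_bigr => k _; rewrite int2Z//; exact: msbT.
  have -> : (fun y => \sum_(k <- cs) k.1 * F k y) = (fun y => fV y * tens2 i (fun z => \sum_(k <- cs) k.1 * a (z - k.2)) b y).
    by apply/funext => y; rewrite /tens2 mulr_suml mulr_sumr; apply: eq_bigr => k _; rewrite /F /tens2; ring.
  rewrite -(int2_supp (U := V) (V := O) mV (msb_open oO) VO _).2; last first.
    move=> y _ nV; rewrite /tens2.
    have [/andP[y3 y4]|/bz ->] := boolP (xj - rho < y 0 (other i) < xj + rho); last by rewrite !mulr0.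
    rewrite big_seq big1 ?mul0r ?mulr0// => k kc; rewrite /a bump_eq0 ?mulr0//.
    apply/negP => y1; apply: nV; split; last by rewrite !ltW.
    by have := itv_widen y1 (cs_s _ kc); rewrite [k.2 + _]addrC subrK.
  rewrite -(int2_supp (U := V) (V := setT) mV (@msbT R) (@subsetT _ _) _).2.
    by apply: eq_int2 => y yV; rewrite /fV patchE mem_set.
  by move=> y _ nV; rewrite /fV patchE memNset// mul0r.
have Tr k : integrable2 setT (fun y => fV (k.2 *: e_ i + y) * tens2 i a b y) /\
   int2 setT (F k) = int2 setT (fun y => fV (k.2 *: e_ i + y) * tens2 i a b y).
  have [i1 e1] := int2_translate (k.2 *: e_ i) (iF k).
  have E : (fun y => F k (k.2 *: e_ i + y)) = (fun y => fV (k.2 *: e_ i + y) * tens2 i a b y).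
    apply/funext => y; rewrite /F /tens2 !mxE !eqxx /=; congr (_ * (a _ * b _)); first by ring.
    by rewrite /other; case: (ord2P i) => -> /=; rewrite mulr0 add0r.
  by rewrite E in i1 e1; split; [exact: i1|exact: esym e1].
pose G' y := \sum_(k <- cs) k.1 * fV (k.2 *: e_ i + y).
have [iG eG] : integrable2 setT (fun y => G' y * tens2 i a b y) /\
    int2 setT (fun y => G' y * tens2 i a b y) = \sum_(k <- cs) k.1 * int2 setT (F k).
  have [i1 e1] := int2_sum cs (@msbT R) (fun k _ => integrable2Z k.1 (@msbT R) (Tr k).1) (P := predT).
  have E : (fun y => \sum_(k <- cs) k.1 * (fV (k.2 *: e_ i + y) * tens2 i a b y)) = (fun y => G' y * tens2 i a b y).
    by apply/funext => y; rewrite /G' mulr_suml; apply: eq_bigr => k _; rewrite mulrA.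
  rewrite E in i1 e1; split; first exact: i1.
  apply: (etrans e1); apply: eq_bigr => k _.
  by rewrite (Tr k).2; apply: int2Z; [exact: msbT|exact: (Tr k).1].
rewrite -eG => le1.
have [it et] : integrable2 setT (tens2 i a b) /\ int2 setT (tens2 i a b) = m * J.
  apply: int2_tens2 => //; try exact: bump_ge0.
    by apply: continuous_measurable_fun; exact: smooth1_continuous.
  by apply: continuous_measurable_fun; exact: smooth1_continuous.
have le2 : `|int2 setT (fun y => G' y * tens2 i a b y) - G x * (m * J)| <= ep / 2 * (m * J).
  rewrite -et -!int2Z//; try exact: msbT.
  have iZ := integrable2Z (G x) (@msbT R) it.
  rewrite -int2B//; last exact: msbT.
  have iB := integrable2B (@msbT R) iG iZ.
  apply: (le_trans (ler_norm_int2 (@msbT R) iB)).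
  apply: (le_int2 (@msbT R) (integrable2_norm iB) (integrable2Z (ep / 2) (@msbT R) it)).
  move=> y _; have t0 : 0 <= tens2 i a b y by rewrite /tens2 mulr_ge0 ?bump_ge0.
  rewrite -mulrBl normrM (ger0_norm t0).
  have [y1|/(bump_eq0 (c := 1) ltr01) ya] := boolP (xi - rho < y 0 i < xi + rho); last first.
    by rewrite /tens2 /a ya mul0r !mulr0.
  have [y3|/bz yb] := boolP (xj - rho < y 0 (other i) < xj + rho); last first.
    by rewrite /tens2 yb !mulr0.
  apply: ler_wpM2r => //.
  have dxy j : `|x 0 j - y 0 j| < rho.
    have [->|->] : j = i \/ j = other i.
      by rewrite /other; case: (ord2P i) => ->; case: (ord2P j) => ->; [left|right|right|left].
    - exact: itv_dist y1.
    - exact: itv_dist y3.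
  have -> : G' y = G y.
    apply: eq_big_seq => k kc; rewrite /fV patchE mem_set//.
    rewrite /V /box2 /= !mxE !eqxx /= mulr1.
    have -> : (other i == i) = false by rewrite /other; case: (ord2P i) => ->.
    rewrite mulr0 add0r; split; first exact: itv_widen y1 (cs_s _ kc).
    by case/andP: y3 => ? ?; rewrite !ltW.
  rewrite distrC ltW//; apply: Hr1; split=> // j1 j; rewrite ord1 /ball /=.
  by apply: (lt_le_trans (dxy j)); lra.
have mJ : 0 < m * J by exact: mulr_gt0.
have : `|G x| * (m * J) <= (2 * K * sigma + ep) * (m * J).
  rewrite -[in leLHS](gtr0_norm mJ) -normrM.
  have := ler_distD (int2 setT (fun y => G' y * tens2 i a b y)) (G x * (m * J)) 0.
  rewrite !subr0 distrC => /le_trans; apply.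
  apply: (le_trans (lerD le2 le1)).
  have -> : K * (m * (xi + rho + sigma - (xi - rho - sigma)) * J) = 2 * K * (rho + sigma) * (m * J) by ring.
  rewrite -mulrDl ler_pM2r//; have : K * rho <= (K + 1) * rho by rewrite ler_wpM2r//; lra.
  nra.
by rewrite ler_pM2r.
Qed.
End WeakDifferenceBound.

(** * From difference quotients to classical derivatives *)

Section Regularity.
Context {R : realType}.
Implicit Types (U O V : set 'rV[R]_2) (f g w : 'rV[R]_2 -> R) (a b B : R -> R).
Local Notation e_ i := (delta_mx 0 i : 'rV[R]_2).

Definition quo f (i : 'I_2) (s : R) (x : 'rV[R]_2) : R := s^-1 * (f (s *: e_ i + x) - f x).

(* f is of class C^{1,1} in direction i, in terms of its difference quotients. *)
Definition quo_cauchy O f i (K : R) : Prop := forall x rho, ball x rho `<=` O ->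
  (forall s, `|s| < rho -> s != 0 -> `|quo f i s x| <= K) /\
  (forall s t, `|s| < rho -> `|t| <= `|s| -> s != 0 -> t != 0 ->
    `|quo f i t x - quo f i s x| <= K * `|s|).

(** The first weak derivative in direction i bounds the quotients, and the second one in the same
    direction makes them Cauchy as the step shrinks. *)
Lemma weak_quo_cauchy O f i : open O -> (forall y, O y -> {for y, continuous f}) ->
  in_sobolev O 2 +oo%E f -> exists2 K, 0 <= K & quo_cauchy O f i K.
Proof.
move=> oO cf sob.
have [g1 [w1 /in_Linf_bound [K1 K10 b1]]] := sob [:: i] isT.
have [g2 [w2 /in_Linf_bound [K2 K20 b2]]] := sob [:: i; i] isT.
have K1m : 2 * K1 <= Num.max (2 * K1) (2 * K2) by rewrite le_max lexx.
have K2m : 2 * K2 <= Num.max (2 * K1) (2 * K2) by rewrite le_max lexx orbT.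
exists (Num.max (2 * K1) (2 * K2)); first by rewrite le_max mulr_ge0.
move=> x rho BO; split=> [s sr s0|s t sr ts s0 t0].
  have Hk (k : R * R) : k \in [:: (1, 0); (-1, s)] -> `|k.2| <= `|s|.
    by rewrite !inE => /orP[] /eqP -> /=; rewrite ?normr0.
  have := @weak_diff_bound R O f g1 K1 1 [:: (1, 0); (-1, s)] `|s| i x rho oO cf w1 b1 K10 (potential1 s) Hk (normr_ge0 s) sr BO.
  rewrite !big_cons big_nil /= scale0r add0r mul1r addr0 mulN1r => h.
  rewrite /quo normrM normfV mulrC ler_pdivrMr ?normr_gt0// distrC (le_trans h)//.
  by rewrite ler_wpM2r.
have Hk (k : R * R) : k \in [:: (s^-1, 0); (- s^-1, s); (- t^-1, 0); (t^-1, t)] -> `|k.2| <= `|s|.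
  by rewrite !inE => /or4P[] /eqP -> /=; rewrite ?normr0.
have := @weak_diff_bound R O f g2 K2 2 _ `|s| i x rho oO cf w2 b2 K20 (potential2 s0 t0 (lexx _) ts) Hk (normr_ge0 s) sr BO.
rewrite !big_cons big_nil /= scale0r add0r addr0 => h.
have -> : quo f i t x - quo f i s x = s^-1 * f x + (- s^-1 * f (s *: e_ i + x) + (- t^-1 * f x + t^-1 * f (t *: e_ i + x))).
  by rewrite /quo; ring.
by rewrite (le_trans h)// ler_wpM2r.
Qed.

(** The Cauchy estimate passes to the limit in t, so it yields both the existence of the derivative
    and the rate K |s| of convergence. *)
Lemma quo_cauchy_pd O f i K x rho : 0 <= K -> quo_cauchy O f i K -> 0 < rho -> ball x rho `<=` O ->
  [/\ derivable f x (e_ i), `|pd i f x| <= K &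
      forall s, `|s| < rho -> s != 0 -> `|pd i f x - quo f i s x| <= K * `|s|].
Proof.
move=> K0 qc r0 BO; have [q1 q2] := qc x rho BO.
have dE : (fun h => h^-1 *: ((f \o shift x) (h *: e_ i) - f x)) = quo f i ^~ x by [].
have dF : derivable f x (e_ i).
  rewrite /derivable dE; apply: cauchy_cvg; apply: cauchy_exP => ep ep0.
  pose s := Num.min (rho / 2) (ep / (2 * (K + 1))).
  have s0 : 0 < s by rewrite lt_min !divr_gt0//; lra.
  have sr : s < rho by rewrite gt_min; apply/orP; left; lra.
  have sK : 2 * (K + 1) * s <= ep by rewrite mulrC -ler_pdivlMr; [rewrite ge_min lexx orbT|lra].
  exists (quo f i s x).
  suff : \forall t \near (0 : R)^', ball (quo f i s x) ep (quo f i t x) by [].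
  near=> t.
  have t0 : t != 0 by near: t; exact: nbhs_dnbhs_neq.
  have ts : `|t| < s by near: t; exact: dnbhs0_lt.
  rewrite /ball /= distrC.
  have := q2 s t; rewrite (gtr0_norm s0) sr (ltW ts) gt_eqF// t0 => /(_ isT isT isT isT) h.
  by apply: (le_lt_trans h); nra.
have lim : quo f i t x @[t --> 0^'] --> pd i f x by exact: dF.
have approx (c d : R) : (\forall t \near 0^', `|quo f i t x - c| <= d) -> `|pd i f x - c| <= d.
  move=> H; apply/ler_addgt0Pr => ep ep0.
  have : \forall t \near (0 : R)^', `|pd i f x - quo f i t x| < ep.
    by move/cvgrPdist_lt : lim; exact.
  move=> H2; have [t [h1 h2]] : exists t : R, `|quo f i t x - c| <= d /\ `|pd i f x - quo f i t x| < ep.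
    by apply: (@filter_ex _ (0 : R)^'); apply: filterI.
  rewrite -(subrK (quo f i t x) (pd i f x)) -addrA (le_trans (ler_normD _ _))//; lra.
split => //.
  rewrite -[pd i f x]subr0; apply: approx; near=> t; rewrite subr0; apply: q1.
    by near: t; exact: dnbhs0_lt.
  by near: t; exact: nbhs_dnbhs_neq.
move=> s sr s0; apply: approx; near=> t; apply: q2 => //.
  by near: t; apply: dnbhs0_le; rewrite normr_gt0.
by near: t; exact: nbhs_dnbhs_neq.
Unshelve. all: by end_near.
Qed.

Lemma continuous_near (T : topologicalType) (f : T -> R) (x : T) :
  (forall e : R, 0 < e -> \forall y \near x, `|f x - f y| < e) -> {for x, continuous f}.
Proof. by move=> H; apply/cvgrPdist_lt. Qed.

Lemma ball_near_sub O x : open O -> O x ->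
  exists2 rho, 0 < rho & forall y, ball x rho y -> ball y rho `<=` O.
Proof.
move=> oO Ox; have /nbhs_ballP [r /= r0 rO] : nbhs x O by exact: open_nbhs_nbhs.
have r2 : 0 < r / 2 by lra.
exists (r / 2) => // y xy z yz; apply: rO; exact: ball_split xy yz.
Qed.

Lemma continuous_shiftx f (v x : 'rV[R]_2) : {for v + x, continuous f} ->
  {for x, continuous (fun y => f (v + y))}.
Proof.
move=> cf; apply: (@continuous_comp _ _ _ (fun y => v + y) f) => //.
by apply: (@continuousD R _ _ (fun=> v) id); [exact: cst_continuous|exact: cvg_id].
Qed.

Lemma continuous_quo f i s x : {for x, continuous f} -> {for s *: e_ i + x, continuous f} ->
  {for x, continuous (quo f i s)}.
Proof.
move=> c1 c2; apply: (@continuousM R _ (fun=> s^-1)); first exact: cst_continuous.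
by apply: (@continuousB R R _ (fun y => f (s *: e_ i + y)) f) => //; exact: continuous_shiftx.
Qed.

Lemma ball_line (x : 'rV[R]_2) (s rho : R) i : `|s| < rho -> ball x rho (s *: e_ i + x).
Proof.
move=> sr; split; first exact: le_lt_trans (normr_ge0 s) sr.
move=> j1 j; rewrite ord1 /ball /= !mxE eqxx /= opprD addrCA subrr addr0 normrN.
by case: (j == i); rewrite ?mulr1// mulr0 normr0 (le_lt_trans _ sr).
Qed.

(** The rate of convergence of the quotients is uniform near x, so the partial derivative is a
    locally uniform limit of continuous functions. *)
Lemma sobolev_C1 O f i : open O -> (forall y, O y -> {for y, continuous f}) ->
  in_sobolev O 2 +oo%E f -> exists2 K, 0 <= K & quo_cauchy O f i K /\
   forall x, O x -> [/\ derivable f x (e_ i), `|pd i f x| <= K & {for x, continuous (pd i f)}].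
Proof.
move=> oO cf sob; have [K K0 qc] := weak_quo_cauchy i oO cf sob.
exists K => //; split => // x Ox; have [rho r0 near_sub] := ball_near_sub oO Ox.
have xx : ball x rho x by exact: ballxx.
have [dx bx qx] := quo_cauchy_pd K0 qc r0 (near_sub x xx).
split => //; apply: continuous_near => ep ep0.
pose s := Num.min (rho / 2) (ep / (4 * (K + 1))).
have s0 : 0 < s by rewrite lt_min !divr_gt0//; lra.
have sr : s < rho by rewrite gt_min; apply/orP; left; lra.
have sK : 4 * (K + 1) * s <= ep by rewrite mulrC -ler_pdivlMr; [rewrite ge_min lexx orbT|lra].
have cq : {for x, continuous (quo f i s)}.
  apply: continuous_quo; first exact: cf.
  by apply: cf; apply: (near_sub x xx); apply: ball_line; rewrite gtr0_norm.
have ep2 : 0 < ep / 2 by lra.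
near=> y.
have xy : ball x rho y by near: y; exact: nbhsx_ballx.
have [_ _ qy] := quo_cauchy_pd K0 qc r0 (near_sub y xy).
have hq : `|quo f i s x - quo f i s y| < ep / 2 by near: y; move/cvgrPdist_lt : cq; exact.
have sn : `|s| < rho by rewrite gtr0_norm.
have := qx s sn; have := qy s sn; rewrite gt_eqF// (gtr0_norm s0) => /(_ isT) h1 /(_ isT) h2.
have := ler_distD (quo f i s x) (pd i f x) (pd i f y).
have := ler_distD (quo f i s y) (quo f i s x) (pd i f y).
rewrite [`|quo f i s y - _|]distrC.
have : K * s <= (K + 1) * s by rewrite ler_wpM2r//; lra.
lra.
Unshelve. all: by end_near.
Qed.
End Regularity.

(** * Integration by parts against products with compact support *)

Section IntegrationByParts.
Context {R : realType}.
Implicit Types (U O V : set 'rV[R]_2) (f g w : 'rV[R]_2 -> R) (a b B : R -> R).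
Local Notation e_ i := (delta_mx 0 i : 'rV[R]_2).

Lemma lipschitz_bump_quotient a a' (l r : R) : smooth1 a -> (forall y : R, is_derive y 1 a (a' y)) ->
  (forall y, ~~ (l < y < r) -> a y = 0) -> exists2 C, 0 <= C &
  forall s y : R, s != 0 -> `|s^-1 * (a (y - s) - a y)| <= C.
Proof.
move=> sa da a0; have [a'' sa'' da''] := smooth1_derive sa.
have ea y : a'' y = a' y by have [_ <-] := da'' y; have [_ <-] := da y.
have ca' : continuous a' by move=> y; rewrite -(_ : a'' = a'); [exact: smooth1_continuous|exact/funext].
have a'0 y : ~~ (l - 1 < y < r + 1) -> a' y = 0.
  move=> ny; have [_ <-] := da y; rewrite -[RHS](derive_cst (0 : R) y 1).
  apply: near_eq_derive; near=> z; apply: a0; apply/negP => /andP[z1 z2].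
  move: ny; rewrite negb_and -!leNgt.
  have : `|y - z| < 1 by near: z; apply: (@nbhsx_ballx _ _ y).
  rewrite ltr_norml => /andP[? ?] /orP[?|?]; lra.
have [C C0 HC] := smooth1_bounded ca' a'0.
exists C => // s y s0.
have main (p q : R) : p < q -> `|a q - a p| <= C * (q - p).
  move=> pq; have [c _ ->] := @MVT R a a' p q pq (fun x _ => da x) (continuous_subspaceT (smooth1_continuous sa)).
  by rewrite normrM [`|q - p|]gtr0_norm ?subr_gt0// ler_wpM2r ?subr_ge0 ?(ltW pq).
rewrite normrM normfV mulrC ler_pdivrMr ?normr_gt0//.
have [s1|s1|/eqP] := ltgtP s 0; last by rewrite (negbTE s0).
  have := main y (y - s); rewrite ltrDl oppr_gt0 => /(_ s1).
  by rewrite (_ : y - s - y = - s) ?[`|s|]ltr0_norm//; ring.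
have := main (y - s) y; rewrite ltrBlDr ltrDl => /(_ s1).
by rewrite (_ : y - (y - s) = s) ?[`|s|]gtr0_norm 1?distrC//; ring.
Unshelve. all: by end_near.
Qed.

Lemma derive_seq_cvg (a : R -> R) (y l d : R) : is_derive y 1 a l -> 0 < d ->
  (d / n.+1%:R)^-1 * (a (y - d / n.+1%:R) - a y) @[n --> \oo] --> - l.
Proof.
move=> [da <-] d0.
have h0 : (- (d / n.+1%:R)) @[n --> \oo] --> (0 : R)^'.
  move=> P /nbhs_ballP[e /= e0 HP].
  suff : \forall n \near \oo, P (- (d / n.+1%:R)) by [].
  near=> n; apply: HP.
    rewrite /ball /= opprK add0r gtr0_norm ?divr_gt0// mulrC -ltr_pdivlMr//.
    near: n; exact: (near_infty_natSinv_lt (PosNum (divr_gt0 e0 d0))).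
  by rewrite /= oppr_eq0 mulf_neq0 ?gt_eqF.
have := cvg_comp _ _ h0 da; rewrite -/('D_1 a y) => H.
rewrite (_ : (fun n => _) = (fun n : nat => - ((- (d / n.+1%:R))^-1 *: (a (- (d / n.+1%:R) *: (1 : R) + y) - a y)))).
  by apply: cvgN; exact: H.
by apply/funext => n; rewrite /GRing.scale /= mulr1 invrN mulNr opprK [- _ + y]addrC.
Unshelve. all: by end_near.
Qed.

Lemma compact_ball_sub (d : nat) (K O : set 'rV[R]_d) : compact K -> open O -> K `<=` O ->
  exists2 e : R, 0 < e & forall x, K x -> ball x e `<=` O.
Proof.
move=> cK oO KO.
have /compact_near_coveringP cov := cK.
have /= H := cov R (0 : R)^'+ (fun e x => ball x e `<=` O) _ _.
have : \forall e \near (0 : R)^'+, K `<=` (fun x => ball x e `<=` O).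
  apply: H => x Kx; have /nbhs_ballP [r /= r0 rO] : nbhs x O by apply: open_nbhs_nbhs; split => //; exact: KO.
  have r2 : 0 < r / 2 by lra.
  exists (ball x (r / 2), [set e | e < r / 2]).
    by split => /=; [exact: nbhsx_ballx|exact: nbhs_right_lt].
  move=> [y e] [/= xy er] z yz; apply: rO; apply: ball_split xy _.
  by apply: le_ball yz; exact: ltW.
move=> H2; have [e [e0 He]] : exists e : R, 0 < e /\ K `<=` (fun x => ball x e `<=` O).
  apply: (@filter_ex _ (0 : R)^'+); apply: filterI => //; exact: nbhs_right_gt.
by exists e.
Qed.

Lemma clamp_dist (l r u d : R) : l <= r -> l - d <= u <= r + d -> 0 < d ->
  `|Num.max l (Num.min u r) - u| <= d.
Proof.
move=> lr /andP[u1 u2] d0; rewrite maxEle minEle ler_norml.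
by case: (leP u r) => h; case: ifP => /= [h'|/negbT]; rewrite -?ltNge => *; apply/andP; split; lra.
Qed.

(** At the discrete level integration by parts is translation invariance: a difference quotient of
    the test function is traded for one of f. Both sides converge dominatedly, the first because a
    is Lipschitz, the second because the quotients of f are bounded by K. *)
Lemma ibp_tens2 O f i K a a' b (l r l' r' : R) : open O -> 0 <= K ->
  (forall y, O y -> {for y, continuous f}) -> quo_cauchy O f i K ->
  smooth1 a -> smooth1 b -> (forall y : R, is_derive y 1 a (a' y)) ->
  (forall y, ~~ (l < y < r) -> a y = 0) -> (forall y, ~~ (l' < y < r') -> b y = 0) ->
  box2 i l r l' r' `<=` O ->
  int2 O (fun y => f y * tens2 i a' b y) = - int2 O (fun y => pd i f y * tens2 i a b y).
Proof.
move=> oO K0 cf qc sa sb da a0 b0 BO.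
(* An empty interval forces a = 0, and both integrals vanish. *)
have [rl|lr] := ltP r l.
  have ea : a = cst 0.
    by apply/funext => y; apply: a0; apply/negP => /andP[h1 h2]; move: (lt_trans h1 h2); rewrite ltNge ltW.
  have ea' y : a' y = 0 by have [_ <-] := da y; rewrite ea derive_cst.
  rewrite (eq_int2 (g := fun=> 0)) ?(eq_int2 (g := fun=> 0) (f := fun y => pd i f y * _)) ?int2_0 ?oppr0//.
    by move=> y _; rewrite /tens2 ea mul0r mulr0.
  by move=> y _; rewrite /tens2 ea' mul0r mulr0.
have [e e0 eO] := compact_ball_sub (@compact_box2 R i l r l' r') oO BO.
have e2 : 0 < e / 2 by lra.
set W := box2 i l r l' r' in BO eO.
(* The box W widened by e/2 in direction i only: it contains all the shifts by [s n] below, and f is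
   bounded on it. *)
set V := box2 i (l - e / 2) (r + e / 2) l' r'.
have VO : V `<=` O.
  move=> y [/andP[y1 y2] y3].
  pose z := (Num.max l (Num.min (y 0 i) r) - y 0 i) *: e_ i + y.
  have zi : z 0 i = Num.max l (Num.min (y 0 i) r) by rewrite !mxE !eqxx /= mulr1 subrK.
  have zo : z 0 (other i) = y 0 (other i).
    by rewrite !mxE /other; case: (ord2P i) => -> /=; rewrite mulr0 add0r.
  apply: (eO z).
    by split; rewrite ?zi ?zo// le_max lexx /= ge_max lr ge_min lexx orbT.
  apply: ball_sym; apply: ball_line; apply: (@le_lt_trans _ _ (e / 2)); last by lra.
  by apply: clamp_dist => //; rewrite y1.
have mV : msb V by exact: msb_box2.
have mW : msb W by exact: msb_box2.
have WV : W `<=` V by move=> y [/andP[y1 y2] y3]; split => //; apply/andP; split; lra.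
have mf : measurable2 O f by exact: measurable2_continuous.
pose fV := f \_ V.
have mfV : measurable2 setT fV.
  by apply: measurable2_patch => //; exact: measurable2_sub (msb_open oO) VO mf.
have [C C0 fC] : exists2 C : R, 0 <= C & forall y, `|fV y| <= C.
  have /compact_bounded [M [_ HM]] : compact (f @` V).
    apply: continuous_compact; last exact: compact_box2.
    by apply: continuous_in_subspaceT => y /set_mem /VO; exact: cf.
  exists (Num.max 0 (M + 1)); first by rewrite le_max lexx.
  move=> y; rewrite /fV patchE; case: ifPn => [/set_mem yV|_]; last by rewrite normr0 le_max lexx.
  by rewrite le_max (HM (M + 1)) ?ltrDl// ?orbT//; exists y.
have [A A0 aA] := smooth1_bounded (smooth1_continuous sa) a0.
have [Bb B0 bB] := smooth1_bounded (smooth1_continuous sb) b0.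
have [Q Q0 aQ] := lipschitz_bump_quotient sa da a0.
have [p [q [p' [q' VE]]]] := box2_sub_box i (l - e / 2) (r + e / 2) l' r'.
pose t := tens2 i a b.
pose s (n : nat) : R := (e / 2) / n.+1%:R.
have s0 n : 0 < s n by rewrite divr_gt0.
have se n : s n <= e / 2 by rewrite ler_pdivrMr// ler_peMr ?(ltW e2)// ler1n.
have tW y : ~ W y -> t y = 0.
  rewrite /W /box2 /t /tens2 /= => nD.
  have [/andP[h1 h2]|/a0 ->] := boolP (l < y 0 i < r); last by rewrite mul0r.
  have [/andP[h3 h4]|/b0 ->] := boolP (l' < y 0 (other i) < r'); last by rewrite mulr0.
  by exfalso; apply: nD; split; rewrite !ltW.
have iT (c : R -> R) (Cc : R) : continuous c -> (forall y, `|c y| <= Cc) -> integrable2 setT (fun y => fV y * tens2 i c b y).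
  move=> cc cC; apply: (@integrable2_compactly R _ (C * (Cc * Bb)) p q p' q').
  - by apply: measurable_funM => //; apply: measurable_tens2 => //; exact: smooth1_continuous.
  - by move=> y; rewrite normrM ler_pM// /tens2 normrM ler_pM.
  - by move=> y; rewrite -VE => nV; rewrite /fV patchE memNset// mul0r.
have i2 : integrable2 setT (fun y => fV y * t y).
  by apply: (iT a A) => //; exact: smooth1_continuous.
have i1 n : integrable2 setT (fun y => fV y * tens2 i (fun z => a (z - s n)) b y).
  by apply: (iT _ A) => //; exact/smooth1_continuous/smooth1_shift.
have tr n : integrable2 setT (fun y => fV (s n *: e_ i + y) * t y) /\
  int2 setT (fun y => fV (s n *: e_ i + y) * t y) = int2 setT (fun y => fV y * tens2 i (fun z => a (z - s n)) b y).
  have [j1 j2] := int2_translate (s n *: e_ i) (i1 n).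
  have E : (fun y => fV (s n *: e_ i + y) * tens2 i (fun z => a (z - s n)) b (s n *: e_ i + y)) =
           (fun y => fV (s n *: e_ i + y) * t y).
    apply/funext => y; rewrite /t /tens2 !mxE !eqxx /=; congr (_ * (a _ * b _)); first by ring.
    by rewrite /other; case: (ord2P i) => -> /=; rewrite mulr0 add0r.
  by rewrite E in j1 j2.
pose F n y := fV y * tens2 i (fun z => (s n)^-1 * (a (z - s n) - a z)) b y.
pose Hn n y := (s n)^-1 * (fV (s n *: e_ i + y) * t y - fV y * t y).
have FH n : int2 setT (F n) = int2 setT (Hn n).
  have [j1 j2] := tr n.
  have -> : F n = (fun y => (s n)^-1 * (fV y * tens2 i (fun z => a (z - s n)) b y - fV y * t y)).
    by apply/funext => y; rewrite /F /t /tens2; ring.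
  rewrite /Hn.
  have k1 := integrable2B (@msbT R) (i1 n) i2.
  have k2 := integrable2B (@msbT R) j1 i2.
  rewrite (int2Z _ (@msbT R) k1) (int2Z _ (@msbT R) k2); congr (_ * _).
  by rewrite (int2B (@msbT R) (i1 n) i2) (int2B (@msbT R) j1 i2) j2.
pose chi y : R := C * (Q * Bb) * (\1_V y).
have ichi : integrable2 setT chi.
  apply: (@integrable2_compactly R _ (C * (Q * Bb)) p q p' q').
  - apply: measurable_funM => //; rewrite preimage_setT.
    rewrite (_ : (fun p => _) = \1_(@vec2 R @^-1` V))//; exact: measurable_indic.
  - by move=> y; rewrite /chi indicE normrM !ger0_norm ?mulr_ge0// ler_piMr ?mulr_ge0//; case: (y \in V).
  - by move=> y; rewrite -VE => nV; rewrite /chi indicE memNset// mulr0.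
have [iF limF] : integrable2 setT (fun y => fV y * tens2 i (fun z => - a' z) b y) /\
    int2 setT (F n) @[n --> \oo] --> int2 setT (fun y => fV y * tens2 i (fun z => - a' z) b y).
  apply: (int2_dct (g := chi)) => //; first exact: msbT.
  - move=> n; apply: measurable_funM => //; apply: measurable_tens2; last exact: smooth1_continuous.
    apply: smooth1_continuous; apply: smooth1Z.
    have := smooth1D (smooth1_shift (s n) sa) (smooth1Z (-1) sa).
    by rewrite (_ : (fun x => _) = (fun z => a (z - s n) - a z))//; apply/funext => z; rewrite mulN1r.
  - move=> y _; apply: cvgMr; apply: cvgMl; exact: derive_seq_cvg.
  - move=> n y _; rewrite /F /chi indicE normrM; case: (boolP (y \in V)) => yV; last first.
      by rewrite /fV patchE (negbTE yV) normr0 mul0r mulr0.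
    by rewrite mulr1 ler_pM// /tens2 normrM ler_pM// aQ// gt_eqF.
have WO (y : 'rV[R]_2) : W y -> forall n, fV (s n *: e_ i + y) = f (s n *: e_ i + y) /\ fV y = f y.
  move=> Wy n; rewrite /fV !patchE !mem_set//; first exact: WV.
  case: Wy => /andP[w1 w2] w3; split.
    by rewrite !mxE !eqxx /= mulr1; have := s0 n; have := se n => ? ?; apply/andP; split; lra.
  rewrite (_ : (s n *: e_ i + y) 0 (other i) = y 0 (other i))//.
  by rewrite !mxE /other; case: (ord2P i) => -> /=; rewrite mulr0 add0r.
have [iH limH] : integrable2 setT (fun y => pd i f y * t y) /\
    int2 setT (Hn n) @[n --> \oo] --> int2 setT (fun y => pd i f y * t y).
  have it : integrable2 setT t.
    have [p0 [q0 [p0' [q0' WE]]]] := box2_sub_box i l r l' r'.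
    apply: (@integrable2_compactly R _ (A * Bb) p0 q0 p0' q0').
    - by apply: measurable_tens2; exact: smooth1_continuous.
    - by move=> y; rewrite /t /tens2 normrM ler_pM.
    - by move=> y; rewrite -WE; exact: tW.
  apply: (int2_dct (g := fun y => K * `|t y|)); first exact: msbT.
  - move=> n; apply: integrable2_measurable; apply: integrable2Z; first exact: msbT.
    by apply: integrable2B => //; [exact: msbT|exact: (tr n).1].
  - move=> y _; have [Wy|/tW t0] := pselect (W y); last first.
      rewrite t0 mulr0 (_ : (fun n => Hn n y) = fun=> 0); first exact: cvg_cst.
      by apply/funext => n; rewrite /Hn t0 !mulr0 subrr mulr0.
    have [_ _ hq] := quo_cauchy_pd K0 qc e0 (eO y Wy).
    have E n : Hn n y = quo f i (s n) y * t y.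
      by have [h1 h2] := WO y Wy n; rewrite /Hn /quo h1 h2; ring.
    rewrite (_ : (fun n => Hn n y) = (fun n => quo f i (s n) y * t y)); last exact/funext.
    apply: cvgMl; apply/cvgrPdist_le => ep ep0; near=> n.
    have sn : `|s n| < e by rewrite gtr0_norm//; have := se n => ?; lra.
    have := hq _ sn; rewrite gt_eqF// => /(_ isT) /le_trans; apply.
    rewrite gtr0_norm//.
    have : n.+1%:R^-1 < ep / ((K + 1) * (e / 2)).
      near: n; have h : 0 < ep / ((K + 1) * (e / 2)) by rewrite divr_gt0// mulr_gt0//; lra.
      exact: (near_infty_natSinv_lt (PosNum h)).
    rewrite ltr_pdivlMr ?mulr_gt0//; last by lra.
    rewrite /s; set u := n.+1%:R^-1; have u0 : 0 < u by rewrite invr_gt0.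
    clearbody u => h; have : K * (e / 2 * u) <= (K + 1) * (e / 2 * u).
      by rewrite ler_wpM2r ?mulr_ge0 ?(ltW u0) ?(ltW e2)//; lra.
    lra.
  - by apply: integrable2Z; [exact: msbT|exact: integrable2_norm].
  - move=> n y _; have [Wy|/tW t0] := pselect (W y); last first.
      by rewrite /Hn t0 !mulr0 subrr mulr0 normr0 mulr0.
    have [h1 h2] := WO y Wy n; rewrite /Hn h1 h2 -mulrBl mulrA normrM ler_wpM2r//.
    have [q1 _] := qc y e (eO y Wy); apply: q1; last by rewrite gt_eqF.
    by rewrite gtr0_norm//; have := se n => ?; lra.
have E : int2 setT (fun y => fV y * tens2 i (fun z => - a' z) b y) = int2 setT (fun y => pd i f y * t y).
  by apply: (cvg_unique (@Rhausdorff R) limF); rewrite (_ : (fun n => int2 setT (F n)) = (fun n => int2 setT (Hn n)))//; exact/funext.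
have a'0 y : ~~ (l <= y <= r) -> a' y = 0.
  move=> ny; have [_ <-] := da y; rewrite -[RHS](derive_cst (0 : R) y 1).
  apply: near_eq_derive; move: ny; rewrite negb_and -!ltNge => /orP[h|h]; near=> z; apply: a0; rewrite negb_and -!leNgt.
    by apply/orP; left; apply/ltW; near: z; exact: lt_nbhsl.
  by apply/orP; right; apply/ltW; near: z; exact: lt_nbhsr.
rewrite (int2_supp (f := fun y => pd i f y * t y) (msb_open oO) (@msbT R) (@subsetT _ _) _).2; last first.
  by move=> y _ nO; rewrite tW ?mulr0// => /BO.
rewrite -E -(int2_supp (f := fun y => f y * tens2 i a' b y) mV (msb_open oO) VO _).2; last first.
  move=> y _ nV; rewrite /tens2; have [h1|/a'0 ->] := boolP (l <= y 0 i <= r); last by rewrite mul0r mulr0.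
  have [/andP[h3 h4]|/b0 ->] := boolP (l' < y 0 (other i) < r'); last by rewrite !mulr0.
  by exfalso; apply: nV; apply: WV; split => //; rewrite !ltW.
rewrite -(int2_supp (f := fun y => fV y * tens2 i (fun z => - a' z) b y) mV (@msbT R) (@subsetT _ _) _).2; last first.
  by move=> y _ nV; rewrite /fV patchE memNset// mul0r.
have iV := integrable2S mV (@msbT R) (@subsetT _ V) iF.
rewrite -mulN1r -(int2Z _ mV iV); apply: eq_int2 => y yV.
by rewrite /fV patchE mem_set// /tens2; ring.
Unshelve. all: by end_near.
Qed.
End IntegrationByParts.

(** * The reference triangle *)

Section ReferenceTriangle.
Context {R : realType}.
Implicit Types (x y : 'rV[R]_2).

Definition iTref : set 'rV[R]_2 := interior (@Tref R).

Lemma bary0 x : bary x ord0 = 1 - (x 0 0 + x 0 1).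
Proof.
rewrite /bary unlift_none big_ord_recl big_ord1.
by rewrite (_ : lift ord0 ord0 = 1)//; exact/val_inj.
Qed.

Lemma baryS x (a : 'I_2) : bary x (lift ord0 a) = x 0 a.
Proof. by rewrite /bary liftK. Qed.

Lemma forall_I3 (P : 'I_3 -> Prop) : P ord0 -> (forall a : 'I_2, P (lift ord0 a)) -> forall k, P k.
Proof. by move=> P0 PS k; case: (unliftP ord0 k) => [a|] ->. Qed.

Lemma continuous_bary k : continuous (fun x => bary x k).
Proof.
move: k; apply: forall_I3 => [|a] x.
  rewrite (_ : (fun x => _) = (fun x : 'rV[R]_2 => 1 - (x 0 0 + x 0 1))); last by apply/funext => y; rewrite bary0.
  apply: (@continuousB R R _ (fun=> 1) (fun x : 'rV[R]_2 => x 0 0 + x 0 1)); first exact: cst_continuous.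
  by apply: (@continuousD R R _ (fun x : 'rV[R]_2 => x 0 0) (fun x : 'rV[R]_2 => x 0 1)); exact: coord_continuous.
rewrite (_ : (fun x => _) = (fun x : 'rV[R]_2 => x 0 a)); last by apply/funext => y; rewrite baryS.
exact: coord_continuous.
Qed.

Lemma iTrefP x : iTref x <-> forall k, 0 < bary x k.
Proof.
split => [/nbhs_ballP [r /= r0 rT]|H].
  have r2 : 0 < r / 2 by lra.
  have test (d : 'rV[R]_2) : (forall j, `|d 0 j| <= r / 2) -> Tref (x + d).
    move=> dr; apply: rT; split=> // i j; rewrite ord1 /ball /= !mxE opprD addrA subrr add0r normrN.
    by rewrite (le_lt_trans (dr j))//; lra.
  apply: forall_I3 => [|a].
    have Ht : Tref (x + const_mx (r / 2)) by apply: test => j; rewrite mxE gtr0_norm.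
    by have := Ht ord0; rewrite !bary0 !mxE; lra.
  have Ht : Tref (x + const_mx (- (r / 2))) by apply: test => j; rewrite mxE normrN gtr0_norm.
  by have := Ht (lift ord0 a); rewrite !baryS !mxE; lra.
rewrite /iTref /interior; near=> y => k.
suff : forall k, 0 < bary y k by move=> /(_ k) /ltW.
move=> {}k; move: k; near: y; apply: filter_forall => k.
by have /cvgr_gt := @continuous_bary k x; apply.
Unshelve. all: by end_near.
Qed.

Lemma iTref3 x : iTref x <-> [/\ 0 < x 0 0, 0 < x 0 1 & x 0 0 + x 0 1 < 1].
Proof.
have l1 : lift ord0 0 = lift ord0 (0 : 'I_2) by [].
split => [/iTrefP H|[h0 h1 h2]].
  have := H ord0; have := H (lift ord0 0); have := H (lift ord0 1).
  by rewrite bary0 !baryS => *; split; lra.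
apply/iTrefP; apply: forall_I3 => [|a]; first by rewrite bary0; lra.
by rewrite baryS; case: (ord2P a) => ->.
Qed.

Lemma Tref3 x : Tref x <-> [/\ 0 <= x 0 0, 0 <= x 0 1 & x 0 0 + x 0 1 <= 1].
Proof.
split => [H|[h0 h1 h2]].
  have := H ord0; have := H (lift ord0 0); have := H (lift ord0 1).
  by rewrite bary0 !baryS => *; split; lra.
apply: forall_I3 => [|a]; first by rewrite bary0; lra.
by rewrite baryS; case: (ord2P a) => ->.
Qed.

Lemma open_iTref : open iTref.
Proof. exact: open_interior. Qed.

Lemma iTref_sub : iTref `<=` @Tref R.
Proof. exact: interior_subset. Qed.

Lemma msb_iTref : msb iTref.
Proof. exact: msb_open open_iTref. Qed.

Lemma Tref_box : @Tref R `<=` box 0 1 0 1.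
Proof. by move=> x /Tref3[? ? ?]; split; apply/andP; split; lra. Qed.

Lemma msb_closed (K : set 'rV[R]_2) : closed K -> msb K.
Proof.
move=> cK; rewrite -(setCK K) -setTD; apply: msbD; first exact: msbT.
by apply: msb_open; exact: closed_openC.
Qed.

Lemma compact_sub_box (K : set 'rV[R]_2) : compact K -> exists r : R, K `<=` box (- r) r (- r) r.
Proof.
move=> /compact_bounded [M [_ HM]]; exists (M + 1) => x Kx.
have := HM (M + 1); rewrite ltrDl ltr01 => /(_ isT x Kx); rewrite /Num.norm /= mx_normrE => h.
have e j : `|x 0 j| <= M + 1.
  apply: le_trans h; exact: (le_bigmax _ (fun i : 'I_1 * 'I_2 => `|x i.1 i.2|) (0, j)).
by split; have := e 0; have := e 1; rewrite !ler_norml.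
Qed.

Lemma loc_integrable_continuous (O : set 'rV[R]_2) (f : 'rV[R]_2 -> R) : open O ->
  (forall x, O x -> {for x, continuous f}) -> loc_integrable O f.
Proof.
move=> oO cf; have mf := measurable2_continuous oO cf; split => // K cK KO.
have mK : msb K by apply: msb_closed; apply: compact_closed => //; exact: norm_hausdorff.
have [r Kr] := compact_sub_box cK.
have /compact_bounded [M [_ HM]] : compact (f @` K).
  apply: continuous_compact => //.
  by apply: continuous_in_subspaceT => y /set_mem /KO; exact: cf.
apply: (@integrable2_bounded _ K f (M + 1) (- r) r (- r) r) => //.
  exact: measurable2_sub (msb_open oO) KO mf.
by move=> x Kx; apply: (HM (M + 1)); [rewrite ltrDl|exists x].
Qed.

Lemma loc_integrableD (O : set 'rV[R]_2) (f g : 'rV[R]_2 -> R) (c : R) : open O ->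
  loc_integrable O f -> loc_integrable O g -> loc_integrable O (fun x => f x + c * g x).
Proof.
move=> oO [mf f1] [mg g1]; split; first by apply: measurable_funD => //; exact: measurable_funM.
move=> K cK KO.
have mK : msb K by apply: msb_closed; apply: compact_closed => //; exact: norm_hausdorff.
by apply: integrable2D => //; [exact: f1|apply: integrable2Z => //; exact: g1].
Qed.

Lemma loc_integrable_aff (P : 'I_3 -> 'rV[R]_2) (O U : set 'rV[R]_2) g :
  \det (edgemx P) != 0 -> open O -> open U -> (forall x, O x -> U (aff P x)) -> loc_integrable U g ->
  loc_integrable O (g \o aff P).
Proof.
move=> D0 oO oU OU [mg ig].
have KK (K : set 'rV[R]_2) : aff P @^-1` (aff P @` K) = K.
  apply/seteqP; split => [x [y Ky /(congr1 (affinv P))]|x Kx]; last by exists x.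
  by rewrite !affK// => <-.
split.
  have [mL _ _] := cov_aff D0; have mO := msb_open oO.
  have mU := msb_open oU.
  have mgU : measurable_fun setT ((g \_ U) \o @vec2 R) by exact: measurable2_patch.
  have : measurable_fun setT (((g \_ U) \o @vec2 R) \o aff_plane (R := R) P) by exact: measurableT_comp.
  move=> /(measurable_funS measurableT (@subsetT _ (@vec2 R @^-1` O))).
  apply: eq_measurable_fun => p /set_mem Op /=.
  by rewrite vec2_aff patchE mem_set //; exact: OU.
move=> K cK KO.
have caK : compact (aff P @` K).
  by apply: continuous_compact => //; apply: continuous_subspaceT; exact: continuous_aff.
have mK : msb (aff P @` K) by apply: msb_closed; apply: compact_closed => //; exact: norm_hausdorff.
have sK : aff P @` K `<=` U by move=> _ [x Kx <-]; apply: OU; exact: KO.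
by have [_ + _] := int2_aff D0 mK (ig _ caK sK); rewrite KK.
Qed.
End ReferenceTriangle.

(** * Weak derivatives on triangulated sets *)

Section WeakDerivativeAffine.
Context {R : realType}.
Implicit Types (x y : 'rV[R]_2) (w h f g : 'rV[R]_2 -> R).
Local Notation e_ i := (delta_mx 0 i : 'rV[R]_2).

Lemma msb_compact (K : set 'rV[R]_2) : compact K -> msb K.
Proof. by move=> cK; apply: msb_closed; apply: compact_closed => //; exact: norm_hausdorff. Qed.

Lemma integrable2_mul_compact (O K : set 'rV[R]_2) w h : open O -> loc_integrable O w ->
  continuous h -> compact K -> K `<=` O -> (forall x, ~ K x -> h x = 0) ->
  integrable2 O (fun x => w x * h x).
Proof.
move=> oO [mw iw] ch cK KO h0; have mO := msb_open oO; have mK := msb_compact cK.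
have /compact_bounded [M [_ HM]] : compact (h @` K).
  by apply: continuous_compact => //; exact: continuous_subspaceT.
have hM x : K x -> `|h x| <= M + 1.
  by move=> Kx; apply: (HM (M + 1)); [rewrite ltrDl|exists x].
have mh U : msb U -> measurable2 U h.
  move=> mU; apply: (measurable2_sub (@msbT R)) => //.
  by apply: measurable2_continuous => [|x _]; [exact: openT|exact: ch].
have [[H _] _] := @int2_supp R K O (fun x => w x * h x) mK mO KO (fun x _ nK => etrans (congr1 _ (h0 x nK)) (mulr0 _)).
apply: H; apply: (@le_integrable2 R K _ (fun x => (M + 1) * `|w x|) mK).
- apply: measurable_funM; [exact: measurable2_sub mO KO mw|exact: mh].
- by move=> x Kx; rewrite normrM mulrC ler_wpM2r// hM.
by apply: integrable2Z => //; apply: integrable2_norm; exact: iw.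
Qed.

Lemma derive_supp (a a' : R -> R) (l r : R) : (forall z : R, is_derive z 1 a (a' z)) ->
  (forall z, ~~ (l < z < r) -> a z = 0) -> forall z, ~~ (l <= z <= r) -> a' z = 0.
Proof.
move=> da a0 z nz.
have [_ <-] := da z; rewrite -[RHS](derive_cst (0 : R) z 1).
apply: near_eq_derive; move: nz; rewrite negb_and -!ltNge => /orP[h|h]; near=> y; apply: a0; rewrite negb_and -!leNgt.
  by apply/orP; left; apply/ltW; near: y; exact: lt_nbhsl.
by apply/orP; right; apply/ltW; near: y; exact: lt_nbhsr.
Unshelve. all: by end_near.
Qed.

(** Testing with tensors in the coordinates of P turns the weak identity on U into one on the
    reference triangle, where f is regular enough to integrate by parts. The difference between g
    and the chain-rule expression is then orthogonal to all products of bumps. *)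
Lemma wder_affine (P : 'I_3 -> 'rV[R]_2) (U : set 'rV[R]_2) (b : 'I_2) v g f (K : R) :
  \det (edgemx P) != 0 -> open U -> (forall x, iTref x -> U (aff P x)) ->
  (forall x, iTref x -> v (aff P x) = f x) ->
  (forall x, iTref x -> {for x, continuous f}) -> 0 <= K ->
  (forall i, quo_cauchy iTref f i K) ->
  (forall i x, iTref x -> {for x, continuous (pd i f)}) ->
  is_wder U [:: b] v g ->
  {ae leb2 R, forall p, iTref (vec2 p) ->
    g (aff P (vec2 p)) = \sum_(j < 2) invmx (edgemx P) b j * pd j f (vec2 p)}.
Proof.
move=> D0 oU TU vf cf K0 qc cpd [lv lg wd]; set M := invmx _.
have oT := @open_iTref R; have mT := msb_open oT.
pose F x := M b 0 * pd 0 f x + M b 1 * pd 1 f x.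
have cF x : iTref x -> {for x, continuous F}.
  move=> Tx; apply: (@continuousD R R _ (fun x => M b 0 * pd 0 f x) (fun x => M b 1 * pd 1 f x)).
    by apply: (@continuousM R _ (fun=> M b 0) (pd 0 f)); [exact: cst_continuous|exact: cpd].
  by apply: (@continuousM R _ (fun=> M b 1) (pd 1 f)); [exact: cst_continuous|exact: cpd].
have lga := loc_integrable_aff D0 oT oU TU lg.
have lF := loc_integrable_continuous oT cF.
have lw := loc_integrableD (-1) oT lga lF.
have e01 : lift ord0 ord0 = 1 :> 'I_2 by exact/val_inj.
suff : {ae leb2 R, forall p, iTref (vec2 p) -> (g \o aff P) (vec2 p) + -1 * F (vec2 p) = 0}.
  case=> N [mN N0 sN]; exists N; split => // p np; apply: sN => /= H; apply: np => Tp.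
  rewrite big_ord_recl big_ord1 e01 -/(F _); have := H Tp; rewrite /= => H'; lra.
apply: (@ae0_of_bumps R iTref (fun x => (g \o aff P) x + -1 * F x) oT lw) => l r l' r' BT c c0.
set a := bump c l r; set e := bump c l' r'.
have sa : smooth1 a := smooth1_bump c l r; have se : smooth1 e := smooth1_bump c l' r'.
have [a' sa' da] := smooth1_derive sa; have [e' se' de] := smooth1_derive se.
have a0 z : ~~ (l < z < r) -> a z = 0 by exact: bump_eq0.
have e0 z : ~~ (l' < z < r') -> e z = 0 by exact: bump_eq0.
have tP : test_function U (tensor P a e).
  by apply: (@test_tensor R P a e l r l' r') => // x Bx; apply: TU; exact: BT.
have := wd _ tP; rewrite /= expr1 mulN1r.
have -> : pd b (tensor P a e) = fun y => M b 0 * tensor P a' e y + M b 1 * tensor P a e' y.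
  by apply: pdE => y; exact: is_derive_tensor.
set B := box l r l' r'; have cB : compact B by exact: compact_box.
have cont1 z : smooth1 z -> continuous z := @smooth1_continuous R z.
have a'0 := derive_supp da a0; have e'0 := derive_supp de e0.
have tz (s t : R -> R) : (forall z, ~~ (l <= z <= r) -> s z = 0) -> (forall z, ~~ (l' <= z <= r') -> t z = 0) ->
    forall x, ~ B x -> tensor refP s t x = 0.
  move=> s0 t0 x nB; rewrite /tensor affinv_ref.
  have [h1|/s0 ->] := boolP (l <= x 0 0 <= r); last by rewrite mul0r.
  have [h2|/t0 ->] := boolP (l' <= x 0 1 <= r'); last by rewrite mulr0.
  by case: nB.
have w0 (s : R -> R) p q : (forall z, ~~ (p < z < q) -> s z = 0) -> forall z, ~~ (p <= z <= q) -> s z = 0.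
  by move=> s0 z nz; apply: s0; apply: contra nz => /andP[z1 z2]; rewrite !ltW.
pose V := aff P @` B.
have cV : compact V by apply: continuous_compact => //; apply: continuous_subspaceT; exact: continuous_aff.
have VU : V `<=` U by move=> _ [x Bx <-]; apply: TU; exact: BT.
have tensA s t x : tensor P s t (aff P x) = tensor refP s t x by rewrite /tensor affK// affinv_ref.
have preV : aff P @^-1` V = B.
  apply/seteqP; split => [x [y By /(congr1 (affinv P))]|x Bx]; last by exists x.
  by rewrite !affK// => <-.
have mV := msb_compact cV; have mU := msb_open oU; have mB := msb_compact cB.
have trans u (phi : 'rV[R]_2 -> R) : loc_integrable U u -> continuous phi -> (forall x, ~ V x -> phi x = 0) ->
    int2 U (fun y => u y * phi y) = `|\det (edgemx P)| * int2 B (fun x => u (aff P x) * phi (aff P x)).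
  move=> lu cphi phi0.
  have iu := integrable2_mul_compact oU lu cphi cV VU phi0.
  have [[_ iV] <-] := @int2_supp R V U (fun y => u y * phi y) mV mU VU (fun x _ nV => etrans (congr1 _ (phi0 x nV)) (mulr0 _)).
  by have [_ _ ->] := int2_aff D0 mV (iV iu); rewrite preV.
have nV s t : (forall x, ~ B x -> tensor refP s t x = 0) -> forall x, ~ V x -> tensor P s t x = 0.
  move=> H x nx; rewrite -(affinvK D0 x) tensA; apply: H => Bx; apply: nx.
  by exists (affinv P x) => //; rewrite affinvK.
have ct s t : smooth1 s -> smooth1 t -> continuous (tensor P s t).
  by move=> ss st; apply: continuous_tensor; exact: smooth1_continuous.
have ct0 (s t : R -> R) : smooth1 s -> smooth1 t -> continuous (tensor refP s t).
  by move=> ss st; apply: continuous_tensor; exact: smooth1_continuous.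
have za'e := tz a' e a'0 (w0 _ _ _ e0); have zae' := tz a e' (w0 _ _ _ a0) e'0; have zae := tz a e (w0 _ _ _ a0) (w0 _ _ _ e0).
rewrite trans//; last first.
- by move=> x nx; rewrite (nV _ _ za'e)// (nV _ _ zae')// !mulr0 addr0.
- move=> x; apply: (@continuousD R R _ (fun y => M b 0 * tensor P a' e y) (fun y => M b 1 * tensor P a e' y)).
    by apply: (@continuousM R _ (fun=> M b 0) (tensor P a' e)); [exact: cst_continuous|exact: ct].
  by apply: (@continuousM R _ (fun=> M b 1) (tensor P a e')); [exact: cst_continuous|exact: ct].
rewrite trans//; [|exact: ct|exact: nV].
rewrite -mulrN => /mulfI; rewrite normr_eq0 => /(_ D0).
have intB u s t : loc_integrable iTref u -> smooth1 s -> smooth1 t -> (forall x, ~ B x -> tensor refP s t x = 0) ->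
    integrable2 B (fun x => u x * tensor refP s t x) /\
    int2 iTref (fun x => u x * tensor refP s t x) = int2 B (fun x => u x * tensor refP s t x).
  move=> lu ss st z0.
  have iu := integrable2_mul_compact oT lu (ct0 s t ss st) cB BT z0.
  by have [[_ iV] <-] := @int2_supp R B iTref (fun y => u y * tensor refP s t y) mB mT BT (fun x _ nV => etrans (congr1 _ (z0 x nV)) (mulr0 _)); split => //; exact: iV.
have lf : loc_integrable iTref f by exact: loc_integrable_continuous.
have lp i : loc_integrable iTref (pd i f) by apply: loc_integrable_continuous => // x Tx; exact: cpd.
have [i1 E1] := intB f a' e lf sa' se za'e; have [i2 E2] := intB f a e' lf sa se' zae'.
have [i3 E3] := intB (pd 0 f) a e (lp 0) sa se zae; have [i4 E4] := intB (pd 1 f) a e (lp 1) sa se zae.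
have [i5 E5] := intB _ a e lga sa se zae; have [i6 E6] := intB _ a e lF sa se zae.
have BT2 : box2 1 l' r' l r `<=` iTref by move=> x [h1 h2]; apply: BT.
have I0 := ibp_tens2 oT K0 cf (qc 0) sa se da a0 e0 BT.
have I1 := ibp_tens2 oT K0 cf (qc 1) se sa de e0 a0 BT2.
rewrite !tens2E /= in I0 I1; rewrite E1 E3 in I0; rewrite E2 E4 in I1.
have -> : int2 B (fun x => v (aff P x) * (M b 0 * tensor P a' e (aff P x) + M b 1 * tensor P a e' (aff P x))) =
    int2 B (fun x => M b 0 * (f x * tensor refP a' e x) + M b 1 * (f x * tensor refP a e' x)).
  by apply: eq_int2 => x Bx; rewrite !tensA vf; [ring|exact: BT].
rewrite int2D ?int2Z ?I0 ?I1//; try exact: integrable2Z.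
have -> : int2 B (fun x => g (aff P x) * tensor P a e (aff P x)) = int2 B (fun x => (g \o aff P) x * tensor refP a e x).
  by apply: eq_int2 => x _; rewrite tensA.
move=> HH.
have [_ ->] := intB _ a e lw sa se zae.
have -> : int2 B (fun x => ((g \o aff P) x + -1 * F x) * tensor refP a e x) =
    int2 B (fun x => (g \o aff P) x * tensor refP a e x - (M b 0 * (pd 0 f x * tensor refP a e x) + M b 1 * (pd 1 f x * tensor refP a e x))).
  by apply: eq_int2 => x _; rewrite /F; ring.
rewrite int2B ?int2D ?int2Z//; try (by apply: integrable2D => //; exact: integrable2Z); try exact: integrable2Z.
by move: HH; rewrite !mulrN -opprD => /oppr_inj <-; rewrite subrr.
Qed.
End WeakDerivativeAffine.

(** * Null sets of the plane *)

Section NullSets.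
Context {R : realType}.
Implicit Types (x y : 'rV[R]_2) (f : 'rV[R]_2 -> R) (S U V : set 'rV[R]_2) (P : 'I_3 -> 'rV[R]_2).
Local Notation e_ i := (delta_mx 0 i : 'rV[R]_2).

Definition null2 S : Prop := (leb2 R).-negligible (@vec2 R @^-1` S).

(** Vertices whose affine map is the inverse of [aff P], so that results on preimages apply to
    images. *)
Definition inv_vert P : 'I_3 -> 'rV[R]_2 :=
  fun k => - P ord0 *m invmx (edgemx P) +
    (if unlift ord0 k is Some a then row a (invmx (edgemx P)) else 0).

Lemma edgemx_inv P : edgemx (inv_vert P) = invmx (edgemx P).
Proof.
by apply/matrixP => a j; rewrite mxE /inv_vert liftK unlift_none addr0 addrAC subrr add0r mxE.
Qed.

Lemma aff_inv P y : aff (inv_vert P) y = affinv P y.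
Proof.
by rewrite /aff edgemx_inv /inv_vert unlift_none addr0 /affinv mulmxBl mulNmx addrC.
Qed.

Lemma det_inv_vert P : \det (edgemx P) != 0 -> \det (edgemx (inv_vert P)) != 0.
Proof. by move=> D0; rewrite edgemx_inv det_inv invr_eq0. Qed.

Lemma null2_preimage P S : \det (edgemx P) != 0 -> null2 S -> null2 (aff P @^-1` S).
Proof.
move=> D0 [N [mN N0 sN]]; have [mL d0 H] := cov_aff D0.
exists (aff_plane P @^-1` N); split.
- by rewrite -[X in measurable X]setTI; exact: mL.
- have := H _ mN; rewrite N0 => /esym/eqP; rewrite mule_eq0 eqe gt_eqF//= => /eqP; exact.
- by move=> p /= Sp; apply: sN; rewrite /= vec2_aff.
Qed.

Lemma null2_image P S : \det (edgemx P) != 0 -> null2 S -> null2 (aff P @` S).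
Proof.
move=> D0 nS; rewrite (_ : aff P @` S = aff (inv_vert P) @^-1` S).
  by apply: null2_preimage => //; exact: det_inv_vert.
apply/seteqP; split => [_ [x Sx <-]|y]; rewrite /= aff_inv ?affK// => Sy.
by exists (affinv P y) => //; rewrite affinvK.
Qed.

Lemma null2U S V : null2 S -> null2 V -> null2 (S `|` V).
Proof. by move=> nS nV; rewrite /null2 preimage_setU; exact: negligibleU. Qed.

Lemma null2S S V : S `<=` V -> null2 V -> null2 S.
Proof. by move=> SV; apply: negligibleS => p /=; exact: SV. Qed.

Lemma null2_axis : null2 [set x : 'rV[R]_2 | x 0 0 = 0].
Proof.
rewrite /null2 (_ : _ @^-1` _ = [set (0 : R)] `*` setT); last first.
  by apply/seteqP; split => -[a b] /=; rewrite !mxE //= => -[].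
have m1 : measurable ([set (0 : R)] : set (measurableTypeR R)) by exact: measurable_set1.
exists ([set (0 : R)] `*` setT); split => //; first exact: measurableX.
rewrite [X in X = _]product_measure1E//.
by rewrite [X in (X * _)%E]lebesgue_measure_set1 mul0e.
Qed.

Lemma null2_line (a b c : R) : (a != 0) || (b != 0) ->
  null2 [set x : 'rV[R]_2 | x 0 0 * a + x 0 1 * b = c].
Proof.
move=> ab.
(* A rotation combined with a scaling, of determinant a^2 + b^2; it carries the line to the axis
   where the first coordinate vanishes. *)
pose E : 'M[R]_2 := \matrix_(i < 2, j < 2)
  if i == 0 then (if j == 0 then a else - b) else (if j == 0 then b else a).
pose Q : 'I_3 -> 'rV[R]_2 := fun k => - c *: e_ 0 + (if unlift ord0 k is Some i then row i E else 0).
have EQ : edgemx Q = E by apply/matrixP => i j; rewrite mxE /Q liftK unlift_none addr0 addrAC subrr add0r mxE.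
have D0 : \det (edgemx Q) != 0.
  rewrite EQ det2E !mxE /= mulNr opprK -!expr2 paddr_eq0 ?sqr_ge0// !sqrf_eq0.
  by rewrite negb_and.
rewrite (_ : mkset _ = aff Q @^-1` [set x : 'rV[R]_2 | x 0 0 = 0]); first exact/null2_preimage/null2_axis.
have e01 : lift ord0 ord0 = 1 :> 'I_2 by exact/val_inj.
apply/seteqP; split => x /=; rewrite /aff EQ /Q unlift_none addr0 !mxE big_ord_recl big_ord1 e01 !mxE /= => H; lra.
Qed.

Lemma null2_boundary : null2 (@Tref R `\` iTref).
Proof.
apply: (@null2S _ ([set x : 'rV[R]_2 | x 0 0 * 1 + x 0 1 * 0 = 0] `|`
  ([set x : 'rV[R]_2 | x 0 0 * 0 + x 0 1 * 1 = 0] `|` [set x : 'rV[R]_2 | x 0 0 * 1 + x 0 1 * 1 = 1]))).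
  move=> x [/Tref3[x0 x1 x2] nx] /=; rewrite !mulr1 !mulr0 addr0 add0r.
  have [h0|h0] := eqVneq (x 0 0) 0; first by left.
  have [h1|h1] := eqVneq (x 0 1) 0; first by right; left.
  have [h2|h2] := eqVneq (x 0 0 + x 0 1) 1; first by right; right.
  by case: nx; apply/iTref3; rewrite !lt_neqAle x0 x1 x2 h2 eq_sym h0 eq_sym h1.
by apply: null2U; [|apply: null2U]; apply: null2_line; rewrite ?oner_eq0 ?orbT.
Qed.

(** If f were positive at x, a small box around x on which f exceeds f(x)/2 would contribute a
    positive amount. *)
Lemma int2_eq0 U f : open U -> (forall x, U x -> {for x, continuous f}) ->
  (forall x, U x -> 0 <= f x) -> integrable2 U f -> int2 U f = 0 -> forall x, U x -> f x = 0.
Proof.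
move=> oU cf f0 fi i0 x Ux; apply/eqP; rewrite eq_le f0// andbT leNgt; apply/negP => fx.
have : \forall y \near x, f x / 2 < f y.
  have /cvgr_gt := cf x Ux; apply; lra.
move=> /nbhs_ballP [r /= r0 rH]; have /nbhs_ballP [s /= s0 sU] : nbhs x U by exact: open_nbhs_nbhs.
pose m := Num.min r s / 2; have m0 : 0 < m by rewrite divr_gt0// lt_min r0.
have mrs : m < r /\ m < s.
  have h : 0 < Num.min r s by rewrite lt_min r0.
  have h1 : Num.min r s <= r by rewrite ge_min lexx.
  have h2 : Num.min r s <= s by rewrite ge_min lexx orbT.
  by rewrite /m; split; lra.
pose B := box (x 0 0 - m) (x 0 0 + m) (x 0 1 - m) (x 0 1 + m).
have Bb y (t : R) : m < t -> B y -> ball x t y.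
  move=> mt [/andP[y1 y2] /andP[y3 y4]]; split; first by rewrite (lt_trans m0).
  move=> i j; rewrite ord1 /ball /= ltr_norml.
  by case: (ord2P j) => ->; apply/andP; split; lra.
have BU : B `<=` U by move=> y By; apply: sU; apply: Bb => //; case: mrs.
have mB : msb B := msb_box _ _ _ _; have mU := msb_open oU.
have iB := integrable2S mB mU BU fi.
have bc : integrable2 B (fun=> f x / 2).
  apply: (@integrable2_bounded R B _ `|f x / 2| (x 0 0 - m) (x 0 0 + m) (x 0 1 - m) (x 0 1 + m)) => //.
  exact: measurable_cst.
have h1 : int2 B (fun=> f x / 2) <= int2 B f.
  by apply: le_int2 => // y By; apply/ltW; apply: rH; apply: Bb => //; case: mrs.
have h2 : int2 B f <= 0.
  rewrite -i0 (int2_mkcond U) (@eq_int2 R B f (f \_ U)); last first.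
    by move=> y By; rewrite patchE mem_set//; exact: BU.
  apply: le_int2S => //; [exact: msbT|exact/(integrable2_mkcond f mU)|].
  by move=> y; rewrite patchE; case: ifP => // /set_mem /f0.
have : 0 < int2 B (fun=> f x / 2); last by rewrite ltNge (le_trans h1 h2).
rewrite /int2 Rintegral_cst//; apply: mulr_gt0; first by rewrite divr_gt0.
apply: fine_gt0; rewrite leb2_box andbT.
rewrite (_ : _ @^-1` _ = `[x 0 0 - m, x 0 0 + m]%classic `*` `[x 0 1 - m, x 0 1 + m]%classic); last first.
  by apply/seteqP; split => -[a b]; rewrite /= /B /box /= !mxE /= !in_itv.
rewrite [X in (_ < X)%E]product_measure1E//; do ?exact: measurable_itv.
set I0 : set R := `[_, _]%classic; set I1 : set R := `[_, _]%classic.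
change (0 < @lebesgue_measure R I0 * @lebesgue_measure R I1)%E.
have e (t : R) : (@lebesgue_measure R `[(t - m)%R, (t + m)%R]%classic = (2 * m)%:E)%E.
  rewrite lebesgue_measure_itv /= lte_fin (_ : t - m < t + m); last by lra.
  by rewrite -EFinD; congr (_%:E); ring.
by apply: mule_gt0; [rewrite (e (x 0 0))|rewrite (e (x 0 1))]; rewrite lte_fin mulr_gt0.
Qed.
End NullSets.

(** * Functions given element by element *)

Section Piecewise.
Context {R : realType} {I : finType} (A : {set I}) (P : I -> 'I_3 -> 'rV[R]_2) (U : set 'rV[R]_2).
Implicit Types (x y : 'rV[R]_2) (g : 'rV[R]_2 -> R) (h : I -> 'rV[R]_2 -> R).

Hypothesis P_nondeg : forall k, k \in A -> \det (edgemx (P k)) != 0.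
Hypothesis P_disjoint : forall k l x y, k \in A -> l \in A -> iTref x -> iTref y ->
  aff (P k) x = aff (P l) y -> k = l.
Hypothesis U_open : open U.
Hypothesis U_sub : forall k x, k \in A -> iTref x -> U (aff (P k) x).
Hypothesis U_cover : forall y, U y -> exists2 k, k \in A & (aff (P k) @` @Tref R) y.

(** At most one term is nonzero, the open elements being disjoint; off the open elements the value
    is 0, which concerns a null set of U only. *)
Definition piecewise h y : R :=
  \sum_(k in A) ((fun z => h k (affinv (P k) z)) \_ (aff (P k) @` iTref)) y.

(** The common feature of all integrands below. It is stable under sums and products and gives
    integrability, while saying nothing about the edges. *)
Definition nice h : Prop := forall k, k \in A ->
  (forall x, iTref x -> {for x, continuous (h k)}) /\
  exists C : R, forall x, iTref x -> `|h k x| <= C.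

Lemma piecewiseE h k x : k \in A -> iTref x -> piecewise h (aff (P k) x) = h k x.
Proof.
move=> kA Tx; rewrite /piecewise (bigD1 k)//= patchE mem_set; last by exists x.
rewrite affK ?P_nondeg// big1 ?addr0// => l /andP[lA /eqP lk].
by rewrite patchE; case: ifP => // /set_mem [y Ty] /P_disjoint e; case: lk; apply: e.
Qed.

Lemma integrable2_nice h k : k \in A -> nice h -> integrable2 iTref (h k).
Proof.
move=> kA /(_ k kA) [ch [C hC]].
apply: (@integrable2_bounded R iTref (h k) C 0 1 0 1) => //; first exact: msb_iTref.
  by move=> x /iTref_sub; exact: Tref_box.
by apply: measurable2_continuous => //; exact: open_iTref.
Qed.

Lemma image_integrable h k : k \in A -> nice h ->
  let O := aff (P k) @` iTref in
  [/\ msb O, integrable2 O (fun z => h k (affinv (P k) z)) &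
   int2 O (fun z => h k (affinv (P k) z)) = `|\det (edgemx (P k))| * int2 iTref (h k)].
Proof.
move=> kA nh O; have D0 := P_nondeg kA; have Di := det_inv_vert D0.
have oE : O = aff (inv_vert (P k)) @^-1` iTref.
  apply/seteqP; split => [_ [x Tx <-]|y]; rewrite /= aff_inv ?affK// => Ty.
  by exists (affinv (P k) y) => //; rewrite affinvK.
have ih := integrable2_nice kA nh.
have [m1 i1 e1] := int2_aff Di (@msb_iTref R) ih.
have fE : h k \o aff (inv_vert (P k)) = fun z => h k (affinv (P k) z).
  by apply/funext => z; rewrite /= aff_inv.
rewrite -oE fE edgemx_inv det_inv in m1 i1 e1; split => //.
by rewrite e1 mulrA normrV ?unitfE// divff ?mul1r// normr_eq0.
Qed.

Lemma int2_piecewise h : nice h ->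
  integrable2 U (piecewise h) /\
  int2 U (piecewise h) = \sum_(k in A) `|\det (edgemx (P k))| * int2 iTref (h k).
Proof.
move=> nh; have mU := msb_open U_open.
pose F k := (fun z => h k (affinv (P k) z)) \_ (aff (P k) @` iTref).
have FE k : k \in A -> integrable2 U (F k) /\ int2 U (F k) = `|\det (edgemx (P k))| * int2 iTref (h k).
  move=> kA; have [mO iO <-] := image_integrable kA nh.
  have OU : aff (P k) @` iTref `<=` U by move=> _ [x Tx <-]; exact: U_sub.
  have F0 y : U y -> ~ (aff (P k) @` iTref) y -> F k y = 0.
    by move=> _ nO; rewrite /F patchE memNset.
  have [[H _] <-] := int2_supp mO mU OU F0.
  have FO y : (aff (P k) @` iTref) y -> F k y = h k (affinv (P k) y).
    by move=> Oy; rewrite /F patchE mem_set.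
  split; last exact: eq_int2.
  by apply: H; apply: (eq_integrable2 _ mO iO) => y Oy; rewrite FO.
have [H1 H2] := @int2_sum R U I (index_enum I) (mem A) F mU (fun k kA => (FE k kA).1).
split; first exact: H1.
by rewrite /piecewise [LHS]H2; apply: eq_bigr => k kA; exact: (FE k kA).2.
Qed.

Lemma piecewise_ae g h : (forall k, k \in A -> {ae leb2 R, forall p, iTref (vec2 p) ->
    g (aff (P k) (vec2 p)) = h k (vec2 p)}) ->
  {ae leb2 R, forall p, U (vec2 p) -> g (vec2 p) = piecewise h (vec2 p)}.
Proof.
move=> gh.
pose N := \bigcup_(k in [set` A]) (aff (P k) @` ((@Tref R `\` iTref) `|` [set x | iTref x /\ g (aff (P k) x) <> h k x])).
have nN : null2 N.
  rewrite /N bigcup_mkcond.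
  pose G k : set 'rV[R]_2 := if k \in [set` A] then aff (P k) @` ((@Tref R `\` iTref) `|` [set x | iTref x /\ g (aff (P k) x) <> h k x]) else set0.
  rewrite /null2 preimage_bigcup; apply: negligible_bigcup_countable => k.
  case: ifPn => [/set_mem kA|_]; last by rewrite preimage_set0; exact: negligible_set0.
  apply: null2_image; first exact: P_nondeg.
  apply: null2U; first exact: null2_boundary.
  have := gh k kA; rewrite /null2; apply: negligibleS => p /= [Tp e] H; exact: e (H Tp).
apply: negligibleS nN => p /= /not_implyP [Up ne].
have [k kA [x Tx xp]] := U_cover Up; exists k => //; exists x => //.
have [iT|niT] := pselect (iTref x); last by left.
by right; split => // e; apply: ne; rewrite -xp piecewiseE.
Qed.

Lemma int2_piecewise_ae g h : measurable2 U g -> nice h ->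
  (forall k, k \in A -> {ae leb2 R, forall p, iTref (vec2 p) ->
    g (aff (P k) (vec2 p)) = h k (vec2 p)}) ->
  int2 U g = \sum_(k in A) `|\det (edgemx (P k))| * int2 iTref (h k).
Proof.
move=> mg nh gh; have [i1 <-] := int2_piecewise nh.
apply: int2_ae => //; [exact: msb_open|exact: integrable2_measurable|exact: piecewise_ae].
Qed.

Lemma nice_lift2 (op : R -> R -> R) h h' : (forall C D : R, exists E : R, forall s t, `|s| <= C -> `|t| <= D -> `|op s t| <= E) ->
  (forall (f1 f2 : 'rV[R]_2 -> R) x, {for x, continuous f1} -> {for x, continuous f2} -> {for x, continuous (fun y => op (f1 y) (f2 y))}) ->
  nice h -> nice h' -> nice (fun k x => op (h k x) (h' k x)).
Proof.
move=> bop cop nh nh' k kA; have [c [C hC]] := nh k kA; have [c' [C' hC']] := nh' k kA.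
split=> [x Tx|]; first exact: (cop (h k) (h' k) x (c x Tx) (c' x Tx)).
by have [E HE] := bop C C'; exists E => x Tx; apply: HE; [exact: hC|exact: hC'].
Qed.

Lemma niceD h h' : nice h -> nice h' -> nice (fun k x => h k x + h' k x).
Proof.
apply: nice_lift2 => [C D|f1 f2 x]; last exact: continuousD.
by exists (C + D) => s t sC tD; rewrite (le_trans (ler_normD _ _))// lerD.
Qed.

Lemma niceM h h' : nice h -> nice h' -> nice (fun k x => h k x * h' k x).
Proof.
apply: nice_lift2 => [C D|f1 f2 x]; last exact: continuousM.
by exists (C * D) => s t sC tD; rewrite normrM ler_pM.
Qed.

Lemma nice_cst (c : I -> R) : nice (fun k _ => c k).
Proof. by move=> k _; split; [move=> x _; exact: cst_continuous|exists `|c k|]. Qed.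

Lemma nice_sum (J : Type) (r : seq J) (h : J -> I -> 'rV[R]_2 -> R) : (forall j, nice (h j)) ->
  nice (fun k x => \sum_(j <- r) h j k x).
Proof.
move=> nh; elim: r => [|j r IH].
  rewrite (_ : (fun k x => _) = (fun k => fun=> 0)); last by apply/funext => k; apply/funext => x; rewrite big_nil.
  exact: nice_cst.
rewrite (_ : (fun k x => _) = (fun k x => h j k x + \sum_(j <- r) h j k x)); last first.
  by apply/funext => k; apply/funext => x; rewrite big_cons.
exact: niceD.
Qed.

Lemma piecewise_in_Lp h : nice h -> in_Lp U 2%:E (piecewise h).
Proof.
move=> nh; have [i1 _] := int2_piecewise nh; have mU := msb_open U_open.
split; first exact: integrable2_measurable.
have [i2 _] := int2_piecewise (niceM nh nh).
have sqE y : piecewise h y ^+ 2 = piecewise (fun k x => h k x * h k x) y.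
  have [[k kA [x Tx <-]]|nO] := pselect (exists2 k, k \in A & (aff (P k) @` iTref) y).
    by rewrite !piecewiseE// expr2.
  have p0 h' : piecewise h' y = 0.
    by rewrite /piecewise big1// => k kA; rewrite patchE memNset// => Oy; apply: nO; exists k.
  by rewrite !p0 expr2 mulr0.
rewrite /Lpnorm unlock /=; apply: poweR_lty.
have /integrableP[_] := (integrable2_mkcond _ mU).1 i2.
rewrite preimage_setT; congr (_ < +oo)%E; apply: eq_integral => p _ /=; congr (_%:E).
rewrite powR_mulrn// -normrX.
rewrite !patchE; case: ifP => _; last by rewrite expr0n.
by rewrite sqE.
Qed.
End Piecewise.

(** * Poincare inequality for a finite-dimensional local space *)

Section PoincareReference.
Context {R : realType}.
Implicit Types (x y : 'rV[R]_2) (f g : 'rV[R]_2 -> R).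
Local Notation e_ i := (delta_mx 0 i : 'rV[R]_2).

Lemma quadratic_ge0 (a b d : R) : 0 <= d -> (forall t, 0 <= a + 2 * b * t + d * t ^+ 2) ->
  b ^+ 2 <= a * d.
Proof.
rewrite le_eqVlt => /orP[/eqP <-|d0] H.
  have [->|b0] := eqVneq b 0; first by rewrite expr2 !mulr0.
  (* When d = 0 the expression is affine in t, and this t gives it the value -1. *)
  have := H (- (a + 1) / (2 * b)).
  have -> : 2 * b * (- (a + 1) / (2 * b)) = - (a + 1) by field.
  by lra.
have := H (- b / d); rewrite -(ler_pM2r d0) mul0r.
have -> : (a + 2 * b * (- b / d) + d * (- b / d) ^+ 2) * d = a * d - b ^+ 2 by field; rewrite gt_eqF.
by rewrite subr_ge0.
Qed.

(** A functional vanishing on the kernel of a semidefinite form factors through it: L = z G with z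
    given by the pseudo-inverse. Cauchy-Schwarz for the form concludes. The constant is explicit,
    hence uniform when L varies in a bounded set. *)
Lemma psd_functional_bound n (G : 'M[R]_n) (L c : 'rV[R]_n) : G^T = G ->
  (forall c : 'rV[R]_n, 0 <= (c *m G *m c^T) 0 0) ->
  (forall c : 'rV[R]_n, (c *m G *m c^T) 0 0 = 0 -> (L *m c^T) 0 0 = 0) ->
  ((L *m c^T) 0 0) ^+ 2 <= (L *m (L *m pinvmx G)^T) 0 0 * (c *m G *m c^T) 0 0.
Proof.
move=> GT G0 L0; set z := L *m pinvmx G.
have LG : z *m G = L.
  rewrite mulmxKpV// submxE; apply/eqP/rowP => j; rewrite !mxE.
  set k := (col j (cokermx G))^T.
  have Gk : G *m k^T = 0 by rewrite trmxK colE mulmxA mulmx_coker mul0mx.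
  have := L0 k; rewrite -mulmxA Gk mulmx0 mxE => /(_ erefl).
  by rewrite mxE => H; rewrite -[RHS]H; apply: eq_bigr => i _; rewrite !mxE.
clearbody z.
have e1 : (L *m z^T) 0 0 = (z *m G *m z^T) 0 0 by rewrite LG.
rewrite e1 -{1}LG; apply: quadratic_ge0 => [|t]; first exact: G0.
have := G0 (z + t *: c).
have -> : ((z + t *: c) *m G *m (z + t *: c)^T) 0 0 =
  (z *m G *m z^T) 0 0 + t * (z *m G *m c^T) 0 0 + (t * (c *m G *m z^T) 0 0 + t ^+ 2 * (c *m G *m c^T) 0 0).
  rewrite linearD linearZ /= !mulmxDl !mulmxDr -!scalemxAl -!scalemxAr !mxE; ring.
have -> : (c *m G *m z^T) 0 0 = (z *m G *m c^T) 0 0.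
  have -> : z *m G *m c^T = (c *m G *m z^T)^T by rewrite !trmx_mul trmxK GT mulmxA.
  by rewrite [RHS]mxE.
lra.
Qed.

(** What membership in W^{2,oo} yields for a continuous function: continuity up to the boundary, and
    bounded continuous derivatives with controlled quotients inside. *)
Definition regT f : Prop :=
  {within @Tref R, continuous f} /\
  exists2 K : R, 0 <= K & forall i, quo_cauchy iTref f i K /\
    forall x, iTref x -> [/\ derivable f x (e_ i), `|pd i f x| <= K & {for x, continuous (pd i f)}].

Lemma within_iTref f x : {within @Tref R, continuous f} -> iTref x -> {for x, continuous f}.
Proof.
move=> cf Tx; have := continuous_subspaceW (@iTref_sub R) cf.
by rewrite continuous_open_subspace; [apply; rewrite inE|exact: open_iTref].
Qed.

Lemma quo_cauchyW (O : set 'rV[R]_2) f i (K K' : R) : K <= K' -> quo_cauchy O f i K -> quo_cauchy O f i K'.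
Proof.
move=> KK q x rho BO; have [q1 q2] := q x rho BO; split.
  by move=> s sr s0; rewrite (le_trans (q1 s sr s0)).
by move=> s t sr ts s0 t0; rewrite (le_trans (q2 s t sr ts s0 t0))// ler_wpM2r.
Qed.

Lemma inF_regT (F : fspace R) r f : fspace_order F r -> inF F f -> regT f.
Proof.
move=> [r1 cF [_ WF] _] Ff; have cf := cF f Ff; split => //.
have ci y : iTref y -> {for y, continuous f} by exact: within_iTref.
have sob : in_sobolev iTref 2 +oo%E f.
  by move=> a a2; apply: (WF f Ff a); rewrite (leq_trans a2)// ltnS.
have [K0 K00 [q0 p0]] := sobolev_C1 0 open_iTref ci sob.
have [K1 K10 [q1 p1]] := sobolev_C1 1 open_iTref ci sob.
exists (K0 + K1); first exact: addr_ge0.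
have l0 : K0 <= K0 + K1 by lra.
have l1 : K1 <= K0 + K1 by lra.
move=> i; case: (ord2P i) => ->.
  split; first exact: quo_cauchyW q0.
  by move=> x /p0[? h ?]; split => //; exact: le_trans h l0.
split; first exact: quo_cauchyW q1.
by move=> x /p1[? h ?]; split => //; exact: le_trans h l1.
Qed.

Lemma pd_lincomb n (c : 'I_n -> R) (g : 'I_n -> 'rV[R]_2 -> R) f i x :
  (forall k, regT (g k)) -> (forall y, Tref y -> f y = \sum_(k < n) c k * g k y) -> iTref x ->
  pd i f x = \sum_(k < n) c k * pd i (g k) x.
Proof.
move=> rg fE Tx; rewrite /pd (@near_eq_derive _ _ _ _ (\sum_(k < n) c k \*: g k)); last first.
  have := open_nbhs_nbhs (conj open_iTref Tx); apply: filterS => y Ty.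
  by rewrite fE ?fct_sumE//; exact: iTref_sub.
have dg k : derivable (c k \*: g k) x (e_ i).
  by apply: derivableZ; have [_ [K _ /(_ i) [_ /(_ x Tx) []]]] := rg k.
rewrite derive_sum//; apply: eq_bigr => k _; rewrite deriveZ//.
by have [_ [K _ /(_ i) [_ /(_ x Tx) []]]] := rg k.
Qed.

Lemma is_derive_on_line (d : nat) (f : 'rV[R]_d -> R) (x v : 'rV[R]_d) (s l : R) :
  is_derive (s *: v + x) v f l -> is_derive s 1 (fun t : R => f (t *: v + x)) l.
Proof.
move=> [dF lF]; apply: is_derive_cvg; rewrite -lF; apply: cvg_trans dF.
apply: near_eq_cvg; near=> h => /=.
by rewrite /shift /= scaler1 scalerDl addrA.
Unshelve. all: by end_near.
Qed.

Lemma mean_value_line (d : nat) (f : 'rV[R]_d -> R) (x v : 'rV[R]_d) (t : R) : 0 <= t ->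
  (forall s, 0 <= s <= t -> derivable f (s *: v + x) v) ->
  exists2 s, 0 <= s <= t & f (t *: v + x) - f x = 'D_v f (s *: v + x) * t.
Proof.
rewrite le_eqVlt => /orP[/eqP <- _|t0 H].
  by exists 0; rewrite ?lexx// scale0r add0r subrr mulr0.
have dl s : 0 <= s <= t -> is_derive s 1 (fun s : R => f (s *: v + x)) ('D_v f (s *: v + x)).
  by move=> st; apply: is_derive_on_line; apply: DeriveDef => //; exact: H.
have [||s] := @MVT R (fun s : R => f (s *: v + x)) (fun s => 'D_v f (s *: v + x)) 0 t t0.
- by move=> s; rewrite in_itv /= => /andP[s0 st]; apply: dl; rewrite !ltW.
- apply: continuous_in_subspaceT => s; rewrite inE /= in_itv /= => st.
  exact: is_derive_continuous (dl s st).
by rewrite in_itv /= scale0r add0r subr0 => /andP[s0 st] E; exists s; rewrite ?ltW.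
Qed.

(** From z one reaches x parallel to the axes; every intermediate point is above z and below x
    coordinatewise, hence in the open triangle. *)
Lemma iTref_path f x z : regT f -> (forall i y, iTref y -> pd i f y = 0) ->
  iTref x -> iTref z -> z 0 0 <= x 0 0 -> z 0 1 <= x 0 1 -> f x = f z.
Proof.
move=> [_ [K _ rK]] p0 /iTref3[x0 x1 x2] /iTref3[z0 z1 z2] zx0 zx1.
have step (i : 'I_2) (y : 'rV[R]_2) (t : R) : 0 <= t -> (forall s, 0 <= s <= t -> iTref (s *: e_ i + y)) ->
    f (t *: e_ i + y) = f y.
  move=> t0 H; have [||s st] := @mean_value_line 2 f y (e_ i) t.
  - exact: t0.
  - by move=> s st; have [_ /(_ _ (H s st)) []] := rK i.
  by have := p0 i _ (H s st); rewrite /pd => ->; rewrite mul0r => /eqP; rewrite subr_eq0 => /eqP.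
have xE : x = (x 0 1 - z 0 1) *: e_ 1 + ((x 0 0 - z 0 0) *: e_ 0 + z).
  by apply/rowP => i; rewrite !mxE; case: (ord2P i) => -> /=; rewrite ?mulr1 ?mulr0; ring.
rewrite [in LHS]xE !step//; try lra.
  by move=> s /andP[s0 s1]; apply/iTref3; rewrite !mxE /= mulr1 mulr0 add0r; split; lra.
by move=> s /andP[s0 s1]; apply/iTref3; rewrite !mxE /= !mulr1 !mulr0 !add0r; split; lra.
Qed.

(** The coordinatewise minimum of x and y lies in the open triangle and is joined to both by such
    paths. *)
Lemma iTref_const f x y : regT f -> (forall i y, iTref y -> pd i f y = 0) ->
  iTref x -> iTref y -> f x = f y.
Proof.
move=> rf p0 Tx Ty; have /iTref3[x0 x1 x2] := Tx; have /iTref3[y0 y1 y2] := Ty.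
pose z : 'rV[R]_2 := \row_i Num.min (x 0 i) (y 0 i).
have zE i : z 0 i = Num.min (x 0 i) (y 0 i) by rewrite mxE.
have zx i : z 0 i <= x 0 i by rewrite zE ge_min lexx.
have zy i : z 0 i <= y 0 i by rewrite zE ge_min lexx orbT.
have Tz : iTref z.
  apply/iTref3; rewrite !zE !lt_min x0 x1 y0 y1; split => //; rewrite -!zE.
  by have := zx 0; have := zx 1; lra.
by rewrite (iTref_path rf p0 Tx Tz) // (iTref_path rf p0 Ty Tz).
Qed.

Definition centerT : 'rV[R]_2 := const_mx (1 / 4).

Lemma iTref_center : iTref centerT.
Proof. by apply/iTref3; rewrite !mxE; split; lra. Qed.

Lemma iTref_shrink x (t : R) : Tref x -> 0 < t <= 1 -> iTref (x + t *: (centerT - x)).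
Proof.
move=> /Tref3[x0 x1 x2] /andP[t0 t1]; apply/iTref3; rewrite !mxE; split; nra.
Qed.

Lemma Tref_dense f x (e : R) : {within @Tref R, continuous f} -> Tref x -> 0 < e ->
  exists2 y, iTref y & `|f x - f y| < e.
Proof.
move=> /subspace_continuousP cf Tx e0.
have /cvgrPdist_lt /(_ e e0) := cf x Tx; rewrite near_withinE => /nbhs_ballP [r /= r0 rH].
pose t := Num.min 1 (r / 2); have t0 : 0 < t by rewrite lt_min ltr01 divr_gt0.
have t1 : t <= 1 by rewrite ge_min lexx.
have tr : t <= r / 2 by rewrite ge_min lexx orbT.
have Ty : iTref (x + t *: (centerT - x)) by apply: iTref_shrink => //; rewrite t0.
exists (x + t *: (centerT - x)) => //; apply: rH; last exact: iTref_sub.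
have /Tref3[x0 x1 x2] := Tx.
split => // i j; rewrite ord1 /ball /= !mxE opprD addrA subrr add0r normrN normrM gtr0_norm//.
apply: (@le_lt_trans _ _ (t * 1)); last by lra.
by rewrite ler_pM2l// ler_norml; case: (ord2P j) => ->; apply/andP; split; lra.
Qed.

Lemma Tref_const f x y : regT f -> (forall i y, iTref y -> pd i f y = 0) ->
  Tref x -> Tref y -> f x = f y.
Proof.
move=> rf p0; suff H z : Tref z -> f z = f centerT by move=> Tx Ty; rewrite !H.
move=> Tz; apply/eqP; rewrite -subr_eq0 -normr_le0; apply/ler_addgt0Pl => e e0.
rewrite addr0; have [u Tu ue] := Tref_dense rf.1 Tz e0.
by rewrite -(iTref_const rf p0 Tu iTref_center) ltW.
Qed.

Lemma compact_Tref : compact (@Tref R).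
Proof.
apply: (subclosed_compact _ (@compact_box R 0 1 0 1)); last exact: Tref_box.
rewrite (_ : @Tref R = \bigcap_(k in [set: 'I_3]) (fun x => bary x k) @^-1` [set t | 0 <= t]); last first.
  by apply/seteqP; split => [x H k _|x H k]; [exact: H|exact: (H k)].
apply: closed_bigI => k _; apply: closed_comp; last exact: closed_ge.
by move=> x _; exact: continuous_bary.
Qed.

Lemma regT_bounded f : regT f -> exists2 C : R, 0 <= C & forall x, Tref x -> `|f x| <= C.
Proof.
move=> [cf _].
have /compact_bounded [M [_ HM]] : compact (f @` @Tref R).
  by apply: continuous_compact => //; exact: compact_Tref.
exists (Num.max 0 (M + 1)); first by rewrite le_max lexx.
by move=> x Tx; rewrite le_max (HM (M + 1)) ?ltrDl// ?orbT//; exists x.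
Qed.

Lemma regT_pd_integrable f g i j : regT f -> regT g ->
  integrable2 iTref (fun x => pd i f x * pd j g x).
Proof.
move=> [_ [K K0 rK]] [_ [L L0 rL]].
apply: (@integrable2_bounded R iTref _ (K * L) 0 1 0 1).
- exact: msb_iTref.
- by move=> x /iTref_sub; exact: Tref_box.
- apply: measurable2_continuous; first exact: open_iTref.
  move=> x Tx; have [_ /(_ x Tx) [_ _ c1]] := rK i; have [_ /(_ x Tx) [_ _ c2]] := rL j.
  exact: (@continuousM R _ (pd i f) (pd j g)).
move=> x Tx; have [_ /(_ x Tx) [_ c1 _]] := rK i; have [_ /(_ x Tx) [_ c2 _]] := rL j.
by rewrite normrM ler_pM.
Qed.

(** The generators may be dependent and constants have no gradient, so the Gram matrix of the
    gradients is only semidefinite. The functional f(x) - f(y) vanishes on its kernel because a zero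
    gradient forces a constant. Its coefficients are bounded uniformly in x and y, and so is the
    constant. *)
Lemma poincare_Tref (F : fspace R) r : fspace_order F r ->
  exists2 C : R, 0 <= C & forall f, inF F f -> forall x y, Tref x -> Tref y ->
    (f x - f y) ^+ 2 <= C * int2 iTref (fun z => \sum_(i < 2) pd i f z ^+ 2).
Proof.
move=> oF; set n := fdim F; pose g : 'I_n -> 'rV[R]_2 -> R := @fgen R F.
have Fg k : inF F (g k).
  exists (fun l => (l == k)%:R) => xi _; rewrite (bigD1 k)//= eqxx mul1r big1 ?addr0//.
  by move=> l /negbTE ->; rewrite mul0r.
have rg k : regT (g k) := inF_regT oF (Fg k).
pose G : 'M[R]_n := \matrix_(i, j) int2 iTref (fun x => \sum_(l < 2) pd l (g i) x * pd l (g j) x).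
have igg i j : integrable2 iTref (fun x => \sum_(l < 2) pd l (g i) x * pd l (g j) x).
  exact: (@int2_sum R iTref _ (index_enum 'I_2) xpredT (fun l x => pd l (g i) x * pd l (g j) x) (@msb_iTref R) (fun l _ => regT_pd_integrable l l (rg i) (rg j))).1.
have GT : G^T = G.
  by apply/matrixP => i j; rewrite !mxE; congr int2; apply/funext => x; apply: eq_bigr => l _; rewrite mulrC.
have energy (c : 'rV[R]_n) f : (forall y, Tref y -> f y = \sum_(k < n) c 0 k * g k y) ->
    (c *m G *m c^T) 0 0 = int2 iTref (fun z => \sum_(i < 2) pd i f z ^+ 2).
  move=> fE.
  have -> : int2 iTref (fun z => \sum_(i < 2) pd i f z ^+ 2) =
     int2 iTref (fun z => \sum_(i < n) \sum_(j < n) (c 0 i * c 0 j) * \sum_(l < 2) pd l (g i) z * pd l (g j) z).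
    apply: eq_int2 => z Tz; under eq_bigr => i _.
      rewrite (pd_lincomb i rg fE Tz) expr2 mulr_suml.
      under eq_bigr => k _ do rewrite mulr_sumr.
      over.
    rewrite exchange_big /=; apply: eq_bigr => i _; rewrite exchange_big /=; apply: eq_bigr => j _.
    by rewrite mulr_sumr; apply: eq_bigr => l _; ring.
  have mT := @msb_iTref R.
  have i1 i j : integrable2 iTref (fun z => (c 0 i * c 0 j) * \sum_(l < 2) pd l (g i) z * pd l (g j) z).
    exact: integrable2Z.
  have s1 i := @int2_sum R iTref _ (index_enum 'I_n) xpredT (fun j z => (c 0 i * c 0 j) * \sum_(l < 2) pd l (g i) z * pd l (g j) z) mT (fun j _ => i1 i j).
  have [_ ->] := @int2_sum R iTref _ (index_enum 'I_n) xpredT (fun i z => \sum_(j < n) (c 0 i * c 0 j) * \sum_(l < 2) pd l (g i) z * pd l (g j) z) mT (fun i _ => (s1 i).1).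
  under [RHS]eq_bigr => i _ do rewrite (s1 i).2.
  rewrite mxE exchange_big /=; apply: eq_bigr => j _; rewrite mxE mulr_suml; apply: eq_bigr => i _.
  by rewrite int2Z// !mxE; ring.
have G0 (c : 'rV[R]_n) : 0 <= (c *m G *m c^T) 0 0.
  rewrite (energy c (fun y => \sum_(k < n) c 0 k * g k y))//.
  by apply: int2_ge0 => x _; apply: sumr_ge0 => l _; exact: sqr_ge0.
have [B B0 gB] : exists2 B : R, 0 <= B & forall k x, Tref x -> `|g k x| <= B.
  have /choice [b Hb] k : exists b : R, 0 <= b /\ forall x, Tref x -> `|g k x| <= b.
    by have [C C0 HC] := regT_bounded (rg k); exists C.
  exists (\sum_(k < n) b k); first by apply: sumr_ge0 => k _; case: (Hb k).
  move=> k x Tx; rewrite (bigD1 k)//= (le_trans ((Hb k).2 x Tx))// lerDl sumr_ge0// => l _.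
  by case: (Hb l).
pose C := \sum_(i < n) \sum_(j < n) (2 * B) * (2 * B) * `|pinvmx G j i|.
exists C; first by do 2![apply: sumr_ge0 => ? _]; rewrite !mulr_ge0.
move=> f [c fE] x y Tx Ty.
have rf : regT f by apply: inF_regT oF _; exists c.
pose cr : 'rV[R]_n := \row_k c k.
have fE' z : Tref z -> f z = \sum_(k < n) cr 0 k * g k z by move=> Tz; rewrite fE//; apply: eq_bigr => k _; rewrite mxE.
rewrite -(energy cr f fE'); pose L : 'rV[R]_n := \row_k (g k x - g k y).
have LE (d : 'rV[R]_n) h : (forall z, Tref z -> h z = \sum_(k < n) d 0 k * g k z) -> (L *m d^T) 0 0 = h x - h y.
  move=> hE; rewrite !hE// -sumrB mxE; apply: eq_bigr => k _; rewrite !mxE; ring.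
rewrite -(LE cr f fE').
have L0 (d : 'rV[R]_n) : (d *m G *m d^T) 0 0 = 0 -> (L *m d^T) 0 0 = 0.
  pose h z := \sum_(k < n) d 0 k * g k z.
  have Fh : inF F h by exists (fun k => d 0 k).
  have rh := inF_regT oF Fh.
  rewrite (energy d h)// (LE d h)// => e0.
  suff p0 i z : iTref z -> pd i h z = 0 by rewrite (Tref_const rh p0 Tx Ty) subrr.
  move=> Tz; have sq0 : \sum_(i < 2) pd i h z ^+ 2 = 0.
    apply: (@int2_eq0 R iTref (fun z => \sum_(i < 2) pd i h z ^+ 2) (@open_iTref R)) => //.
    - move=> u Tu; rewrite (_ : (fun z => _) = (fun z => pd 0 h z * pd 0 h z + pd 1 h z * pd 1 h z)); last first.
        by apply/funext => w; rewrite big_ord_recl big_ord1 (_ : lift ord0 ord0 = 1)//; exact/val_inj.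
      have ch l : {for u, continuous (pd l h)} by have [_ [K _ /(_ l) [_ /(_ u Tu) []]]] := rh.
      apply: (@continuousD R R _ (fun z => pd 0 h z * pd 0 h z) (fun z => pd 1 h z * pd 1 h z)).
        exact: (@continuousM R _ (pd 0 h) (pd 0 h)).
      exact: (@continuousM R _ (pd 1 h) (pd 1 h)).
    - by move=> u _; apply: sumr_ge0 => l _; exact: sqr_ge0.
    - exact: (@int2_sum R iTref _ (index_enum 'I_2) xpredT (fun l x => pd l h x * pd l h x) (@msb_iTref R) (fun l _ => regT_pd_integrable l l rh rh)).1.
  by apply/eqP; rewrite -sqrf_eq0; apply/eqP; apply: (psumr_eq0P _ sq0) => // l _; exact: sqr_ge0.
apply: (le_trans (psd_functional_bound cr GT G0 L0)); rewrite ler_wpM2r// mxE.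
apply: (le_trans (ler_norm _)); apply: (le_trans (ler_norm_sum _ _ _)); apply: ler_sum => i _.
rewrite normrM [X in _ * `|X|]mxE [X in _ * `|X|]mxE.
have LB k : `|L 0 k| <= 2 * B.
  by rewrite mxE (le_trans (ler_normB _ _))// (_ : 2 * B = B + B) ?lerD ?gB//; ring.
apply: (@le_trans _ _ (2 * B * \sum_(j < n) (2 * B) * `|pinvmx G j i|)).
  apply: ler_pM => //; apply: (le_trans (ler_norm_sum _ _ _)); apply: ler_sum => j _.
  by rewrite normrM ler_wpM2r.
by rewrite mulr_sumr; apply: ler_sum => j _; rewrite mulrA.
Qed.
End PoincareReference.

(** * Geometry of the surface and of its elements *)

Section Norms.
Context {R : realType}.

Lemma eq_ler (x y : R) : x = y -> x <= y.
Proof. by move=> ->. Qed.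

Lemma mxnorm_entry m n (A : 'M[R]_(m, n)) i j : `|A i j| <= `|A|.
Proof.
rewrite /Num.norm /= mx_normrE.
exact: (le_bigmax _ (fun ij : 'I_m * 'I_n => `|A ij.1 ij.2|) (i, j)).
Qed.

Lemma mxnorm_le m n (A : 'M[R]_(m, n)) (e : R) : 0 <= e -> (forall i j, `|A i j| <= e) -> `|A| <= e.
Proof.
move=> e0 H; rewrite /Num.norm /= mx_normrE; apply/bigmax_leP; split => // ij _; exact: H.
Qed.

Lemma mxnorm_lt m n (A : 'M[R]_(m, n)) (e : R) : 0 < e -> (forall i j, `|A i j| < e) -> `|A| < e.
Proof.
move=> e0 H; rewrite /Num.norm /= mx_normrE; apply/bigmax_ltP; split => // ij _; exact: H.
Qed.

Lemma mxnormM m n p (A : 'M[R]_(m, n)) (B : 'M[R]_(n, p)) : `|A *m B| <= n%:R * `|A| * `|B|.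
Proof.
apply: mxnorm_le => [|i j]; first by rewrite !mulr_ge0.
rewrite mxE (le_trans (ler_norm_sum _ _ _))// -mulrA mulr_natl.
apply: (@le_trans _ _ (\sum_(k < n) `|A| * `|B|)); last by rewrite sumr_const card_ord.
by apply: ler_sum => k _; rewrite normrM ler_pM// mxnorm_entry.
Qed.

Lemma mxnormT m n (A : 'M[R]_(m, n)) : `|A^T| = `|A|.
Proof.
have le1 p q (B : 'M[R]_(p, q)) : `|B^T| <= `|B|.
  by apply: mxnorm_le => // i j; rewrite mxE mxnorm_entry.
by apply/eqP; rewrite eq_le le1 /= -{1}(trmxK A) le1.
Qed.

Lemma dotE d (u v : 'rV[R]_d) : dot u v = (u *m v^T) 0 0.
Proof. by rewrite mxE; apply: eq_bigr => i _; rewrite mxE. Qed.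

Lemma dot_ge0 d (u : 'rV[R]_d) : 0 <= dot u u.
Proof. by apply: sumr_ge0 => i _; rewrite -expr2 sqr_ge0. Qed.

Lemma enorm_sqr d (u : 'rV[R]_d) : enorm u ^+ 2 = dot u u.
Proof. by rewrite sqr_sqrtr// dot_ge0. Qed.

Lemma enorm_ge0 d (u : 'rV[R]_d) : 0 <= enorm u.
Proof. exact: sqrtr_ge0. Qed.

Lemma enormZ d (a : R) (u : 'rV[R]_d) : enorm (a *: u) = `|a| * enorm u.
Proof.
rewrite /enorm; have -> : dot (a *: u) (a *: u) = a ^+ 2 * dot u u; last by rewrite sqrtrM ?sqr_ge0// sqrtr_sqr.
by rewrite /dot mulr_sumr; apply: eq_bigr => i _; rewrite !mxE; ring.
Qed.

Lemma enormN d (u : 'rV[R]_d) : enorm (- u) = enorm u.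
Proof. by rewrite -scaleN1r enormZ normrN1 mul1r. Qed.

Lemma norm_le_enorm d (u : 'rV[R]_d) : `|u| <= enorm u.
Proof.
apply: mxnorm_le; first exact: enorm_ge0.
move=> i j; rewrite ord1 -(@ler_pXn2r _ 2)// ?nnegrE ?enorm_ge0// real_normK ?num_real//.
rewrite enorm_sqr /dot (bigD1 j)//= -expr2 lerDl sumr_ge0// => k _; by rewrite -expr2 sqr_ge0.
Qed.

Lemma enorm_le_norm d (u : 'rV[R]_d) : enorm u <= d%:R * `|u|.
Proof.
case: d u => [|d] u.
  by rewrite /enorm /dot big_ord0 sqrtr0 mul0r.
rewrite -(@ler_pXn2r _ 2)// ?nnegrE ?enorm_ge0 ?mulr_ge0// enorm_sqr /dot.
apply: (@le_trans _ _ (\sum_(i < d.+1) `|u| ^+ 2)).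
  apply: ler_sum => i _; rewrite -expr2 -(real_normK (num_real (u 0 i))).
  by rewrite ler_pXn2r ?nnegrE// mxnorm_entry.
rewrite sumr_const card_ord -[leLHS]mulr_natl exprMn ler_wpM2r ?sqr_ge0// -natrX ler_nat.
by rewrite expnS expn1 leq_pmulr.
Qed.

Lemma dotDl d (u v w : 'rV[R]_d) : dot (u + v) w = dot u w + dot v w.
Proof. by rewrite !dotE mulmxDl mxE. Qed.

Lemma dotZl d (a : R) (u w : 'rV[R]_d) : dot (a *: u) w = a * dot u w.
Proof. by rewrite !dotE -scalemxAl mxE. Qed.

End Norms.

Lemma ord3P (i : 'I_3) : [\/ i = 0, i = 1 | i = 2].
Proof.
by case: i => -[|[|[|//]]] p; [constructor 1|constructor 2|constructor 3]; exact/val_inj.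
Qed.

Lemma sum3 (V : nmodType) (f : 'I_3 -> V) : \sum_(i < 3) f i = f 0 + f 1 + f 2.
Proof.
rewrite !big_ord_recl big_ord0 addr0 addrA; congr (_ + f _ + f _); exact/val_inj.
Qed.

Lemma sum2 (V : nmodType) (f : 'I_2 -> V) : \sum_(i < 2) f i = f 0 + f 1.
Proof. by rewrite big_ord_recl big_ord1; congr (_ + f _); exact/val_inj. Qed.

(** * Flatness of a compact surface at small scale *)

Section Flatness.
Context {R : realType}.
Implicit Types (x y z n : 'rV[R]_3) (Gamma : set 'rV[R]_3).
Local Notation e_ i := (delta_mx 0 i : 'rV[R]_3).

(* At scale r the surface stays within slope eps of the plane orthogonal to n,
   and chord triangles stay within distance eps * s of the surface. *)
Definition flat_at Gamma (eps r : R) x : Prop := exists n,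
  [/\ `|n| = 1,
    forall y z, Gamma y -> Gamma z -> `|y - x| < r -> `|z - x| < r ->
      `|dot (y - z) n| <= eps * `|y - z| &
    forall (P : 'I_3 -> 'rV[R]_3) (s : R), (forall k, Gamma (P k) /\ `|P k - x| < r) ->
      (forall a, `|P (lift ord0 a) - P ord0| <= s) -> s <= r ->
      forall xi, Tref xi -> exists2 y, Gamma y & `|y - aff P xi| <= eps * s].

(* Mean value along the three coordinate axes; a cube contains the path. *)
Lemma first_order_expansion (phi : 'rV[R]_3 -> R) (c n : 'rV[R]_3) (rho e m : R) :
  (forall y, `|y - c| < rho -> forall i, derivable phi y (e_ i) /\ `|pd i phi y - m * n 0 i| <= e) ->
  forall y z, `|y - c| < rho -> `|z - c| < rho ->
  `|phi y - phi z - m * dot (y - z) n| <= 3 * e * `|y - z|.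
Proof.
move=> H y z yc zc.
have step0 i (u : 'rV[R]_3) (t : R) : 0 <= t -> `|u - c| < rho -> `|t *: e_ i + u - c| < rho ->
    `|phi (t *: e_ i + u) - phi u - m * (t * n 0 i)| <= e * t.
  move=> t0 uc tc.
  have path s : 0 <= s <= t -> `|s *: e_ i + u - c| < rho.
    move=> /andP[s0 st]; have [tz|tn0] := eqVneq t 0.
      have s00 : s = 0 by apply/eqP; rewrite eq_le s0 -[X in _ <= X]tz st.
      by rewrite s00 scale0r add0r.
    pose l := s / t; have sE : s = l * t by rewrite /l divfK.
    have l0 : 0 <= l by rewrite divr_ge0.
    have l1 : l <= 1 by rewrite ler_pdivrMr ?mul1r// lt_neqAle eq_sym tn0.
    have -> : s *: e_ i + u - c = (1 - l) *: (u - c) + l *: (t *: e_ i + u - c).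
      by rewrite sE; apply/rowP => k; rewrite !mxE; ring.
    apply: (le_lt_trans (ler_normD _ _)); rewrite !mx_normZ (ger0_norm l0) ger0_norm ?subr_ge0//.
    have [->|l00] := eqVneq l 0; first by rewrite subr0 mul1r mul0r addr0.
    have : l * `|t *: e_ i + u - c| < l * rho by rewrite ltr_pM2l// lt_neqAle eq_sym l00.
    have : (1 - l) * `|u - c| <= (1 - l) * rho by rewrite ler_wpM2l ?subr_ge0// ltW.
    lra.
  have [||s st E] := @mean_value_line R 3 phi u (e_ i) t; first exact: t0.
    by move=> s /path /H /(_ i) [].
  have [_ h] := H _ (path s st) i; rewrite E -/(pd i phi _).
  rewrite (_ : _ - _ = (pd i phi (s *: e_ i + u) - m * n 0 i) * t); last by ring.
  by rewrite normrM (ger0_norm t0) ler_wpM2r.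
have step i (u : 'rV[R]_3) (t : R) : `|u - c| < rho -> `|t *: e_ i + u - c| < rho ->
    `|phi (t *: e_ i + u) - phi u - m * (t * n 0 i)| <= e * `|t|.
  move=> uc tc; have [t0|t0] := leP 0 t; first by rewrite (ger0_norm t0); exact: step0.
  have uE : - t *: e_ i + (t *: e_ i + u) = u by rewrite addrA -scalerDl addNr scale0r add0r.
  have := @step0 i (t *: e_ i + u) (- t); rewrite uE (ltr0_norm t0) => h.
  rewrite -normrN; apply: (le_trans _ (h _ _ _)) => //; last by lra.
  by rewrite le_eqVlt; apply/orP; left; apply/eqP; congr (`|_|); ring.
set d := y - z.
have rho0 : 0 < rho by apply: le_lt_trans zc.
pose z1 := d 0 0 *: e_ 0 + z; pose z2 := d 0 1 *: e_ 1 + z1.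
have dE : y = d 0 2 *: e_ 2 + z2.
  apply/rowP => i; rewrite /z2 /z1 /d !mxE.
  by case: (ord3P i) => -> /=; rewrite ?mulr1 ?mulr0; ring.
have lt_entry (u v : 'rV[R]_3) : (forall i, u 0 i = y 0 i \/ u 0 i = z 0 i) -> `|u - c| < rho.
  move=> uv; apply: mxnorm_lt => // i j; rewrite ord1 !mxE.
  case: (uv j) => ->.
    by apply: le_lt_trans yc; have := mxnorm_entry (y - c) 0 j; rewrite !mxE.
  by apply: le_lt_trans zc; have := mxnorm_entry (z - c) 0 j; rewrite !mxE.
have z1c : `|z1 - c| < rho.
  apply: (lt_entry _ z) => i; rewrite /z1 /d !mxE.
  by case: (ord3P i) => -> /=; [left|right|right]; rewrite ?mulr1 ?mulr0; ring.
have z2c : `|z2 - c| < rho.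
  apply: (lt_entry _ z) => i; rewrite /z2 /z1 /d !mxE.
  by case: (ord3P i) => -> /=; [left|left|right]; rewrite ?mulr1 ?mulr0; ring.
have h0 := step 0 z (d 0 0) zc z1c; have h1 := step 1 z1 (d 0 1) z1c z2c.
have h2 := step 2 z2 (d 0 2) z2c; rewrite -dE in h2; have {}h2 := h2 yc.
have e0 : 0 <= e by have [_ h] := H y yc 0; exact: le_trans h.
have le1 i : e * `|d 0 i| <= e * `|d| by rewrite ler_wpM2l// mxnorm_entry.
have -> : phi y - phi z - m * dot d n = (phi y - phi z2 - m * (d 0 2 * n 0 2)) +
    ((phi z2 - phi z1 - m * (d 0 1 * n 0 1)) + (phi z1 - phi z - m * (d 0 0 * n 0 0))).
  by rewrite /dot sum3; ring.
have -> : 3 * e * `|d| = e * `|d| + (e * `|d| + e * `|d|) by ring.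
apply: (le_trans (ler_normD _ _)); apply: lerD; first exact: le_trans h2 (le1 2).
apply: (le_trans (ler_normD _ _)); apply: lerD; first exact: le_trans h1 (le1 1).
exact: le_trans h0 (le1 0).
Qed.

Lemma sign_bracket (p q a b : R) : `|p| <= q / 2 -> `|a - p - q| <= q / 2 -> `|b - p + q| <= q / 2 ->
  b <= 0 /\ 0 <= a.
Proof. by rewrite !ler_norml => /andP[? ?] /andP[? ?] /andP[? ?]; split; lra. Qed.

(** On the chord triangle phi is of size e m s, while along the coordinate axis of its largest
    derivative it varies at the rate m. It therefore changes sign within distance 12 e s on that
    line, and the intermediate value theorem gives a point of the surface. *)
Lemma triangle_near_surface Gamma (phi : 'rV[R]_3 -> R) (c n x : 'rV[R]_3) (rho e m r eps : R) (i0 : 'I_3) :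
  0 < m -> 0 < e -> 72 * e <= 1 -> 72 * e <= eps -> `|n 0 i0| = 1 -> 0 < r ->
  (forall y z, `|y - c| < rho -> `|z - c| < rho -> `|phi y - phi z - m * dot (y - z) n| <= 3 * (e * m) * `|y - z|) ->
  (forall y, `|y - c| < rho -> derivable phi y (e_ i0)) ->
  (forall y, `|y - c| < rho -> Gamma y <-> phi y = 0) ->
  (forall y z, `|y - c| < rho -> `|z - c| < rho -> Gamma y -> Gamma z -> `|dot (y - z) n| <= 3 * e * `|y - z|) ->
  (forall y, `|y - x| < 4 * r -> `|y - c| < rho) ->
  forall (P : 'I_3 -> 'rV[R]_3) (s : R), (forall k, Gamma (P k) /\ `|P k - x| < r) ->
      (forall a, `|P (lift ord0 a) - P ord0| <= s) -> s <= r ->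
      forall xi, Tref xi -> exists2 y, Gamma y & `|y - aff P xi| <= eps * s.
Proof.
move=> m0 e0 e1 e2 n1 r0 expn dphi inG chord near_x; have em0 := mulr_gt0 e0 m0.
move=> P s GP Ps sr xi Txi; set y := aff P xi.
have [xi0 xi1 xi2] : [/\ 0 <= xi 0 0, 0 <= xi 0 1 & xi 0 0 + xi 0 1 <= 1] by exact/Tref3.
have s0 : 0 <= s by exact: le_trans (normr_ge0 _) (Ps 0).
have yE : y - P ord0 = xi 0 0 *: (P (lift ord0 0) - P ord0) + xi 0 1 *: (P (lift ord0 1) - P ord0).
  by rewrite /y /aff addrC addKr; apply/rowP => j; rewrite mxE sum2 !mxE.
have yP : `|y - P ord0| <= s.
  rewrite yE (le_trans (ler_normD _ _))// !mx_normZ !ger0_norm//.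
  apply: (@le_trans _ _ (xi 0 0 * s + xi 0 1 * s)); first by apply: lerD; apply: ler_wpM2l.
  by rewrite -mulrDl ler_piMl.
have Pr k : `|P k - c| < rho by apply: near_x; have [_ h] := GP k; lra.
have Pc : `|P ord0 - x| < r by have [] := GP ord0.
have yx t : `|t| <= 2 * r -> `|t *: e_ i0 + y - c| < rho.
  move=> tr; apply: near_x; rewrite (_ : _ - _ = t *: e_ i0 + ((y - P ord0) + (P ord0 - x))); last first.
    by rewrite -addrA; congr (_ + _); rewrite addrA subrK.
  have eN : `|t *: (e_ i0 : 'rV[R]_3)| <= `|t|.
    apply: mxnorm_le => // i j; rewrite !mxE normrM ler_piMr//.
    by case: eqP => _; case: eqP => _; rewrite ?normr1 ?normr0 ?ler01.
  have h1 := ler_normD (t *: (e_ i0 : 'rV[R]_3)) (y - P ord0 + (P ord0 - x)).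
  have h2 := ler_normD (y - P ord0) (P ord0 - x).
  by lra.
have y0 : `|y - c| < rho by have := yx 0; rewrite scale0r add0r; apply; rewrite normr0; lra.
have dyn : `|dot (y - P ord0) n| <= 3 * e * s.
  have -> : dot (y - P ord0) n = xi 0 0 * dot (P (lift ord0 0) - P ord0) n + xi 0 1 * dot (P (lift ord0 1) - P ord0) n.
    by rewrite yE [LHS]dotDl !dotZl.
  have hd (b : 'I_2) : `|dot (P (lift ord0 b) - P ord0) n| <= 3 * e * s.
    by apply: (le_trans (chord _ _ (Pr _) (Pr _) (GP _).1 (GP _).1)); apply: ler_wpM2l (Ps b); lra.
  have es0 : 0 <= 3 * e * s by apply: mulr_ge0; [lra|exact: s0].
  rewrite (le_trans (ler_normD _ _))// !normrM (ger0_norm xi0) (ger0_norm xi1).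
  apply: (@le_trans _ _ (xi 0 0 * (3 * e * s) + xi 0 1 * (3 * e * s))); first by apply: lerD; apply: ler_wpM2l.
  by rewrite -mulrDl ler_piMl.
have phiP : phi (P ord0) = 0 by apply/(inG _ (Pr ord0)); have [] := GP ord0.
have phiy : `|phi y| <= m * (6 * e * s).
  have := expn y (P ord0) y0 (Pr ord0); rewrite phiP subr0 => h.
  have -> : phi y = (phi y - m * dot (y - P ord0) n) + m * dot (y - P ord0) n by rewrite subrK.
  rewrite (le_trans (ler_normD _ _))// normrM (gtr0_norm m0).
  have h2 : m * `|dot (y - P ord0) n| <= m * (3 * e * s) by rewrite ler_pM2l.
  have h3 : 3 * (e * m) * `|y - P ord0| <= 3 * (e * m) * s by rewrite ler_wpM2l//; lra.
  by apply: (le_trans (lerD h h2)); apply: (le_trans (lerD h3 (lexx _))); apply: eq_ler; ring.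
(* Both |phi y| and the remainder at distance tau are at most m tau / 2, together no more than the
   variation m tau of the linear part; so the values at -tau and tau have opposite signs or
   vanish. *)
pose tau := 12 * e * s; have tau0 : 0 <= tau by rewrite mulr_ge0//; lra.
have taur : tau <= 2 * r.
  have : 12 * e * s <= 1 * s by rewrite ler_wpM2r//; lra.
  by rewrite /tau; lra.
pose G t := phi (t *: e_ i0 + y).
have Gexp t : `|t| <= tau -> `|G t - phi y - m * (t * n 0 i0)| <= m * (6 * e * `|t|) / 2.
  move=> ht; have tr := le_trans ht taur.
  have := expn (t *: e_ i0 + y) y (yx t tr) y0.
  have -> : t *: e_ i0 + y - y = t *: e_ i0 by rewrite addrK.
  have -> : dot (t *: e_ i0) n = t * n 0 i0.
    rewrite /dot (bigD1 i0)//= big1 ?addr0 ?mxE ?mxE ?eqxx ?mulr1//.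
    by move=> j /negbTE ji; rewrite !mxE ji andbF mulr0 mul0r.
  have eN : `|t *: (e_ i0 : 'rV[R]_3)| <= `|t|.
    apply: mxnorm_le => // i j; rewrite !mxE normrM ler_piMr//.
    by case: eqP => _; case: eqP => _; rewrite ?normr1 ?normr0 ?ler01.
  move=> h; apply: (le_trans h); apply: (@le_trans _ _ (3 * (e * m) * `|t|)).
    by rewrite ler_wpM2l//; lra.
  by apply: eq_ler; field.
have cG : {within `[- tau, tau], continuous G}.
  apply: continuous_in_subspaceT => t; rewrite inE /= in_itv /= -ler_norml => ht.
  have dt := dphi _ (yx t (le_trans ht taur)).
  exact: is_derive_continuous (is_derive_on_line (DeriveDef dt erefl)).
have yb : `|phi y| <= m * tau / 2.
  by have E : m * (6 * e * s) = m * tau / 2; [rewrite /tau; field|rewrite -E].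
have Gb t : `|t| = tau -> `|G t - phi y - m * (t * n 0 i0)| <= m * tau / 2.
  move=> tt; apply: (le_trans (Gexp t _)); rewrite tt//.
  have : m * (6 * e * tau) <= m * tau by rewrite ler_pM2l// ler_piMl//; lra.
  by lra.
have [t tI Gt0] : exists2 t, t \in `[- tau, tau] & G t = 0.
  have g1 := Gb tau (ger0_norm tau0); have g2 : `|- tau| = tau by rewrite normrN ger0_norm.
  have {}g2 := Gb (- tau) g2.
  apply: IVT => //; first by rewrite (le_trans _ tau0)// oppr_le0.
  have [np|np] : n 0 i0 = 1 \/ n 0 i0 = -1.
    by move: n1 => /eqP; rewrite eqr_norml ler01 andbT => /orP[/eqP|/eqP]; [left|right].
  - rewrite np mulr1 in g1; rewrite np mulr1 mulrN opprK in g2.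
    by have [h1 h2] := sign_bracket yb g1 g2; rewrite ge_min le_max h1 h2 orbT.
  rewrite np mulrN1 mulrN opprK in g1; rewrite np mulrN1 opprK in g2.
  by have [h1 h2] := sign_bracket yb g2 g1; rewrite ge_min le_max h1 h2 orbT.
move: tI; rewrite in_itv /= -ler_norml => tt.
exists (t *: e_ i0 + y); first by apply/(inG _ (yx t (le_trans tt taur))).
rewrite addrK; apply: (@le_trans _ _ tau).
  apply: (le_trans _ tt); apply: mxnorm_le => // i j; rewrite !mxE normrM ler_piMr//.
  by case: eqP => _; case: eqP => _; rewrite ?normr1 ?normr0 ?ler01.
by rewrite /tau ler_wpM2r//; lra.
Qed.

(** The centre and the radius vary together, as required by the near-covering form of compactness
    that turns local flatness into one radius for the whole surface. *)
Lemma flat_local Gamma (eps : R) (x0 : 'rV[R]_3) : closed_hypersurface Gamma -> 0 < eps -> Gamma x0 ->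
  \forall x \near x0 & r \near 0^'+, flat_at Gamma eps r x.
Proof.
move=> [_ hyp] eps0 G0; have [U [phi [oU Ux0 sphi GU reg]]] := hyp x0 G0.
have G0' : phi x0 = 0 by have : (Gamma `&` U) x0; [split|rewrite GU => -[]].
pose a i := `|pd i phi x0|.
have [i0 m_max] : exists i0, forall i, a i <= a i0.
  have := @arg_maxP _ R 'I_3 0 xpredT a isT; case: arg_maxP => // i _ H _; exists i => j; exact: H.
set m := a i0 in m_max.
have m0 : 0 < m.
  have [i ni] := reg x0 Ux0 G0'; apply: lt_le_trans (m_max i); by rewrite normr_gt0.
(* The gradient normalized in the sup norm: its largest component becomes 1 or -1. *)
pose n : 'rV[R]_3 := m^-1 *: \row_i pd i phi x0.
have nE i : m * n 0 i = pd i phi x0 by rewrite !mxE mulrA divff ?mul1r// gt_eqF.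
have n1 : `|n 0 i0| = 1 by rewrite !mxE normrM gtr0_norm ?invr_gt0// mulVf// gt_eqF.
have nn : `|n| = 1.
  apply/eqP; rewrite eq_le -{2}n1 mxnorm_entry andbT; apply: mxnorm_le => // i j.
  by rewrite ord1 !mxE normrM gtr0_norm ?invr_gt0// mulrC ler_pdivrMr// mul1r; exact: m_max.
(* The divisor dominates the factor 3 of the chord slope and the factor 12 of the distance from
   chord triangles to the surface. *)
pose e := Num.min eps 1 / 72.
have e0 : 0 < e by rewrite divr_gt0// lt_min eps0 ltr01.
have e1 : 72 * e <= 1 by rewrite mulrC divfK// ge_min lexx orbT.
have e2 : 72 * e <= eps by rewrite mulrC divfK// ge_min lexx.
have em0 : 0 < e * m by exact: mulr_gt0.
clearbody e n m.
have [rho rho0 Hrho] : exists2 rho : R, 0 < rho & forall y, `|y - x0| < rho ->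
    U y /\ forall i, derivable phi y (e_ i) /\ `|pd i phi y - m * n 0 i| <= e * m.
  have : \forall y \near x0, U y /\ forall i, `|pd i phi x0 - pd i phi y| < e * m.
    have c i : \forall y \near x0, `|pd i phi x0 - pd i phi y| < e * m.
      by have [/cvgrPdist_lt ci _] := sphi [:: i] x0 Ux0; exact: ci.
    have UU := open_nbhs_nbhs (conj oU Ux0).
    have c3 := @filter_forall _ _ (fun i y => `|pd i phi x0 - pd i phi y| < e * m) (nbhs x0) _ c.
    exact: (filterI UU (c3 _)).
  move=> /nbhs_ballP [rho /= rho0 H]; exists rho => // y yx.
  have [Uy hy] : U y /\ forall i, `|pd i phi x0 - pd i phi y| < e * m.
    by apply: H; rewrite -ball_normE /= distrC.
  split => // i; have [_ /(_ i) dy] := sphi [::] y Uy; split => //.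
  by rewrite nE distrC ltW.
have expn := first_order_expansion (fun y yr => (Hrho y yr).2).
have inG y : `|y - x0| < rho -> Gamma y <-> phi y = 0.
  move=> yr; have [Uy _] := Hrho y yr; split => [Gy|py].
    by have : (Gamma `&` U) y; [split|rewrite GU => -[]].
  by have : [set y | U y /\ phi y = 0] y; [split|rewrite -GU => -[]].
have chord y z : `|y - x0| < rho -> `|z - x0| < rho -> Gamma y -> Gamma z -> `|dot (y - z) n| <= 3 * e * `|y - z|.
  move=> yr zr /(inG y yr) y0 /(inG z zr) z0; have := expn y z yr zr.
  rewrite y0 z0 subrr sub0r normrN normrM (gtr0_norm m0) => h.
  by rewrite -(ler_pM2l m0) (le_trans h)//; apply: eq_ler; ring.
near=> x r.
have xr : `|x - x0| < rho / 4.
  near: x; apply/nbhs_ballP; exists (rho / 4) => /=; first by rewrite divr_gt0.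
  by move=> y; rewrite -ball_normE /= distrC.
have r0 : 0 < r by near: r; exact: nbhs_right_gt.
have rr : r < rho / 8 by near: r; apply: nbhs_right_lt; rewrite divr_gt0.
have near_x y : `|y - x| < 4 * r -> `|y - x0| < rho.
  by move=> yx; rewrite (le_lt_trans (ler_distD x _ _))//; clear -yx xr rr r0; lra.
rewrite /=; exists n; split => //.
  move=> y z Gy Gz yx zx; apply: (le_trans (chord y z _ _ Gy Gz)).
  - by apply: near_x; clear -yx r0; lra.
  - by apply: near_x; clear -zx r0; lra.
  by rewrite ler_wpM2r//; lra.
apply: (@triangle_near_surface Gamma phi x0 n x rho e m r eps i0) => //.
by move=> y yr; have [_ /(_ i0) []] := Hrho y yr.
Unshelve. all: by end_near.
Qed.

Lemma closed_hypersurface_flat Gamma (eps : R) : closed_hypersurface Gamma -> 0 < eps ->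
  exists2 r : R, 0 < r & forall x, Gamma x -> flat_at Gamma eps r x.
Proof.
move=> hyp eps0; have [cG _] := hyp.
have /compact_near_coveringP /(_ R 0^'+ (fun r x => flat_at Gamma eps r x) _) := cG.
move=> /(_ (fun x Gx => flat_local hyp eps0 Gx)) H.
have [r [r0 Hr]] : exists r : R, 0 < r /\ Gamma `<=` flat_at Gamma eps r.
  apply: (@filter_ex _ (0^'+ : set_system R)).
  by apply: filterI H; exact: nbhs_right_gt.
by exists r.
Qed.
End Flatness.

(** * Element planes, normals and shape regularity *)

Section Frames.
Context {R : realType}.
Implicit Types (J E : 'M[R]_(2, 3)) (u v n : 'rV[R]_3).

Lemma ord3_add : [/\ (0 + 1 = 1 :> 'I_3), (0 + 2 = 2 :> 'I_3), (1 + 1 = 2 :> 'I_3) &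
  [/\ (1 + 2 = 0 :> 'I_3), (2 + 1 = 0 :> 'I_3) & (2 + 2 = 1 :> 'I_3)]].
Proof. by do ![split]; exact/val_inj. Qed.

(** Lagrange's identity. *)
Lemma cross_sqr u v : dot (cross u v) (cross u v) = dot u u * dot v v - dot u v ^+ 2.
Proof.
have [e1 e2 e3 [e4 e5 e6]] := ord3_add.
by rewrite /dot !sum3 !mxE e1 e2 e3 e4 e5 e6; ring.
Qed.

Lemma dot_crossl u v : dot u (cross u v) = 0.
Proof.
have [e1 e2 e3 [e4 e5 e6]] := ord3_add.
by rewrite /dot !sum3 !mxE e1 e2 e3 e4 e5 e6; ring.
Qed.

Lemma dot_crossr u v : dot v (cross u v) = 0.
Proof.
have [e1 e2 e3 [e4 e5 e6]] := ord3_add.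
by rewrite /dot !sum3 !mxE e1 e2 e3 e4 e5 e6; ring.
Qed.

Lemma dot_mul d (u v : 'rV[R]_d) : u *m v^T = (dot u v)%:M.
Proof. by rewrite dotE -mx11_scalar. Qed.

Lemma dotC d (u v : 'rV[R]_d) : dot u v = dot v u.
Proof. by apply: eq_bigr => i _; rewrite mulrC. Qed.

Lemma enorm_eq0 d (u : 'rV[R]_d) : enorm u = 0 -> u = 0.
Proof. by move=> u0; apply/eqP; rewrite -normr_le0 -u0 norm_le_enorm. Qed.

Lemma gram_unit m d (E : 'M[R]_(m, d)) : row_free E -> E *m E^T \in unitmx.
Proof.
move=> fE; rewrite -row_free_unit; apply: inj_row_free => v v0.
apply: (row_free_inj fE); rewrite mul0mx; apply: enorm_eq0.
by rewrite /enorm dotE trmx_mul mulmxA -(mulmxA v) v0 mul0mx mxE sqrtr0.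
Qed.

Lemma det_gram J : \det (J *m J^T) = dot (cross (row 0 J) (row 1 J)) (cross (row 0 J) (row 1 J)).
Proof.
have e i j : (J *m J^T) i j = dot (row i J) (row j J).
  by rewrite mxE; apply: eq_bigr => k _; rewrite !mxE.
by rewrite det2E !e cross_sqr expr2 (dotC (row 1 J) (row 0 J)).
Qed.

Lemma unormal_unit J : J *m J^T \in unitmx -> unormal J *m (unormal J)^T = 1%:M.
Proof.
rewrite unitmxE unitfE det_gram => c0; rewrite /unormal; set c := cross _ _ in c0 *.
have e0 : enorm c != 0.
  by apply: contra c0 => /eqP ec; rewrite -enorm_sqr ec expr0n.
by rewrite linearZ /= -scalemxAr -scalemxAl dot_mul -enorm_sqr !scale_scalar_mx; congr (_%:M); field.
Qed.

Lemma unormal_orth J : J *m (unormal J)^T = 0.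
Proof.
rewrite /unormal linearZ /= -scalemxAr; set c := cross _ _.
rewrite (_ : J *m c^T = 0) ?scaler0//; apply/matrixP => i j; rewrite [RHS]mxE ord1.
transitivity (dot (row i J) c); first by rewrite mxE; apply: eq_bigr => k _; rewrite !mxE.
by case: (ord2P i) => ->; [exact: dot_crossl|exact: dot_crossr].
Qed.

(** The rows of J together with n form an invertible matrix K with K K^T block diagonal; the claim
    is K^T (K K^T)^-1 K = 1 written in blocks. *)
Lemma orthoframe J n : J *m J^T \in unitmx -> n *m n^T = 1%:M -> n *m J^T = 0 ->
  J^T *m invmx (J *m J^T) *m J + n^T *m n = 1%:M.
Proof.
move=> JJ nn nJ.
have Jn : J *m n^T = 0 by rewrite -[LHS]trmxK trmx_mul trmxK nJ trmx0.
have KK : col_mx J n *m (col_mx J n)^T = block_mx (J *m J^T) 0 0 1%:M.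
  by rewrite tr_col_mx mul_col_row nn nJ Jn.
have uK : (col_mx J n : 'M[R]_(2 + 1)) \in unitmx.
  have : \det (col_mx J n *m (col_mx J n)^T) != 0 by rewrite KK det_ublock det1 mulr1 -unitfE -unitmxE.
  by rewrite det_mulmx unitmxE unitfE mulf_eq0 negb_or => /andP[].
apply: (can_inj (mulKmx uK)); rewrite mulmx1 mulmxDr !mulmxA !mul_col_mx.
by rewrite mulmxV// nJ Jn nn !mul1mx !mul0mx add_col_mx addr0 add0r.
Qed.

Lemma tanprojE J : J *m J^T \in unitmx -> tanproj J = J^T *m invmx (J *m J^T) *m J.
Proof.
move=> JJ; have nJ : unormal J *m J^T = 0 by rewrite -[LHS]trmxK trmx_mul trmxK unormal_orth trmx0.
by rewrite /tanproj -(orthoframe JJ (unormal_unit JJ) nJ) addrK.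
Qed.

Lemma row_free_full (T E : 'M[R]_(2, 3)) n : row_free E -> n *m n^T = 1%:M -> E *m n^T = 0 ->
  T *m n^T = 0 -> T = (T *m E^T *m invmx (E *m E^T)) *m E.
Proof.
move=> fE nn nE nT.
have nE' : n *m E^T = 0 by rewrite -[LHS]trmxK trmx_mul trmxK nE trmx0.
by rewrite -{1}(mulmx1 T) -(orthoframe (gram_unit fE) nn nE') mulmxDr (mulmxA T n^T) nT mul0mx addr0 !mulmxA.
Qed.

Lemma diam_le m (P : 'I_3 -> 'rV[R]_m) x y : tri P x -> tri P y -> enorm (x - y) <= diam (tri P).
Proof.
move=> Px Py; apply: ub_le_sup; last by exists x, y.
exists (m%:R * (2%:R * 2 * `|edgemx P|)) => r [_ [_ [[xi Tx <-] [eta Ty <-] ->]]].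
rewrite (le_trans (enorm_le_norm _))// ler_wpM2l//.
have -> : aff P xi - aff P eta = (xi - eta) *m edgemx P.
  by rewrite /aff mulmxBl opprD addrACA subrr add0r.
rewrite (le_trans (mxnormM _ _))// ler_wpM2r// ler_wpM2l//.
have h (z : 'rV[R]_2) : Tref z -> `|z| <= 1.
  move=> /Tref3[z0 z1 z2]; apply: mxnorm_le => // i j; rewrite ord1 ler_norml.
  by case: (ord2P j) => ->; apply/andP; split; lra.
by rewrite (le_trans (ler_normB _ _))// (_ : 2 = 1 + 1)// lerD ?h.
Qed.

Lemma vert_tri m (P : 'I_3 -> 'rV[R]_m) k : tri P (P k).
Proof.
case: (unliftP ord0 k) => [a|] ->; last first.
  exists 0; first by apply/Tref3; rewrite !mxE addr0; split; lra.
  by rewrite /aff mul0mx addr0.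
exists (delta_mx 0 a).
  by apply/Tref3; rewrite !mxE; case: (ord2P a) => -> /=; split; lra.
by rewrite /aff -rowE rowK addrC subrK.
Qed.

Lemma edgemx_le m (P : 'I_3 -> 'rV[R]_m) (h : R) : diam (tri P) <= h -> `|edgemx P| <= h.
Proof.
move=> dh; have h0 : 0 <= h.
  by apply: le_trans dh; apply: le_trans (diam_le (vert_tri P ord0) (vert_tri P ord0)); exact: enorm_ge0.
apply: mxnorm_le => // a j; rewrite mxE.
apply: le_trans (mxnorm_entry _ _ _) _; apply: le_trans (norm_le_enorm _) _.
by apply: le_trans dh; apply: diam_le; exact: vert_tri.
Qed.

Lemma shape_low m (P : 'I_3 -> 'rV[R]_m) (sigma h : R) (z : 'rV[R]_2) : 0 < sigma -> 0 < h ->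
  h / sigma <= diam (tri P) -> shape_regular sigma P ->
  `|z| <= sigma ^+ 2 / h * enorm (z *m edgemx P).
Proof.
move=> s0 h0 dh [fE [_ [xi0 T0 <-] H]]; set E := edgemx P in fE *.
have [->|zn0] := eqVneq z 0; first by rewrite mul0mx normr0 mulr_ge0 ?enorm_ge0// divr_ge0 ?sqr_ge0 ?ltW.
set N := enorm (z *m E).
have N0 : 0 < N.
  rewrite lt_neqAle enorm_ge0 andbT eq_sym; apply: contra zn0 => /eqP /enorm_eq0 zE.
  by apply/eqP; apply: (row_free_inj fE); rewrite zE mul0mx.
set rho := diam (tri P) / sigma; have rho0 : 0 < rho.
  by rewrite divr_gt0// (lt_le_trans _ dh)// divr_gt0.
have [eta Te] : tri P (aff P (xi0 + (rho / N) *: z)).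
  apply: H; have -> : aff P (xi0 + (rho / N) *: z) - aff P xi0 = (rho / N) *: (z *m E).
    by apply/eqP; rewrite subr_eq; apply/eqP; rewrite /aff mulmxDl -scalemxAl addrA [RHS]addrC.
  by rewrite enormZ -/N (gtr0_norm (divr_gt0 rho0 N0)) divfK ?gt_eqF//.
rewrite /aff -/E => /addrI /(row_free_inj fE) eE.
have zE : (rho / N) *: z = eta - xi0 by rewrite eE addrAC subrr add0r.
have : `|(rho / N) *: z| <= 1.
  have /Tref3[a0 a1 a2] := Te; have /Tref3[b0 b1 b2] := T0.
  rewrite zE; apply: mxnorm_le => // i j; rewrite ord1 !mxE ler_norml.
  by case: (ord2P j) => ->; apply/andP; split; lra.
rewrite mx_normZ (gtr0_norm (divr_gt0 rho0 N0)) => hz.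
have {}hz : `|z| <= N / rho.
  by rewrite ler_pdivlMr// mulrC -(ler_pM2r (_ : 0 < N^-1)) ?invr_gt0// divff ?gt_eqF// mulrAC.
have hr : h / sigma ^+ 2 <= rho by rewrite /rho expr2 invfM mulrA ler_wpM2r// invr_ge0 ltW.
clearbody rho; have hs0 : 0 < h / sigma ^+ 2 by rewrite divr_gt0// exprn_gt0.
have k : rho^-1 <= (h / sigma ^+ 2)^-1 by rewrite lef_pV2 ?posrE.
rewrite invf_div in k.
by apply: (le_trans hz); rewrite mulrC; apply: ler_wpM2r => //; exact: ltW.
Qed.

Lemma enorm_split (T : 'M[R]_(2, 3)) n (d : 'rV[R]_3) : T *m T^T = 1%:M -> n *m n^T = 1%:M -> n *m T^T = 0 ->
  enorm d <= enorm (d *m T^T) + `|(d *m n^T) 0 0|.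
Proof.
move=> TT nn nT.
have TTu : T *m T^T \in unitmx by rewrite TT unitmx1.
have fr := orthoframe TTu nn nT; rewrite TT invmx1 mulmx1 in fr.
have E : dot d d = dot (d *m T^T) (d *m T^T) + ((d *m n^T) 0 0) ^+ 2.
  rewrite !dotE -{1}(mulmx1 d) -fr mulmxDr mulmxDl mxE trmx_mul trmxK !mulmxA; congr (_ + _).
  by rewrite -(mulmxA _ n) mxE big_ord1 expr2; congr (_ * _); rewrite -[in RHS](trmxK (d *m n^T)) trmx_mul trmxK [RHS]mxE.
rewrite -(@ler_pXn2r _ 2)// ?nnegrE ?addr_ge0 ?enorm_ge0//.
rewrite enorm_sqr E sqrrD !enorm_sqr real_normK ?num_real// addrAC lerDl.
by rewrite mulrn_wge0// mulr_ge0 ?enorm_ge0.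
Qed.

Lemma enorm_row_orthonormal m (T : 'M[R]_(m, 3)) i : T *m T^T = 1%:M -> enorm (row i T) = 1.
Proof.
move=> TT; rewrite /enorm; have -> : dot (row i T) (row i T) = (T *m T^T) i i.
  by rewrite [RHS]mxE; apply: eq_bigr => k _; rewrite !mxE.
by rewrite TT mxE eqxx sqrtr1.
Qed.

Lemma norm_orthonormal m (T : 'M[R]_(m, 3)) : T *m T^T = 1%:M -> `|T| <= 1.
Proof.
move=> TT; apply: mxnorm_le => // i j.
have <- : row i T 0 j = T i j by rewrite mxE.
apply: le_trans (mxnorm_entry _ _ _) _; apply: le_trans (norm_le_enorm _) _.
by rewrite enorm_row_orthonormal.
Qed.

(** The edges E are nearly orthogonal to n, and shape regularity expresses the orthonormal frame T
    by them, so T n^T is small. Hence n is close to a multiple b nu with |b| at least 1/2, and a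
    chord nearly orthogonal to n is nearly orthogonal to nu. *)
Lemma frame_tilt (T E : 'M[R]_(2, 3)) (nu n d : 'rV[R]_3) (S h eps : R) :
  T *m T^T = 1%:M -> nu *m nu^T = 1%:M -> nu *m T^T = 0 ->
  row_free E -> E *m nu^T = 0 -> 0 < h -> 0 <= S -> 0 <= eps -> 8 * S * eps <= 1 ->
  (forall z, `|z| <= S / h * enorm (z *m E)) ->
  `|n| = 1 -> `|E *m n^T| <= eps * h -> `|dot d n| <= eps * `|d| ->
  `|dot d nu| <= (2 + 24 * S) * eps * `|d|.
Proof.
move=> TT nn nT fE nE h0 S0 e0 Se low n1 En dn.
have Tn : T *m nu^T = 0 by rewrite -[LHS]trmxK trmx_mul trmxK nT trmx0.
have TE := row_free_full fE nn nE Tn; set Z := _ *m invmx _ in TE.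
have ZS : `|Z| <= S / h.
  apply: mxnorm_le => [|i j]; first by rewrite divr_ge0// ltW.
  have <- : row i Z 0 j = Z i j by rewrite mxE.
  by rewrite (le_trans (mxnorm_entry _ _ _))// (le_trans (low _))// -row_mul -TE enorm_row_orthonormal// mulr1.
set a := T *m n^T.
have aS : `|a| <= 2 * S * eps.
  rewrite /a TE -mulmxA (le_trans (mxnormM _ _))//.
  apply: (@le_trans _ _ (2 * (S / h) * (eps * h))); first by rewrite ler_pM ?mulr_ge0// ler_wpM2l.
  by apply: eq_ler; field; rewrite gt_eqF.
have TTu : T *m T^T \in unitmx by rewrite TT unitmx1.
have fr := orthoframe TTu nn nT; rewrite TT invmx1 mulmx1 in fr.
set b := dot n nu.
have nE' : n = a^T *m T + b *: nu.
  rewrite /a trmx_mul trmxK -{1}(mulmx1 n) -fr mulmxDr !mulmxA; congr (_ + _).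
  by rewrite dot_mul mul_scalar_mx.
have T1 := norm_orthonormal TT; have nu1 := norm_orthonormal nn.
have b2 : 1 <= 2 * `|b|.
  have : `|n| <= 2%:R * `|a^T| * `|T| + `|b| * `|nu|.
    by rewrite {1}nE' (le_trans (ler_normD _ _))// lerD ?mxnormM// mx_normZ.
  rewrite n1 mxnormT => H.
  have h1 : 2%:R * `|a| * `|T| <= 2 * (2 * S * eps) * 1 by rewrite ler_pM// ler_wpM2l.
  have h2 : `|b| * `|nu| <= `|b| * 1 by rewrite ler_wpM2l.
  lra.
have dE : dot d n = (d *m T^T *m a) 0 0 + b * dot d nu.
  rewrite dotC {1}nE' dotDl dotZl (dotC nu); congr (_ + _).
  by rewrite dotC dotE trmx_mul trmxK mulmxA.
have h1 : `|(d *m T^T *m a) 0 0| <= 12 * S * eps * `|d|.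
  rewrite (le_trans (mxnorm_entry _ _ _))// (le_trans (mxnormM _ _))//.
  apply: (@le_trans _ _ (2%:R * (3%:R * `|d| * 1) * (2 * S * eps))); last by apply: eq_ler; ring.
  rewrite ler_pM ?mulr_ge0// ler_wpM2l// (le_trans (mxnormM _ _))// mxnormT ler_wpM2l// mulr_ge0//.
have h2 : `|b| * `|dot d nu| <= (1 + 12 * S) * eps * `|d|.
  rewrite -normrM (_ : b * _ = dot d n - (d *m T^T *m a) 0 0); last by rewrite dE addrAC subrr add0r.
  rewrite (le_trans (ler_normB _ _))// (le_trans (lerD dn h1))//.
  by apply: eq_ler; ring.
apply: (@le_trans _ _ (2 * `|b| * `|dot d nu|)); first by rewrite ler_peMl.
rewrite -mulrA; apply: (@le_trans _ _ (2 * ((1 + 12 * S) * eps * `|d|))); first by rewrite ler_wpM2l.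
by apply: eq_ler; ring.
Qed.

(** Projection onto the plane of T loses only the small normal part of an edge vector, which is
    absorbed into the left-hand side because 4 S tau <= 1. *)
Lemma flat_low (T E : 'M[R]_(2, 3)) (nu : 'rV[R]_3) (S h tau : R) :
  T *m T^T = 1%:M -> nu *m nu^T = 1%:M -> nu *m T^T = 0 -> 0 < h -> 0 <= S -> 4 * S * tau <= 1 ->
  (forall z, `|z| <= S / h * enorm (z *m E)) -> `|E *m nu^T| <= tau * h ->
  E *m T^T \in unitmx /\ `|invmx (E *m T^T)| <= 2 * S / h.
Proof.
move=> TT nn nT h0 S0 St low En.
have lowb (z : 'rV[R]_2) : `|z| <= 2 * S / h * enorm (z *m (E *m T^T)).
  have := low z; have := enorm_split (z *m E) TT nn nT.
  set A := enorm _; set B := enorm _; set C := `|(_ : R)| => h1 h2.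
  have -> : enorm (z *m (E *m T^T)) = B by rewrite mulmxA.
  have h3 : C <= 2%:R * `|z| * (tau * h).
    rewrite /C -mulmxA (le_trans (mxnorm_entry _ _ _))// (le_trans (mxnormM _ _))// ler_wpM2l// mulr_ge0//.
  have Sh : 0 <= S / h by rewrite divr_ge0// ltW.
  have h4 : S / h * A <= S / h * (B + 2%:R * `|z| * (tau * h)) by rewrite ler_wpM2l// (le_trans h1)// lerD2l.
  have h5 : S / h * (B + 2%:R * `|z| * (tau * h)) = S / h * B + (2 * S * tau) * `|z| by field; rewrite gt_eqF.
  have h6 : 4 * S * tau * `|z| <= 1 * `|z| by rewrite ler_wpM2r.
  rewrite h5 in h4; have h7 := le_trans h2 h4; rewrite -!mulrA in h6 h7 *; lra.
have uE : E *m T^T \in unitmx.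
  rewrite -row_free_unit; apply: inj_row_free => v v0; apply/eqP; rewrite -normr_le0.
  by rewrite (le_trans (lowb v))// v0 /enorm /dot big1 ?sqrtr0 ?mulr0// => i _; rewrite mxE mul0r.
split => //; apply: mxnorm_le => [|i j]; first by rewrite divr_ge0 ?mulr_ge0// ltW.
set M := invmx _; have <- : row i M 0 j = M i j by rewrite mxE.
rewrite (le_trans (mxnorm_entry _ _ _))// (le_trans (lowb _))// -row_mul mulVmx//.
rewrite (_ : enorm _ = 1) ?mulr1// /enorm (_ : dot _ _ = 1) ?sqrtr1//.
rewrite /dot (bigD1 i)//= big1 ?addr0 ?mxE ?mxE ?eqxx ?mulr1//.
by move=> k /negbTE ki; rewrite !mxE eq_sym ki mulr0.
Qed.
End Frames.

(** * Lagrange interpolation *)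

Section Lagrange.
Context {R : realType}.
Implicit Types (x y z : R) (xi : 'rV[R]_2).

(** Generalized binomial coefficient of x over m. The one-dimensional Lagrange factor is [gbin] at k
    t, so identities between basis functions become Vandermonde convolutions. *)
Definition gbin x m : R := (\prod_(a < m) (x - a%:R)) / (m`!)%:R.

Lemma prod_sub_nat m : \prod_(a < m) (m - a)%:R = (m`!)%:R :> R.
Proof.
elim: m => [|m IH]; first by rewrite big_ord0.
rewrite big_ord_recl subn0 factS natrM -IH; congr (_ * _).
Qed.

Lemma lagrange1E k m (t : R) : lagrange1 k m t = gbin (k%:R * t) m.
Proof. by rewrite /lagrange1 /gbin prodf_div prod_sub_nat. Qed.

Lemma gbin0 x : gbin x 0 = 1.
Proof. by rewrite /gbin big_ord0 fact0 divr1. Qed.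

Lemma gbinS x m : m.+1%:R * gbin x m.+1 = (x - m%:R) * gbin x m.
Proof.
rewrite /gbin big_ord_recr /= factS natrM; field.
by rewrite pnatr_eq0 -lt0n fact_gt0 addrC natr1 pnatr_eq0.
Qed.

Lemma gbinS' x m : m.+1%:R * gbin x m.+1 = x * gbin (x - 1) m.
Proof.
rewrite /gbin big_ord_recl /= subr0 factS natrM.
have -> : \prod_(i < m) (x - (fintype.bump 0 i)%:R) = \prod_(i < m) (x - 1 - i%:R).
  by apply: eq_bigr => i _; rewrite /fintype.bump /= natrD; ring.
by field; rewrite pnatr_eq0 -lt0n fact_gt0 addrC natr1 pnatr_eq0.
Qed.

Lemma gbin_nat n : gbin n%:R n = 1.
Proof.
rewrite /gbin -prod_sub_nat (eq_bigr (fun a : 'I_n => (n - a)%:R)) ?divff//.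
  by apply/prodf_neq0 => a _; rewrite pnatr_eq0 -lt0n subn_gt0.
by move=> a _; rewrite natrB// ltnW.
Qed.

(** Multiply by n+1, split this weight as i + (n+1-i), and absorb each half with the recursion
    [gbinS]. *)
Lemma gbin_vandermonde x y n :
  \sum_(i < n.+1) gbin x i * gbin y (n - i) = gbin (x + y) n.
Proof.
elim: n => [|n IH]; first by rewrite big_ord1 !gbin0 mulr1.
have n0 : n.+1%:R != 0 :> R by rewrite pnatr_eq0.
apply: (mulfI n0); rewrite gbinS -IH mulr_sumr.
have -> : \sum_(i < n.+2) n.+1%:R * (gbin x i * gbin y (n.+1 - i)) =
   \sum_(i < n.+2) i%:R * gbin x i * gbin y (n.+1 - i) + \sum_(i < n.+2) gbin x i * ((n.+1 - i)%:R * gbin y (n.+1 - i)).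
  rewrite -big_split /=; apply: eq_bigr => i _; rewrite natrB; last by rewrite -ltnS.
  ring.
rewrite big_ord_recl /= !mul0r add0r [X in _ + X]big_ord_recr /= subnn mul0r mulr0 addr0 -big_split mulr_sumr /=.
apply: eq_bigr => i _; rewrite /fintype.bump /= add1n subSS gbinS.
have ni : (i <= n)%N by rewrite -ltnS.
by rewrite subSn// gbinS natrB//; ring.
Qed.

Lemma gbin_vandermonde_mean x y n :
  \sum_(i < n.+2) i%:R * gbin x i * gbin y (n.+1 - i) = x * gbin (x + y - 1) n.
Proof.
rewrite big_ord_recl /= !mul0r add0r (_ : x + y - 1 = x - 1 + y) -?gbin_vandermonde; last by ring.
rewrite mulr_sumr; apply: eq_bigr => i _; rewrite /fintype.bump /= add1n subSS gbinS'; ring.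
Qed.

Definition lbasis k (i j : nat) xi : R :=
  lagrange1 k i (xi 0 0) * lagrange1 k j (xi 0 1) * lagrange1 k (k - (i + j)) (bary xi ord0).

Lemma sum_narrow k (i : 'I_k.+1) (F : nat -> R) :
  \sum_(j < k.+1 | (i + j <= k)%N) F j = \sum_(j < (k - i).+1) F j.
Proof.
have ik : (i <= k)%N by rewrite -ltnS.
have le : ((k - i).+1 <= k.+1)%N by rewrite ltnS leq_subr.
rewrite (big_ord_widen_cond k.+1 xpredT F le) /=; apply: eq_bigl => j.
by rewrite ltnS leq_subRL.
Qed.

Lemma bary_sum k xi : k%:R * xi 0 0 + (k%:R * xi 0 1 + k%:R * bary xi ord0) = k%:R.
Proof. by rewrite bary0; ring. Qed.

(** Two Vandermonde convolutions: k times the three barycentric coordinates adds up to k, and the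
    binomial coefficient of k over k is 1. *)
Lemma lbasis_sum1 k xi : \sum_(i < k.+1) \sum_(j < k.+1 | (i + j <= k)%N) lbasis k i j xi = 1.
Proof.
rewrite -(gbin_nat k) -[in RHS](bary_sum k xi) -gbin_vandermonde; apply: eq_bigr => i _.
rewrite (sum_narrow i (fun j => lbasis k i j xi)) -gbin_vandermonde mulr_sumr; apply: eq_bigr => j _.
by rewrite /lbasis !lagrange1E subnDA mulrA.
Qed.

Lemma lbasis_mean0 k xi :
  \sum_(i < k.+1) \sum_(j < k.+1 | (i + j <= k)%N) i%:R * lbasis k i j xi = k%:R * xi 0 0.
Proof.
case: k => [|k].
  by rewrite big_ord1 big1 ?mul0r// => j _; rewrite mul0r.
transitivity (\sum_(i < k.+2) i%:R * gbin (k.+1%:R * xi 0 0) i * gbin (k.+1%:R * xi 0 1 + k.+1%:R * bary xi ord0) (k.+1 - i)).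
  apply: eq_bigr => i _.
  rewrite (sum_narrow i (fun j => i%:R * lbasis k.+1 i j xi)) -gbin_vandermonde mulr_sumr; apply: eq_bigr => j _.
  by rewrite /lbasis !lagrange1E subnDA !mulrA.
rewrite gbin_vandermonde_mean bary_sum.
by rewrite (_ : k.+1%:R - 1 = k%:R :> R) ?gbin_nat ?mulr1// -natr1 addrK.
Qed.

Lemma lbasis_mean1 k xi :
  \sum_(i < k.+1) \sum_(j < k.+1 | (i + j <= k)%N) j%:R * lbasis k i j xi = k%:R * xi 0 1.
Proof.
rewrite (exchange_big_dep xpredT)//=.
pose xi' : 'rV[R]_2 := \row_i xi 0 (other i).
have e0 : xi' 0 0 = xi 0 1 by rewrite mxE.
have e1 : xi' 0 1 = xi 0 0 by rewrite mxE.
rewrite -e0 -lbasis_mean0; apply: eq_bigr => j _.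
apply: eq_big => [i|i _]; first by rewrite addnC.
by rewrite /lbasis !bary0 e0 e1 [(j + i)%N]addnC [xi 0 1 + xi 0 0]addrC; ring.
Qed.

Lemma lagrange_interp_aff k (P : 'I_3 -> 'rV[R]_3) xi : (0 < k)%N ->
  lagrange_interp k (aff P) xi = aff P xi.
Proof.
move=> k0; have kn0 : k%:R != 0 :> R by rewrite pnatr_eq0 -lt0n.
transitivity (\sum_(i < k.+1) \sum_(j < k.+1 | (i + j <= k)%N)
   (lbasis k i j xi *: P ord0 + (i%:R * lbasis k i j xi) *: (k%:R^-1 *: row 0 (edgemx P)) +
    (j%:R * lbasis k i j xi) *: (k%:R^-1 *: row 1 (edgemx P)))).
  apply: eq_bigr => i _; apply: eq_bigr => j _; rewrite -/(lbasis k i j xi) /aff.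
  have -> : lagrange_node R k i j *m edgemx P = (i%:R / k%:R) *: row 0 (edgemx P) + (j%:R / k%:R) *: row 1 (edgemx P).
    by apply/rowP => c; rewrite [LHS]mxE sum2 !mxE.
  by rewrite !scalerDr !scalerA !addrA; congr (_ + _ *: _ + _ *: _); ring.
under eq_bigr => i _ do rewrite !big_split /= -!scaler_suml.
rewrite !big_split /= -!scaler_suml lbasis_sum1 lbasis_mean0 lbasis_mean1 scale1r !scalerA.
rewrite !(mulrC k%:R) !mulfK// /aff -addrA; congr (_ + _).
by apply/rowP => c; rewrite [RHS]mxE sum2 !mxE.
Qed.
End Lagrange.

(** * Polynomial maps and perturbation of the interpolated parametrization *)

Section Polynomials.
Context {R : realType}.
Implicit Types (x xi : 'rV[R]_2) (f g : 'rV[R]_2 -> R).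
Local Notation e_ i := (delta_mx 0 i : 'rV[R]_2).

(** Polynomials as an inductive class, so that differentiability, stability under derivation and
    bounds on the triangle follow by induction. *)
Inductive poly2 : ('rV[R]_2 -> R) -> Prop :=
| poly2_cst (c : R) : poly2 (fun=> c)
| poly2_coord (a : 'I_2) : poly2 (fun x => x 0 a)
| poly2_add f g : poly2 f -> poly2 g -> poly2 (fun x => f x + g x)
| poly2_mul f g : poly2 f -> poly2 g -> poly2 (fun x => f x * g x).

Lemma poly2_sum (I : Type) (r : seq I) (p : pred I) (f : I -> 'rV[R]_2 -> R) :
  (forall i, poly2 (f i)) -> poly2 (fun x => \sum_(i <- r | p i) f i x).
Proof.
move=> pf; elim: r => [|i r IH].
  rewrite (_ : (fun x => _) = fun=> 0); first exact: poly2_cst.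
  by apply/funext => x; rewrite big_nil.
case pi: (p i).
  rewrite (_ : (fun x => _) = (fun x => f i x + \sum_(i <- r | p i) f i x)); first exact: poly2_add.
  by apply/funext => x; rewrite big_cons pi.
by rewrite (_ : (fun x => _) = (fun x => \sum_(i <- r | p i) f i x))//; apply/funext => x; rewrite big_cons pi.
Qed.

Lemma poly2_prod (m : nat) (f : 'I_m -> 'rV[R]_2 -> R) :
  (forall i, poly2 (f i)) -> poly2 (fun x => \prod_(i < m) f i x).
Proof.
elim: m f => [|m IH] f pf.
  rewrite (_ : (fun x => _) = fun=> 1); first exact: poly2_cst.
  by apply/funext => x; rewrite big_ord0.
rewrite (_ : (fun x => _) = (fun x => f ord0 x * \prod_(i < m) f (lift ord0 i) x)); first by apply: poly2_mul; last exact: IH.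
by apply/funext => x; rewrite big_ord_recl.
Qed.

Lemma poly2_derive f i : poly2 f -> exists2 g, poly2 g & forall x, is_derive x (e_ i) f (g x).
Proof.
elim=> [c|a|{}f g pf [f' pf' df] pg [g' pg' dg]|{}f g pf [f' pf' df] pg [g' pg' dg]].
- by exists (fun=> 0); [exact: poly2_cst|move=> x; exact: is_derive_cst].
- exists (fun=> e_ i 0 a); first exact: poly2_cst.
  move=> x; apply: is_derive_cvg; apply: cvg_near_cst; near=> h.
  have h0 : h != 0 by near: h; exact: nbhs_dnbhs_neq.
  by rewrite [X in X - _]mxE addrK mxE scalerA mulVf// scale1r.
- exists (fun x => f' x + g' x); first exact: poly2_add.
  by move=> x; exact: (is_deriveD (df x) (dg x)).
exists (fun x => f x * g' x + g x * f' x).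
  by apply: poly2_add; exact: poly2_mul.
by move=> x; exact: (is_deriveM (df x) (dg x)).
Unshelve. all: by end_near.
Qed.

Lemma poly2_differentiable f x : poly2 f -> differentiable f x.
Proof.
elim=> [c|a|{}f g _ df _ dg|{}f g _ df _ dg].
- exact: differentiable_cst.
- exact: differentiable_coord.
- exact: differentiableD.
exact: differentiableM.
Qed.

Lemma poly2_continuous f : poly2 f -> continuous f.
Proof. by move=> pf x; apply: differentiable_continuous; exact: poly2_differentiable. Qed.

Lemma poly2_bounded f : poly2 f -> exists2 B : R, 0 <= B & forall x, Tref x -> `|f x| <= B.
Proof.
elim=> [c|a|{}f g _ [B B0 fB] _ [C C0 gC]|{}f g _ [B B0 fB] _ [C C0 gC]].
- by exists `|c|.
- exists 1 => // x /Tref3[x0 x1 x2]; rewrite ler_norml.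
  by case: (ord2P a) => ->; apply/andP; split; lra.
- by exists (B + C) => [|x Tx]; [exact: addr_ge0|rewrite (le_trans (ler_normD _ _))// lerD ?fB ?gC].
by exists (B * C) => [|x Tx]; [exact: mulr_ge0|rewrite normrM ler_pM ?fB ?gC].
Qed.

Lemma poly2_affine (c a b : R) : poly2 (fun x => c + (x 0 0 * a + x 0 1 * b)).
Proof.
apply: poly2_add; first exact: poly2_cst.
by apply: poly2_add; apply: poly2_mul; [exact: poly2_coord|exact: poly2_cst|exact: poly2_coord|exact: poly2_cst].
Qed.

Lemma poly2_lagrange1 k m f : poly2 f -> poly2 (fun x => lagrange1 k m (f x)).
Proof.
move=> pf; apply: poly2_prod => a; apply: poly2_mul; last exact: poly2_cst.
apply: poly2_add; last exact: poly2_cst.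
by apply: poly2_mul => //; exact: poly2_cst.
Qed.

Lemma poly2_lbasis k i j : poly2 (@lbasis R k i j).
Proof.
apply: poly2_mul; first by apply: poly2_mul; apply: poly2_lagrange1; exact: poly2_coord.
apply: poly2_lagrange1; rewrite (_ : (fun x => _) = (fun x => 1 + (x 0 0 * -1 + x 0 1 * -1))); first exact: poly2_affine.
by apply/funext => x; rewrite bary0; ring.
Qed.

Lemma jacobianE (X : 'rV[R]_2 -> 'rV[R]_3) (a : 'I_2) (c : 'I_3) x :
  (forall c, poly2 (fun x => X x 0 c)) -> jacobian X x a c = pd a (fun x => X x 0 c) x.
Proof.
move=> pX.
have XE : X = \sum_(c < 3) (fun x => X x 0 c *: (delta_mx 0 c : 'rV[R]_3)).
  apply/funext => y; rewrite fct_sumE; exact: row_sum_delta.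
have dX : differentiable X x.
  rewrite XE; apply: differentiable_sum => c'; apply: differentiableZl.
  exact: poly2_differentiable.
have := deriveEjacobian (e_ a) dX; rewrite -rowE => /(congr1 (fun M : 'rV[R]_3 => M 0 c)).
rewrite [in RHS]mxE => <-; rewrite derive_mx; first by rewrite mxE.
exact: diff_derivable.
Qed.

Lemma derivable_poly2 f i x : poly2 f -> derivable f x (e_ i).
Proof. by move=> /(poly2_derive i)[g _ /(_ x) []]. Qed.

Lemma pd_poly2 f i : poly2 f -> poly2 (pd i f).
Proof. by move=> /(poly2_derive i)[g pg df]; rewrite (pdE df). Qed.

Lemma lagrange_node_Tref k i j : (0 < k)%N -> (i + j <= k)%N -> Tref (lagrange_node R k i j).
Proof.
move=> k0 ij; have kp : 0 < k%:R :> R by rewrite ltr0n.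
apply/Tref3; rewrite !mxE /=; split; rewrite ?divr_ge0//.
by rewrite -mulrDl ler_pdivrMr// mul1r -natrD ler_nat.
Qed.

Lemma is_derive_lincomb (I : finType) (b : I -> 'rV[R]_2 -> R) (w : I -> R) i x :
  (forall t, poly2 (b t)) ->
  is_derive x (e_ i) (fun y => \sum_t b t y * w t) (\sum_t pd i (b t) x * w t).
Proof.
move=> pb; elim: (index_enum I) => [|t s IH].
  rewrite big_nil (_ : (fun y => _) = cst 0); first exact: is_derive_cst.
  by apply/funext => y; rewrite big_nil.
rewrite big_cons (_ : (fun y => _) = (fun y => w t * b t y) + (fun y => \sum_(t <- s) b t y * w t)); last first.
  by apply/funext => y; rewrite big_cons mulrC.
apply: is_deriveD => //; rewrite mulrC; apply: is_deriveZ.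
by apply: DeriveDef => //; exact: derivable_poly2.
Qed.

(** Interpolation of positive order reproduces affine maps, so the interpolant differs from [aff P]
    by basis functions weighted with nodal errors of size d. The basis lives on the reference
    triangle, hence C depends on k only. *)
Lemma lagrange_perturbation k : (0 < k)%N -> exists2 C : R, 0 <= C &
  forall (P : 'I_3 -> 'rV[R]_3) (F : 'rV[R]_2 -> 'rV[R]_3) (d : R), 0 <= d ->
    (forall xi, Tref xi -> `|F xi - aff P xi| <= d) ->
  exists r : 'I_2 -> 'I_3 -> 'rV[R]_2 -> R, [/\
    forall a c, poly2 (r a c),
    forall xi, jacobian (lagrange_interp k F) xi = edgemx P + \matrix_(a, c) r a c xi,
    forall a c xi, Tref xi -> `|r a c xi| <= C * d &
    forall i a c xi, Tref xi -> `|pd i (r a c) xi| <= C * d].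
Proof.
move=> k0.
have /choice [B HB] (t : 'I_k.+1 * 'I_k.+1) : exists B : R, 0 <= B /\ forall xi, Tref xi ->
    (forall a, `|pd a (@lbasis R k t.1 t.2) xi| <= B) /\ forall i a, `|pd i (pd a (@lbasis R k t.1 t.2)) xi| <= B.
  have pb := poly2_lbasis k t.1 t.2; set b := lbasis _ _ _ in pb *.
  have pb1 a := pd_poly2 a pb; have pb2 i a := pd_poly2 i (pb1 a).
  have /choice [B1 HB1] a : exists B, 0 <= B /\ forall x, Tref x -> `|pd a b x| <= B.
    by have [B ? ?] := poly2_bounded (pb1 a); exists B.
  have /choice [B2 HB2] (ia : 'I_2 * 'I_2) : exists B, 0 <= B /\ forall x, Tref x -> `|pd ia.1 (pd ia.2 b) x| <= B.
    by have [B ? ?] := poly2_bounded (pb2 ia.1 ia.2); exists B.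
  have s1 a : 0 <= \sum_(l | l != a) B1 l by apply: sumr_ge0 => l _; case: (HB1 l).
  have t1 : 0 <= \sum_l B1 l by apply: sumr_ge0 => l _; case: (HB1 l).
  have s2 a : 0 <= \sum_(l | l != a) B2 l by apply: sumr_ge0 => l _; case: (HB2 l).
  have t2 : 0 <= \sum_l B2 l by apply: sumr_ge0 => l _; case: (HB2 l).
  exists (\sum_l B1 l + \sum_l B2 l); split; first exact: addr_ge0.
  move=> xi Txi; split => [a|i a].
    apply: (le_trans ((HB1 a).2 xi Txi)); rewrite (bigD1 a)//= -addrA lerDl addr_ge0//.
  apply: (le_trans ((HB2 (i, a)).2 xi Txi)); rewrite [X in _ + X](bigD1 (i, a))//= addrCA lerDl addr_ge0//.
exists (\sum_(t : 'I_k.+1 * 'I_k.+1) B t); first by apply: sumr_ge0 => t _; case: (HB t).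
move=> P F d d0 Fd.
(* Nodes are indexed by the whole square; the error is set to 0 outside the range i + j <= k. *)
pose delta (t : 'I_k.+1 * 'I_k.+1) : 'rV[R]_3 :=
  if (t.1 + t.2 <= k)%N then F (lagrange_node R k t.1 t.2) - aff P (lagrange_node R k t.1 t.2) else 0.
have dd t c : `|delta t 0 c| <= d.
  apply: le_trans (mxnorm_entry _ _ _) _; rewrite /delta; case: ifP => [tk|_]; last by rewrite normr0.
  by apply: Fd; exact: lagrange_node_Tref.
pose b (t : 'I_k.+1 * 'I_k.+1) := @lbasis R k t.1 t.2.
have pb t : poly2 (b t) by exact: poly2_lbasis.
have XE xi : lagrange_interp k F xi = aff P xi + \sum_t b t xi *: delta t.
  rewrite -(lagrange_interp_aff P xi k0) /lagrange_interp !pair_big_dep /=.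
  rewrite [X in _ + X](bigID (fun t : 'I_k.+1 * 'I_k.+1 => (t.1 + t.2 <= k)%N)) /= [X in _ + (_ + X)]big1 ?addr0.
    rewrite -big_split /=; apply: eq_bigr => t tk.
    by rewrite -/(lbasis k t.1 t.2 xi) -/(b t xi) /delta tk -scalerDr addrC subrK.
  by move=> t /negbTE tk; rewrite /delta tk scaler0.
have Xc c : (fun xi => lagrange_interp k F xi 0 c) =
   fun xi => (P ord0 0 c + (xi 0 0 * edgemx P 0 c + xi 0 1 * edgemx P 1 c)) + \sum_t b t xi * delta t 0 c.
  apply/funext => xi; rewrite XE /aff mxE [X in X + _]mxE [X in _ + X + _]mxE sum2; congr (_ + _).
  by rewrite summxE; apply: eq_bigr => t _; rewrite mxE.
have pX c : poly2 (fun xi => lagrange_interp k F xi 0 c).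
  rewrite Xc; apply: poly2_add; first exact: poly2_affine.
  by apply: poly2_sum => t; apply: poly2_mul => //; exact: poly2_cst.
pose r a c xi := \sum_t pd a (b t) xi * delta t 0 c.
exists r; split.
- by move=> a c; apply: poly2_sum => t; apply: poly2_mul; [exact: pd_poly2|exact: poly2_cst].
- move=> xi; apply/matrixP => a c; rewrite jacobianE// mxE [X in _ = _ + X]mxE Xc.
  have dsum : is_derive xi (e_ a) (fun y => \sum_t b t y * delta t 0 c) (r a c xi).
    exact: is_derive_lincomb.
  have daff : is_derive xi (e_ a) (fun y => P ord0 0 c + (y 0 0 * edgemx P 0 c + y 0 1 * edgemx P 1 c)) (edgemx P a c).
    apply: is_derive_cvg; apply: cvg_near_cst; near=> h.
    have h0 : h != 0 by near: h; exact: nbhs_dnbhs_neq.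
    have e j : (h *: e_ a + xi) 0 j = h * (a == j)%:R + xi 0 j by rewrite !mxE eqxx /= eq_sym.
    by rewrite !e; case: (ord2P a) => -> /=; rewrite /GRing.scale /=; field.
  by have [_ <-] := is_deriveD daff dsum.
- move=> a c xi Txi; rewrite /r mulr_suml (le_trans (ler_norm_sum _ _ _))//; apply: ler_sum => t _.
  by rewrite normrM ler_pM//; have [_ /(_ xi Txi) []] := HB t.
move=> i a c xi Txi.
have -> : pd i (r a c) xi = \sum_t pd i (pd a (b t)) xi * delta t 0 c.
  by have [_ <-] := is_derive_lincomb (fun t => delta t 0 c) i xi (fun t => pd_poly2 a (pb t)).
rewrite mulr_suml (le_trans (ler_norm_sum _ _ _))//; apply: ler_sum => t _.
by rewrite normrM ler_pM//; have [_ /(_ xi Txi) []] := HB t.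
Unshelve. all: by end_near.
Qed.
End Polynomials.

(** * Macroelements *)

Section MacroGeometry.
Context {R : realType} (M : mesh R) (w : macro M).
Hypothesis tM : triangulated_surface M.
Hypothesis mw : is_macro w.
Implicit Types (x y : 'rV[R]_2) (k l j : 'I_(nel M)).

Let fE k : row_free (edgemx (@vert R M k)).
Proof. by case: tM => + _ _ _; apply. Qed.

(** The rows of tk span the plane of the element, so edges are combinations of them, and the
    prescribed coordinate formula becomes d |-> d T^T, with T the frame [mtan w]. *)
Lemma mflat_edge k (z : 'rV[R]_2) (p q : 'rV[R]_3) : k \in mel w -> tri (vert k) p -> tri (vert k) q ->
  q - p = z *m edgemx (vert k) -> mflat w q - mflat w p = z *m (edgemx (vert k) *m (mtan w)^T).
Proof.
move=> kw kp kq e; have [_ _ _ /(_ k kw) [ft H] _] := mw.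
set E := edgemx (vert k) in e *; set tk := mtan w *m tanproj E in ft H.
have nn := unormal_unit (gram_unit (fE k)); have En := unormal_orth E.
have tn : tk *m (unormal E)^T = 0.
  by rewrite -mulmxA /tanproj mulmxBl mul1mx -mulmxA nn mulmx1 subrr mulmx0.
have EC := row_free_full ft nn tn En; set C := _ *m invmx _ in EC.
rewrite (H p q (z *m C)) //; last by rewrite e {1}EC mulmxA.
by rewrite trmx_mul trmxK -mulmxA; congr (_ *m _); rewrite mulmxA -EC.
Qed.

Lemma tri_aff m (P : 'I_3 -> 'rV[R]_m) x : Tref x -> tri P (aff P x).
Proof. by move=> Tx; exists x. Qed.

Lemma fvert_edge k : k \in mel w -> edgemx (fvert w k) = edgemx (vert k) *m (mtan w)^T.
Proof.
move=> kw; apply/row_matrixP => a; rewrite rowK.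
have := @mflat_edge k (delta_mx 0 a) _ _ kw (vert_tri (vert k) ord0) (vert_tri (vert k) (lift ord0 a)).
by rewrite -!rowE rowK => /(_ erefl).
Qed.

Lemma mflat_aff k x : k \in mel w -> Tref x -> mflat w (aff (vert k) x) = aff (fvert w k) x.
Proof.
move=> kw Tx.
have := @mflat_edge k x _ _ kw (vert_tri (vert k) ord0) (tri_aff (vert k) Tx).
rewrite {1}/aff addrAC subrr add0r => /(_ erefl) /eqP; rewrite subr_eq => /eqP ->.
by rewrite /aff fvert_edge// addrC.
Qed.

Lemma aff_vert_inj k : injective (aff (@vert R M k)).
Proof. by move=> x y /addrI /(row_free_inj (fE k)). Qed.

Lemma mflat_tri_inj k l x y : k \in mel w -> l \in mel w -> Tref x -> Tref y ->
  aff (fvert w k) x = aff (fvert w l) y -> aff (vert k) x = aff (vert l) y.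
Proof.
move=> kw lw Tx Ty; rewrite -!mflat_aff//; have [_ _ _ _ [_ inj]] := mw; apply: inj.
  by apply/mem_set; exists k => //; exact: tri_aff.
by apply/mem_set; exists l => //; exact: tri_aff.
Qed.

(** Distinct elements meet in a proper face, on which some barycentric coordinate vanishes, whereas
    all of them are positive at x. *)
Lemma flat_disjoint k l x y : k \in mel w -> l \in mel w -> iTref x -> Tref y ->
  aff (fvert w k) x = aff (fvert w l) y -> k = l.
Proof.
move=> kw lw iTx Ty; have Tx := iTref_sub iTx => /(mflat_tri_inj kw lw Tx Ty) e.
have [//|kl] := eqVneq k l; exfalso; have [_ /(_ k l kl) [c3 I] _ _] := tM.
have : (tri (vert k) `&` tri (vert l)) (aff (vert k) x).
  by split; [exact: tri_aff|rewrite e; exact: tri_aff].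
rewrite I => -[z [_ z0] /aff_vert_inj zx].
have [m mc] : exists m, m \notin common k l.
  apply/existsP; rewrite -negb_forall; apply: contraL c3 => /forallP H.
  by rewrite (_ : common k l = [set: 'I_3]%SET) ?cardsT ?card_ord//; apply/setP => m; rewrite H inE.
by have := z0 m mc; rewrite zx; have /iTrefP /(_ m) := iTx => /lt0r_neq0 /eqP.
Qed.

Lemma macro_barP y : macro_bar w y <-> exists2 k, k \in mel w & (aff (fvert w k) @` @Tref R) y.
Proof.
split => [[_ [k kw [x Tx <-]] <-]|[k kw [x Tx <-]]].
  by exists k => //; exists x => //; rewrite mflat_aff.
by exists (aff (vert k) x); [exists k => //; exact: tri_aff|rewrite mflat_aff].
Qed.

Hypothesis nondeg : forall k, k \in mel w -> \det (edgemx (fvert w k)) != 0.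

Lemma open_aff_image (P : 'I_3 -> 'rV[R]_2) (O : set 'rV[R]_2) : \det (edgemx P) != 0 -> open O -> open (aff P @` O).
Proof.
move=> D0 oO; rewrite (_ : aff P @` O = affinv P @^-1` O).
  by apply: open_comp => // x _; exact: continuous_affinv.
apply/seteqP; split => [_ [x Ox <-]|y Oy]; rewrite /= ?affK//.
by exists (affinv P y) => //; rewrite affinvK.
Qed.

Lemma macro_interior k x : k \in mel w -> iTref x -> interior (macro_bar w) (aff (fvert w k) x).
Proof.
move=> kw Tx; have oI := open_aff_image (nondeg kw) (@open_iTref R).
have Ix : (aff (fvert w k) @` iTref) (aff (fvert w k) x) by exists x.
apply: filterS (open_nbhs_nbhs (conj oI Ix)) => _ [z Tz <-].
by apply/macro_barP; exists k => //; exists z => //; exact: iTref_sub.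
Qed.

Lemma compact_macro_bar : compact (macro_bar w).
Proof.
have -> : macro_bar w = \big[setU/set0]_(k <- index_enum 'I_(nel M) | k \in mel w) (aff (fvert w k) @` @Tref R).
  apply/seteqP; split => y.
    by move=> /macro_barP [k kw Hk]; rewrite -bigcup_seq_cond; exists k => //=; rewrite kw mem_index_enum.
  by rewrite -bigcup_seq_cond => -[k /= /andP[_ kw] Hk]; apply/macro_barP; exists k.
apply: bigsetU_compact => k _; apply: continuous_compact; last exact: compact_Tref.
by apply: continuous_subspaceT; exact: continuous_aff.
Qed.

Lemma fresh_value (s : seq R) (a b : R) : a < b -> exists2 c, a < c < b & c \notin s.
Proof.
elim: s a b => [|x s IH] a b ab; first by exists ((a + b) / 2) => //; apply/andP; split; lra.
set m := (a + b) / 2; have [xm|mx] := leP m x.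
  have am : a < m by rewrite /m; lra.
  have [c /andP[ac cm] cs] := IH a m am; exists c; first by apply/andP; split => //; rewrite (lt_trans cm)// /m; lra.
  by rewrite inE negb_or cs andbT lt_eqF// (lt_le_trans cm).
have mb : m < b by rewrite /m; lra.
have [c /andP[ac cm] cs] := IH m b mb; exists c; first by apply/andP; split => //; rewrite (lt_trans _ ac)// /m; lra.
by rewrite inE negb_or cs andbT gt_eqF// (lt_trans mx).
Qed.

(* Leaving the triangle at once when moving in the direction e_0 from a point
   that is not at the height of a vertex. *)
Lemma triangle_exit (P : 'I_3 -> 'rV[R]_2) x : \det (edgemx P) != 0 -> Tref x ->
  (forall a, aff P x 0 1 != P a 0 1) ->
  (forall t : R, 0 < t -> ~ tri P (aff P x + t *: delta_mx 0 0)) ->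
  exists m, [/\ bary x m = 0, forall i, i != m -> 0 < bary x i &
    exists2 d : R, 0 < d & forall t, 0 < t -> t < d -> (aff P @` iTref) (aff P x - t *: delta_mx 0 0)].
Proof.
move=> D0 Tx hv ex.
set E := edgemx P in D0; pose s : 'rV[R]_2 := delta_mx 0 0 *m invmx E.
have uE : E \in unitmx by rewrite unitmxE unitfE.
have mv t : aff P x + t *: delta_mx 0 0 = aff P (x + t *: s).
  by rewrite /aff mulmxDl -scalemxAl /s mulmxKV// addrA.
pose sg (i : 'I_3) := if unlift ord0 i is Some a then s 0 a else - (s 0 0 + s 0 1).
have bE t i : bary (x + t *: s) i = bary x i + t * sg i.
  move: i; apply: forall_I3 => [|a]; rewrite /sg ?unlift_none ?liftK.
    by rewrite !bary0 !mxE; ring.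
  by rewrite !baryS !mxE.
(* A positive coordinate stays positive over displacements shorter than [d i]; the value 1 for
   vanishing coordinates is a dummy. *)
pose d i := if 0 < bary x i then bary x i / (`|sg i| + 1) else 1.
have sp i : 0 < `|sg i| + 1 by rewrite ltr_pwDr.
have d0 i : 0 < d i by rewrite /d; case: ifP => // b0; rewrite divr_gt0.
have dP i t : 0 < bary x i -> `|t| < d i -> 0 < bary x i + t * sg i.
  rewrite /d => b0; rewrite b0 ltr_pdivlMr// mulrDr mulr1 -normrM => h.
  have h1 := ler_norm (- (t * sg i)); rewrite normrN in h1.
  by have := normr_ge0 t; lra.
pose dm := Num.min (d 0) (Num.min (d 1) (d 2)).
have dm0 : 0 < dm by rewrite !lt_min !d0.
have dmi i : dm <= d i by case: (ord3P i) => ->; rewrite !ge_min lexx ?orbT.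
have [m [bm sm]] : exists m, bary x m = 0 /\ sg m < 0.
  apply: contrapT => nm; have t2 : 0 < dm / 2 by lra.
  apply: (ex _ t2); rewrite mv; exists (x + (dm / 2) *: s) => // i; rewrite bE.
  have [b0|] := ltP 0 (bary x i).
    by apply/ltW; apply: dP => //; rewrite gtr0_norm// (lt_le_trans _ (dmi i))//; lra.
  move=> b0; have b00 : bary x i = 0 by apply/eqP; rewrite eq_le b0 Tx.
  rewrite b00 add0r; apply: mulr_ge0; first exact: ltW t2.
  by rewrite leNgt; apply/negP => si; apply: nm; exists i.
have hE : aff P x 0 1 = \sum_(i < 3) bary x i * P i 0 1.
  rewrite [RHS]big_ord_recl sum2 !baryS bary0 /aff mxE [X in _ + X]mxE sum2 !mxE; ring.
have sumb : bary x 0 + bary x 1 + bary x 2 = 1 by rewrite -sum3 big_ord_recl sum2 !baryS bary0; ring.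
(* A second vanishing coordinate would put the point at a vertex, which its height excludes. *)
have pos i : i != m -> 0 < bary x i.
  move=> im; rewrite lt_neqAle Tx andbT eq_sym; apply/eqP => bi.
  have [l [li lm]] : exists l : 'I_3, l != i /\ l != m.
    by case: (ord3P i) im => ->; case: (ord3P m) => -> // _; [exists 2|exists 1|exists 2|exists 0|exists 1|exists 0].
  have bl : forall j : 'I_3, j != l -> bary x j = 0.
    move=> j jl; move: im li lm jl bi bm.
    by case: (ord3P i) => ->; case: (ord3P m) => ->; case: (ord3P l) => ->; case: (ord3P j) => -> //.
  have b1 : bary x l = 1.
    move: sumb bl; case: (ord3P l) => -> sb bl.
    - by rewrite (bl 1)// (bl 2)// !addr0 in sb.
    - by rewrite (bl 0)// (bl 2)// addr0 add0r in sb.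
    by rewrite (bl 0)// (bl 1)// !add0r in sb.
  have /eqP := hv l; apply; rewrite hE (bigD1 l)//= big1 ?addr0 ?b1 ?mul1r//.
  by move=> j /bl ->; rewrite mul0r.
exists m; split => //; exists dm => // t t0 td; exists (x + (- t) *: s); last by rewrite -mv scaleNr.
apply/iTrefP => i; rewrite bE; have [->|im] := eqVneq i m.
  by rewrite bm add0r mulNr -mulrN mulr_gt0// oppr_gt0.
by apply: dP; [exact: pos|rewrite normrN gtr0_norm// (lt_le_trans td)].
Qed.

(* The rightmost point of the flat macroelement at a height avoiding all vertices
   lies inside an edge; if a second element shared this edge, both would contain
   the points immediately to its left. *)
Lemma outer_edge_exists : exists k (A : {set 'I_3}), outer_edge w k A.
Proof.
apply: contrapT => none.
have full k (A : {set 'I_3}) : k \in mel w -> #|A| = 2%N -> exists2 j, j \in mel w & common k j = A.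
  move=> kw A2; apply: contrapT => nj; apply: none; exists k, A; split => // j jw e.
  by apply: nj; exists j.
have [bw _ _ _ _] := mw.
pose s : seq R := flatten [seq [seq fvert w k a 0 1 | a <- enum 'I_3] | k <- enum 'I_(nel M)].
have ins k a : fvert w k a 0 1 \in s.
  apply/flattenP; exists [seq fvert w k a 0 1 | a <- enum 'I_3]; first by apply/mapP; exists k; rewrite ?mem_enum.
  by apply/mapP; exists a; rewrite ?mem_enum.
(* The open base element contains points at all heights of some interval, and one of these heights
   avoids the finitely many vertices. *)
have [c cs [y0 [y0K y0c]]] : exists2 c, c \notin s & exists y, macro_bar w y /\ y 0 1 = c.
  have oI := open_aff_image (nondeg bw) (@open_iTref R).
  set z := aff (fvert w (mbase w)) (@centerT R).
  have Iz : (aff (fvert w (mbase w)) @` iTref) z by exists (@centerT R) => //; exact: iTref_center.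
  have /nbhs_ballP [r /= r0 rI] := open_nbhs_nbhs (conj oI Iz).
  have [|c /andP[c0 c1] cs] := @fresh_value s (z 0 1) (z 0 1 + r); first by rewrite ltrDl.
  exists c => //; exists (\row_i (if i == 0 then z 0 0 else c)); split; last by rewrite mxE.
  apply/macro_barP; exists (mbase w) => //.
  have /rI [x Tx <-] : ball z r (\row_i (if i == 0 then z 0 0 else c)).
    split => // i j; rewrite ord1 /ball /= mxE; case: (ord2P j) => -> /=; first by rewrite subrr normr0.
    by rewrite ltr0_norm; lra.
  by exists x => //; exact: iTref_sub.
pose L := macro_bar w `&` [set y : 'rV[R]_2 | y 0 1 = c].
have cL : compact L.
  apply: (subclosed_compact _ compact_macro_bar); last by move=> y [].
  apply: closedI; first by apply: compact_closed; [exact: norm_hausdorff|exact: compact_macro_bar].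
  apply: (@closed_comp _ _ (fun y : 'rV[R]_2 => y 0 1) [set t | t = c]); last exact: closed_eq.
  by move=> y _; exact: coord_continuous.
have [||y /set_mem [yK yc] ymax] := @compact_EVT_max _ R (fun y : 'rV[R]_2 => y 0 0) L _ cL.
- by exists y0.
- by apply: continuous_subspaceT => x; exact: coord_continuous.
have out t : 0 < t -> ~ macro_bar w (y + t *: delta_mx 0 0).
  move=> t0 Kt; have := ymax (y + t *: delta_mx 0 0); rewrite !mxE /= mulr1.
  have Lt : (y + t *: delta_mx 0 0) \in L by apply/mem_set; split => //; rewrite /= !mxE /= mulr0 addr0.
  by move=> /(_ Lt); rewrite gerDl leNgt t0.
have exit k x : k \in mel w -> Tref x -> aff (fvert w k) x = y ->
    exists m, [/\ bary x m = 0, forall i, i != m -> 0 < bary x i &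
      exists2 d : R, 0 < d & forall t, 0 < t -> t < d -> (aff (fvert w k) @` iTref) (y - t *: delta_mx 0 0)].
  move=> kw Tx xy; rewrite -xy; apply: triangle_exit => //; first exact: nondeg.
    by move=> a; rewrite xy yc; apply: contra cs => /eqP ->; exact: ins.
  by move=> t t0 [z Tz zE]; apply: (out t t0); rewrite -xy -zE; apply/macro_barP; exists k => //; exists z.
have /macro_barP [k kw [x Tx xy]] := yK.
have [m [bm bi [d d0 dk]]] := exit k x kw Tx xy.
have [j jw kj] := full k (~: [set m])%SET kw (etrans (cardsC1 m) (congr1 predn (card_ord 3))).
have knj : k != j.
  apply/eqP => e; have : m \in common k k by rewrite inE; apply/existsP; exists m.
  by rewrite {2}e kj in_setC1 eqxx.
have [z Tz zx] : tri (vert j) (aff (vert k) x).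
  have [_ /(_ k j knj) [_ I] _ _] := tM.
  suff : (tri (vert k) `&` tri (vert j)) (aff (vert k) x) by case.
  rewrite I; exists x => //; split => // i; rewrite kj in_setC1 negbK => /eqP ->; exact: bm.
have zy : aff (fvert w j) z = y by rewrite -mflat_aff// zx mflat_aff.
have [m' [_ _ [d' d'0 dj]]] := exit j z jw Tz zy.
pose t := Num.min d d' / 2.
have dd : 0 < Num.min d d' by rewrite lt_min d0.
have t0 : 0 < t by rewrite divr_gt0.
have td : t < d by rewrite (@lt_le_trans _ _ (Num.min d d'))// ?ge_min ?lexx// /t; lra.
have td' : t < d' by rewrite (@lt_le_trans _ _ (Num.min d d'))// ?ge_min ?lexx ?orbT// /t; lra.
have [u Tu uy] := dk t t0 td; have [u' Tu' uy'] := dj t t0 td'.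
by move: knj; rewrite (flat_disjoint kw jw Tu (iTref_sub Tu') (etrans uy (esym uy'))) eqxx.
Qed.

End MacroGeometry.

(** * Number of elements and chains of elements in a macroelement *)

Section MacroChains.
Context {R : realType}.

(** Each element of w' is the image of an element of w, found at a preimage of its centre. A centre
    lies in one element only, so the choice is injective. Finitely many representatives thus bound
    the size of all macroelements. *)
Lemma macro_equiv_card (M M' : mesh R) (w : macro M) (w' : macro M') :
  triangulated_surface M -> triangulated_surface M' -> is_macro w -> is_macro w' ->
  macro_equiv w w' -> (#|mel w'| <= #|mel w|)%N.
Proof.
move=> tM tM' mw mw' [psi [[_ _ psi_surj] _ H]].
have center_uniq k l : k \in mel w' -> l \in mel w' -> tri (fvert w' l) (aff (fvert w' k) (@centerT R)) -> k = l.
  by move=> kw lw [x Tx e]; apply: (flat_disjoint tM' mw' kw lw (@iTref_center R) Tx).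
have /choice [f fP] (k' : 'I_(nel M')) : exists k : 'I_(nel M), k' \in mel w' ->
    k \in mel w /\ psi @` tri (fvert w k) = tri (fvert w' k').
  have [k'w|nk] := boolP (k' \in mel w'); last by exists (mbase w).
  have Ky : macro_bar w' (aff (fvert w' k') (@centerT R)).
    apply/(macro_barP tM' mw'); exists k' => //; exists (@centerT R) => //.
    exact: iTref_sub (@iTref_center R).
  have [x /(macro_barP tM mw) [k kw [z Tz zx]] xy] := psi_surj _ Ky.
  have [[k'' k''w e] _] := H k kw; exists k => _; split => //.
  rewrite e; congr (tri (fvert w' _)); apply/esym; apply: center_uniq => //.
  by rewrite -e; exists x => //; rewrite -zx; exists z.
rewrite -(card_in_imset (f := f)).
  by apply: subset_leq_card; apply/fintype.subsetP => _ /imsetP [k kw ->]; have [] := fP k kw.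
move=> k l kw lw fkl; apply: center_uniq => //.
have [_ <-] := fP l lw; rewrite -fkl; have [_ ->] := fP k kw.
by exists (@centerT R) => //; exact: iTref_sub (@iTref_center R).
Qed.

(** Consecutive elements of an adjacency path share a vertex, so along the path the value changes by
    at most the oscillation on each element. The path is shortened to visit every element once,
    whence the sum over the macroelement. *)
Lemma chain_bound (M : mesh R) (w : macro M) (v : bfun M R) (o : 'I_(nel M) -> R)
  (k0 : 'I_(nel M)) (x0 : 'rV[R]_2) :
  is_macro w -> (forall k, 0 <= o k) ->
  (forall i j, edge_adjacent i j -> forall x y, Tref x -> Tref y ->
    aff (vert i) x = aff (vert j) y -> v i x = v j y) ->
  (forall k x y, k \in mel w -> Tref x -> Tref y -> `|v k x - v k y| <= o k) ->
  k0 \in mel w -> Tref x0 -> v k0 x0 = 0 ->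
  forall k x, k \in mel w -> Tref x -> `|v k x| <= \sum_(l in mel w) o l.
Proof.
move=> [_ conn _ _ _] o0 vS osc k0w Tx0 v0 k x kw Tx.
set e := (fun a b : 'I_(nel M) => [&& a \in mel w, b \in mel w & edge_adjacent a b]) in conn.
have vertT m (P : 'I_3 -> 'rV[R]_m) a : exists2 y, Tref y & aff P y = P a by have [y ? ?] := vert_tri P a; exists y.
have walk p : forall k1, path e k1 p -> k1 \in mel w -> forall y z, Tref y -> Tref z ->
    `|v (last k1 p) y| <= `|v k1 z| + \sum_(l <- k1 :: p) o l /\ all (mem (mel w)) (k1 :: p).
  elim: p => [|l p IH] k1 /=.
    move=> _ k1w y z Ty Tz; rewrite big_seq1 k1w; split => //.
    by rewrite -[v k1 y](subrK (v k1 z)) addrC (le_trans (ler_normD _ _))// lerD2l osc.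
  move=> /andP[/and3P[_ lw adj] pp] k1w y z Ty Tz.
  have [a] : exists a, a \in common k1 l by apply/card_gt0P; rewrite (eqP adj).
  rewrite inE => /existsP [b /eqP ab].
  have [s Ts sa] := vertT _ (vert k1) a; have [t Tt tb] := vertT _ (vert l) b.
  have vst : v k1 s = v l t by apply: (vS k1 l adj) => //; rewrite sa tb.
  have [IH1 IH2] := IH l pp lw y t Ty Tt; split; last by rewrite k1w.
  rewrite big_cons (le_trans IH1)// addrA lerD2r -vst -[v k1 s](subrK (v k1 z)) [leRHS]addrC.
  by rewrite (le_trans (ler_normD _ _))// lerD2r osc.
have /connectP [p pp kl] := conn k0 k k0w kw.
case: (shortenP pp) kl => q qp uq _ ->.
have [h1 h2] := walk q k0 qp k0w x x0 Tx Tx0.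
rewrite (le_trans h1)// v0 normr0 add0r big_uniq//=.
rewrite [leRHS](bigID (mem (k0 :: q)))/= (eq_bigl (fun l => (l \in mel w) && (l \in k0 :: q))); last first.
  by move=> l; case lq: (l \in k0 :: q); rewrite ?andbF ?andbT//; have /allP /(_ l lq) := h2.
by rewrite lerDl sumr_ge0.
Qed.
End MacroChains.

(** * Surface calculus near a fixed plane *)

Section NearConstant.
Context {R : realType}.
Implicit Types (x : 'rV[R]_2) (g f : 'rV[R]_2 -> R) (e c : R).
Local Notation e_ i := (delta_mx 0 i : 'rV[R]_2).

(** A C^1 perturbation of the constant c: one number e bounds both the deviation and the first
    derivatives, which makes the notion stable under sums, products and inverses with explicit
    factors. *)
Definition near1 e c g : Prop := exists dg : 'I_2 -> 'rV[R]_2 -> R, forall x, iTref x ->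
  [/\ {for x, continuous g}, `|g x - c| <= e &
   forall i, [/\ is_derive x (e_ i) g (dg i x), {for x, continuous (dg i)} & `|dg i x| <= e]].

Lemma near1_ge0 e c g : near1 e c g -> 0 <= e.
Proof. by move=> [dg /(_ _ (@iTref_center R)) [_ h _]]; exact: le_trans h. Qed.

Lemma near1_cst c : near1 0 c (fun=> c).
Proof.
exists (fun _ _ => 0) => x _; split; [exact: cst_continuous|by rewrite subrr normr0|].
by move=> i; split; [exact: is_derive_cst|exact: cst_continuous|rewrite normr0].
Qed.

Lemma near1W e e' c g : e <= e' -> near1 e c g -> near1 e' c g.
Proof.
move=> ee [dg H]; exists dg => x Tx; have [h1 h2 h3] := H x Tx; split => //; first exact: le_trans ee.
by move=> i; have [? ? h] := h3 i; split => //; exact: le_trans ee.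
Qed.

Lemma near1D e e' c c' g g' : near1 e c g -> near1 e' c' g' -> near1 (e + e') (c + c') (fun x => g x + g' x).
Proof.
move=> [dg H] [dg' H']; exists (fun i x => dg i x + dg' i x) => x Tx.
have [h1 h2 h3] := H x Tx; have [k1 k2 k3] := H' x Tx; split.
- exact: (@continuousD R R _ g g').
- by rewrite opprD addrACA (le_trans (ler_normD _ _))// lerD.
move=> i; have [h4 h5 h6] := h3 i; have [k4 k5 k6] := k3 i; split.
- exact: (is_deriveD h4 k4).
- exact: (@continuousD R R _ (dg i) (dg' i)).
- by rewrite (le_trans (ler_normD _ _))// lerD.
Qed.

(** Both functions stay below 3, and each of the two terms of the product rule costs 3 e. *)
Lemma near1M e c c' g g' : e <= 1 -> `|c| <= 2 -> `|c'| <= 2 -> near1 e c g -> near1 e c' g' ->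
  near1 (6 * e) (c * c') (fun x => g x * g' x).
Proof.
move=> e1 c2 c2' ng ng'; have e0 := near1_ge0 ng; move: ng ng' => [dg H] [dg' H'].
exists (fun i x => g x * dg' i x + g' x * dg i x) => x Tx.
have [h1 h2 h3] := H x Tx; have [k1 k2 k3] := H' x Tx.
have g3 : `|g x| <= 3.
  by rewrite -(subrK c (g x)) (le_trans (ler_normD _ _))//; have := lerD h2 c2; lra.
have g3' : `|g' x| <= 3.
  by rewrite -(subrK c' (g' x)) (le_trans (ler_normD _ _))//; have := lerD k2 c2'; lra.
have three a b : `|a| <= 3 -> `|b| <= e -> `|a * b| <= 3 * e by move=> ? ?; rewrite normrM ler_pM.
have e6 : 6 * e = 3 * e + 3 * e by ring.
split.
- exact: (@continuousM R _ g g').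
- have -> : g x * g' x - c * c' = g' x * (g x - c) + c * (g' x - c') by ring.
  rewrite e6 (le_trans (ler_normD _ _))// lerD// three//.
  by rewrite (le_trans c2)// ler_nat.
move=> i; have [h4 h5 h6] := h3 i; have [k4 k5 k6] := k3 i; split.
- exact: (is_deriveM h4 k4).
- apply: (@continuousD R R _ (fun y => g y * dg' i y) (fun y => g' y * dg i y)).
    exact: (@continuousM R _ g (dg' i)).
  exact: (@continuousM R _ g' (dg i)).
- by rewrite e6 (le_trans (ler_normD _ _))// lerD// three.
Qed.

Lemma near1_inv e g : e <= 1 / 2 -> near1 e 1 g -> near1 (4 * e) 1 (fun x => (g x)^-1).
Proof.
move=> e2 ng; have e0 := near1_ge0 ng; case: ng => dg H.
exists (fun i x => - ((g x)^-1 * (g x)^-1 * dg i x)) => x Tx; have [h1 h2 h3] := H x Tx.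
have gx : 1 / 2 <= g x by move: h2; rewrite ler_norml => /andP[? ?]; lra.
have g0 : g x != 0 by rewrite gt_eqF//; lra.
have gi : `|(g x)^-1| <= 2.
  rewrite normfV gtr0_norm; last by lra.
  by rewrite -[leRHS]invrK lef_pV2 ?posrE//; lra.
have ci : {for x, continuous (fun y => (g y)^-1)} by exact: (@continuousV _ _ g).
split => //.
- have -> : (g x)^-1 - 1 = (g x)^-1 * (1 - g x) by rewrite mulrBr mulr1 mulVf.
  by rewrite normrM distrC; have := ler_pM (normr_ge0 _) (normr_ge0 _) gi h2; lra.
move=> i; have [h4 h5 h6] := h3 i; split.
- case: h4 => d4 <-; apply: DeriveDef; first exact: derivableV.
  by rewrite deriveV// /GRing.scale /= expr2 invfM mulNr.
- apply: (@continuousN R R _ (fun y => (g y)^-1 * (g y)^-1 * dg i y)).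
  apply: (@continuousM R _ (fun y => (g y)^-1 * (g y)^-1) (dg i)) => //.
  exact: (@continuousM R _ (fun y => (g y)^-1) (fun y => (g y)^-1)).
rewrite normrN !normrM; apply: (@le_trans _ _ (2 * 2 * e)); last by lra.
by rewrite !ler_pM.
Qed.

Lemma near1_sum n e (c : 'I_n -> R) (g : 'I_n -> 'rV[R]_2 -> R) :
  (forall k, near1 e (c k) (g k)) -> near1 (n%:R * e) (\sum_k c k) (fun x => \sum_k g k x).
Proof.
elim: n c g => [|n IH] c g H.
  rewrite (_ : (fun x => _) = fun=> 0) ?big_ord0 ?mul0r; first exact: near1_cst.
  by apply/funext => x; rewrite big_ord0.
rewrite (_ : (fun x => _) = fun x => g ord0 x + \sum_k g (lift ord0 k) x); last first.
  by apply/funext => x; rewrite big_ord_recl.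
by rewrite big_ord_recl -nat1r mulrDl mul1r; apply: near1D => //; exact: IH.
Qed.

Definition nearm m n e (C : 'M[R]_(m, n)) (A : 'rV[R]_2 -> 'M[R]_(m, n)) : Prop :=
  forall i j, near1 e (C i j) (fun x => A x i j).

Lemma nearm_cst m n (C : 'M[R]_(m, n)) e : 0 <= e -> nearm e C (fun=> C).
Proof. by move=> e0 i j; apply: near1W e0 _; exact: near1_cst. Qed.

Lemma nearmW m n e e' (C : 'M[R]_(m, n)) A : e <= e' -> nearm e C A -> nearm e' C A.
Proof. by move=> ee H i j; exact: near1W (H i j). Qed.

Lemma nearmT m n e (C : 'M[R]_(m, n)) A : nearm e C A -> nearm e C^T (fun x => (A x)^T).
Proof.
move=> H i j; rewrite mxE (_ : (fun x => _) = fun x => A x j i); first exact: H.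
by apply/funext => x; rewrite mxE.
Qed.

Lemma nearmM m n p e (C : 'M[R]_(m, n)) (D : 'M[R]_(n, p)) A B : (n <= 3)%N -> 0 <= e -> e <= 1 ->
  `|C| <= 2 -> `|D| <= 2 -> nearm e C A -> nearm e D B -> nearm (18 * e) (C *m D) (fun x => A x *m B x).
Proof.
move=> n3 e0 e1 C2 D2 nA nB i j; rewrite mxE.
rewrite (_ : (fun x => _) = fun x => \sum_k A x i k * B x k j); last by apply/funext => x; rewrite mxE.
apply: (@near1W (n%:R * (6 * e))).
  by rewrite mulrA ler_wpM2r// (_ : 18 = 3%:R * 6) ?ler_wpM2r ?ler_nat//; ring.
apply: near1_sum => k; apply: near1M => //; [exact: le_trans (mxnorm_entry _ _ _) C2|exact: le_trans (mxnorm_entry _ _ _) D2].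
Qed.

Lemma nearm_bound m n e (C : 'M[R]_(m, n)) A x : nearm e C A -> 0 <= e -> iTref x -> `|A x - C| <= e.
Proof.
move=> nA e0 Tx; apply: mxnorm_le => // i j; rewrite !mxE.
by have [dg /(_ x Tx) []] := nA i j.
Qed.

Lemma near1_det e (A : 'rV[R]_2 -> 'M[R]_2) : 0 <= e -> e <= 1 -> nearm e 1%:M A ->
  near1 (12 * e) 1 (fun x => \det (A x)).
Proof.
move=> e0 e1 nA.
have b i j : `|(1%:M : 'M[R]_2) i j| <= 2 by rewrite mxE; case: eqP; rewrite ?normr1 ?normr0 ?ler1n.
have h1 := near1M e1 (b 0 0) (b 1 1) (nA 0 0) (nA 1 1).
have h2 := near1M e1 (b 0 1) (b 1 0) (nA 0 1) (nA 1 0).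
have h3 : near1 (6 * e) (- ((1%:M : 'M[R]_2) 0 1 * (1%:M : 'M[R]_2) 1 0)) (fun x => - (A x 0 1 * A x 1 0)).
  case: h2 => dg H; exists (fun i x => - dg i x) => x Tx; have [k1 k2 k3] := H x Tx; split.
  - exact: (@continuousN R R _ (fun x => A x 0 1 * A x 1 0)).
  - by rewrite -opprD normrN.
  move=> i; have [k4 k5 k6] := k3 i; split; [exact: is_deriveN|exact: (@continuousN R R _ (dg i))|by rewrite normrN].
have := near1D h1 h3; rewrite !mxE /= mulr1 mulr0 subr0 -mulrDl (_ : 6 + 6 = 12); last by ring.
by rewrite (_ : (fun x => _) = (fun x => \det (A x)))//; apply/funext => x; rewrite det2E.
Qed.

(** The inverse by cofactors: its entries are explicit rational functions of those of A, to which
    the rules for [near1] apply. *)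
Definition inv2 (A : 'M[R]_2) : 'M[R]_2 :=
  \matrix_(i, j) ((\det A)^-1 * (if i == j then A (other i) (other i) else - A i j)).

Lemma inv2E (A : 'M[R]_2) : A \in unitmx -> inv2 A = invmx A.
Proof.
move=> uA; have D0 : \det A != 0 by rewrite -unitfE -unitmxE.
apply: (can_inj (mulKmx uA)); rewrite mulmxV//; apply/matrixP => i j; rewrite [LHS]mxE sum2 [RHS]mxE !mxE /other.
case: (ord2P i) => ->; case: (ord2P j) => -> /=; try ring.
  by rewrite mulr1n -[RHS](mulVf D0) [X in _ = _ * X]det2E; ring.
by rewrite mulr1n -[RHS](mulVf D0) [X in _ = _ * X]det2E; ring.
Qed.

Lemma near1N e c g : near1 e c g -> near1 e (- c) (fun x => - g x).
Proof.
case=> dg H; exists (fun i x => - dg i x) => x Tx; have [k1 k2 k3] := H x Tx; split.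
- exact: (@continuousN R R _ g).
- by rewrite -opprD normrN.
by move=> i; have [k4 k5 k6] := k3 i; split; [exact: is_deriveN|exact: (@continuousN R R _ (dg i))|rewrite normrN].
Qed.

(** The computation gives the factor 6 * 4 * 12 = 288, rounded up to 18^2 so that an inversion
    counts as two matrix products. *)
Lemma nearm_inv2 e (A : 'rV[R]_2 -> 'M[R]_2) : 0 <= e -> 324 * e <= 1 -> nearm e 1%:M A ->
  nearm (324 * e) 1%:M (fun x => inv2 (A x)) /\ forall x, iTref x -> A x \in unitmx.
Proof.
move=> e0 e1 nA; have e1' : e <= 1 by lra.
have nd := near1_det e0 e1' nA.
have e2 : 12 * e <= 1 / 2 by lra.
have ni := near1_inv e2 nd.
split; last first.
  move=> x Tx; rewrite unitmxE unitfE; case: nd => dg /(_ x Tx) [_ h _].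
  by move: h; rewrite ler_norml => /andP[? ?]; rewrite gt_eqF//; lra.
have b i j : `|(1%:M : 'M[R]_2) i j| <= 2 by rewrite mxE; case: eqP; rewrite ?normr1 ?normr0 ?ler1n.
move=> i j; have b1 : `|1 : R| <= 2 by rewrite normr1 ler1n.
have e48 : 4 * (12 * e) <= 1 by lra.
have e48' : e <= 4 * (12 * e) by lra.
have l : 6 * (4 * (12 * e)) <= 324 * e by lra.
apply: (near1W l); rewrite mxE.
have -> : (i == j)%:R = 1 * (i == j)%:R :> R by rewrite mul1r.
rewrite (_ : (fun x => _) = (fun x => (\det (A x))^-1 * (if i == j then A x (other i) (other i) else - A x i j))); last first.
  by apply/funext => x; rewrite mxE.
have [ij|ij] := eqVneq i j.
  apply: near1M; [exact: e48|exact: b1|by rewrite normr1 ler1n|exact: ni|].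
  by have := nA (other i) (other i); rewrite mxE eqxx; exact: near1W.
apply: near1M; [exact: e48|exact: b1|by rewrite normr0|exact: ni|].
by have := near1N (nA i j); rewrite mxE (negbTE ij) oppr0; exact: near1W.
Qed.
End NearConstant.

(** * Dual frame and tangential projection of a nearly constant frame *)

Section NearFrame.
Context {R : realType}.
Local Notation e_ i := (delta_mx 0 i : 'rV[R]_2).

Definition frame_K (N : 'M[R]_(2, 3)) : 'M[R]_2 := inv2 (N *m N^T).
(** For independent rows of N, the rows of [frame_W] are their dual basis within the plane they
    span, and [frame_P] is the orthogonal projection onto this plane. *)
Definition frame_W (N : 'M[R]_(2, 3)) : 'M[R]_(2, 3) := frame_K N *m N.
Definition frame_P (N : 'M[R]_(2, 3)) : 'M[R]_3 := N^T *m frame_W N.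

Lemma near_frame (e : R) (T : 'M[R]_(2, 3)) (N : 'rV[R]_2 -> 'M[R]_(2, 3)) :
  0 <= e -> 18 ^+ 8 * e <= 1 -> T *m T^T = 1%:M -> nearm e T N ->
  [/\ near1 (18 ^+ 8 * e) 1 (fun x => \det (N x *m (N x)^T)),
      forall x, iTref x -> N x *m (N x)^T \in unitmx &
  [/\ nearm (18 ^+ 8 * e) T (fun x => frame_W (N x)),
      nearm (18 ^+ 8 * e) (T^T *m T) (fun x => frame_P (N x)),
      nearm (18 ^+ 8 * e) T (fun x => T *m frame_P (N x)),
      nearm (18 ^+ 8 * e) T (fun x => T *m frame_P (N x) *m (frame_P (N x))^T) &
      nearm (18 ^+ 8 * e) 1%:M (fun x => T *m frame_P (N x) *m (frame_P (N x))^T *m (frame_W (N x))^T)]].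
Proof.
move=> e0 e8 TT nN.
(* The error after k matrix products, each costing a factor 18. The longest chain below has length
   eight, the inversion counting as two. *)
pose E k : R := 18 ^+ k * e.
have E0 k : 0 <= E k by rewrite mulr_ge0// exprn_ge0.
have ES k : E k.+1 = 18 * E k by rewrite /E exprS mulrA.
have EE j k : (j <= k)%N -> E j <= E k by move=> jk; rewrite ler_wpM2r// ler_weXn2l// ler1n.
have E1 k : (k <= 8)%N -> E k <= 1 by move=> k8; apply: le_trans (EE _ _ k8) e8.
have T1 := norm_orthonormal TT.
have T2 : `|T| <= 2 by lra.
have T2' : `|T^T| <= 2 by rewrite mxnormT.
have I2 : `|1%:M : 'M[R]_2| <= 2.
  by apply: mxnorm_le => // i j; rewrite mxE; case: eqP; rewrite ?normr1 ?normr0 ?ler1n.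
have TTT2 : `|T^T *m T| <= 2.
  rewrite (le_trans (mxnormM _ _))// mxnormT; have := ler_pM (normr_ge0 T) (normr_ge0 T) T1 T1; lra.
have up m n (C : 'M[R]_(m, n)) A j k : (j <= k)%N -> nearm (E j) C A -> nearm (E k) C A.
  by move=> jk; apply: nearmW; exact: EE.
have mul m n p (C : 'M[R]_(m, n)) (D : 'M[R]_(n, p)) A B k : (n <= 3)%N -> (k <= 8)%N ->
    `|C| <= 2 -> `|D| <= 2 -> nearm (E k) C A -> nearm (E k) D B -> nearm (E k.+1) (C *m D) (fun x => A x *m B x).
  by move=> n3 k7 C2 D2 nA nB; rewrite ES; apply: nearmM => //; exact: E1.
have n0 : nearm (E 0%N) T N by rewrite /E expr0 mul1r.
have nG : nearm (E 1%N) 1%:M (fun x => N x *m (N x)^T).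
  by rewrite -TT; apply: mul => //; exact: nearmT.
have e324 : 324 * E 1%N = E 3%N by rewrite !ES; ring.
have [nK uG] := @nearm_inv2 _ (E 1%N) _ (E0 _) (le_trans (eq_ler e324) (E1 3%N isT)) nG.
rewrite e324 in nK.
have nW : nearm (E 4%N) T (fun x => frame_W (N x)).
  by rewrite -[T]mul1mx; apply: mul => //; exact: (up _ _ _ _ 0%N).
have nP : nearm (E 5%N) (T^T *m T) (fun x => frame_P (N x)).
  by apply: mul => //; apply: nearmT; exact: (up _ _ _ _ 0%N).
have nY : nearm (E 6%N) T (fun x => T *m frame_P (N x)).
  have -> : T = T *m (T^T *m T) by rewrite mulmxA TT mul1mx.
  by rewrite {2}mulmxA TT mul1mx; apply: mul => //; exact: nearm_cst.
have nZ : nearm (E 7%N) T (fun x => T *m frame_P (N x) *m (frame_P (N x))^T).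
  have -> : T = T *m (T^T *m T)^T by rewrite trmx_mul trmxK mulmxA TT mul1mx.
  rewrite {2}trmx_mul trmxK mulmxA TT mul1mx; apply: mul => //; first by rewrite mxnormT.
  by apply: nearmT; exact: (up _ _ _ _ 5%N).
have nZW : nearm (E 8%N) 1%:M (fun x => T *m frame_P (N x) *m (frame_P (N x))^T *m (frame_W (N x))^T).
  by rewrite -TT; apply: mul => //; apply: nearmT; exact: (up _ _ _ _ 4%N).
split => //.
  have := near1_det (E0 1%N) (E1 1%N isT) nG; apply: near1W.
  have := EE 2%N 8%N isT; rewrite ES -/(E 8%N); have := E0 1%N; lra.
by split => //; [exact: (up _ _ _ _ 4%N)|exact: (up _ _ _ _ 5%N)|exact: (up _ _ _ _ 6%N)|exact: (up _ _ _ _ 7%N)].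
Qed.

(** Passing from N to B N only changes the basis of the plane: the projection is the same, and the
    dual basis is transformed by the inverse transpose of B. *)
Lemma frame_PK (N : 'M[R]_(2, 3)) (B : 'M[R]_2) : N *m N^T \in unitmx -> B \in unitmx ->
  (B *m N) *m (B *m N)^T \in unitmx /\ tanproj (B *m N) = frame_P N /\
  invmx ((B *m N) *m (B *m N)^T) *m (B *m N) = (invmx B)^T *m frame_W N.
Proof.
move=> uN uB.
have gE : (B *m N) *m (B *m N)^T = B *m (N *m N^T) *m B^T by rewrite trmx_mul !mulmxA.
have uBT : B^T \in unitmx by rewrite unitmx_tr.
have uG : (B *m N) *m (B *m N)^T \in unitmx by rewrite gE !unitmx_mul uB uN uBT.
have iG : invmx ((B *m N) *m (B *m N)^T) *m (B *m N) = (invmx B)^T *m frame_W N.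
  apply: (can_inj (mulKmx uG)); rewrite mulKVmx// gE /frame_W /frame_K inv2E// trmx_inv.
  by rewrite (mulmxA _ (invmx B^T)) mulmxK// (mulmxA (B *m (N *m N^T))) mulmxK.
split => //; split => //.
by rewrite tanprojE// -mulmxA iG trmx_mul mulmxA -(mulmxA N^T) -trmx_mul mulVmx// trmx1 mulmx1.
Qed.
End NearFrame.

(** * Surface derivatives of fields with constant directions *)

Section SurfaceCalculus.
Context {R : realType}.
Local Notation e_ i := (delta_mx 0 i : 'rV[R]_2).
Implicit Types (x y : 'rV[R]_2).

Lemma continuous_on_iTref (f g : 'rV[R]_2 -> R) x : iTref x -> (forall y, iTref y -> f y = g y) ->
  {for x, continuous g} -> {for x, continuous f}.
Proof.
move=> Tx fg cg; have Tn := open_nbhs_nbhs (conj (@open_iTref R) Tx).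
apply: continuous_near => e e0; have /cvgrPdist_lt /(_ e e0) ce := cg.
by rewrite fg//; apply: filterS2 Tn ce => y Ty; rewrite fg.
Qed.

Lemma continuous_sum_at n (f : 'I_n -> 'rV[R]_2 -> R) x : (forall k, {for x, continuous (f k)}) ->
  {for x, continuous (fun y => \sum_k f k y)}.
Proof.
elim: n f => [|n IH] f cf.
  rewrite (_ : (fun y => _) = fun=> 0); first exact: cst_continuous.
  by apply/funext => y; rewrite big_ord0.
rewrite (_ : (fun y => _) = fun y => f ord0 y + \sum_k f (lift ord0 k) y); last by apply/funext => y; rewrite big_ord_recl.
by apply: (@continuousD R R _ (f ord0)) => //; exact: IH.
Qed.

Lemma continuousM_at (f g : 'rV[R]_2 -> R) x : {for x, continuous f} -> {for x, continuous g} ->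
  {for x, continuous (fun y => f y * g y)}.
Proof. by move=> cf cg; exact: (@continuousM R _ f g). Qed.

Lemma sqrt_near1 (d E : R) : 0 <= d -> `|d - 1| <= E -> `|Num.sqrt d - 1| <= E.
Proof.
move=> d0; apply: le_trans; have s0 := sqrtr_ge0 d.
have -> : d - 1 = (Num.sqrt d - 1) * (Num.sqrt d + 1) by rewrite -subr_sqr sqr_sqrtr// expr1n.
by rewrite normrM (ger0_norm (addr_ge0 s0 ler01)) ler_peMr// lerDr.
Qed.

Lemma norm_sum_le n (f : 'I_n -> R) (b : R) : (forall k, `|f k| <= b) -> `|\sum_k f k| <= n%:R * b.
Proof.
move=> H; apply: (@le_trans _ _ (\sum_(k < n) b)); last by rewrite sumr_const card_ord mulr_natl.
by rewrite (le_trans (ler_norm_sum _ _ _))// ler_sum.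
Qed.

(** With jacobian B N, surface derivatives are the flat derivatives p contracted with the dual frame
    W. The projected field has coefficients Y = T P close to T, so the product rule gives p times Z
    and W, with Z = Y P^T, plus v times derivatives of Y, of size kappa E. The trace of the first
    part is nearly the flat divergence since Z W^T is close to the identity. *)
Lemma surface_calculus (e kappa : R) (T : 'M[R]_(2, 3)) (N : 'rV[R]_2 -> 'M[R]_(2, 3)) (B : 'M[R]_2)
    (X : 'rV[R]_2 -> 'rV[R]_3) :
  0 <= e -> 18 ^+ 8 * e <= 1 -> T *m T^T = 1%:M -> nearm e T N -> B \in unitmx ->
  `|invmx B| <= kappa -> (forall x, jacobian X x = B *m N x) ->
  let E := 18 ^+ 8 * e in
  (exists alpha : 'rV[R]_2 -> R, forall x, iTref x ->
    [/\ area X x = `|\det B| * alpha x, `|alpha x - 1| <= E & {for x, continuous alpha}]) /\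
  forall v : 'I_2 -> 'rV[R]_2 -> R, (forall a, regT (v a)) ->
  let u := fun x => \sum_(a < 2) v a x *: row a T in
  let p := fun b a x => \sum_(l < 2) invmx B b l * pd l (v a) x in
  let S0 := fun x => \sum_(a < 2) `|v a x| in
  let s := fun x => \sum_(b < 2) \sum_(a < 2) `|p b a x| + kappa * S0 x in
  forall x, iTref x ->
  [/\ `|surface_div X (Pfield X u) x - \sum_(a < 2) p a a x| <= 324 * E * s x,
      forall i j, `|surface_nabla X (Pfield X u) x i j| <= 108 * s x,
      forall c, `|Pfield X u x 0 c| <= 3 * S0 x &
      forall c, `|Qfield X u x 0 c| <= E * S0 x] /\
  [/\ forall i j, {for x, continuous (fun x => surface_nabla X (Pfield X u) x i j)},
      forall c, {for x, continuous (fun x => Pfield X u x 0 c)} &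
      forall c, {for x, continuous (fun x => Qfield X u x 0 c)}].
Proof.
move=> e0 e8 TT nN uB kB JX E.
have [nd uG [nW nP nY nZ nZW]] := near_frame e0 e8 TT nN.
have E0 : 0 <= E by rewrite mulr_ge0// exprn_ge0.
have PE x : iTref x -> Ph X x = frame_P (N x).
  by move=> Tx; rewrite /Ph JX; have [_ [-> _]] := frame_PK (uG x Tx) uB.
split.
  exists (fun x => Num.sqrt (\det (N x *m (N x)^T))) => x Tx; case: nd => dg /(_ x Tx) [cd bd _].
  have d0 : 0 <= \det (N x *m (N x)^T) by rewrite det_gram dot_ge0.
  split; last by apply: (@continuous_comp _ _ _ (fun x => \det (N x *m (N x)^T)) Num.sqrt); [exact: cd|exact: sqrt_continuous].
  - have gE : (B *m N x) *m (B *m N x)^T = B *m (N x *m (N x)^T) *m B^T by rewrite trmx_mul !mulmxA.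
    rewrite /area /gram JX gE det_mulmx [X in X * _]det_mulmx det_tr mulrAC -expr2.
    by rewrite sqrtrM ?sqr_ge0// sqrtr_sqr.
  - exact: sqrt_near1.
move=> v rv u p S0 s.
have PuE x c : iTref x -> Pfield X u x 0 c = \sum_(a < 2) v a x * (T *m frame_P (N x)) a c.
  move=> Tx; rewrite /Pfield PE// /u mulmx_suml summxE; apply: eq_bigr => a _.
  by rewrite -scalemxAl mxE -row_mul mxE.
have QuE x c : iTref x -> Qfield X u x 0 c = \sum_(a < 2) v a x * (T - T *m frame_P (N x)) a c.
  move=> Tx; rewrite /Qfield PE// /u mulmx_suml summxE; apply: eq_bigr => a _.
  by rewrite -scalemxAl mxE mulmxBr mulmx1 -row_mul !mxE.
pose Y x := T *m frame_P (N x); pose Z x := T *m frame_P (N x) *m (frame_P (N x))^T.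
pose W x := frame_W (N x); pose P x := frame_P (N x); pose Mi := invmx B.
have /choice [dY HdY] (ac : 'I_2 * 'I_3) := nY ac.1 ac.2.
have T1 := norm_orthonormal TT.
have bnd m n (C : 'M[R]_(m, n)) A x i j (b : R) : nearm E C A -> iTref x -> `|C| <= b -> `|A x i j| <= b + 1.
  move=> nA Tx Cb; have := nearm_bound nA E0 Tx => h.
  have h1 := mxnorm_entry (A x - C) i j; have h2 := mxnorm_entry C i j; rewrite !mxE in h1.
  rewrite -(subrK (C i j) (A x i j)) (le_trans (ler_normD _ _))//.
  by rewrite -/E in e8; lra.
have Y2 x a c : iTref x -> `|Y x a c| <= 2 by move=> Tx; have := bnd _ _ _ _ x a c 1 nY Tx T1.
have Z2 x a c : iTref x -> `|Z x a c| <= 2 by move=> Tx; have := bnd _ _ _ _ x a c 1 nZ Tx T1.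
have W2 x a c : iTref x -> `|W x a c| <= 2 by move=> Tx; have := bnd _ _ _ _ x a c 1 nW Tx T1.
have TTT2 : `|T^T *m T| <= 2.
  rewrite (le_trans (mxnormM _ _))// mxnormT; have := ler_pM (normr_ge0 T) (normr_ge0 T) T1 T1; lra.
have P3 x i j : iTref x -> `|P x i j| <= 3 by move=> Tx; rewrite (_ : 3 = 2 + 1); [exact: bnd nP Tx TTT2|ring].
have dv a l x : iTref x -> is_derive x (e_ l) (v a) (pd l (v a) x).
  by move=> Tx; apply: DeriveDef => //; have [_ [K _ /(_ l) [_ /(_ x Tx) []]]] := rv a.
have cpv a l x : iTref x -> {for x, continuous (pd l (v a))}.
  by move=> Tx; have [_ [K _ /(_ l) [_ /(_ x Tx) []]]] := rv a.
have cv a x : iTref x -> {for x, continuous (v a)} by move=> Tx; apply: within_iTref => //; have [] := rv a.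
have dPu l c x : iTref x -> pd l (fun y => Pfield X u y 0 c) x =
    \sum_(a < 2) (v a x * dY (a, c) l x + Y x a c * pd l (v a) x).
  move=> Tx; have Tn := open_nbhs_nbhs (conj (@open_iTref R) Tx).
  have da a : is_derive x (e_ l) (fun y => v a y * Y y a c) (v a x * dY (a, c) l x + Y x a c * pd l (v a) x).
    by have [_ _ /(_ l) [dYx _ _]] := HdY (a, c) x Tx; exact: (is_deriveM (dv a l x Tx) dYx).
  have [_ <-] : is_derive x (e_ l) (fun y => Pfield X u y 0 c) (\sum_(a < 2) (v a x * dY (a, c) l x + Y x a c * pd l (v a) x)) => //.
  apply: (@near_eq_is_derive _ _ _ (fun y => v 0 y * Y y 0 c + v 1 y * Y y 1 c)).
    by apply: filterS Tn => y Ty; rewrite PuE// sum2.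
  by rewrite sum2; exact: is_deriveD (da 0) (da 1).
(* q holds the flat derivatives of the coefficients Y, and n collects everything that multiplies the
   undifferentiated v. *)
pose q x a b c := \sum_(l < 2) Mi b l * dY (a, c) l x.
pose n i j a x := \sum_(b < 2) \sum_(c < 3) P x i c * q x a b c * W x b j.
have nabE x i j : iTref x -> surface_nabla X (Pfield X u) x i j =
    \sum_(a < 2) \sum_(b < 2) p b a x * (Z x a i * W x b j) + \sum_(a < 2) v a x * n i j a x.
  move=> Tx; rewrite /surface_nabla PE// mxE.
  have gradE c : surface_D X (Pfield X u) x c j = \sum_(b < 2) (\sum_(a < 2) (v a x * q x a b c + p b a x * Y x a c)) * W x b j.
    rewrite mxE /surface_grad /gram JX -mulmxA; have [_ [_ ->]] := frame_PK (uG x Tx) uB.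
    rewrite mulmxA mxE; apply: eq_bigr => b _; congr (_ * _); rewrite mxE.
    rewrite [LHS]sum2 [X in X * _ + _]mxE [X in _ * X + _]mxE [X in _ + X * _]mxE [X in _ + _ * X]mxE !dPu//.
    rewrite /q /p /Mi !sum2; set m0 := invmx B b 0; set m1 := invmx B b 1.
    set y0 := Y x 0 c; set y1 := Y x 1 c; set v0 := v 0 x; set v1 := v 1 x.
    clearbody m0 m1 y0 y1 v0 v1; ring.
  under eq_bigr => c _ do rewrite gradE.
  have ZE a : Z x a i = \sum_(c < 3) Y x a c * P x i c.
    by rewrite /Z mxE; apply: eq_bigr => c _; rewrite [X in _ * X]mxE.
  rewrite /n !sum2 !ZE !sum3 !sum2; rewrite -/(P x); ring.
have q_le x a b c : iTref x -> `|q x a b c| <= 2 * (kappa * E).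
  move=> Tx; apply: norm_sum_le => l; rewrite normrM ler_pM//; first exact: le_trans (mxnorm_entry _ _ _) kB.
  by have [_ _ /(_ l) []] := HdY (a, c) x Tx.
have kap0 : 0 <= kappa := le_trans (normr_ge0 _) kB.
have kE0 : 0 <= kappa * E by rewrite mulr_ge0.
have n_le x i j a : iTref x -> `|n i j a x| <= 72 * (kappa * E).
  move=> Tx; apply: (@le_trans _ _ (2%:R * (3%:R * (3 * (2 * (kappa * E)) * 2)))); last by apply: eq_ler; ring.
  apply: norm_sum_le => b; apply: norm_sum_le => c; rewrite !normrM ler_pM ?mulr_ge0//; last exact: W2.
  by rewrite ler_pM//; [exact: P3|exact: q_le].
have S00 x : 0 <= S0 x by apply: sumr_ge0.
have sumle x (m : 'I_2 -> 'I_2 -> R) (r : R) : (forall a b, `|m a b| <= r) ->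
    `|\sum_(a < 2) \sum_(b < 2) p b a x * m a b| <= r * \sum_(b < 2) \sum_(a < 2) `|p b a x|.
  move=> mr; rewrite exchange_big /= mulr_sumr (le_trans (ler_norm_sum _ _ _))//; apply: ler_sum => b _.
  rewrite mulr_sumr (le_trans (ler_norm_sum _ _ _))//; apply: ler_sum => a _.
  by rewrite normrM mulrC ler_wpM2r.
have sumle0 x (m : 'I_2 -> R) (r : R) : (forall a, `|m a| <= r) -> `|\sum_(a < 2) v a x * m a| <= r * S0 x.
  move=> mr; rewrite /S0 mulr_sumr (le_trans (ler_norm_sum _ _ _))//; apply: ler_sum => a _.
  by rewrite normrM mulrC ler_wpM2r.
have S10 x : 0 <= \sum_(b < 2) \sum_(a < 2) `|p b a x| by do 2![apply: sumr_ge0 => ? _].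
move=> x Tx; split.
  split.
  - have divE : surface_div X (Pfield X u) x - \sum_(a < 2) p a a x =
       \sum_(a < 2) \sum_(b < 2) p b a x * ((Z x *m (W x)^T) a b - (1%:M : 'M[R]_2) a b) + \sum_(a < 2) v a x * \sum_(i < 3) n i i a x.
      have ZWE a b : (Z x *m (W x)^T) a b = Z x a 0 * W x b 0 + Z x a 1 * W x b 1 + Z x a 2 * W x b 2.
        by rewrite -(sum3 (fun k => Z x a k * W x b k)) mxE; apply: eq_bigr => k _; rewrite [X in _ * X]mxE.
      have [d0 d1 [d2 d3]] : [/\ (1%:M : 'M[R]_2) 0 0 = 1, (1%:M : 'M[R]_2) 0 1 = 0 &
          (1%:M : 'M[R]_2) 1 0 = 0 /\ (1%:M : 'M[R]_2) 1 1 = 1] by rewrite !mxE.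
      rewrite /surface_div /mxtrace sum3 !nabE// !sum2 !sum3 !ZWE d0 d1 d2 d3; ring.
    rewrite divE (le_trans (ler_normD _ _))//.
    have h1 := sumle x (fun a b => (Z x *m (W x)^T) a b - (1%:M : 'M[R]_2) a b) E.
    have h2 := sumle0 x (fun a => \sum_(i < 3) n i i a x) (3%:R * (72 * (kappa * E))).
    apply: (@le_trans _ _ (E * (\sum_(b < 2) \sum_(a < 2) `|p b a x|) + 3%:R * (72 * (kappa * E)) * S0 x)).
      apply: lerD; [apply: h1 => a b|apply: h2 => a; apply: norm_sum_le => i; exact: n_le].
      have := mxnorm_entry (Z x *m (W x)^T - 1%:M) a b; rewrite [in X in X <= _](mxE) [X in _ + X]mxE => h.
      by apply: le_trans h _; exact: nearm_bound nZW E0 Tx.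
    rewrite /s; set S1 := \sum_(b < 2) _.
    have : 0 <= E * S1 by rewrite mulr_ge0// S10.
    have : 0 <= kappa * E * S0 x by rewrite mulr_ge0.
    set t1 := E * S1; set t2 := kappa * E * S0 x => t20 t10.
    have -> : 324 * E * (S1 + kappa * S0 x) = 324 * t1 + 324 * t2 by rewrite /t1 /t2; ring.
    have -> : 3%:R * (72 * (kappa * E)) * S0 x = 216 * t2 by rewrite /t2; ring.
    clearbody t1 t2; clear -t10 t20; lra.
  - move=> i j; rewrite nabE// (le_trans (ler_normD _ _))//.
    have h1 := sumle x (fun a b => Z x a i * W x b j) 4.
    have h2 := sumle0 x (fun a => n i j a x) (72 * (kappa * E)).
    apply: (@le_trans _ _ (4 * (\sum_(b < 2) \sum_(a < 2) `|p b a x|) + 72 * (kappa * E) * S0 x)).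
      apply: lerD; [apply: h1 => a b|apply: h2 => a; exact: n_le].
      rewrite normrM (_ : 4 = 2 * 2); last by ring.
      by apply: ler_pM => //; [exact: Z2|exact: W2].
    rewrite /s; set S1 := \sum_(b < 2) _.
    have k1 : kappa * E * S0 x <= kappa * 1 * S0 x by rewrite ler_wpM2r// ler_wpM2l.
    have k2 : 0 <= S1 := S10 x.
    have k3 : 0 <= kappa * S0 x by rewrite mulr_ge0.
    have -> : 72 * (kappa * E) * S0 x = 72 * (kappa * E * S0 x) by ring.
    move: k1 k2 k3; rewrite mulr1; set t1 := kappa * E * S0 x; set t2 := kappa * S0 x; clearbody t1 t2 S1; clear -t1; lra.
  - move=> c; rewrite PuE//; apply: le_trans (sumle0 x (fun a => Y x a c) 2 _) _; first by move=> a; exact: Y2.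
    by rewrite ler_wpM2r// ler_nat.
  - move=> c; rewrite QuE//; apply: sumle0 => a.
    apply: le_trans (mxnorm_entry _ _ _) _; rewrite distrC; exact: nearm_bound nY E0 Tx.
have cm m k (C : 'M[R]_(m, k)) A i j : nearm E C A -> {for x, continuous (fun x => A x i j)}.
  by move=> nA; have [dg /(_ x Tx) []] := nA i j.
split.
- move=> i j; apply: (continuous_on_iTref Tx (fun y Ty => nabE y i j Ty)).
  apply: (@continuousD R R _ (fun x => \sum_(a < 2) \sum_(b < 2) p b a x * (Z x a i * W x b j)) (fun x => \sum_(a < 2) v a x * n i j a x)).
    apply: continuous_sum_at => a; apply: continuous_sum_at => b; apply: continuousM_at.
      by apply: continuous_sum_at => l; apply: continuousM_at; [exact: cst_continuous|exact: cpv].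
    by apply: continuousM_at; [exact: cm nZ|exact: cm nW].
  apply: continuous_sum_at => a; apply: continuousM_at; first exact: cv.
  apply: continuous_sum_at => b; apply: continuous_sum_at => c; apply: continuousM_at; last exact: cm nW.
  apply: continuousM_at; first exact: cm nP.
  apply: continuous_sum_at => l; apply: continuousM_at; first exact: cst_continuous.
  by have [_ _ /(_ l) []] := HdY (a, c) x Tx.
- move=> c; apply: (continuous_on_iTref Tx (fun y Ty => PuE y c Ty)).
  by apply: continuous_sum_at => a; apply: continuousM_at; [exact: cv|exact: cm nY].
move=> c; apply: (continuous_on_iTref Tx (fun y Ty => QuE y c Ty)).
apply: continuous_sum_at => a; apply: continuousM_at; first exact: cv.
rewrite (_ : (fun y => _) = (fun y => T a c - (T *m frame_P (N y)) a c)); last by apply/funext => y; rewrite !mxE.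
by apply: (@continuousB R R _ (fun=> T a c)); [exact: cst_continuous|exact: cm nY].
Qed.
End SurfaceCalculus.

(** * Parametric elements compared with the plane of the macroelement *)

Section MacroNearFrame.
Context {R : realType}.
Local Notation e_ i := (delta_mx 0 i : 'rV[R]_2).
Implicit Types (x y : 'rV[R]_2).

Lemma Tref0 : Tref (0 : 'rV[R]_2).
Proof. by apply/Tref3; rewrite !mxE; split; lra. Qed.

Lemma nearm_perturbation (e h kap d : R) (T : 'M[R]_(2, 3)) (Bi : 'M[R]_2) (G : 'M[R]_(2, 3))
    (r : 'I_2 -> 'I_3 -> 'rV[R]_2 -> R) (N : 'rV[R]_2 -> 'M[R]_(2, 3)) :
  (forall a c, poly2 (r a c)) ->
  (forall a c x, Tref x -> `|r a c x| <= d) -> (forall i a c x, Tref x -> `|pd i (r a c) x| <= d) ->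
  `|G| <= h -> `|Bi| <= kap -> 2 * kap * (h + d) <= e -> 0 <= h ->
  (forall x, N x = T + Bi *m (G + \matrix_(a, c) r a c x)) -> nearm e T N.
Proof.
move=> pr rd dd Gh Bk ke h0 NE a c.
have k0 : 0 <= kap := le_trans (normr_ge0 _) Bk.
have d0 : 0 <= d := le_trans (normr_ge0 _) (rd 0 0 _ (iTref_sub (@iTref_center R))).
have NcE x : N x a c = (T a c + (Bi *m G) a c) + \sum_l r l c x * Bi a l.
  rewrite NE mxE mulmxDr [X in _ + X]mxE addrA; congr (_ + _).
  by rewrite mxE; apply: eq_bigr => l _; rewrite [X in _ * X]mxE mulrC.
have BG : `|(Bi *m G) a c| <= 2%:R * (kap * h).
  rewrite mxE; apply: norm_sum_le => l; rewrite normrM ler_pM//.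
    exact: le_trans (mxnorm_entry _ _ _) Bk.
  exact: le_trans (mxnorm_entry _ _ _) Gh.
have entry l : `|Bi a l| <= kap by exact: le_trans (mxnorm_entry _ _ _) Bk.
have kd0 : 0 <= kap * d by rewrite mulr_ge0.
have kh0 : 0 <= kap * h by rewrite mulr_ge0.
exists (fun i x => \sum_l pd i (r l c) x * Bi a l) => x Tx; have Tx' := iTref_sub Tx.
have rs : `|\sum_l r l c x * Bi a l| <= 2%:R * (d * kap).
  by apply: norm_sum_le => l; rewrite normrM ler_pM// rd.
split.
- have -> : (fun x => N x a c) = fun x => (T a c + (Bi *m G) a c) + \sum_l r l c x * Bi a l by apply/funext.
  apply: (@continuousD R R _ (fun=> T a c + (Bi *m G) a c)); first exact: cst_continuous.
  by apply: continuous_sum_at => l; apply: continuousM_at; [exact: poly2_continuous|exact: cst_continuous].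
- rewrite (_ : N x a c - T a c = (Bi *m G) a c + \sum_l r l c x * Bi a l); last by rewrite NcE; ring.
  rewrite (le_trans (ler_normD _ _))// (le_trans (lerD BG rs))//; lra.
move=> i; split.
- have -> : (fun x => N x a c) = (fun=> T a c + (Bi *m G) a c) + (fun x => \sum_l r l c x * Bi a l) by apply/funext.
  have := is_deriveD (is_derive_cst (T a c + (Bi *m G) a c) x (e_ i)) (is_derive_lincomb (fun l => Bi a l) i x (fun l => pr l c)).
  by rewrite add0r.
- by apply: continuous_sum_at => l; apply: continuousM_at; [apply: poly2_continuous; exact: pd_poly2|exact: cst_continuous].
have : `|\sum_l pd i (r l c) x * Bi a l| <= 2%:R * (d * kap).
  by apply: norm_sum_le => l; rewrite normrM ler_pM// dd.
lra.
Qed.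

(** All edges of the macroelement are compared with the base plane through a common nearly normal
    direction n, and the projected points differ from the flat element by a small multiple of h. The
    jacobian therefore differs from [B *m mtan w] by a small multiple of h, and multiplication by
    the inverse of B, of size S / h, leaves an error below e. *)
Lemma macro_near_frame (Gamma : set 'rV[R]_3) (delta : R) (proj : 'rV[R]_3 -> 'rV[R]_3)
    (H : set R) (msh : R -> mesh R) (kg : nat) (n0 : nat) :
  closed_hypersurface Gamma -> closest_point_projection Gamma delta proj ->
  surface_family Gamma delta H msh -> (1 <= kg)%N ->
  exists2 S : R, 0 < S & forall e : R, 0 < e -> exists2 h1 : R, 0 < h1 &
  forall h, H h -> h <= h1 -> forall w : macro (msh h), is_macro w -> (#|mel w| <= n0)%N ->
  forall k, k \in mel w ->
  let B := edgemx (fvert w k) in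
  [/\ B \in unitmx, `|invmx B| <= S / h, `|B| <= 3 * h &
   exists2 N, nearm e (mtan w) N & forall x, jacobian (@param R proj kg (msh h) k) x = B *m N x].
Proof.
move=> hyp cpp [Hpos [sigma s0 Hfam]] kg0.
pose S0 := sigma ^+ 2; have S0p : 0 < S0 by rewrite exprn_gt0.
have [Cl Cl0 HCl] := @lagrange_perturbation R kg kg0.
exists (2 * S0); first by rewrite mulr_gt0.
move=> e e0.
(* K adds up the factors of eps in the smallness conditions c1, c2 and c3. *)
pose K := 4 * S0 * (2 + 24 * S0 + 3 * Cl) + 8 * S0 + 1.
have SC0 : 0 <= S0 * Cl by rewrite mulr_ge0// ltW.
have SS0 : 0 <= S0 * S0 by rewrite mulr_ge0// ltW.
have K0 : 0 < K by rewrite /K; lra.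
pose eps := Num.min e 1 / K.
have m0 : 0 < Num.min e 1 by rewrite lt_min e0 ltr01.
have eps0 : 0 < eps by rewrite divr_gt0.
have epsK : eps * K = Num.min e 1 by rewrite /eps divfK// gt_eqF.
have epsK1 : eps * K <= 1 by rewrite epsK ge_min lexx orbT.
have epsKe : eps * K <= e by rewrite epsK ge_min lexx.
have [eS eSS eSC] : [/\ 0 <= eps * S0, 0 <= eps * (S0 * S0) & 0 <= eps * (S0 * Cl)].
  by split; apply: mulr_ge0 => //; exact: ltW.
have c1 : 8 * S0 * eps <= 1 by move: epsK1; rewrite /K; lra.
pose tau := (2 + 24 * S0) * eps.
have c2 : 4 * S0 * tau <= 1 by move: epsK1; rewrite /K /tau; lra.
have c3 : 4 * S0 * (tau + 3 * Cl * eps) <= e by move: epsKe; rewrite /K /tau; lra.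
have tau0 : 0 <= tau by rewrite mulr_ge0//; lra.
have tauE : (2 + 24 * S0) * eps = tau by [].
clearbody eps tau.
have [r r0 flat] := closed_hypersurface_flat hyp eps0.
have n20 : 0 < n0%:R + 2 :> R by rewrite ltr_wpDl.
(* A chain of at most n0 elements of size h then stays within the radius r of flatness, and h itself
   is at most r. *)
exists (r / (n0%:R + 2)); first by rewrite divr_gt0.
move=> h Hh hr w mw cw k kw B.
have h0 := Hpos h Hh; have [tM Hel] := Hfam h Hh.
have hr1 : (n0%:R + 2) * h <= r by move: hr; rewrite ler_pdivlMr// mulrC.
have n00 : 0 <= n0%:R * h by rewrite mulr_ge0// ltW.
have hr2 : h <= r by move: hr1; rewrite mulrDl; lra.
have hr3 : n0%:R * h < r by move: hr1; rewrite mulrDl; lra.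
have [bw _ [TT uT] _ _] := mw.
set E := edgemx (vert k); set b := mbase w in bw uT *; set Eb := edgemx (vert b) in uT.
have fE j : row_free (edgemx (@vert R (msh h) j)) by case: tM => + _ _ _; apply.
set nu := unormal Eb in uT.
have nn : nu *m nu^T = 1%:M by exact: unormal_unit (gram_unit (fE b)).
have low j (z : 'rV[R]_2) : `|z| <= S0 / h * enorm (z *m edgemx (@vert R (msh h) j)).
  by have [sr /andP[d1 _] _ _] := Hel j; exact: shape_low.
have Eh j : `|edgemx (@vert R (msh h) j)| <= h by have [_ /andP[_ d2] _ _] := Hel j; exact: edgemx_le.
set P0 := vert b ord0.
(* This is [chain_bound] for the coordinates of the embedding itself, whose oscillation on an
   element is at most h. *)
have near_base j a : j \in mel w -> `|vert j a - P0| < r.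
  move=> jw; have [z Tz <-] := vert_tri (vert j) a.
  apply: le_lt_trans hr3; apply: mxnorm_le => // i c; rewrite ord1.
  have := @chain_bound R (msh h) w (fun j x => (aff (vert j) x - P0) 0 c) (fun=> h) b 0 mw.
  have T0 := Tref0.
  have v0 : (aff (vert b) 0 - P0) 0 c = 0 by rewrite /aff mul0mx addr0 subrr mxE.
  move=> /(_ (fun=> ltW h0) _ _ bw T0 v0 j z jw Tz) H1.
  apply: (@le_trans _ _ (\sum_(l in mel w) h)).
    apply: H1 => [i' j' _ x y _ _ -> //|l x y lw Tx Ty].
    have [_ /andP[_ d2] _ _] := Hel l; apply: le_trans d2.
    rewrite (_ : _ - _ = (aff (vert l) x - aff (vert l) y) 0 c); last by rewrite !mxE; ring.
    rewrite (le_trans (mxnorm_entry _ _ _))// (le_trans (norm_le_enorm _))//.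
    by apply: diam_le; exact: tri_aff.
  by rewrite sumr_const -[leLHS]mulr_natl; apply: ler_wpM2r; [exact: ltW|rewrite ler_nat].
have GP j a : Gamma (@vert R (msh h) j a) by have [_ _ _] := Hel j; apply.
have [n [n1 chord prox]] := flat P0 (GP b ord0).
have P00 : `|P0 - P0| < r by rewrite subrr normr0.
have edge j a : `|vert j (lift ord0 a) - @vert R (msh h) j ord0| <= h.
  apply: mxnorm_le => [|i c]; first exact: ltW.
  by rewrite ord1; have := le_trans (mxnorm_entry (edgemx (@vert R (msh h) j)) a c) (Eh j); rewrite !mxE.
have rowE j a (u : 'rV[R]_3) : (edgemx (@vert R (msh h) j) *m u^T) a 0 = dot (vert j (lift ord0 a) - vert j ord0) u.
  by rewrite mxE; apply: eq_bigr => c _; rewrite !mxE.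
have En : `|Eb *m n^T| <= eps * h.
  apply: mxnorm_le => [|a i]; first by rewrite mulr_ge0// ltW.
  rewrite ord1 rowE (le_trans (chord _ _ (GP _ _) (GP _ _) (near_base _ _ bw) (near_base _ _ bw)))//.
  by rewrite ler_pM2l.
have nT : nu *m (mtan w)^T = 0 by [].
have Ekn : `|E *m nu^T| <= tau * h.
  apply: mxnorm_le => [|a i]; first by rewrite mulr_ge0// ltW.
  rewrite ord1 rowE; apply: le_trans (frame_tilt TT nn nT (fE b) (unormal_orth Eb) h0 (ltW S0p) (ltW eps0) c1 (low b) n1 En _) _.
    by apply: chord; rewrite ?near_base.
  by rewrite tauE; apply: ler_wpM2l.
have BE : B = E *m (mtan w)^T by rewrite /B fvert_edge.
have [uB iB] := flat_low TT nn nT h0 (ltW S0p) c2 (low k) Ekn.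
rewrite -BE in uB iB.
have T1 := norm_orthonormal TT.
have B3 : `|B| <= 3 * h.
  rewrite BE (le_trans (mxnormM _ _))// mxnormT -mulrA ler_wpM2l//.
  by have := ler_pM (normr_ge0 _) (normr_ge0 _) (Eh k) T1; rewrite mulr1.
(* The closest point is no farther, in the Euclidean norm, than the surface point found near the
   chord triangle; the factor 3 compares the Euclidean and sup norms. *)
have pd_ x : Tref x -> `|proj (aff (vert k) x) - aff (vert k) x| <= 3 * (eps * h).
  move=> Tx; have [y Gy yx] := prox (vert k) h (fun a => conj (GP k a) (near_base k a kw)) (edge k) hr2 x Tx.
  have [_ _ nb _] := Hel k; have [Gp cl] := cpp _ (nb _ (tri_aff (vert k) Tx)).
  rewrite distrC (le_trans (norm_le_enorm _))//.
  apply: (@le_trans _ _ (enorm (aff (vert k) x - y))).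
    by have [->|yp] := pselect (y = proj (aff (vert k) x)); [|exact: ltW (cl y Gy yp)].
  rewrite -enormN opprB (le_trans (enorm_le_norm _))// ler_wpM2l//.
have d0 : 0 <= 3 * (eps * h) by rewrite mulr_ge0// mulr_ge0// ltW.
have [rr [pr JE rb db]] := HCl (vert k) (proj \o aff (vert k)) _ d0 pd_.
split => //.
exists (fun x => invmx B *m jacobian (@param R proj kg (msh h) k) x); last by move=> x; rewrite mulKVmx.
apply: (@nearm_perturbation e (tau * h) (2 * S0 / h) (Cl * (3 * (eps * h))) _ (invmx B) (E *m nu^T *m nu) rr) => //.
- rewrite (le_trans (mxnormM _ _))// mul1r.
  by have := ler_pM (normr_ge0 _) (normr_ge0 _) Ekn (norm_orthonormal nn); rewrite mulr1.
- apply: le_trans c3; apply: eq_ler; field; rewrite gt_eqF//.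
- by rewrite mulr_ge0// ltW.
move=> x; rewrite JE -/E.
have TTu : mtan w *m (mtan w)^T \in unitmx by rewrite TT unitmx1.
have fr := orthoframe TTu nn nT; rewrite TT invmx1 mulmx1 in fr.
have EE : E = B *m mtan w + E *m nu^T *m nu.
  by rewrite BE -!mulmxA -mulmxDr fr mulmx1.
by rewrite [in LHS]EE -addrA mulmxDr mulKmx.
Qed.
End MacroNearFrame.

(** * The inf-sup inequality on one macroelement *)

Section WeightedIntegral.
Context {R : realType} {I : finType} (A : {set I}) (D : I -> R).
Hypothesis D_gt0 : forall k, k \in A -> 0 < D k.
Implicit Types f g q s : I -> 'rV[R]_2 -> R.

(** The integral over the flat macroelement written on the reference triangle, D k being the
    Jacobian of element k. *)
Definition wint f : R := \sum_(k in A) D k * int2 iTref (f k).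

Lemma wintD f g : nice A f -> nice A g -> wint (fun k x => f k x + g k x) = wint f + wint g.
Proof.
move=> nf ng; rewrite /wint -big_split; apply: eq_bigr => k kA /=.
by rewrite int2D ?mulrDr//; [exact: msb_iTref|exact: integrable2_nice kA nf|exact: integrable2_nice kA ng].
Qed.

Lemma wintZ (c : R) f : nice A f -> wint (fun k x => c * f k x) = c * wint f.
Proof.
move=> nf; rewrite /wint mulr_sumr; apply: eq_bigr => k kA.
by rewrite int2Z; [ring|exact: msb_iTref|exact: integrable2_nice kA nf].
Qed.

Lemma eq_wint f g : (forall k x, k \in A -> iTref x -> f k x = g k x) -> wint f = wint g.
Proof. by move=> fg; apply: eq_bigr => k kA; congr (_ * _); apply: eq_int2 => x Tx; exact: fg. Qed.

Lemma le_wint f g : nice A f -> nice A g -> (forall k x, k \in A -> iTref x -> f k x <= g k x) ->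
  wint f <= wint g.
Proof.
move=> nf ng fg; apply: ler_sum => k kA; rewrite ler_pM2l ?D_gt0//.
by apply: le_int2; [exact: msb_iTref|exact: integrable2_nice kA nf|exact: integrable2_nice kA ng|move=> x; exact: fg].
Qed.

Lemma wint_ge0 f : (forall k x, k \in A -> iTref x -> 0 <= f k x) -> 0 <= wint f.
Proof.
move=> f0; apply: sumr_ge0 => k kA; apply: mulr_ge0; first exact: ltW (D_gt0 kA).
by apply: int2_ge0 => x; exact: f0.
Qed.

Lemma niceZ (c : R) f : nice A f -> nice A (fun k x => c * f k x).
Proof. by apply: niceM; exact: (nice_cst (fun=> c)). Qed.

Lemma nice_norm f : nice A f -> nice A (fun k x => `|f k x|).
Proof.
move=> nf k kA; have [cf [C fC]] := nf k kA; split; last by exists C => x Tx; rewrite normr_id fC.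
by move=> x Tx; apply: (@continuous_comp _ _ _ (f k) Num.norm); [exact: cf|exact: norm_continuous].
Qed.

Lemma wint_cs f g : nice A f -> nice A g ->
  `|wint (fun k x => f k x * g k x)| <= Num.sqrt (wint (fun k x => f k x * f k x)) * Num.sqrt (wint (fun k x => g k x * g k x)).
Proof.
move=> nf ng; have nff := niceM nf nf; have ngg := niceM ng ng; have nfg := niceM nf ng.
have f0 : 0 <= wint (fun k x => f k x * f k x) by apply: wint_ge0 => k x _ _; rewrite -expr2 sqr_ge0.
have g0 : 0 <= wint (fun k x => g k x * g k x) by apply: wint_ge0 => k x _ _; rewrite -expr2 sqr_ge0.
rewrite -sqrtrM// -sqrtr_sqr ler_wsqrtr//; apply: quadratic_ge0 => // t.
have : 0 <= wint (fun k x => f k x * f k x + ((2 * t) * (f k x * g k x) + t ^+ 2 * (g k x * g k x))).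
  apply: wint_ge0 => k x _ _; rewrite (_ : _ + _ = (f k x + t * g k x) ^+ 2) ?sqr_ge0//; ring.
rewrite wintD//; last by apply: niceD; exact: niceZ.
by rewrite wintD ?wintZ//; [lra|exact: niceZ|exact: niceZ].
Qed.

Lemma abs_wint_le f g : nice A f -> nice A g -> (forall k x, k \in A -> iTref x -> `|f k x| <= g k x) ->
  `|wint f| <= wint g.
Proof.
move=> nf ng fg; rewrite ler_norml; apply/andP; split; last first.
  by apply: le_wint => // k x kA Tx; exact: le_trans (ler_norm _) (fg k x kA Tx).
rewrite -mulN1r -wintZ//; apply: le_wint => //; first exact: niceZ.
by move=> k x kA Tx; have := fg k x kA Tx; rewrite ler_norml mulN1r => /andP[].
Qed.

(* The surface mean of q vanishes, hence its flat mean c is of size E; the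
   divergence tested with q is compared with the flat one tested with q - c. *)
Lemma perturbed_divergence (E c : R) q alpha s div S (L1 Q2 S2 : R) :
  0 <= E -> 4 * E <= 1 ->
  nice A q -> nice A alpha -> nice A s -> nice A div -> nice A S ->
  (forall k x, k \in A -> iTref x -> `|alpha k x - 1| <= E) ->
  (forall k x, k \in A -> iTref x -> `|s k x| <= S k x) ->
  (forall k x, k \in A -> iTref x -> `|div k x - s k x| <= 324 * E * S k x) ->
  wint (fun k x => q k x * alpha k x) = 0 ->
  wint (fun k x => q k x - c) = 0 ->
  0 < L1 -> L1 = wint (fun _ _ => 1) -> Q2 = wint (fun k x => (q k x - c) * (q k x - c)) ->
  S2 = wint (fun k x => S k x * S k x) ->
  wint (fun k x => q k x * q k x * alpha k x) <= 4 * Q2 /\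
  wint (fun k x => s k x * (q k x - c)) - 2000 * E * (Num.sqrt S2 * Num.sqrt Q2) <=
    wint (fun k x => div k x * q k x * alpha k x).
Proof.
move=> E0 E4 nq na ns nd nS aE sS dE qa0 q0 L10 L1E Q2E S2E.
pose q' := fun k x => q k x - c.
have nc (d : R) : nice A (fun _ _ => d) by exact: (nice_cst (fun=> d)).
have nq' : nice A q' by rewrite /q'; apply: niceD nq _; exact: (nc (- c)).
have nq'q' := niceM nq' nq'.
have na1 : nice A (fun k x => alpha k x - 1) by apply: niceD na _; exact: (nc (-1)).
have Q20 : 0 <= Q2 by rewrite Q2E; apply: wint_ge0 => k x _ _; rewrite -expr2 sqr_ge0.
have a2 k x : k \in A -> iTref x -> 1 / 2 <= alpha k x <= 2.
  by move=> kA Tx; have := aE k x kA Tx; rewrite ler_norml => /andP[? ?]; apply/andP; split; lra.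
set rL := Num.sqrt L1; set rQ := Num.sqrt Q2; set rS := Num.sqrt S2.
have rL0 : 0 < rL by rewrite sqrtr_gt0.
have rQ0 : 0 <= rQ by exact: sqrtr_ge0.
have rS0 : 0 <= rS by exact: sqrtr_ge0.
have rLL : rL * rL = L1 by rewrite -expr2 sqr_sqrtr// ltW.
have rQQ : rQ * rQ = Q2 by rewrite -expr2 sqr_sqrtr.
have csq1 (f : I -> 'rV[R]_2 -> R) : nice A f ->
    wint (fun k x => `|f k x|) <= Num.sqrt (wint (fun k x => f k x * f k x)) * rL.
  move=> nf; have h := wint_cs (nice_norm nf) (nc 1).
  rewrite (eq_wint (g := fun k x => `|f k x|)) in h; last by move=> k x _ _; rewrite mulr1.
  rewrite (_ : wint (fun k x => `|f k x| * `|f k x|) = wint (fun k x => f k x * f k x)) in h; last first.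
    by apply: eq_wint => k x _ _; rewrite -normrM ger0_norm// -expr2 sqr_ge0.
  rewrite (_ : wint (fun _ _ => 1 * 1) = L1) in h; last by rewrite L1E; apply: eq_wint => k x _ _; rewrite mulr1.
  exact: le_trans (ler_norm _) h.
(* The zero surface mean says that c times the integral of alpha, itself at least L1 / 2, equals
   minus the integral of q' (alpha - 1), which is at most E rQ rL. *)
have cL : `|c| * rL <= 2 * E * rQ.
  have na' : nice A (fun k x => q' k x * (alpha k x - 1)) by exact: niceM.
  have e1 : wint (fun k x => q k x * alpha k x) = wint (fun k x => q' k x * (alpha k x - 1)) + c * wint alpha.
    have -> : wint (fun k x => q k x * alpha k x) = wint (fun k x => q' k x * (alpha k x - 1) + (q' k x + c * alpha k x)).
      by apply: eq_wint => k x _ _; rewrite /q'; ring.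
    rewrite wintD//; last by apply: niceD nq' _; exact: niceZ.
    by rewrite wintD//; [rewrite q0 add0r wintZ|exact: niceZ].
  have h1 : `|wint (fun k x => q' k x * (alpha k x - 1))| <= E * (rQ * rL).
    apply: (@le_trans _ _ (wint (fun k x => E * `|q' k x|))).
      apply: abs_wint_le => //; first by apply: niceZ; exact: nice_norm.
      by move=> k x kA Tx; rewrite normrM mulrC ler_wpM2r// aE.
    rewrite wintZ; last exact: nice_norm.
    by rewrite ler_wpM2l// /rQ Q2E; exact: csq1.
  have h2 : L1 / 2 <= wint alpha.
    have -> : L1 / 2 = wint (fun _ _ => 2^-1 * 1) by rewrite (wintZ _ (nc 1)) -L1E mulrC.
    apply: (le_wint (nc _) na) => k x kA Tx; by have /andP[] := a2 k x kA Tx; rewrite mulr1 div1r.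
  rewrite qa0 in e1.
  have h3 : `|c| * wint alpha <= E * (rQ * rL).
    rewrite -[X in _ * X]ger0_norm; last by rewrite (le_trans _ h2)// divr_ge0// ltW.
    rewrite -normrM (_ : c * _ = - wint (fun k x => q' k x * (alpha k x - 1))) ?normrN//.
    by apply/eqP; rewrite -addr_eq0 addrC -e1.
  have h4 : `|c| * (L1 / 2) <= E * (rQ * rL) by apply: le_trans h3; rewrite ler_wpM2l.
  rewrite -(ler_pM2r rL0); rewrite -rLL in h4; lra.
have c2L : c ^+ 2 * L1 <= Q2.
  have h : (`|c| * rL) * (`|c| * rL) <= (2 * E * rQ) * (2 * E * rQ) by apply: ler_pM => //; rewrite mulr_ge0// ltW.
  have -> : c ^+ 2 * L1 = (`|c| * rL) * (`|c| * rL) by rewrite -rLL -(real_normK (num_real c)); ring.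
  apply: (le_trans h); rewrite (_ : _ * _ = (2 * E * (2 * E)) * Q2); last by rewrite -rQQ; ring.
  apply: ler_piMl => //; clear -E0 E4; nra.
split.
  (* One factor 2 bounds alpha; the other comes from the orthogonal splitting of q into q - c and c,
     the constant part contributing c^2 L1 <= Q2. *)
  have -> : 4 * Q2 = 2 * (Q2 + Q2) by ring.
  apply: (@le_trans _ _ (2 * wint (fun k x => q k x * q k x))).
    rewrite -wintZ; last exact: niceM.
    apply: le_wint; [by apply: niceM => //; exact: niceM|by apply: niceZ; exact: niceM|].
    move=> k x kA Tx; rewrite mulrC ler_wpM2r -?expr2 ?sqr_ge0//; by have /andP[] := a2 k x kA Tx.
  rewrite ler_pM2l//.
  have -> : wint (fun k x => q k x * q k x) = wint (fun k x => q' k x * q' k x + (2 * c * q' k x + c ^+ 2 * 1)).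
    by apply: eq_wint => k x _ _; rewrite /q'; ring.
  rewrite wintD//; last by apply: niceD; [exact: niceZ|exact: (nc (c ^+ 2 * 1))].
  rewrite wintD; [|exact: niceZ|exact: (nc (c ^+ 2 * 1))].
  by rewrite wintZ// wintZ// q0 mulr0 add0r -L1E -Q2E lerD2l.
(* 649 = 2 * 324 + 1 collects the error of div, weighted by alpha <= 2, and that of alpha. By [cL]
   the term in c adds at most 2 * 650 E, and the sum of the two stays below 2000 E. *)
have nSq : nice A (fun k x => S k x * (649 * E * `|q' k x| + 650 * `|c|)).
  by apply: niceM nS _; apply: niceD; [apply: niceZ; exact: nice_norm|exact: (nc (650 * `|c|))].
have ndqa : nice A (fun k x => div k x * q k x * alpha k x) by apply: niceM na; exact: niceM.
have nsq' : nice A (fun k x => s k x * q' k x) by exact: niceM.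
have S0 k x : k \in A -> iTref x -> 0 <= S k x.
  by move=> kA Tx; exact: le_trans (normr_ge0 _) (sS k x kA Tx).
have diff : `|wint (fun k x => div k x * q k x * alpha k x - s k x * q' k x)| <=
    wint (fun k x => S k x * (649 * E * `|q' k x| + 650 * `|c|)).
  apply: abs_wint_le => //.
    rewrite (_ : (fun k x => _) = (fun k x => div k x * q k x * alpha k x + -1 * (s k x * q' k x))); last first.
      by apply/funext => k; apply/funext => x; rewrite mulN1r.
    by apply: niceD => //; exact: niceZ.
  move=> k x kA Tx.
  have -> : div k x * q k x * alpha k x - s k x * q' k x =
     (div k x - s k x) * (q k x * alpha k x) + s k x * (q k x * (alpha k x - 1) + c) by rewrite /q'; ring.
  have Sx := S0 k x kA Tx; have /andP[al ah] := a2 k x kA Tx.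
  have qq : `|q k x| <= `|q' k x| + `|c|.
    by rewrite -[q k x](subrK c) (le_trans (ler_normD _ _)).
  have b1 : `|(div k x - s k x) * (q k x * alpha k x)| <= (324 * E * S k x) * (`|q k x| * 2).
    by rewrite normrM ler_pM ?dE// normrM ler_pM// ger0_norm//; lra.
  have b2 : `|s k x * (q k x * (alpha k x - 1) + c)| <= S k x * (`|q k x| * E + `|c|).
    rewrite normrM ler_pM ?sS// (le_trans (ler_normD _ _))// lerD2r normrM ler_pM// aE//.
  apply: (le_trans (ler_normD _ _)); apply: (le_trans (lerD b1 b2)).
  have -> : 324 * E * S k x * (`|q k x| * 2) + S k x * (`|q k x| * E + `|c|) = S k x * (649 * E * `|q k x| + `|c|) by ring.
  apply: ler_wpM2l; first exact: Sx.
  have : 649 * E * `|q k x| <= 649 * E * (`|q' k x| + `|c|).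
    by apply: ler_wpM2l; [apply: mulr_ge0; [exact: ler0n|exact: E0]|exact: qq].
  have : E * `|c| <= 1 * `|c| by rewrite ler_wpM2r//; lra.
  have := normr_ge0 c; set u := `|c|; set t := `|q' k x|; set t1 := `|q k x|.
  rewrite (_ : 649 * E * (t + u) = 649 * E * t + 649 * (E * u)); last by ring.
  by move: (E * u) => Eu; clearbody u t t1; clear -u; lra.
have int_le : wint (fun k x => S k x * (649 * E * `|q' k x| + 650 * `|c|)) <= 2000 * E * (rS * rQ).
  have -> : wint (fun k x => S k x * (649 * E * `|q' k x| + 650 * `|c|)) =
      wint (fun k x => 649 * E * (S k x * `|q' k x|) + (650 * `|c|) * S k x).
    by apply: eq_wint => k x _ _; ring.
  have nSq1 : nice A (fun k x => S k x * `|q' k x|) by apply: niceM nS _; exact: nice_norm.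
  rewrite wintD ?wintZ//; [|exact: niceZ|exact: niceZ].
  have i1 : wint (fun k x => S k x * `|q' k x|) <= rS * rQ.
    have := le_trans (ler_norm _) (wint_cs nS (nice_norm nq')).
    rewrite -S2E (_ : wint (fun k x => `|q' k x| * `|q' k x|) = Q2)//.
    by rewrite Q2E; apply: eq_wint => k x _ _; rewrite -normrM ger0_norm// -expr2 sqr_ge0.
  have i2 : wint S <= rS * rL.
    have h := csq1 S nS; rewrite -S2E in h; apply: le_trans h.
    by apply: le_wint => //; [exact: nice_norm|move=> k x _ _; exact: ler_norm].
  have i3 : `|c| * wint S <= `|c| * (rS * rL) by rewrite ler_wpM2l.
  have i4 : `|c| * (rS * rL) <= 2 * E * (rS * rQ).
    by rewrite [rS * rL]mulrC mulrA [rS * rQ]mulrC [X in _ <= X]mulrA; exact: (ler_wpM2r rS0 cL).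
  have i5 : E * wint (fun k x => S k x * `|q' k x|) <= E * (rS * rQ) by rewrite ler_wpM2l.
  have i6 : 0 <= E * (rS * rQ) by apply: mulr_ge0 E0 _; exact: mulr_ge0.
  have -> : 650 * `|c| * wint S = 650 * (`|c| * wint S) by ring.
  have -> : 649 * E * wint (fun k x => S k x * `|q' k x|) = 649 * (E * wint (fun k x => S k x * `|q' k x|)) by ring.
  have -> : 2000 * E * (rS * rQ) = 2000 * (E * (rS * rQ)) by ring.
  have i7 : 2 * E * (rS * rQ) = 2 * (E * (rS * rQ)) by ring.
  rewrite i7 in i4; have i8 := le_trans i3 i4.
  move: i5 i6 i8; set a := E * wint _; set b := `|c| * wint S; set d := E * (rS * rQ).
  by clearbody a b d; clear -a; lra.
have e : wint (fun k x => div k x * q k x * alpha k x) =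
    wint (fun k x => s k x * q' k x) + wint (fun k x => div k x * q k x * alpha k x - s k x * q' k x).
  rewrite -wintD//.
    by apply: eq_wint => k x _ _; ring.
  rewrite (_ : (fun k x => _) = (fun k x => div k x * q k x * alpha k x + -1 * (s k x * q' k x))); last first.
    by apply/funext => k; apply/funext => x; rewrite mulN1r.
  by apply: niceD => //; exact: niceZ.
rewrite e lerD2l; have := le_trans diff int_le; rewrite ler_norml => /andP[h _]; exact: h.
Qed.
End WeightedIntegral.

(** * Poincare inequality on a macroelement *)

Section MacroPoincare.
Context {R : realType}.

Lemma nice_regT {I : finType} (A : {set I}) (v : I -> 'rV[R]_2 -> R) :
  (forall k, regT (v k)) -> nice A v /\ forall i, nice A (fun k x => pd i (v k) x).
Proof.
move=> rv; split=> [|i] k _.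
  split; first by move=> x Tx; apply: within_iTref Tx; exact: (rv k).1.
  by have [C _ vC] := regT_bounded (rv k); exists C => x /iTref_sub; exact: vC.
have [_ [K _ /(_ i) [_ rK]]] := rv k; split; first by move=> x Tx; have [] := rK x Tx.
by exists K => x Tx; have [] := rK x Tx.
Qed.

Lemma det2_le (B : 'M[R]_2) : `|\det B| <= 2 * `|B| ^+ 2.
Proof.
rewrite det2E (le_trans (ler_normB _ _))// mulr2n mulrDl mul1r expr2 !normrM.
by apply: lerD; apply: ler_pM => //; exact: mxnorm_entry.
Qed.

Lemma grad_pullback_le (B : 'M[R]_2) (g p : 'I_2 -> R) (c : R) : B \in unitmx -> `|B| <= c ->
  (forall b, p b = \sum_(l < 2) invmx B b l * g l) ->
  \sum_(l < 2) g l ^+ 2 <= 4 * c ^+ 2 * \sum_(b < 2) p b ^+ 2.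
Proof.
move=> uB Bc pE; have c0 : 0 <= c := le_trans (normr_ge0 _) Bc.
have gE l : g l = \sum_(b < 2) B l b * p b.
  transitivity ((B *m (invmx B *m \col_l g l)) l 0); first by rewrite mulKVmx// mxE.
  by rewrite mxE; apply: eq_bigr => b _; rewrite mxE pE; congr (_ * _); apply: eq_bigr => j _; rewrite mxE.
have gl l : g l ^+ 2 <= 2 * c ^+ 2 * \sum_(b < 2) p b ^+ 2.
  have gB : `|g l| <= c * (`|p 0| + `|p 1|).
    rewrite gE sum2 mulrDr (le_trans (ler_normD _ _))// !normrM.
    by apply: lerD; apply: ler_wpM2r => //; exact: le_trans (mxnorm_entry _ _ _) Bc.
  rewrite -(real_normK (num_real (g l))) (le_trans (lerXn2r 2 _ _ gB))// ?nnegrE ?mulr_ge0 ?addr_ge0//.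
  rewrite exprMn sum2 -[p 0 ^+ 2](real_normK (num_real _)) -[p 1 ^+ 2](real_normK (num_real _)).
  rewrite (_ : 2 * c ^+ 2 * _ = c ^+ 2 * (2 * (`|p 0| ^+ 2 + `|p 1| ^+ 2))); last by ring.
  apply: ler_wpM2l; first exact: sqr_ge0.
  have := sqr_ge0 (`|p 0| - `|p 1|); move: `|p 0| `|p 1| => a b; rewrite sqrrB sqrrD; lra.
rewrite sum2 (le_trans (lerD (gl 0) (gl 1)))//.
by rewrite (_ : 4 * _ * _ = 2 * c ^+ 2 * (\sum_(b < 2) p b ^+ 2) + 2 * c ^+ 2 * (\sum_(b < 2) p b ^+ 2))//; ring.
Qed.

(* The oscillation of v on one element is controlled by its gradient; walking
   from element to element starting at a zero of v controls v itself. *)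
Lemma macro_poincare (F : fspace R) r (S : R) (n0 : nat) : fspace_order F r -> 0 <= S ->
  exists2 CP : R, 0 <= CP & forall (M : mesh R) (w : macro M) (h : R) (v : bfun M R) k0 x0,
    0 < h -> is_macro w -> (#|mel w| <= n0)%N -> in_S F v ->
    (forall k, k \in mel w -> let B := edgemx (fvert w k) in
      [/\ B \in unitmx, `|invmx B| <= S / h & `|B| <= 3 * h]) ->
    k0 \in mel w -> Tref x0 -> v k0 x0 = 0 ->
    let D k := `|\det (edgemx (fvert w k))| in
    let p b k x := \sum_(l < 2) invmx (edgemx (fvert w k)) b l * pd l (v k) x in
    wint (mel w) D (fun k x => v k x * v k x) <=
      CP * h ^+ 2 * wint (mel w) D (fun k x => \sum_(b < 2) p b k x ^+ 2).
Proof.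
move=> oF S0; have [C C0 HC] := poincare_Tref oF.
pose a1 : R := int2 iTref (fun=> 1).
have a10 : 0 <= a1 by apply: int2_ge0 => x _; exact: ler01.
exists (n0%:R * 18 * (n0%:R ^+ 2 * (72 * C * S ^+ 2)) * a1).
  by rewrite !mulr_ge0 ?ler0n ?exprn_ge0.
move=> M w h v k0 x0 h0 mw nw [vF vS] HB k0w Tx0 v0.
pose D k := `|\det (edgemx (fvert w k))|.
pose p b k x := \sum_(l < 2) invmx (edgemx (fvert w k)) b l * pd l (v k) x.
pose p2 k x := \sum_(b < 2) p b k x ^+ 2.
rewrite -[is_true _]/(is_true (wint (mel w) D (fun k x => v k x * v k x) <= _ * h ^+ 2 * wint (mel w) D p2)).
have rv k : regT (v k) by exact: inF_regT oF (vF k).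
have [nv npd] := nice_regT (mel w) rv.
have np b : nice (mel w) (p b).
  by apply: nice_sum => l; apply: niceM (npd l); exact: (nice_cst (fun k => invmx (edgemx (fvert w k)) b l)).
have np2 : nice (mel w) p2.
  by apply: nice_sum => b; have := niceM (np b) (np b); congr nice; apply/funext => k; apply/funext => x; rewrite expr2.
have p20 k x : 0 <= p2 k x by apply: sumr_ge0 => b _; exact: sqr_ge0.
have D0 k : k \in mel w -> 0 < D k.
  by move=> kw; have [uB _ _] := HB k kw; rewrite normr_gt0 -unitfE -unitmxE.
set L := wint (mel w) D p2.
have L0 : 0 <= L by apply: wint_ge0 => // k x _ _; exact: p20.
(* Squared oscillation on one element: C from the reference triangle, 36 h^2 from pulling back the
   gradient, 2 (S / h)^2 from the inverse Jacobian. The powers of h cancel. *)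
pose T := 72 * C * S ^+ 2 * L.
have T0 : 0 <= T by rewrite !mulr_ge0 ?ler0n ?sqr_ge0.
have osc k x y : k \in mel w -> Tref x -> Tref y -> `|v k x - v k y| <= Num.sqrt T.
  move=> kw Tx Ty; rewrite -sqrtr_sqr ler_wsqrtr//; apply: (le_trans (HC _ (vF k) x y Tx Ty)).
  have [uB iB B3] := HB k kw; have Dk := D0 k kw; set B := edgemx _ in uB iB B3.
  have i1 : int2 iTref (fun z => \sum_(i < 2) pd i (v k) z ^+ 2) <= 36 * h ^+ 2 * int2 iTref (p2 k).
    rewrite -int2Z; [|exact: msb_iTref|exact: (integrable2_nice kw np2)].
    apply: le_int2; first exact: msb_iTref.
    - have nn : nice (mel w) (fun k z => \sum_(i < 2) pd i (v k) z * pd i (v k) z).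
        by apply: nice_sum => i; exact: niceM.
      exact: (integrable2_nice kw nn).
    - have := integrable2_nice kw (niceZ (36 * h ^+ 2) np2); exact.
    - move=> z _ /=; have := @grad_pullback_le B (fun l => pd l (v k) z) (fun b => p b k z) (3 * h) uB B3 (fun=> erefl).
      by rewrite exprMn (_ : 4 * (3 ^+ 2 * h ^+ 2) = 36 * h ^+ 2)//; ring.
  have i2 : int2 iTref (p2 k) <= 2 * (S / h) ^+ 2 * (D k * int2 iTref (p2 k)).
    have I0 : 0 <= int2 iTref (p2 k) by apply: int2_ge0 => z _.
    rewrite mulrA -[X in X <= _]mul1r ler_wpM2r//.
    have e1 : `|\det (invmx B)| * D k = 1 by rewrite -normrM det_inv mulVf ?normr1// -unitfE -unitmxE.
    rewrite -[X in X <= _]e1 ler_wpM2r ?(ltW Dk)// (le_trans (det2_le _))// ler_wpM2l// lerXn2r ?nnegrE//.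
    by rewrite divr_ge0// ltW.
  have i3 : D k * int2 iTref (p2 k) <= L.
    rewrite /L /wint (bigD1 k)//= lerDl; apply: sumr_ge0 => l /andP[lw _].
    by apply: mulr_ge0; [exact: ltW (D0 l lw)|apply: int2_ge0 => z _].
  have -> : T = C * (36 * h ^+ 2 * (2 * (S / h) ^+ 2 * L)).
    by rewrite /T; field; rewrite gt_eqF.
  apply: (ler_wpM2l C0); apply: (le_trans i1); apply: ler_wpM2l.
    by apply: mulr_ge0 (sqr_ge0 h); exact: ler0n.
  by apply: (le_trans i2); apply: ler_wpM2l; [|exact: i3]; apply: mulr_ge0 (sqr_ge0 _); exact: ler0n.
have vT k x : k \in mel w -> iTref x -> v k x * v k x <= n0%:R ^+ 2 * T.
  move=> kw /iTref_sub Tx.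
  have vk := chain_bound mw (fun=> sqrtr_ge0 T) vS osc k0w Tx0 v0 kw Tx.
  rewrite sumr_const -[X in _ <= X]mulr_natl in vk.
  have vk' : `|v k x| <= n0%:R * Num.sqrt T.
    by apply: (le_trans vk); rewrite ler_wpM2r ?sqrtr_ge0// ler_nat.
  rewrite -expr2 -(real_normK (num_real (v k x))) -[T in _ * T](sqr_sqrtr T0) -exprMn.
  by rewrite lerXn2r ?nnegrE// mulr_ge0 ?sqrtr_ge0.
(* Integration of the pointwise bound produces the factor h^2, as the Jacobian of an element is at
   most 18 h^2. *)
apply: (@le_trans _ _ (\sum_(k in mel w) 18 * h ^+ 2 * (n0%:R ^+ 2 * T * a1))).
  apply: ler_sum => k kw; have [uB _ B3] := HB k kw.
  apply: ler_pM; first exact: normr_ge0.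
  - by apply: int2_ge0 => x _; rewrite -expr2 sqr_ge0.
  - apply: (le_trans (det2_le _)); rewrite (_ : 18 * h ^+ 2 = 2 * (3 * h) ^+ 2); last by ring.
    by rewrite ler_wpM2l// lerXn2r ?nnegrE// mulr_ge0 ?ler0n ?ltW.
  - have nc (d : R) : nice (mel w) (fun _ _ => d) by exact: (nice_cst (fun=> d)).
    rewrite /a1 -int2Z; [|exact: msb_iTref|exact: (integrable2_nice kw (nc 1))].
    apply: le_int2; first exact: msb_iTref.
    + exact: (integrable2_nice kw (niceM nv nv)).
    + exact: (integrable2_nice kw (nc (n0%:R ^+ 2 * T * 1))).
    + by move=> x Tx /=; rewrite mulr1; exact: vT.
rewrite sumr_const -[X in X <= _]mulr_natl.
have -> : n0%:R * 18 * (n0%:R ^+ 2 * (72 * C * S ^+ 2)) * a1 * h ^+ 2 * L =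
   n0%:R * (18 * h ^+ 2 * (n0%:R ^+ 2 * T * a1)) by rewrite /T; ring.
by rewrite ler_wpM2r ?ler_nat// !mulr_ge0 ?ler0n ?sqr_ge0 ?(ltW h0)//.
Qed.

End MacroPoincare.

(** * Flat stability in terms of elementwise classical derivatives *)

Section FlatVelocity.
Context {R : realType}.

Lemma wint_sum {I : finType} (A : {set I}) (D : I -> R) (J : Type) (r : seq J)
  (f : J -> I -> 'rV[R]_2 -> R) : (forall j, nice A (f j)) ->
  wint A D (fun k x => \sum_(j <- r) f j k x) = \sum_(j <- r) wint A D (f j).
Proof.
move=> nf; elim: r => [|j r IH].
  rewrite big_nil /wint big1// => k _; rewrite (_ : (fun x => _) = fun=> 0) ?int2_0 ?mulr0//.
  by apply/funext => x; rewrite big_nil.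
rewrite big_cons -IH -wintD//; last exact: nice_sum.
by apply: eq_wint => k x _ _; rewrite big_cons.
Qed.

Lemma wint_sqr_eq0 {I : finType} (A : {set I}) (D : I -> R) (q : I -> 'rV[R]_2 -> R) (c : R) :
  (forall k, k \in A -> 0 < D k) -> (forall k, regT (q k)) ->
  wint A D (fun k x => (q k x - c) * (q k x - c)) = 0 ->
  forall k x, k \in A -> Tref x -> q k x = c.
Proof.
move=> D0 rq w0 k x kA Tx; have [nq _] := nice_regT A rq.
have nc : nice A (fun k x => q k x - c) by apply: niceD nq _; exact: (nice_cst (fun=> - c)).
have s0 (l : I) y : 0 <= (q l y - c) * (q l y - c) by rewrite -expr2 sqr_ge0.
have i0 : int2 iTref (fun y => (q k y - c) * (q k y - c)) = 0.
  have t0 l : l \in A -> 0 <= D l * int2 iTref (fun y => (q l y - c) * (q l y - c)).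
    by move=> lA; apply: mulr_ge0; [exact: ltW (D0 l lA)|apply: int2_ge0 => y _].
  have /eqP := psumr_eq0P t0 w0 kA; rewrite mulf_eq0 gt_eqF ?D0//= => /eqP; exact.
have q0 y : iTref y -> q k y = c.
  move=> Ty; have [cc _] := niceM nc nc kA.
  have /eqP := int2_eq0 (@open_iTref R) cc (fun y _ => s0 k y) (integrable2_nice kA (niceM nc nc)) i0 Ty.
  by rewrite -expr2 sqrf_eq0 subr_eq0 => /eqP.
apply/eqP; rewrite -subr_eq0 -normr_le0; apply/ler_addgt0Pl => e e0; rewrite addr0.
by have [y Ty ye] := Tref_dense (rq k).1 Tx e0; rewrite -(q0 y Ty) ltW.
Qed.

(** Constants are polynomials and so belong to the local space; this keeps a pressure admissible
    once its flat mean is subtracted. *)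
Lemma inF_sub_cst (F : fspace R) r f (c : R) : fspace_order F r -> inF F f -> inF F (fun x => f x - c).
Proof.
move=> [_ _ [pF _] _] [d fd].
have [|e fe] := pF (fun=> c).
  exists (fun i j => c * ((i == 0%N) && (j == 0%N))%:R) => x.
  rewrite (bigD1 ord0)//= (bigD1 ord0)//= !expr0 !mulr1 big1 => [|j /andP[_ j0]].
    by rewrite addr0 big1 ?addr0// => i i0; rewrite big1// => j _; rewrite (negPf (i0 : (i : nat) != 0%N)) mulr0 !mul0r.
  by rewrite (negPf (j0 : (j : nat) != 0%N)) mulr0 !mul0r.
exists (fun i => d i - e i) => x Tx; rewrite fd// {1}(fe x Tx) -sumrB.
by apply: eq_bigr => i _; rewrite mulrBl.
Qed.

Lemma in_Q_sub_cst (cont : bool) (F : fspace R) r (M : mesh R) (q : bfun M R) (c : R) :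
  fspace_order F r -> in_Q cont F q -> in_Q cont F (fun k x => q k x - c).
Proof.
move=> oF; case: cont => [[bq sq]|bq]; last by move=> k; exact: (inF_sub_cst c oF (bq k)).
split; first by move=> k; exact: (inF_sub_cst c oF (bq k)).
by move=> i j ij x y Tx Ty e; rewrite (sq i j ij x y).
Qed.

Lemma measurable2M (U : set 'rV[R]_2) (f g : 'rV[R]_2 -> R) : measurable2 U f -> measurable2 U g ->
  measurable2 U (fun x => f x * g x).
Proof. by move=> mf mg; exact: (measurable_funM mf mg). Qed.

(** Flat stability speaks of functions on the plane and of weak derivatives. The pressure q - c is
    assembled by [piecewise]; the velocity is read back on the elements, where its weak derivatives
    agree almost everywhere with p by [wder_affine]. *)
Lemma flat_velocity (cont : bool) (FV FQ : fspace R) rV rQ (M : mesh R) (w : macro M) (beta c : R) (q : bfun M R) :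
  fspace_order FV rV -> fspace_order FQ rQ ->
  triangulated_surface M -> is_macro w ->
  (forall k, k \in mel w -> \det (edgemx (fvert w k)) != 0) ->
  flat_stability cont FV FQ w beta -> in_Q cont FQ q ->
  forall D, D = (fun k => `|\det (edgemx (fvert w k))|) ->
  forall Q2, Q2 = wint (mel w) D (fun k x => (q k x - c) * (q k x - c)) ->
  wint (mel w) D (fun k x => q k x - c) = 0 -> 0 < Q2 ->
  exists v : 'I_2 -> bfun M R,
    [/\ forall a, in_S FV (v a),
        exists a k x, [/\ k \in mel w, Tref x & v a k x != 0],
        forall a, vanishes_on_boundary w (v a) &
        forall p, p = (fun b a k x => \sum_(l < 2) invmx (edgemx (fvert w k)) b l * pd l (v a k) x) ->
        beta * Num.sqrt (wint (mel w) D (fun k x => \sum_(a < 2) \sum_(b < 2) p b a k x ^+ 2)) * Num.sqrt Q2 <=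
        wint (mel w) D (fun k x => (\sum_(a < 2) p a a k x) * (q k x - c))].
Proof.
move=> oV oQ tM mw nd FS Qq; set A := mel w; move=> D DE Q2 Q2E q0 Q20.
set U := interior (macro_bar w).
have dis k l x y : k \in A -> l \in A -> iTref x -> iTref y -> aff (fvert w k) x = aff (fvert w l) y -> k = l.
  by move=> kA lA Tx /iTref_sub Ty; exact: flat_disjoint.
have oU : open U by exact: open_interior.
have Usub k x : k \in A -> iTref x -> U (aff (fvert w k) x) by move=> kA Tx; exact: macro_interior.
have Ucov y : U y -> exists2 k, k \in A & (aff (fvert w k) @` @Tref R) y.
  by move=> /interior_subset /(macro_barP tM mw).
have mU := msb_open oU.
have rq k : regT (q k).
  by apply: inF_regT oQ _; move: Qq; rewrite /in_Q; case: (cont) => [[H _]|H]; exact: H.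
have [nq _] := nice_regT A rq.
have nc : nice A (fun k x => q k x - c) by apply: niceD nq _; exact: (nice_cst (fun=> - c)).
have nc2 := niceM nc nc.
pose qb := piecewise A (fvert w) (fun k x => q k x - c).
have qbE k x : k \in A -> iTref x -> qb (aff (fvert w k) x) = q k x - c.
  by move=> kA Tx; rewrite /qb piecewiseE.
have [qi qI] := int2_piecewise nd oU Usub nc.
have mqb : measurable2 U qb := integrable2_measurable qi.
have wintE g h : measurable2 U g -> nice A h ->
  (forall k, k \in A -> {ae leb2 R, forall p, iTref (vec2 p) -> g (aff (fvert w k) (vec2 p)) = h k (vec2 p)}) ->
  int2 U g = wint A D h.
  by move=> mg nh gh; rewrite (int2_piecewise_ae nd dis oU Usub Ucov mg nh gh) /wint DE.
have QE : l2norm U qb = Num.sqrt Q2.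
  rewrite /l2norm Q2E; congr Num.sqrt; apply: wintE nc2 _; first exact: (measurable2M mqb mqb).
  by move=> k kA; apply: aeW => p Tp; rewrite qbE// expr2.
have [|||v [Vv vn vb vi]] := FS qb.
- split; first exact: (piecewise_in_Lp nd dis oU Usub nc).
  exists (fun k x => q k x - c); first exact: in_Q_sub_cst oQ Qq.
  by move=> k x kA Tx; rewrite mflat_aff ?qbE//; exact: iTref_sub.
- by rewrite /qb qI -[RHS]q0 /wint DE.
- by rewrite QE gt_eqF// sqrtr_gt0.
have /choice [z zP] a : exists z : bfun M R, in_S FV z /\
    forall k x, k \in A -> Tref x -> v a (mflat w (aff (vert k) x)) = z k x.
  by have [_ [z ? ?]] := Vv a; exists z.
exists z; split.
- by move=> a; exact: (zP a).1.
- have [a [x [/(macro_barP tM mw) [k kA [y Ty <-]] vx]]] := vn.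
  by exists a, k, y; split => //; rewrite -(zP a).2 ?mflat_aff.
- by move=> a k B oB x Bx; rewrite -(zP a).2; [exact: vb oB x Bx|case: oB|case: Bx].
move=> p pE.
have rz a k : regT (z a k) by exact: inF_regT oV ((zP a).1.1 k).
have np b a : nice A (p b a).
  rewrite pE; apply: nice_sum => l; have [_ /(_ l) npd] := nice_regT A (rz a).
  by apply: niceM npd; exact: (nice_cst (fun k => invmx (edgemx (fvert w k)) b l)).
(* [wD] is a choice; it is a weak derivative because the Sobolev membership of v provides one. *)
have wd a b : is_wder U [:: b] (v a) (wD U [:: b] (v a)).
  have [sob _] := Vv a; have [|g [wg _]] := sob [:: b]; first by [].
  exact: (xgetPex point (ex_intro _ g wg)).
have wp a b k : k \in A -> {ae leb2 R, forall y, iTref (vec2 y) ->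
    wD U [:: b] (v a) (aff (fvert w k) (vec2 y)) = p b a k (vec2 y)}.
  move=> kA; rewrite pE; have [c1 [K K0 HK]] := rz a k.
  apply: (wder_affine (nd k kA) oU (fun x => Usub k x kA) _ _ K0 (fun i => (HK i).1) _ (wd a b)).
  - by move=> x Tx; rewrite -(zP a).2 ?mflat_aff//; exact: iTref_sub.
  - by move=> x; exact: within_iTref.
  - by move=> i x Tx; have [] := (HK i).2 x Tx.
have mw' a b : measurable2 U (wD U [:: b] (v a)) by have [_ [? _] _] := wd a b.
have wp2 a b : l2norm U (wD U [:: b] (v a)) ^+ 2 = wint A D (fun k x => p b a k x ^+ 2).
  rewrite /l2norm sqr_sqrtr; last by apply: int2_ge0 => x _; exact: sqr_ge0.
  apply: wintE; [exact: (measurable2M (mw' a b) (mw' a b))|exact: (niceM (np b a) (np b a))|].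
  by move=> k kA; apply: (@filterS _ _ (ae_filter_ringOfSetsType (leb2 R)) _ _ _ (wp a b k kA)) => y H Ty; rewrite H.
move: vi; rewrite QE.
rewrite (_ : \sum_(a < 2) _ = wint A D (fun k x => \sum_(a < 2) \sum_(b < 2) p b a k x ^+ 2)); last first.
  rewrite wint_sum; last by move=> a; apply: nice_sum => b; exact: (niceM (np b a) (np b a)).
  apply: eq_bigr => a _; rewrite wint_sum; last by move=> b; exact: (niceM (np b a) (np b a)).
  by apply: eq_bigr => b _; rewrite wp2.
move=> vi; apply: (le_trans vi); rewrite le_eqVlt; apply/orP; left; apply/eqP.
apply: wintE.
- by apply: (measurable2M _ mqb); apply: (measurable_sum); move=> a; exact: mw'.
- by apply: niceM nc; apply: nice_sum => a; exact: np.
- move=> k kA; have w0 := wp 0 0 k kA; have w1 := wp 1 1 k kA.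
  apply: (@filterS2 _ _ (ae_filter_ringOfSetsType (leb2 R)) _ _ _ _ w0 w1) => y H0 H1 Ty; rewrite qbE// !sum2 H0// H1//.
Qed.

End FlatVelocity.

(** * Divergence and norm of the lifted field *)

Section MacroCalculus.
Context {R : realType}.

Lemma nice_dominated {I : finType} (A : {set I}) (f g : I -> 'rV[R]_2 -> R) :
  (forall k x, k \in A -> iTref x -> {for x, continuous (f k)}) -> nice A g ->
  (forall k x, k \in A -> iTref x -> `|f k x| <= g k x) -> nice A f.
Proof.
move=> cf ng fg k kA; split; first by move=> x; exact: cf.
by have [_ [C gC]] := ng k kA; exists C => x Tx; rewrite (le_trans (fg k x kA Tx))// (le_trans (ler_norm _))// gC.
Qed.

Lemma near_one_bounds (a E : R) : 4 * E <= 1 -> `|a - 1| <= E -> 0 <= a <= 2.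
Proof. by move=> E4; rewrite ler_norml => /andP[? ?]; apply/andP; split; lra. Qed.

Lemma sqr_le_norm (a b : R) : `|a| <= b -> a * a <= b * b.
Proof.
by move=> ab; rewrite -expr2 -(real_normK (num_real a)) expr2 ler_pM.
Qed.

(** Everything is dominated by Sf, the flat gradient plus S / h times v. Since v itself is at most
    (h / S) Sf, the normal part gains the h that cancels its weight, and the L^2 part is controlled
    by h <= 1. The constants count entries, nine for the gradient and three for a vector, with a
    factor 2 for the area density alpha. *)
Lemma macro_calculus (M : mesh R) (w : macro M) (X : bfun M 'rV[R]_3) (h S e : R)
    (v : 'I_2 -> bfun M R) :
  is_macro w -> 0 < h -> h <= 1 -> 0 < S -> 0 <= e -> 4 * (18 ^+ 8 * e) <= 1 ->
  (forall k, k \in mel w -> let B := edgemx (fvert w k) in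
    [/\ B \in unitmx, `|invmx B| <= S / h &
        exists2 N, nearm e (mtan w) N & forall x, jacobian (X k) x = B *m N x]) ->
  (forall a k, regT (v a k)) ->
  let E := 18 ^+ 8 * e in
  let D := fun k => `|\det (edgemx (fvert w k))| in
  let p := fun b a k x => \sum_(l < 2) invmx (edgemx (fvert w k)) b l * pd l (v a k) x in
  let u := fun k x => \sum_(a < 2) v a k x *: row a (mtan w) in
  let Sf := fun k x => \sum_(b < 2) \sum_(a < 2) `|p b a k x| + S / h * \sum_(a < 2) `|v a k x| in
  let div := fun k => surface_div (X k) (Pfield (X k) (u k)) in
  [/\ exists alpha, [/\ nice (mel w) alpha,
        forall k x, k \in mel w -> iTref x -> `|alpha k x - 1| <= E &
        forall f, nice (mel w) f -> surface_int X w f = wint (mel w) D (fun k x => f k x * alpha k x)],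
      nice (mel w) Sf /\ nice (mel w) div,
      forall k x, k \in mel w -> iTref x ->
        `|div k x - \sum_(a < 2) p a a k x| <= 324 * E * Sf k x &
      norm_1h X h w u <=
        (Num.sqrt (2 * (9 * 108 ^+ 2 + 27 * (1 / S) ^+ 2)) + Num.sqrt (6 * (1 / S) ^+ 2)) *
        Num.sqrt (wint (mel w) D (fun k x => Sf k x * Sf k x))].
Proof.
move=> mw h0 h1 S0 e0 e4 HX rv E D p u Sf div; have [_ _ [TT _] _ _] := mw.
set A := mel w in HX *.
have E0 : 0 <= E by rewrite mulr_ge0// exprn_ge0.
have e8 : 18 ^+ 8 * e <= 1 by move: E0 e4; rewrite /E; move: (_ * e) => t; lra.
have E4 : 4 * E <= 1 := e4.
have EE : E = 18 ^+ 8 * e by [].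
clearbody E.
have calc k : k \in A -> exists alpha : 'rV[R]_2 -> R, (forall x, iTref x ->
      [/\ area (X k) x = D k * alpha x, `|alpha x - 1| <= E & {for x, continuous alpha}]) /\
    forall x, iTref x ->
     [/\ `|div k x - \sum_(a < 2) p a a k x| <= 324 * E * Sf k x,
      forall i j, `|surface_nabla (X k) (Pfield (X k) (u k)) x i j| <= 108 * Sf k x,
      forall c, `|Pfield (X k) (u k) x 0 c| <= 3 * \sum_(a < 2) `|v a k x| &
      forall c, `|Qfield (X k) (u k) x 0 c| <= E * \sum_(a < 2) `|v a k x| ] /\
     [/\ forall i j, {for x, continuous (fun x => surface_nabla (X k) (Pfield (X k) (u k)) x i j)},
      forall c, {for x, continuous (fun x => Pfield (X k) (u k) x 0 c)} &
      forall c, {for x, continuous (fun x => Qfield (X k) (u k) x 0 c)}].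
  move=> kA; have [uB iB [N nN JX]] := HX k kA.
  have [[alpha Ha] Hv] := surface_calculus e0 e8 TT nN uB iB JX.
  by exists alpha; rewrite EE; split; [exact: Ha|exact: (Hv (fun a => v a k) (fun a => rv a k))].
have /choice [alpha Ha] k : exists alpha : 'rV[R]_2 -> R, k \in A -> forall x, iTref x ->
      [/\ area (X k) x = D k * alpha x, `|alpha x - 1| <= E & {for x, continuous alpha}].
  have [kA|nk] := boolP (k \in A); last by exists (fun=> 0).
  by have [al [H _]] := calc k kA; exists al.
have Hc k (kA : k \in A) := projT2 (cid (calc k kA)).
have nc (d : R) : nice A (fun _ _ => d) by exact: (nice_cst (fun=> d)).
have a1 k x : k \in A -> iTref x -> `|alpha k x - 1| <= E by move=> kA Tx; have [] := Ha k kA x Tx.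
have a2 k x : k \in A -> iTref x -> 0 <= alpha k x <= 2.
  by move=> kA Tx; exact: near_one_bounds E4 (a1 k x kA Tx).
have na : nice A alpha.
  apply: (@nice_dominated _ A alpha (fun _ _ => 2)) => // k x kA Tx; first by have [] := Ha k kA x Tx.
  by have /andP[a0 ?] := a2 k x kA Tx; rewrite ger0_norm.
have sI f : nice A f -> surface_int X w f = wint A D (fun k x => f k x * alpha k x).
  move=> nf; rewrite /surface_int /wint; apply: eq_bigr => k kA.
  have -> : int2 (interior (@Tref R)) (fun x => f k x * area (X k) x) = int2 iTref (fun x => D k * (f k x * alpha k x)).
    by apply: eq_int2 => x Tx; have [-> _ _] := Ha k kA x Tx; rewrite mulrCA.
  by rewrite int2Z; [rewrite mulrC|exact: msb_iTref|exact: (integrable2_nice kA (niceM nf na))].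
have nv a : nice A (v a) by have [] := nice_regT A (rv a).
have np b a : nice A (p b a).
  apply: nice_sum => l; have [_ /(_ l) npd] := nice_regT A (rv a).
  by apply: niceM npd; exact: (nice_cst (fun k => invmx (edgemx (fvert w k)) b l)).
have nSf : nice A Sf.
  apply: niceD; first by apply: nice_sum => b; apply: nice_sum => a; exact: nice_norm.
  by apply: niceZ; apply: nice_sum => a; exact: nice_norm.
have SS : 0 < S / h by rewrite divr_gt0.
have s0 k x : 0 <= \sum_(a < 2) `|v a k x| by apply: sumr_ge0 => a _; exact: normr_ge0.
have sSf k x : \sum_(a < 2) `|v a k x| <= h / S * Sf k x.
  rewrite -(ler_pM2l SS) mulrA (_ : S / h * (h / S) = 1) ?mul1r; last by field; rewrite !gt_eqF.
  by rewrite lerDr; apply: sumr_ge0 => b _; apply: sumr_ge0 => a _; exact: normr_ge0.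
have Sf0 k x : 0 <= Sf k x.
  by apply: addr_ge0; [apply: sumr_ge0 => b _; apply: sumr_ge0 => a _; exact: normr_ge0|exact: mulr_ge0 (ltW SS) (s0 k x)].
have hS : h / S <= 1 / S by rewrite ler_wpM2r// invr_ge0 ltW.
have hS0 : 0 <= h / S by rewrite divr_ge0 ?ltW.
have dB k x : k \in A -> iTref x -> `|div k x - \sum_(a < 2) p a a k x| <= 324 * E * Sf k x.
  by move=> kA Tx; have [_ /(_ x Tx) [[]]] := Hc k kA.
have GB k x i j : k \in A -> iTref x -> `|surface_nabla (X k) (Pfield (X k) (u k)) x i j| <= 108 * Sf k x.
  by move=> kA Tx; have [_ /(_ x Tx) [[_ H _ _] _]] := Hc k kA.
have PB k x c : k \in A -> iTref x -> `|Pfield (X k) (u k) x 0 c| <= 3 * (1 / S) * Sf k x.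
  move=> kA Tx; have [_ /(_ x Tx) [[_ _ H _] _]] := Hc k kA; apply: (le_trans (H c)).
  rewrite -mulrA; apply: ler_wpM2l; first exact: ler0n.
  by apply: (le_trans (sSf k x)); exact: ler_wpM2r (Sf0 k x) _ _ hS.
have QB k x c : k \in A -> iTref x -> `|Qfield (X k) (u k) x 0 c| <= h / S * Sf k x.
  move=> kA Tx; have [_ /(_ x Tx) [[_ _ _ H] _]] := Hc k kA; apply: (le_trans (H c)).
  by apply: le_trans (sSf k x); apply: ler_piMl => //; clear -E0 E4; lra.
have cG k x i j : k \in A -> iTref x -> {for x, continuous (fun x => surface_nabla (X k) (Pfield (X k) (u k)) x i j)}.
  by move=> kA Tx; have [_ /(_ x Tx) [_ [H _ _]]] := Hc k kA; exact: H.
have cP k x c : k \in A -> iTref x -> {for x, continuous (fun x => Pfield (X k) (u k) x 0 c)}.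
  by move=> kA Tx; have [_ /(_ x Tx) [_ [_ H _]]] := Hc k kA; exact: H.
have cQ k x c : k \in A -> iTref x -> {for x, continuous (fun x => Qfield (X k) (u k) x 0 c)}.
  by move=> kA Tx; have [_ /(_ x Tx) [_ [_ _ H]]] := Hc k kA; exact: H.
clear calc Hc HX.
have ndiv : nice A div.
  have ns : nice A (fun k x => 324 * E * Sf k x + \sum_(a < 2) `|p a a k x|).
    by apply: niceD; [exact: niceZ|apply: nice_sum => a; exact: nice_norm].
  apply: nice_dominated ns _ => k x kA Tx; first by apply: continuous_sum_at => i; exact: cG.
  rewrite -[div k x](subrK (\sum_(a < 2) p a a k x)) (le_trans (ler_normD _ _))// lerD ?dB//.
  exact: ler_norm_sum.
split => //; first by exists alpha.
have D0 k : 0 <= D k by exact: normr_ge0.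
set S2 := wint A D (fun k x => Sf k x * Sf k x).
have S20 : 0 <= S2.
  apply: sumr_ge0 => k _; apply: mulr_ge0 => //; apply: int2_ge0 => x _; exact: mulr_ge0.
have nSS := niceM nSf nSf.
have key (f : 'I_(nel M) -> 'rV[R]_2 -> R) (c : R) : (forall k x, k \in A -> iTref x -> {for x, continuous (f k)}) ->
    (forall k x, k \in A -> iTref x -> 0 <= f k x <= c * (Sf k x * Sf k x)) ->
    surface_int X w f <= 2 * c * S2.
  move=> cf bf.
  have nf : nice A f.
    apply: (nice_dominated cf (niceZ c nSS)) => k x kA Tx.
    by have /andP[f0 ?] := bf k x kA Tx; rewrite ger0_norm.
  rewrite sI// -(wintZ _ (2 * c) nSS); apply: ler_sum => k kA; apply: ler_wpM2l => //.
  apply: le_int2; first exact: msb_iTref.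
  - exact: integrable2_nice kA (niceM nf na).
  - exact: integrable2_nice kA (niceZ (2 * c) nSS).
  - move=> x Tx; have /andP[f0 fc] := bf k x kA Tx; have /andP[al0 al2] := a2 k x kA Tx.
    by rewrite mulrC -[X in _ <= X]mulrA; exact: ler_pM.
have k1 : surface_int X w (fun k x => let G := surface_nabla (X k) (Pfield (X k) (u k)) x in \tr (G *m G^T)) <= 2 * (9 * 108 ^+ 2) * S2.
  have trE (G : 'M[R]_3) : \tr (G *m G^T) = \sum_i \sum_j G i j * G i j.
    by apply: eq_bigr => i _; rewrite mxE; apply: eq_bigr => j _; rewrite mxE.
  apply: key => k x kA Tx.
    rewrite (_ : (fun x => _) = (fun x => \sum_i \sum_j surface_nabla (X k) (Pfield (X k) (u k)) x i j * surface_nabla (X k) (Pfield (X k) (u k)) x i j)); last first.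
      by apply/funext => y; exact: trE.
    by apply: continuous_sum_at => i; apply: continuous_sum_at => j; apply: continuousM_at; exact: cG.
  rewrite /= trE; apply/andP; split.
    by apply: sumr_ge0 => i _; apply: sumr_ge0 => j _; rewrite -expr2 sqr_ge0.
  have -> : 9 * 108 ^+ 2 * (Sf k x * Sf k x) = \sum_(i < 3) \sum_(j < 3) (108 * Sf k x) * (108 * Sf k x).
    by rewrite !sum3; ring.
  by apply: ler_sum => i _; apply: ler_sum => j _; apply: sqr_le_norm; exact: GB.
have sqE (c : R) (f : 'I_(nel M) -> 'rV[R]_2 -> 'rV[R]_3) :
    (forall k x i, k \in A -> iTref x -> {for x, continuous (fun x => f k x 0 i)}) ->
    (forall k x i, k \in A -> iTref x -> `|f k x 0 i| <= c * Sf k x) ->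
    surface_int X w (fun k x => enorm (f k x) ^+ 2) <= 2 * (3 * c ^+ 2) * S2.
  move=> cf fc; apply: key => k x kA Tx.
    rewrite (_ : (fun x => _) = (fun x => \sum_i f k x 0 i * f k x 0 i)); last first.
      by apply/funext => y; exact: enorm_sqr.
    by apply: continuous_sum_at => i; apply: continuousM_at; exact: cf.
  rewrite sqr_ge0 /= enorm_sqr /dot.
  have -> : 3 * c ^+ 2 * (Sf k x * Sf k x) = \sum_(i < 3) (c * Sf k x) * (c * Sf k x) by rewrite sum3; ring.
  by apply: ler_sum => i _; apply: sqr_le_norm; exact: fc.
have k2 := sqE _ _ cP PB; have k3 := sqE _ _ cQ QB.
rewrite /norm_1h mulrDl; apply: lerD.
  have c0 : 0 <= 2 * (9 * 108 ^+ 2 + 27 * (1 / S) ^+ 2).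
    apply: mulr_ge0; first exact: ler0n.
    by apply: addr_ge0; apply: mulr_ge0; [exact: ler0n|exact: sqr_ge0|exact: ler0n|exact: sqr_ge0].
  rewrite /norm_H1tan -(sqrtrM _ c0).
  apply: ler_wsqrtr; apply: (le_trans (lerD k1 k2)).
  by rewrite le_eqVlt; apply/orP; left; apply/eqP; ring.
rewrite /surface_l2; set Z := surface_int _ _ _ in k3 *.
have c0 : 0 <= 6 * (1 / S) ^+ 2 by apply: mulr_ge0; [exact: ler0n|exact: sqr_ge0].
have k4 : Num.sqrt Z <= h * (Num.sqrt (6 * (1 / S) ^+ 2) * Num.sqrt S2).
  rewrite -{1}[h]gtr0_norm// -sqrtr_sqr -(sqrtrM _ c0).
  rewrite -sqrtrM ?sqr_ge0//; apply: ler_wsqrtr; apply: (le_trans k3).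
  by rewrite le_eqVlt; apply/orP; left; apply/eqP; field; rewrite gt_eqF.
by rewrite mulrC ler_pdivrMr// mulrC.
Qed.
End MacroCalculus.

(** * Elementary facts on fields with constant directions, and the final arithmetic *)

Section TangentialFields.
Context {R : realType}.

Lemma ref_face_nonempty (A : {set 'I_3}) m : m \in A -> exists x : 'rV[R]_2, ref_face A x.
Proof.
move=> mA; pose x : 'rV[R]_2 := \row_a (lift ord0 a == m)%:R.
have bx k : bary x k = (k == m)%:R.
  rewrite /bary; case: unliftP => [a ->|->]; first by rewrite mxE.
  rewrite sum2 !mxE (_ : lift ord0 0 = 1 :> 'I_3); last exact/val_inj.
  rewrite (_ : lift ord0 1 = 2 :> 'I_3); last exact/val_inj.
  by have [->|->|->] := ord3P m; rewrite /= ?addr0 ?add0r ?subr0 ?subrr.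
exists x; split; first by move=> k; rewrite bx; exact: ler0n.
by move=> k kA; rewrite bx; case: eqP => // km; rewrite km mA in kA.
Qed.

Lemma in_S_lincomb (F : fspace R) (M : mesh R) (v : 'I_2 -> bfun M R) (t : 'I_2 -> R) :
  (forall a, in_S F (v a)) -> in_S F (fun k x => \sum_(a < 2) v a k x * t a).
Proof.
move=> vS; split; last first.
  move=> i j ij x y Tx Ty e; apply: eq_bigr => a _; congr (_ * _).
  by have [_ H] := vS a; exact: H.
move=> k; have /choice [d dE] a := (vS a).1 k.
exists (fun i => \sum_(a < 2) d a i * t a) => x Tx.
transitivity (\sum_(a < 2) \sum_(i < fdim F) d a i * t a * fgen i x).
  by apply: eq_bigr => a _; rewrite dE// mulr_suml; apply: eq_bigr => i _; rewrite mulrAC.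
by rewrite exchange_big; apply: eq_bigr => i _; rewrite mulr_suml.
Qed.

Lemma sqrD_le (x y : R) : (x + y) * (x + y) <= 2 * (x * x + y * y).
Proof. by rewrite -subr_ge0 (_ : _ - _ = (x - y) ^+ 2) ?sqr_ge0//; ring. Qed.

Lemma tangential_sqr_le (p : 'I_2 -> 'I_2 -> R) (v : 'I_2 -> R) (kappa : R) :
  let s := \sum_(b < 2) \sum_(a < 2) `|p b a| + kappa * \sum_(a < 2) `|v a| in
  s * s <= 8 * (\sum_(a < 2) \sum_(b < 2) p b a ^+ 2) + 4 * kappa ^+ 2 * \sum_(a < 2) v a * v a.
Proof.
rewrite /= !sum2; have nn (t : R) : `|t| * `|t| = t * t by rewrite -normrM ger0_norm// -expr2 sqr_ge0.
apply: (le_trans (sqrD_le _ _)).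
have h1 := sqrD_le (`|p 0 0| + `|p 0 1|) (`|p 1 0| + `|p 1 1|).
have h2 := sqrD_le `|p 0 0| `|p 0 1|; have h3 := sqrD_le `|p 1 0| `|p 1 1|.
have h4 : (kappa * (`|v 0| + `|v 1|)) * (kappa * (`|v 0| + `|v 1|)) <= kappa ^+ 2 * (2 * (v 0 * v 0 + v 1 * v 1)).
  rewrite (_ : _ * _ = kappa ^+ 2 * ((`|v 0| + `|v 1|) * (`|v 0| + `|v 1|))); last by ring.
  by have := sqrD_le `|v 0| `|v 1|; rewrite !nn; apply: ler_wpM2l; exact: sqr_ge0.
rewrite !nn in h2 h3.
have -> : 4 * kappa ^+ 2 * (v 0 * v 0 + v 1 * v 1) = 2 * (kappa ^+ 2 * (2 * (v 0 * v 0 + v 1 * v 1))) by ring.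
have -> : 8 * (p 0 0 ^+ 2 + p 1 0 ^+ 2 + (p 0 1 ^+ 2 + p 1 1 ^+ 2)) =
    2 * (2 * (2 * (p 0 0 * p 0 0 + p 0 1 * p 0 1) + 2 * (p 1 0 * p 1 0 + p 1 1 * p 1 1))) by ring.
rewrite -mulrDr; apply: ler_wpM2l; first exact: ler0n.
apply: lerD h4; apply: (le_trans h1); apply: ler_wpM2l; first exact: ler0n.
exact: lerD.
Qed.

Lemma near_one_ge_half (a E : R) : 4 * E <= 1 -> `|a - 1| <= E -> 2^-1 <= a.
Proof. by move=> E4; rewrite ler_norml => /andP[? ?]; lra. Qed.

Lemma le_half_sub (t1 t2 t3 : R) : t2 <= t1 / 2 -> t3 <= t1 / 2 -> t3 <= t1 - t2.
Proof. by lra. Qed.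

(** Half of the main term bb rL rQ absorbs the perturbation, as 4000 E K <= bb; the other half
    dominates the product of norms, since nn <= C5 K rL and ll <= 2 rQ. *)
Lemma infsup_arith (bb C5 K rL rQ nn ll sS E W : R) :
  0 < bb -> 0 < C5 -> 0 < K -> 0 <= rL -> 0 <= rQ -> 0 <= ll -> 0 <= E ->
  nn <= C5 * sS -> ll <= 2 * rQ -> sS <= K * rL -> 4000 * E * K <= bb ->
  bb * rL * rQ - 2000 * E * (sS * rQ) <= W -> bb / (4 * C5 * K) * nn * ll <= W.
Proof.
move=> b0 C0 K0 L0 Q0 l0 E0 nC lQ sK EK; apply: le_trans.
have h1 : 2000 * E * (sS * rQ) <= bb * rL * rQ / 2.
  apply: (@le_trans _ _ (2000 * E * (K * rL * rQ))).
    by apply: ler_wpM2l; [apply: mulr_ge0 E0; exact: ler0n|exact: ler_wpM2r].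
  have -> : 2000 * E * (K * rL * rQ) = (4000 * E * K) * (rL * rQ / 2) by field.
  have -> : bb * rL * rQ / 2 = bb * (rL * rQ / 2) by field.
  by apply: ler_wpM2r EK; rewrite divr_ge0// mulr_ge0.
have h2 : bb / (4 * C5 * K) * nn * ll <= bb * rL * rQ / 2.
  have -> : bb * rL * rQ / 2 = bb / (4 * C5 * K) * (C5 * (K * rL)) * (2 * rQ).
    by field; rewrite !gt_eqF.
  have b1 : 0 <= bb / (4 * C5 * K) by rewrite divr_ge0 ?mulr_ge0 ?ltW// ler0n.
  have n2 : nn <= C5 * (K * rL) by apply: (le_trans nC); exact: ler_wpM2l (ltW C0) _ _ sK.
  have n3 : bb / (4 * C5 * K) * nn <= bb / (4 * C5 * K) * (C5 * (K * rL)) by exact: ler_wpM2l.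
  apply: (le_trans (ler_wpM2r l0 n3)); apply: ler_wpM2l lQ.
  by rewrite mulr_ge0// mulr_ge0 ?mulr_ge0// ltW.
exact: le_half_sub h1 h2.
Qed.

Lemma int2_iTref1_gt0 : 0 < int2 iTref (fun _ : 'rV[R]_2 => 1 : R).
Proof.
have g0 : 0 <= int2 iTref (fun _ : 'rV[R]_2 => 1 : R) by apply: int2_ge0 => x _; exact: ler01.
rewrite lt0r g0 andbT.
have nT : nice [set: 'I_1]%SET (fun _ _ => 1 : R) by exact: (nice_cst (fun=> 1)).
apply/eqP => i0; have i1 := integrable2_nice (finset.in_setT (ord0 : 'I_1)) nT.
have := int2_eq0 (@open_iTref R) (nT ord0 (finset.in_setT _)).1 (fun _ _ => ler01) i1 i0 (@iTref_center R).
by move/eqP; rewrite oner_eq0.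
Qed.

End TangentialFields.

(** * Transfer of the flat inequality to one parametric macroelement *)

Section MacroInfSup.
Context {R : realType}.

Lemma macro_infsup (cont : bool) (FV FQ : fspace R) rV rQ (M : mesh R) (w : macro M)
    (X : bfun M 'rV[R]_3) (h S e bb CP : R) :
  fspace_order FV rV -> fspace_order FQ rQ ->
  triangulated_surface M -> is_macro w -> 0 < h -> h <= 1 -> 0 < S -> 0 <= e ->
  0 < bb -> 0 <= CP ->
  (forall k, k \in mel w -> let B := edgemx (fvert w k) in
    [/\ B \in unitmx, `|invmx B| <= S / h &
        exists2 N, nearm e (mtan w) N & forall x, jacobian (X k) x = B *m N x]) ->
  (forall (v : bfun M R) k0 x0, in_S FV v -> k0 \in mel w -> Tref x0 -> v k0 x0 = 0 ->
    let D k := `|\det (edgemx (fvert w k))| in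
    let p b k x := \sum_(l < 2) invmx (edgemx (fvert w k)) b l * pd l (v k) x in
    wint (mel w) D (fun k x => v k x * v k x) <=
      CP * h ^+ 2 * wint (mel w) D (fun k x => \sum_(b < 2) p b k x ^+ 2)) ->
  let K := Num.sqrt (8 + 4 * S ^+ 2 * CP) in
  let C5 := Num.sqrt (2 * (9 * 108 ^+ 2 + 27 * (1 / S) ^+ 2)) + Num.sqrt (6 * (1 / S) ^+ 2) in
  4 * (18 ^+ 8 * e) <= 1 -> 4000 * (18 ^+ 8 * e) * K <= bb ->
  flat_stability cont FV FQ w bb ->
  forall q, in_Q cont FQ q -> nonzero_on w q -> surface_int X w q = 0 ->
  exists v : bfun M 'rV[R]_3,
    [/\ in_V3 FV v, vanishes_on_boundary w v, nonzero_on w v &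
        bb / (4 * C5 * K) * norm_1h X h w v * surface_l2 X w q <=
        surface_int X w (fun k xi =>
          surface_div (X k) (Pfield (X k) (v k)) xi * q k xi)].
Proof.
move=> oV oQ tM mw h0 h1 S0 e0 bb0 CP0 HX HP K C5 E4 EK FS q Qq qn q0.
pose A := mel w; pose D k := `|\det (edgemx (fvert w k))|.
have E0 : 0 <= 18 ^+ 8 * e by rewrite mulr_ge0// exprn_ge0.
have nd k : k \in A -> \det (edgemx (fvert w k)) != 0.
  by move=> kA; have [uB _ _] := HX k kA; rewrite -unitfE -unitmxE.
have D0 k : k \in A -> 0 < D k by move=> kA; rewrite normr_gt0 nd.
have rq k : regT (q k).
  by apply: inF_regT oQ _; move: Qq; rewrite /in_Q; case: (cont) => [[H _]|H]; exact: H.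
have [nq _] := nice_regT A rq.
have nc (d : R) : nice A (fun _ _ => d) by exact: (nice_cst (fun=> d)).
pose L1 := wint A D (fun _ _ => 1 : R).
have L10 : 0 < L1.
  have [bA _ _ _ _] := mw; rewrite /L1 /wint (bigD1 (mbase w))//=.
  apply: ltr_wpDr; last by rewrite mulr_gt0 ?D0// int2_iTref1_gt0.
  by apply: sumr_ge0 => k /andP[kA _]; rewrite mulr_ge0 ?ltW ?D0// int2_iTref1_gt0.
pose c := wint A D q / L1.
have nqc : nice A (fun k x => q k x - c) by apply: niceD nq _; exact: (nc (- c)).
have qc0 : wint A D (fun k x => q k x - c) = 0.
  rewrite (@eq_wint _ _ A D _ (fun k x => q k x + (- c) * 1)); last by move=> k x _ _; rewrite mulr1.
  rewrite (wintD D nq (nc (- c * 1))) (wintZ D (- c) (nc 1)).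
  by rewrite -/L1 /c mulNr divfK ?subrr// gt_eqF.
pose Q2 := wint A D (fun k x => (q k x - c) * (q k x - c)).
have calc v (rv : forall a k, regT (v a k)) := macro_calculus mw h0 h1 S0 e0 E4 HX rv.
(* Otherwise q would equal its flat mean c everywhere; the zero surface mean, with alpha bounded
   below, would give c = 0, against q being nonzero. *)
have Q20 : 0 < Q2.
  rewrite lt0r wint_ge0 ?andbT//; last by move=> k x _ _; rewrite -expr2 sqr_ge0.
  apply/eqP => Q2n; have qc := wint_sqr_eq0 D0 rq Q2n.
  have r0 : regT (fun _ : 'rV[R]_2 => 0 : R).
    by apply: (inF_regT oQ); exists (fun=> 0) => x _; rewrite big1// => i _; rewrite mul0r.
  have [[alpha [na a1 sI]] _ _ _] := calc (fun _ _ _ => 0) (fun _ _ => r0).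
  have wa : 0 < wint A D alpha.
    apply: (@lt_le_trans _ _ (2^-1 * L1)); first by rewrite mulr_gt0 ?invr_gt0.
    rewrite -wintZ; last exact: (nc 1).
    apply: (le_wint D0 (nc (2^-1 * 1)) na) => k x kA Tx; rewrite mulr1; exact: near_one_ge_half E4 (a1 k x kA Tx).
  have c0 : c = 0.
    move: q0; rewrite sI//.
    rewrite (@eq_wint _ _ A D _ (fun k x => c * alpha k x)); last by move=> k x kA /iTref_sub Tx; rewrite qc.
    by rewrite wintZ// => /eqP; rewrite mulf_eq0 (gt_eqF wa) orbF => /eqP.
  by have [k [x [kA Tx qx]]] := qn; apply: qx; rewrite qc.
have [z [zS zn zb zp]] := flat_velocity oV oQ tM mw nd FS Qq erefl erefl qc0 Q20.
pose p b a k x := \sum_(l < 2) invmx (edgemx (fvert w k)) b l * pd l (z a k) x.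
have {zp} ip := zp p erefl.
have rz a k : regT (z a k) by exact: inF_regT oV ((zS a).1 k).
pose u k x := \sum_(a < 2) z a k x *: row a (mtan w).
pose Sf k x := \sum_(b < 2) \sum_(a < 2) `|p b a k x| + S / h * \sum_(a < 2) `|z a k x|.
pose div k := surface_div (X k) (Pfield (X k) (u k)).
have [[alpha [na a1 sI]] [nSf ndiv] dB nB] := calc z rz.
have np b a : nice A (p b a).
  apply: nice_sum => l; have [_ /(_ l) npd] := nice_regT A (rz a).
  by apply: niceM npd; exact: (nice_cst (fun k => invmx (edgemx (fvert w k)) b l)).
have ns : nice A (fun k x => \sum_(a < 2) p a a k x) by apply: nice_sum => a; exact: np.
have sS k x : k \in A -> iTref x -> `|\sum_(a < 2) p a a k x| <= Sf k x.
  move=> _ _; apply: (le_trans (ler_norm_sum _ _ _)); apply: ler_wpDr.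
    by apply: mulr_ge0; [rewrite divr_ge0 ?ltW|apply: sumr_ge0 => a _; exact: normr_ge0].
  by apply: ler_sum => a _; rewrite (bigD1 a)//= lerDl; apply: sumr_ge0 => b _; exact: normr_ge0.
have [qa_ le_div] := perturbed_divergence D0 E0 E4 nq na ns ndiv nSf a1 sS dB (etrans (esym (sI q nq)) q0) qc0 L10 erefl (erefl Q2) erefl.
exists u; split.
- move=> i; have := in_S_lincomb (fun a => row a (mtan w) 0 i) zS; congr in_S.
  by apply/funext => k; apply/funext => x; rewrite /u summxE; apply: eq_bigr => a _; rewrite [RHS]mxE.
- by move=> k B oB x Bx; rewrite /u big1// => a _; rewrite (zb a k B oB x Bx) scale0r.
(* The rows of [mtan w] are orthonormal, so multiplication by its transpose recovers the components
   of the field. *)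
- have [a [k [x [kA Tx zx]]]] := zn; exists k, x; split => // ux; move/eqP: zx; apply.
  have [_ _ [TT _] _ _] := mw.
  have uE : u k x = (\row_b z b k x) *m mtan w.
    rewrite mulmx_sum_row; apply: eq_bigr => b _; by rewrite mxE.
  have : (\row_b z b k x) *m (mtan w *m (mtan w)^T) = 0 by rewrite mulmxA -uE ux mul0mx.
  by rewrite TT mulmx1 => /rowP /(_ a); rewrite !mxE.
pose Lp := wint A D (fun k x => \sum_(a < 2) \sum_(b < 2) p b a k x ^+ 2).
have np2 a : nice A (fun k x => \sum_(b < 2) p b a k x ^+ 2) by apply: nice_sum => b; exact: (niceM (np b a) (np b a)).
have Lp0 : 0 <= Lp by apply: wint_ge0 => // k x _ _; apply: sumr_ge0 => a _; apply: sumr_ge0 => b _; exact: sqr_ge0.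
have LpE : Lp = \sum_(a < 2) wint A D (fun k x => \sum_(b < 2) p b a k x ^+ 2) by rewrite /Lp wint_sum.
have nz a : nice A (z a) by have [] := nice_regT A (rz a).
(* Here the factor S / h in Sf is absorbed: each component vanishes at a point of an outer edge, and
   the h^2 of the Poincare inequality turns (S / h)^2 into S^2. *)
have S2K : wint A D (fun k x => Sf k x * Sf k x) <= (8 + 4 * S ^+ 2 * CP) * Lp.
  have [k0 [B oB]] := outer_edge_exists tM mw nd.
  have [m mB] : exists m, m \in B by apply/set0Pn; rewrite -card_gt0; case: oB => _ ->.
  have [x0 Bx0] := ref_face_nonempty (R := R) mB.
  have zL a : wint A D (fun k x => z a k x * z a k x) <= CP * h ^+ 2 * wint A D (fun k x => \sum_(b < 2) p b a k x ^+ 2).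
    by apply: (HP (z a) k0 x0 (zS a)); [case: oB|case: Bx0|exact: zb oB x0 Bx0].
  have npp : nice A (fun k x => \sum_(a < 2) \sum_(b < 2) p b a k x ^+ 2) by exact: nice_sum.
  have nzz : nice A (fun k x => \sum_(a < 2) z a k x * z a k x) by apply: nice_sum => a; exact: niceM.
  apply: (@le_trans _ _ (wint A D (fun k x => 8 * (\sum_(a < 2) \sum_(b < 2) p b a k x ^+ 2) + 4 * (S / h) ^+ 2 * \sum_(a < 2) z a k x * z a k x))).
    apply: (le_wint D0); [exact: niceM|by apply: niceD; exact: niceZ|].
    by move=> k x _ _; exact: (tangential_sqr_le (fun b a => p b a k x) (fun a => z a k x) (S / h)).
  rewrite wintD ?wintZ//; [|exact: niceZ|exact: niceZ].
  rewrite [X in _ <= X]mulrDl; apply: lerD; first exact: lexx.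
  rewrite wint_sum => [|a]; last exact: niceM.
  apply: (@le_trans _ _ (4 * (S / h) ^+ 2 * \sum_(a < 2) CP * h ^+ 2 * wint A D (fun k x => \sum_(b < 2) p b a k x ^+ 2))).
    apply: ler_wpM2l; first by apply: mulr_ge0; [exact: ler0n|exact: sqr_ge0].
    by apply: ler_sum => a _; exact: zL.
  rewrite -mulr_sumr -LpE le_eqVlt; apply/orP; left; apply/eqP.
  by field; rewrite gt_eqF.
have K0 : 0 < 8 + 4 * S ^+ 2 * CP by apply: ltr_wpDr; [apply: mulr_ge0 CP0; apply: mulr_ge0 (sqr_ge0 S); exact: ler0n|exact: ltr0n].
apply: (@infsup_arith _ bb C5 K (Num.sqrt Lp) (Num.sqrt Q2) _ _ (Num.sqrt (wint A D (fun k x => Sf k x * Sf k x))) (18 ^+ 8 * e)) => //.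
- apply: ltr_wpDl; first exact: sqrtr_ge0.
  by rewrite sqrtr_gt0; apply: mulr_gt0; [exact: ltr0n|apply: exprn_gt0; exact: divr_gt0].
- by rewrite sqrtr_gt0.
- exact: sqrtr_ge0.
- rewrite (_ : 2 * Num.sqrt Q2 = Num.sqrt (4 * Q2)); last first.
    by rewrite sqrtrM ?ler0n// (_ : 4 = 2 ^+ 2) ?sqrtr_sqr ?ger0_norm ?ler0n//; ring.
  rewrite /surface_l2 sI; last exact: (niceM nq nq).
  apply: ler_wsqrtr; exact: qa_.
- by rewrite /K -(sqrtrM _ (ltW K0)); exact: ler_wsqrtr.
- rewrite sI; last exact: niceM.
  by apply: le_trans le_div; rewrite lerD2r.
Qed.
End MacroInfSup.

(* Elements of the restricted spaces on a macroelement are given by global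
   discrete functions, of which only the values on that macroelement matter. *)
Theorem lemma3p10 (R : realType)
    (Gamma : set 'rV[R]_3) (delta : R) (proj : 'rV[R]_3 -> 'rV[R]_3)
    (H : set R) (msh : R -> mesh R) (kg : nat)
    (FV FQ : fspace R) (cont : bool)
    (Omega : forall h : R, mpart (msh h)) (h0 betabar : R) :
  closed_hypersurface Gamma ->
  0 < delta -> closest_point_projection Gamma delta proj ->
  surface_family Gamma delta H msh ->
  (1 <= kg)%N ->
  discrete_space H msh FV -> discrete_space H msh FQ ->
  0 < h0 -> 0 < betabar ->
  stable_pair H cont FV FQ Omega h0 betabar ->
  exists h1 : R, [/\ 0 < h1, h1 <= h0 &
    forall B : nat -> R, exists beta : R, 0 < beta /\
      forall h, H h -> h <= h1 -> forall p : 'I_(npart (Omega h)),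
      let w := pmac p in
      let X := @param R proj kg (msh h) in
      Fh_bounded proj kg w B ->
      forall q : bfun (msh h) R, in_Q cont FQ q -> nonzero_on w q ->
      surface_int X w q = 0 ->
      exists v : bfun (msh h) 'rV[R]_3,
        [/\ in_V3 FV v, vanishes_on_boundary w v, nonzero_on w v &
            beta * norm_1h X h w v * surface_l2 X w q <=
            surface_int X w (fun k xi =>
              surface_div (X k) (Pfield (X k) (v k)) xi * q k xi)]].
Proof.
move=> hyp d0 cpp fam kg1 [rV [oV _ _]] [rQ [oQ _ _]] h00 bb0 [_ [L part] [N [rep [repP equiv]]] _ FS].
have [Hpos [sigma sigma0 mshP]] := fam.
(* The largest representative bounds every macroelement of the partitionings, by
   [macro_equiv_card]. *)
pose n0 := \max_(n < N) #|mel (projT2 (rep n))|.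
have [S S0 HS] := macro_near_frame n0 hyp cpp fam kg1.
have [CP CP0 HP] := macro_poincare n0 oV (ltW S0).
pose K := Num.sqrt (8 + 4 * S ^+ 2 * CP).
pose C5 := Num.sqrt (2 * (9 * 108 ^+ 2 + 27 * (1 / S) ^+ 2)) + Num.sqrt (6 * (1 / S) ^+ 2).
have K0 : 0 < K.
  rewrite sqrtr_gt0; apply: ltr_wpDr; last exact: ltr0n.
  by apply: mulr_ge0 CP0; apply: mulr_ge0 (sqr_ge0 S); exact: ler0n.
have C50 : 0 < C5.
  apply: ltr_wpDl; first exact: sqrtr_ge0.
  by rewrite sqrtr_gt0; apply: mulr_gt0; [exact: ltr0n|apply: exprn_gt0; exact: divr_gt0].
(* The bound 1/4 keeps the area density between 1/2 and 2; the other one makes the perturbation at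
   most half of the flat inf-sup term. *)
pose E := Num.min 4^-1 (betabar / (4000 * K)).
have K4 : 0 < 4000 * K by apply: mulr_gt0 K0; exact: ltr0n.
have E0 : 0 < E.
  by rewrite lt_min; apply/andP; split; [rewrite invr_gt0 ltr0n|exact: divr_gt0 bb0 K4].
have E4 : 4 * E <= 1.
  by rewrite -[X in _ <= X](@divff _ (4 : R)) ?gt_eqF ?ltr0n// ler_wpM2l ?ler0n// ge_min lexx.
have EK : 4000 * E * K <= betabar.
  rewrite mulrAC -(ler_pdivlMl _ _ K4) mulrC.
  by rewrite ge_min lexx orbT.
have p18 : 0 < 18 ^+ 8 :> R by apply: exprn_gt0; exact: ltr0n.
(* Division by 18^8 compensates the loss of accuracy in [near_frame]. *)
have [h2 h20 Hh2] := HS (E / 18 ^+ 8) (divr_gt0 E0 p18).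
have eE : 18 ^+ 8 * (E / 18 ^+ 8) = E by rewrite mulrC divfK// gt_eqF.
(* The three bounds serve flat stability, the frame estimate, and the L^2 part of the norm, which is
   controlled by h <= 1. *)
exists (Num.min h0 (Num.min h2 1)); split.
- by rewrite !lt_min h00 h20 ltr01.
- by rewrite ge_min lexx.
move=> B; exists (betabar / (4 * C5 * K)); split.
  by apply: divr_gt0 bb0 _; apply: mulr_gt0 K0; apply: mulr_gt0 C50; exact: ltr0n.
move=> h Hh; rewrite !le_min => /and3P[hh0 hh2 hh1] p w X _ q Qq qn q0.
have [mp _] := part h Hh hh0; have mw : is_macro w := mp p.
have [tM _] := mshP h Hh.
have wn0 : (#|mel w| <= n0)%N.
  have [n eq] := equiv h Hh hh0 p; have [Hn mn] := repP n.
  have [tMn _] := mshP _ Hn.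
  apply: leq_trans (macro_equiv_card tMn tM mn mw eq) _.
  exact: (leq_bigmax_cond (F := fun n => #|mel (projT2 (rep n))|)).
have fr := Hh2 h Hh hh2 w mw wn0.
have e0 : 0 <= E / 18 ^+ 8 by apply: divr_ge0; exact: ltW.
have fr' k : k \in mel w -> let B := edgemx (fvert w k) in [/\ B \in unitmx, `|invmx B| <= S / h &
    exists2 N, nearm (E / 18 ^+ 8) (mtan w) N & forall x, jacobian (X k) x = B *m N x].
  by move=> kw; have [uB iB _ H4] := fr k kw.
have frP k : k \in mel w -> let B := edgemx (fvert w k) in [/\ B \in unitmx, `|invmx B| <= S / h & `|B| <= 3 * h].
  by move=> kw; have [uB iB B3 _] := fr k kw.
have e4 : 4 * (18 ^+ 8 * (E / 18 ^+ 8)) <= 1 by rewrite eE.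
have eK : 4000 * (18 ^+ 8 * (E / 18 ^+ 8)) * K <= betabar by rewrite eE.
exact: (macro_infsup oV oQ tM mw (Hpos h Hh) hh1 S0 e0 bb0 CP0 fr'
  (fun v k0 x0 vS k0w Tx0 v0 => HP _ w h v k0 x0 (Hpos h Hh) mw wn0 vS frP k0w Tx0 v0)
  e4 eK (FS h Hh hh0 p) Qq qn q0).
Qed.
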